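(* Let $q\in[3,6]$, $r\in[3,\infty)$ and $\alpha=\frac{6-q}{3}$. Let $$\omega_1(x')=(1+|x'|)^{-\alpha},\quad x'=(x_1,x_2)\in\mathbb{R}^2,\qquad \omega_2\equiv 1 \text{ on } \mathbb{R},$$ and $\omega(x)=\omega_1(x_1,x_2)\,\omega_2(x_3)$ for $x = (x_1,x_2,x_3)\in\mathbb{R}^3$. Let $u\in[H^1_{\mathrm{loc}}(\mathbb{R}^3)]^3$ be a weak solution of the stationary Navier-Stokes equations $$-\Delta u + (u\cdot\nabla)u + \nabla p = 0, \qquad \operatorname{div}(u) = 0 \qquad \text{in } \mathbb{R}^3.$$ Assume that $u\in[L_{q,r}(\mathbb{R}^3,\omega)]^3$ and that there exists $R_0>0$ such that $$\operatorname{support}(u)\subset\mathbb{R}^2\times[-R_0,R_0].$$ Then $u\equiv 0$ in $\mathbb{R}^3$.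
   Context: **Weighted mixed-norm spaces.** For $q,r\in(1,\infty)$ and weights $\omega_1:\mathbb{R}^2\to\mathbb{R}$, $\omega_2:\mathbb{R}\to\mathbb{R}$, with $\omega(x)=\omega_1(x_1,x_2)\omega_2(x_3)$, $L_{q,r}(\mathbb{R}^3,\omega)$ is the space of measurable $f:\mathbb{R}^3\to\mathbb{R}$ with $$\|f\|_{L_{q,r}(\mathbb{R}^3,\omega)} = \left[\int_{\mathbb{R}}\left(\int_{\mathbb{R}^2}|f(x_1,x_2,x_3)|^q\omega_1(x_1,x_2)\,dx_1dx_2\right)^{r/q}\omega_2(x_3)\,dx_3\right]^{1/r}<\infty.$$ **Local spaces.** $f\in L_{q,\mathrm{loc}}(\mathbb{R}^3)$ (resp. $f \in H^1_{\mathrm{loc}}(\mathbb{R}^3)$) means $f\in L_q(U)$ (resp. $f\in H^1(U)$) for every compact $U\subset\mathbb{R}^3$. **Weak solution.** $u=(u_1,u_2,u_3)\in[H^1_{\mathrm{loc}}(\mathbb{R}^3)]^3$ is a weak solution of the stationary Navier-Stokes equations if: (i) $\operatorname{div}(u)=0$ in the sense of distributions; (ii) the pressure $$p=\sum_{i,j=1}^3\mathscr{R}_i\mathscr{R}_j(u_iu_j)$$ is well-defined, with $p\in L_{1,\mathrm{loc}}(\mathbb{R}^3)$, where $\mathscr{R}_i$ is the $i$-th Riesz transform on $\mathbb{R}^3$ (so $\mathscr{R}_i\mathscr{R}_j$ is the Calderón-Zygmund operator with Fourier multiplier $-\xi_i\xi_j/|\xi|^2$, extended to the space containing $u_iu_j$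 in the usual way for singular integral operators); (iii) for all $\phi=(\phi_1,\phi_2,\phi_3)\in[C_0^\infty(\mathbb{R}^3)]^3$, $$\sum_{k=1}^3\int_{\mathbb{R}^3}\Big[\nabla u_k\cdot\nabla\phi_k+\big((u\cdot\nabla)u_k\big)\phi_k\Big]dx-\int_{\mathbb{R}^3}p\,\operatorname{div}\phi\,dx=0.$$ *)

(* Defs.v *)
From HB Require Import structures.
From mathcomp Require Import all_boot all_order all_algebra.
From mathcomp Require Import all_classical all_reals all_analysis.

Set Implicit Arguments.
Unset Strict Implicit.
Unset Printing Implicit Defensive.

Import Order.TTheory GRing.Theory Num.Theory.
Import numFieldNormedType.Exports.

Local Open Scope classical_set_scope.
Local Open Scope ring_scope.

Section Space.
Variable R : realType.

(* A point (x1, x2, x3) is ((x1, x2), x3), so that x.1 is the horizontal part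
   x' used by the mixed norms. *)
Definition R2 := (R * R)%type.
Definition R3 := (R * R * R)%type.

Definition leb2 : set (measurableTypeR R * measurableTypeR R) -> \bar R :=
  (@lebesgue_measure R \x @lebesgue_measure R)%E.
HB.instance Definition _ := Measure.on leb2.

Definition leb3 :
    set (measurableTypeR R * measurableTypeR R * measurableTypeR R) -> \bar R :=
  (leb2 \x @lebesgue_measure R)%E.
HB.instance Definition _ := Measure.on leb3.

Definition coord3 (i : 'I_3) (x : R3) : R := nth 0 [:: x.1.1; x.1.2; x.2] i.

Definition unit_vector (i : 'I_3) : R3 :=
  ((i == 0 :> nat)%:R, (i == 1 :> nat)%:R, (i == 2 :> nat)%:R).

Definition dot3 (x y : R3) : R := \sum_(i < 3) coord3 i x * coord3 i y.

(* The topology comes from the library's (max) norm on products; the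
   Euclidean norms below are only used in explicit formulas. *)
Definition norm2 (x : R2) : R := Num.sqrt (x.1 ^+ 2 + x.2 ^+ 2).

End Space.

Section TestFunctions.
Variable R : realType.

Definition partial (i : 'I_3) (f : R3 R -> R) : R3 R -> R :=
  fun x => 'D_(unit_vector R i) f x.

(* C^oo: all iterated partial derivatives exist and are continuous. *)
Definition smooth (f : R3 R -> R) : Prop :=
  forall s : seq 'I_3,
    continuous (foldr partial f s) /\
    forall (i : 'I_3) (x : R3 R), derivable (foldr partial f s) x (unit_vector R i).

Definition test_function (f : R3 R -> R) : Prop :=
  smooth f /\ compact (closure [set x | f x != 0]).

End TestFunctions.

Section FunctionSpaces.
Variable R : realType.

Definition Lloc (q : R) (f : R3 R -> R) : Prop :=
  measurable_fun setT f /\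
  forall K : set (R3 R), compact K ->
    (\int[@leb3 R]_(x in K) (`|f x| `^ q)%:E < +oo)%E.

Definition cvg_L1loc (f : nat -> R3 R -> R) (g : R3 R -> R) : Prop :=
  forall K : set (R3 R), compact K ->
    (\int[@leb3 R]_(x in K) `|f n x - g x|%:E)%E @[n --> \oo] --> 0%E.

Definition weak_partial (i : 'I_3) (f g : R3 R -> R) : Prop :=
  forall phi, test_function phi ->
    \int[@leb3 R]_x (f x * partial i phi x) =
    - \int[@leb3 R]_x (g x * phi x).

Definition H1loc_grad (f : R3 R -> R) (Df : 'I_3 -> R3 R -> R) : Prop :=
  Lloc 2 f /\ forall i, Lloc 2 (Df i) /\ weak_partial i f (Df i).

Definition H1loc (f : R3 R -> R) : Prop := exists Df, H1loc_grad f Df.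

Definition mixed_norm (q r : R) (w1 : R2 R -> R) (w2 : R -> R)
    (f : R3 R -> R) : \bar R :=
  ((\int[@lebesgue_measure R]_x3
      ((\int[@leb2 R]_x' (`|f (x', x3)| `^ q * w1 x')%:E) `^ (r / q)
       * (w2 x3)%:E)) `^ r^-1)%E.

Definition Lqr (q r : R) (w1 : R2 R -> R) (w2 : R -> R)
    (f : R3 R -> R) : Prop :=
  measurable_fun setT f /\ (mixed_norm q r w1 w2 f < +oo)%E.

(* Essential support of a vector field: the complement of the largest open
   set on which it vanishes almost everywhere. *)
Definition ess_support (u : 'I_3 -> R3 R -> R) : set (R3 R) :=
  [set x | forall U : set (R3 R), open U -> U x ->
    ~ {ae @leb3 R, forall y, U y -> forall k, u k y = 0}].

End FunctionSpaces.

Section RieszTransforms.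
Variable R : realType.

(* Fourier transform  f^(xi) = \int f(x) e^(-i x.xi) dx = fourier_cos f xi
   - i fourier_sin f xi. *)
Definition fourier_cos (f : R3 R -> R) (xi : R3 R) : R :=
  \int[@leb3 R]_x (f x * cos (dot3 x xi)).

Definition fourier_sin (f : R3 R -> R) (xi : R3 R) : R :=
  \int[@leb3 R]_x (f x * sin (dot3 x xi)).

Definition riesz_multiplier (i j : 'I_3) (xi : R3 R) : R :=
  - (coord3 i xi * coord3 j xi / dot3 xi xi).

(* (2 pi)^-3 \int m(xi) f^(xi) e^(i x.xi) dxi  for the multiplier m of R_i R_j
   and f real-valued: the integrand below is the real part of the one displayed,
   whose imaginary part is odd in xi because m is even. *)
Definition riesz2_test (i j : 'I_3) (f : R3 R -> R) (x : R3 R) : R :=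
  (2 * pi) ^- 3 *
  \int[@leb3 R]_xi (riesz_multiplier i j xi *
    (fourier_cos f xi * cos (dot3 x xi) + fourier_sin f xi * sin (dot3 x xi))).

Definition test_approx (q r : R) (w1 : R2 R -> R) (w2 : R -> R)
    (phi : nat -> R3 R -> R) (f : R3 R -> R) : Prop :=
  (forall n, test_function (phi n)) /\
  mixed_norm q r w1 w2 (fun x => phi n x - f x) @[n --> \oo] --> 0%E.

(* h = R_i R_j f, where R_i R_j is extended by continuity from test functions
   to L_{q,r}(w1 w2), with values in L_{1,loc}: f is a limit of test functions
   in L_{q,r}(w1 w2), and along every such approximation the images converge
   to h. *)
Definition riesz2 (q r : R) (w1 : R2 R -> R) (w2 : R -> R) (i j : 'I_3)
    (f h : R3 R -> R) : Prop :=
  [/\ Lqr q r w1 w2 f, Lloc 1 h,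
      exists phi, test_approx q r w1 w2 phi f &
      forall phi, test_approx q r w1 w2 phi f ->
        cvg_L1loc (fun n => riesz2_test i j (phi n)) h].

End RieszTransforms.

Section NavierStokes.
Variable R : realType.

Definition divergence_free (u : 'I_3 -> R3 R -> R) : Prop :=
  forall phi, test_function phi ->
    \int[@leb3 R]_x (\sum_(k < 3) u k x * partial k phi x) = 0.

(* p = \sum_(i, j) R_i R_j (u_i u_j), the products u_i u_j being in
   L_{q,r}(w1 w2). *)
Definition is_pressure (q r : R) (w1 : R2 R -> R) (w2 : R -> R)
    (u : 'I_3 -> R3 R -> R) (p : R3 R -> R) : Prop :=
  Lloc 1 p /\
  exists P : 'I_3 -> 'I_3 -> R3 R -> R,
    (forall i j, riesz2 q r w1 w2 i j (fun x => u i x * u j x) (P i j)) /\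
    {ae @leb3 R, forall x, p x = \sum_(i < 3) \sum_(j < 3) P i j x}.

(* q, r, w1, w2 specify the space L_{q,r}(w1 w2) containing the products
   u_i u_j to which the operators R_i R_j are extended; Du k j is the weak
   derivative of u k in the direction j. *)
Definition weak_solution (q r : R) (w1 : R2 R -> R) (w2 : R -> R)
    (u : 'I_3 -> R3 R -> R) : Prop :=
  divergence_free u /\
  exists (Du : 'I_3 -> 'I_3 -> R3 R -> R) (p : R3 R -> R),
    [/\ forall k, H1loc_grad (u k) (Du k),
        is_pressure q r w1 w2 u p &
        forall phi : 'I_3 -> R3 R -> R, (forall k, test_function (phi k)) ->
          \sum_(k < 3) \int[@leb3 R]_x
              (\sum_(j < 3) Du k j x * partial j (phi k) x
               + (\sum_(j < 3) u j x * Du k j x) * phi k x)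
          - \int[@leb3 R]_x (p x * \sum_(k < 3) partial k (phi k) x) = 0].

End NavierStokes.

Definition horizontal_weight (R : realType) (alpha : R) (x : R2 R) : R :=
  (1 + norm2 x) `^ (- alpha).

(* Main.v *)
(* The pressure plays no role if one only tests with solenoidal fields. Let [phi] be a
   horizontal cutoff between the squares of half-sides [s < t], and [g = u . grad phi]. Since
   [u] lives in the slab [|x_3| <= R0], the field [phi u] can be made solenoidal with compact
   support: replace [g] by its average over horizontal squares of side [h], at the price of
   two small horizontal components, then integrate the averaged [g] vertically and release
   the excess flux at a height where [u] vanishes. Choosing [h] small enough with respect to
   [t - s] and to the local energy, the local Dirichlet energy [f] satisfies
   [f s <= f t / 512 + G / (t - s) ^+ 8] for [r <= s < t < 2 r], hence [f r <= 512 G / r ^+ 8].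
   Here [G] depends on the L2 norm of [u] over the box of size [2 r] and on the L3 norm over
   the annulus of sizes between [r] and [2 r]; the mixed norm, with this weight, bounds the
   former by [r ^ (2/3)] and makes the cube of the latter [o(r)], so [G = o(r ^ 8)]. Thus the
   gradient of [u] vanishes and, [u] being supported in a slab, so does [u]. *)
From HB Require Import structures.
Require Import Defs.
From mathcomp Require Import all_boot all_order all_algebra.
From mathcomp Require Import all_classical all_reals all_analysis.
From mathcomp Require Import measurable_realfun.
From mathcomp Require Import ring lra.
Import Order.TTheory GRing.Theory Num.Theory.
Import numFieldNormedType.Exports.
Local Open Scope classical_set_scope.
Local Open Scope ring_scope.
Set Implicit Arguments.
Unset Strict Implicit.
Unset Printing Implicit Defensive.


(** * Lebesgue measure on R^3 *)

Local Notation leb := lebesgue_measure.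
Local Notation T2 R := (measurableTypeR R * measurableTypeR R)%type.
Local Notation T3 R := (T2 R * measurableTypeR R)%type.

Section SigmaFinite.
Variable R : realType.

(** The obstacle is to correct the divergence of [phi u] so that every error is a small multiple of
    [B ^ 2], with [B] the local Dirichlet norm, or of lower degree in [B], even when [t - s] is much
    smaller than [r]. A vertical primitive of [g] itself would have a horizontal gradient of order
    [B / (t - s)], and its viscous error [B ^ 2 / (t - s)] cannot be absorbed. Averaging puts that
    derivative on the kernel, at the cost [A / ((t - s) h)] with [A] the local L2 norm of [u], and
    leaves horizontal components carrying the factor [h / (t - s)]. The excess flux is released by
    translation: averages commute with derivatives, so a copy of the averaged field, shifted to a
    height out of reach of [u], has exactly the missing divergence and is invisible to the equation.
    The weight makes the scaling critical: Hölder's inequality on squares of side [r] bounds the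
    cube of the L3 norm by one power of [r], which the gradient [1 / r] of the cutoff compensates,
    so smallness comes from the tail of a convergent integral. Radii are cubes [n ^ 3], so that
    [r ^ (2/3)] is [n ^ 2]. *)

Lemma sigma_finite_leb : exists F : (set (measurableTypeR R))^nat,
  [/\ setT = \bigcup_i F i, nondecreasing_seq F &
      forall i, measurable (F i) /\ (@leb R (F i) < +oo)%E].
Proof.
exists (fun n => `[- n%:R, n%:R]%classic); split.
- apply/esym; rewrite -subTset => x _ /=.
  have [n hn] : exists n : nat, `|x| < n%:R.
    exists (Num.truncn `|x|).+1; exact: truncnS_gt.
  by exists n => //=; rewrite in_itv/= -ler_norml ltW.
- move=> m n mn; apply/subsetPset => x /=; rewrite !in_itv/= => /andP[a b].
  apply/andP; split.
    by apply: le_trans a; rewrite lerN2 ler_nat.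
  by apply: le_trans b _; rewrite ler_nat.
- move=> n; split; first exact: measurable_itv.
  by rewrite lebesgue_measure_itv/=; case: ifP => //= _; rewrite -EFinB ltry.
Qed.

Lemma leb2_sigma_finite : exists F : (set (T2 R))^nat,
  [/\ setT = \bigcup_i F i, nondecreasing_seq F &
      forall i, measurable (F i) /\ (@leb2 R (F i) < +oo)%E].
Proof.
have [F [FT Fnd hF]] := sigma_finite_leb.
exists (fun n => F n `*` F n); split.
- apply/esym; rewrite -subTset => -[x y] _.
  have [i _ Fi] : (\bigcup_i F i) x by rewrite -FT.
  have [j _ Fj] : (\bigcup_i F i) y by rewrite -FT.
  exists (maxn i j) => //; split => /=.
    by move: (Fnd i (maxn i j) (leq_maxl _ _)) => /subsetPset; apply.
  by move: (Fnd j (maxn i j) (leq_maxr _ _)) => /subsetPset; apply.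
- move=> m n mn; apply/subsetPset => -[x y] /= [] a b; split => /=.
    by move: (Fnd m n mn) => /subsetPset; apply.
  by move: (Fnd m n mn) => /subsetPset; apply.
- move=> n; have [mF Ffin] := hF n; split; first exact: measurableX.
  by rewrite /leb2 product_measure1E// lte_mul_pinfty// ge0_fin_numE.
Qed.

Lemma leb2_sigma_finiteT : sigma_finite setT (@leb2 R).
Proof.
have [F [FT _ hF]] := leb2_sigma_finite.
by exists F => // i; have [] := hF i.
Qed.

HB.instance Definition _ := Measure_isSigmaFinite.Build _ _ _ (@leb2 R) leb2_sigma_finiteT.

Lemma leb3_sigma_finite : exists F : (set (T3 R))^nat,
  [/\ setT = \bigcup_i F i, nondecreasing_seq F &
      forall i, measurable (F i) /\ (@leb3 R (F i) < +oo)%E].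
Proof.
have [F [FT Fnd hF]] := sigma_finite_leb.
have [G [GT Gnd hG]] := leb2_sigma_finite.
exists (fun n => G n `*` F n); split.
- apply/esym; rewrite -subTset => -[x y] _.
  have [i _ Fi] : (\bigcup_i G i) x by rewrite -GT.
  have [j _ Fj] : (\bigcup_i F i) y by rewrite -FT.
  exists (maxn i j) => //; split => /=.
    by move: (Gnd i (maxn i j) (leq_maxl _ _)) => /subsetPset; apply.
  by move: (Fnd j (maxn i j) (leq_maxr _ _)) => /subsetPset; apply.
- move=> m n mn; apply/subsetPset => -[x y] /= [] a b; split => /=.
    by move: (Gnd m n mn) => /subsetPset; apply.
  by move: (Fnd m n mn) => /subsetPset; apply.
- move=> n; have [mF Ffin] := hF n; have [mG Gfin] := hG n.
  split; first exact: measurableX.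
  by rewrite /leb3 product_measure1E// lte_mul_pinfty// ge0_fin_numE.
Qed.

Lemma leb3_sigma_finiteT : sigma_finite setT (@leb3 R).
Proof.
have [F [FT _ hF]] := leb3_sigma_finite.
by exists F => // i; have [] := hF i.
Qed.

HB.instance Definition _ := Measure_isSigmaFinite.Build _ _ _ (@leb3 R) leb3_sigma_finiteT.

End SigmaFinite.

(** * Tonelli's theorem and translation invariance *)

Section Tonelli.
Variable R : realType.
Local Open Scope ereal_scope.
Implicit Types F : T3 R -> \bar R.

Lemma tonelli3 F : measurable_fun setT F -> (forall x, 0 <= F x) ->
  \int[@leb3 R]_x F x = \int[leb]_z \int[leb]_y \int[leb]_x F ((x, y), z).
Proof.
move=> mF F0; rewrite /leb3 fubini_tonelli2//; apply: eq_integral => z _.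
rewrite /fubini_G /leb2 fubini_tonelli2//.
exact: (measurableT_comp mF (pair2_measurable z)).
Qed.

Lemma measurable_pairl d1 d2 d3 (X : measurableType d1) (Y : measurableType d2)
   (Z : measurableType d3) (f : X * Y -> Z) x :
  measurable_fun setT f -> measurable_fun setT (fun y => f (x, y)).
Proof. by move=> mf; exact: (measurableT_comp mf (pair1_measurable x)). Qed.

Lemma measurable_pairr d1 d2 d3 (X : measurableType d1) (Y : measurableType d2)
   (Z : measurableType d3) (f : X * Y -> Z) y :
  measurable_fun setT f -> measurable_fun setT (fun x => f (x, y)).
Proof. by move=> mf; exact: (measurableT_comp mf (pair2_measurable y)). Qed.

(** The image of Lebesgue measure under the translation gives the intervals []b, c]] their length,
    hence is Lebesgue measure by uniqueness. *)
Lemma ge0_integral_translate (f : measurableTypeR R -> \bar R) (a : R) :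
  measurable_fun setT f -> (forall x, 0 <= f x) ->
  \int[leb]_x f (x + a)%R = \int[leb]_x f x.
Proof.
move=> mf f0.
have mt : measurable_fun setT (fun x : measurableTypeR R => (x + a)%R : measurableTypeR R).
  exact: measurable_funD.
rewrite (_ : \int[leb]_x f (x + a)%R =
   \int[pushforward leb (fun x : measurableTypeR R => (x + a)%R : measurableTypeR R)]_x f x); last first.
  by rewrite ge0_integral_pushforward.
apply: eq_measure_integral => /= A mA _; apply/esym.
apply: lebesgue_measure_unique => //= X [[b c] /= bc <-].
rewrite /pushforward.
rewrite (_ : _ @^-1` _ = `](b - a)%R, (c - a)%R]%classic).
  by rewrite !lebesgue_measure_itv/= !lte_fin ltrD2r -!EFinB opprB addrA subrK.
by apply/seteqP; split=> x /=; rewrite !in_itv/= ltrBlDr lerBrDr.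
Qed.

(** Convertible with [x + a], but spelled out coordinatewise so that its measurability for the
    product sigma-algebra is proved component by component. *)
Definition tr3 (a x : R3 R) : R3 R := ((x.1.1 + a.1.1, x.1.2 + a.1.2), x.2 + a.2)%R.

Lemma measurable_tr3 (a : T3 R) :
  measurable_fun setT (tr3 a : T3 R -> T3 R).
Proof.
apply: (@measurable_fun_pair _ _ _ (T3 R) (T2 R) (measurableTypeR R)
  (fun x => (x.1.1 + a.1.1, x.1.2 + a.1.2)%R) (fun x => (x.2 + a.2)%R)); last first.
  by apply: measurable_funD => //; exact: measurable_snd.
apply: (@measurable_fun_pair _ _ _ (T3 R) (measurableTypeR R) (measurableTypeR R)
  (fun x => (x.1.1 + a.1.1)%R) (fun x => (x.1.2 + a.1.2)%R)).
  by apply: measurable_funD => //; exact: (measurableT_comp measurable_fst measurable_fst).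
by apply: measurable_funD => //; exact: (measurableT_comp measurable_snd measurable_fst).
Qed.

Lemma ge0_integral_tr3 F (a : T3 R) :
  measurable_fun setT F -> (forall x, 0 <= F x) ->
  \int[@leb3 R]_x F (tr3 a x) = \int[@leb3 R]_x F x.
Proof.
move=> mF F0.
have mFa : measurable_fun setT (F \o tr3 a).
  exact: (measurableT_comp mF (measurable_tr3 a)).
apply: etrans; first exact: (tonelli3 mFa (fun x => F0 _)).
apply: etrans; last exact/esym/(tonelli3 mF F0).
rewrite /tr3/=.
have mF1 y z : measurable_fun setT (fun x => F ((x, y), z)).
  apply: (measurable_pairr (f := fun x => F (x, z))).
  exact: measurable_pairr.
have m2 z : measurable_fun setT (fun y => \int[leb]_x F ((x, y), z)).
  apply: (@measurable_fun_fubini_tonelli_G _ _ _ _ _ (@leb R) (fun x => F (x, z))) => //.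
  exact: measurable_pairr.
transitivity (\int[leb]_z \int[leb]_y \int[leb]_x F ((x, y + a.1.2), z + a.2)%R).
  apply: eq_integral => z _; apply: eq_integral => y _.
  exact: (ge0_integral_translate (f := fun x => F ((x, y + a.1.2)%R, (z + a.2)%R))).
transitivity (\int[leb]_z \int[leb]_y \int[leb]_x F ((x, y), z + a.2)%R).
  apply: eq_integral => z _.
  apply: (ge0_integral_translate (f := fun y => \int[leb]_x F ((x, y), (z + a.2)%R))) => //.
  by move=> y; exact: integral_ge0.
apply: (ge0_integral_translate (f := fun z => \int[leb]_y \int[leb]_x F ((x, y), z))) => //.
  rewrite (_ : (fun z => _) = fun z => \int[@leb2 R]_x F (x, z)).
    exact: (@measurable_fun_fubini_tonelli_G _ _ _ _ _ (@leb2 R) F).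
  apply/funext => z; rewrite /leb2 fubini_tonelli2//.
  exact: measurable_pairr.
by move=> z; apply: integral_ge0 => y _; exact: integral_ge0.
Qed.

End Tonelli.

(** * Boxes, open sets and compact supports in R^3 *)

Section Topology3.
Variable R : realType.

Definition bx (a c : R) : set (R3 R) :=
  [set x | [/\ `|x.1.1| <= a, `|x.1.2| <= a & `|x.2| <= c]].

Lemma bx_sub (a c a' c' : R) : a <= a' -> c <= c' -> bx a c `<=` bx a' c'.
Proof.
by move=> aa cc x [h1 h2 h3]; split; [exact: le_trans aa|exact: le_trans aa|exact: le_trans cc].
Qed.

Lemma bxE (a c : R) : bx a c = (`[- a, a]%classic `*` `[- a, a]%classic) `*` `[- c, c]%classic.
Proof.
apply/seteqP; split=> -[[x y] z] /=; rewrite /bx/= !in_itv/= -!ler_norml.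
  by case.
by move=> [[]].
Qed.

Lemma bx_compact (a c : R) : compact (bx a c).
Proof.
by rewrite bxE; apply: compact_setX; [apply: compact_setX|]; exact: segment_compact.
Qed.

Lemma bx_measurable (a c : R) : measurable (bx a c : set (T3 R)).
Proof.
by rewrite bxE; apply: measurableX; [apply: measurableX|]; exact: measurable_itv.
Qed.

Lemma leb3_bx (a c : R) : 0 <= a -> 0 <= c -> @leb3 R (bx a c) = ((2 * a) ^+ 2 * (2 * c))%:E.
Proof.
move=> a0 c0.
have H (b : R) : 0 <= b -> @leb R `[- b, b]%classic = (2 * b)%:E.
  move=> b0; rewrite lebesgue_measure_itv/= lte_fin.
  case: ltP => [_|]; first by rewrite -EFinD opprK mulr2n mulrDl mul1r.
  by move=> h; have -> : b = 0 by [lra]; rewrite mulr0.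
have mI (b : R) : measurable (`[- b, b]%classic : set (measurableTypeR R)).
  exact: measurable_itv.
have mII : measurable (`[- a, a]%classic `*` `[- a, a]%classic : set (T2 R)).
  exact: measurableX.
have E2 : @leb2 R (`[- a, a]%classic `*` `[- a, a]%classic) = ((2 * a) * (2 * a))%:E.
  by apply: etrans (product_measure1E _ _ (mI a) (mI a)) _; rewrite EFinM -!H.
rewrite bxE; apply: etrans (product_measure1E _ _ mII (mI c)) _.
transitivity (((2 * a) * (2 * a))%:E * (2 * c)%:E)%E; last by rewrite -EFinM expr2.
by congr (_ * _)%E; [exact: E2|exact: H].
Qed.

(** Boxes with rational centre and half-side [1 / (n + 1)]: a base of the topology indexed by a
    countable type. *)
Definition rbox (q : rat * rat * rat * nat) : set (R3 R) :=
  [set x : R3 R | [/\ `|x.1.1 - ratr q.1.1.1| < q.2.+1%:R^-1,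
     `|x.1.2 - ratr q.1.1.2| < q.2.+1%:R^-1 & `|x.2 - ratr q.1.2| < q.2.+1%:R^-1]].

Lemma rbox_measurable q : measurable (rbox q : set (T3 R)).
Proof.
have -> : rbox q = (`]ratr q.1.1.1 - q.2.+1%:R^-1, ratr q.1.1.1 + q.2.+1%:R^-1[%classic `*`
                 `]ratr q.1.1.2 - q.2.+1%:R^-1, ratr q.1.1.2 + q.2.+1%:R^-1[%classic) `*`
                 `]ratr q.1.2 - q.2.+1%:R^-1, ratr q.1.2 + q.2.+1%:R^-1[%classic.
  apply/seteqP; split=> -[[x y] z] /=; rewrite /rbox/= !in_itv/= -!ltr_distl.
    by case.
  by move=> [[]].
by apply: measurableX; [apply: measurableX|]; exact: measurable_itv.
Qed.

Lemma rbox_base (O : set (R3 R)) x : open O -> O x -> exists2 q, rbox q x & rbox q `<=` O.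
Proof.
move=> oO Ox; have /nbhs_ballP[e /= e0 eO] : nbhs (x : R3 R) O by exact: open_nbhs_nbhs.
have [n ne] : exists n : nat, n.+1%:R^-1 < e / 2.
  exists (Num.truncn (e / 2)^-1); rewrite invf_plt ?posrE ?divr_gt0//.
  exact: truncnS_gt.
have n0 : 0 < (n.+1%:R^-1 : R) by rewrite invr_gt0 ltr0n.
have ex (y : R) : exists q : rat, `|y - ratr q| < n.+1%:R^-1.
  have : y - n.+1%:R^-1 < y + n.+1%:R^-1 by rewrite ltrD2l gtrN.
  by move=> /rat_in_itvoo[q]; rewrite in_itv/= => h; exists q; rewrite distrC ltr_distl.
have [q1 h1] := ex x.1.1; have [q2 h2] := ex x.1.2; have [q3 h3] := ex x.2.
exists (q1, q2, q3, n) => // y [/= k1 k2 k3]; apply: eO.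
have tri (a b c : R) : `|a - c| < n.+1%:R^-1 -> `|b - c| < n.+1%:R^-1 -> ball a e b.
  move=> h k; rewrite /ball/= (le_lt_trans (ler_distD c _ _))// [`|c - _|]distrC.
  rewrite (splitr e); apply: ltrD; exact: lt_trans ne.
by split; [split|]; [exact: (tri _ _ (ratr q1))|exact: (tri _ _ (ratr q2))|exact: (tri _ _ (ratr q3))].
Qed.

(** The sigma-algebra is the product one, not defined from the topology; the link is that an open
    set is the countable union of the [rbox] sets it contains. *)
Lemma open3_measurable (O : set (R3 R)) : open O -> measurable (O : set (T3 R)).
Proof.
move=> oO.
have -> : (O : set (T3 R)) = \bigcup_q (if `[< rbox q `<=` O >] then rbox q else set0).
  apply/seteqP; split=> [x Ox|x [q _]]; last by case: ifPn => // /asboolP; exact.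
  have [q qx qO] := rbox_base oO Ox.
  by exists q => //; rewrite ifT//; exact/asboolP.
apply: countable_bigcupT_measurable; first exact: countableP.
by move=> q; case: ifP => _; [exact: rbox_measurable|exact: measurable0].
Qed.

Lemma cont3_measurable (f : R3 R -> R) : continuous f -> measurable_fun setT (f : T3 R -> R).
Proof.
move=> cf; apply: (@measurability _ _ _ _ _ _ (@RGenOInfty.G R)).
  exact: RGenOInfty.measurableE.
move=> _ [_ [a ->] <-]; rewrite setTI; apply: open3_measurable.
by apply: open_comp => //; exact: open_gt.
Qed.

Lemma support_bounded (f : R3 R -> R) : compact (closure [set x | f x != 0]) ->
  exists N, 0 < N /\ forall x, f x != 0 -> bx N N x.
Proof.
move=> /compact_bounded[M [Mr hM]].
exists (`|M| + 1); split; first by have := normr_ge0 M; lra.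
move=> x fx.
have := hM (`|M| + 1); rewrite (le_lt_trans (ler_norm M)) ?ltrDl// => /(_ isT x).
move=> /(_ (@subset_closure _ [set x | f x != 0] x fx)).
move=> h.
have : Num.max (Num.max `|x.1.1| `|x.1.2|) `|x.2| <= `|M| + 1 by exact: h.
by rewrite !ge_max => /andP[/andP[? ?] ?].
Qed.

Lemma bounded_support (f : R3 R -> R) N : (forall x, f x != 0 -> bx N N x) ->
  compact (closure [set x | f x != 0]).
Proof.
move=> fN; apply: (subclosed_compact _ (bx_compact (a := N) (c := N))).
  exact: closed_closure.
rewrite -[X in _ `<=` X](_ : closure (bx N N) = _).
  by apply: closure_subset => x; exact: fN.
apply/esym/closure_id; apply: compact_closed; last exact: bx_compact.
exact: norm_hausdorff.
Qed.

(** Compactness of the support is traded here for vanishing outside a box [bx N N], the form in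
    which it is used and propagated below. *)
Lemma test_functionP (f : R3 R -> R) :
  test_function f <-> smooth f /\ exists N, 0 < N /\ forall x, f x != 0 -> bx N N x.
Proof.
split=> [[sf cf]|[sf [N [_ hN]]]]; split => //; first exact: support_bounded.
exact: bounded_support hN.
Qed.

Lemma compact_support_bounded (f : R3 R -> R) N : continuous f ->
  (forall x, f x != 0 -> bx N N x) -> exists M, 0 <= M /\ forall x, `|f x| <= M.
Proof.
move=> cf fN.
have /compact_bounded[M [Mr hM]] : compact (f @` bx N N).
  apply: continuous_compact; last exact: bx_compact.
  exact: continuous_subspaceT.
exists (`|M| + 1); split; first by rewrite addr_ge0.
move=> x; have [->|fx] := eqVneq (f x) 0; first by rewrite normr0 addr_ge0.
have := hM (`|M| + 1); rewrite (le_lt_trans (ler_norm M)) ?ltrDl// => /(_ isT (f x)).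
by apply; exists x => //; exact: fN.
Qed.

End Topology3.

(** * Smooth functions *)

Section SmoothCalculus.
Variable R : realType.
Implicit Types (f g : R3 R -> R) (i j : 'I_3).

Local Notation e_ i := (unit_vector R i).

(** The recursion peels off the derivative that is taken first, whereas the [foldr] of [smooth]
    peels off the last one; in this order sums, products and compositions are handled by induction
    on [n]. *)
Fixpoint Cn (n : nat) (f : R3 R -> R) : Prop :=
  continuous f /\
  match n with
  | 0 => True
  | n'.+1 => forall i, (forall x, derivable f x (e_ i)) /\ Cn n' (partial i f)
  end.

Lemma Cn_continuous n f : Cn n f -> continuous f.
Proof. by case: n => [|n] []. Qed.

Lemma smoothP f : smooth f <-> forall n, Cn n f.
Proof.
split=> [sf n|].
  elim: n f sf => [|n IH] f sf; first by split => //; exact: (sf [::]).1.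
  split; first exact: (sf [::]).1.
  move=> i; split; first exact: (sf [::]).2.
  apply: IH => s.
  by have := sf (rcons s i); rewrite foldr_rcons.
move=> cf s; elim/last_ind: s f cf => [|s i IH] f cf.
  by split; [exact: (cf 0%N).1 | move=> i x; exact: ((cf 1%N).2 i).1].
rewrite foldr_rcons; apply: IH => n.
exact: ((cf n.+1).2 i).2.
Qed.

Lemma CnS n f (df : 'I_3 -> R3 R -> R) :
  continuous f -> (forall i x, is_derive x (e_ i) f (df i x)) ->
  (forall i, Cn n (df i)) -> Cn n.+1 f.
Proof.
move=> cf hd hn; split => // i; split; first by move=> x; have [] := hd i x.
have -> : partial i f = df i by apply/funext => x; exact: derive_val.
exact: hn.
Qed.

Lemma Cn_is_derive n f i x : Cn n.+1 f -> is_derive x (e_ i) f (partial i f x).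
Proof. by case=> _ /(_ i)[d _]; apply: DeriveDef. Qed.

Lemma Cn_partial n f i : Cn n.+1 f -> Cn n (partial i f).
Proof. by case=> _ /(_ i)[]. Qed.

Lemma CnW n f : Cn n.+1 f -> Cn n f.
Proof.
elim: n f => [|n IH] f; first by case=> c _; split.
case=> c h; split => // i; have [d hc] := h i; split => //; exact: IH.
Qed.

Lemma Cn_cst n (c : R) : Cn n (fun=> c).
Proof.
elim: n c => [|n IH] c; first by split => // x; exact: cst_continuous.
have hd (i : 'I_3) (x : R3 R) : is_derive x (e_ i) (fun=> c) (0 : R) by exact: is_derive_cst.
have cc : continuous (fun _ : R3 R => c) by move=> x; exact: cst_continuous.
exact: (CnS (df := fun _ _ => 0) cc hd (fun _ => IH 0)).
Qed.

Lemma Cn_add n f g : Cn n f -> Cn n g -> Cn n (fun x => f x + g x).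
Proof.
elim: n f g => [|n IH] f g cf cg.
  by split => // x; apply: continuousD; [exact: (Cn_continuous cf)|exact: (Cn_continuous cg)].
apply: (@CnS _ _ (fun i x => partial i f x + partial i g x)) => [x|i x|i].
- by apply: continuousD; [exact: (Cn_continuous cf)|exact: (Cn_continuous cg)].
- exact: (is_deriveD (Cn_is_derive i x cf) (Cn_is_derive i x cg)).
- by apply: IH; exact: Cn_partial.
Qed.

Lemma Cn_mul n f g : Cn n f -> Cn n g -> Cn n (fun x => f x * g x).
Proof.
elim: n f g => [|n IH] f g cf cg.
  by split => // x; apply: continuousM; [exact: (Cn_continuous cf)|exact: (Cn_continuous cg)].
apply: (@CnS _ _ (fun i x => f x * partial i g x + g x * partial i f x)) => [x|i x|i].
- by apply: continuousM; [exact: (Cn_continuous cf)|exact: (Cn_continuous cg)].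
- exact: (is_deriveM (Cn_is_derive i x cf) (Cn_is_derive i x cg)).
- by apply: Cn_add; apply: IH; (exact: CnW || exact: Cn_partial).
Qed.

Lemma smooth_cst (c : R) : smooth (fun=> c).
Proof. by apply/smoothP => n; exact: Cn_cst. Qed.

Lemma smooth_add f g : smooth f -> smooth g -> smooth (fun x => f x + g x).
Proof. by move=> /smoothP sf /smoothP sg; apply/smoothP => n; exact: Cn_add. Qed.

Lemma smooth_mul f g : smooth f -> smooth g -> smooth (fun x => f x * g x).
Proof. by move=> /smoothP sf /smoothP sg; apply/smoothP => n; exact: Cn_mul. Qed.

Lemma smooth_opp f : smooth f -> smooth (fun x => - f x).
Proof.
move=> sf; rewrite (_ : (fun _ => _) = fun x => -1 * f x).
  exact: (smooth_mul (smooth_cst (-1)) sf).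
by apply/funext => x; rewrite mulN1r.
Qed.

Lemma smooth_sub f g : smooth f -> smooth g -> smooth (fun x => f x - g x).
Proof. by move=> sf sg; exact: (smooth_add sf (smooth_opp sg)). Qed.

Lemma smooth_sum (I : Type) (r : seq I) (f : I -> R3 R -> R) :
  (forall k, smooth (f k)) -> smooth (fun x => \sum_(k <- r) f k x).
Proof.
move=> sf; elim: r => [|a r IH].
  by under eq_fun do rewrite big_nil; exact: (smooth_cst 0).
by under eq_fun do rewrite big_cons; exact: (smooth_add (sf a) IH).
Qed.

Lemma smooth_partial i f : smooth f -> smooth (partial i f).
Proof. by move=> /smoothP sf; apply/smoothP => n; exact: (Cn_partial i (sf n.+1)). Qed.

Lemma smooth_continuous f : smooth f -> continuous f.
Proof. by move=> sf; exact: (sf [::]).1. Qed.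

Lemma smooth_derivable f i x : smooth f -> derivable f x (e_ i).
Proof. by move=> sf; exact: (sf [::]).2. Qed.

Lemma partial_add i f g : smooth f -> smooth g ->
  partial i (fun x => f x + g x) = fun x => partial i f x + partial i g x.
Proof.
move=> sf sg; apply/funext => x; rewrite /partial.
by apply: deriveD; exact: smooth_derivable.
Qed.

Lemma partial_mul i f g : smooth f -> smooth g ->
  partial i (fun x => f x * g x) = fun x => f x * partial i g x + g x * partial i f x.
Proof.
move=> sf sg; apply/funext => x; rewrite /partial.
by apply: deriveM; exact: smooth_derivable.
Qed.

Lemma partial_opp i f : smooth f ->
  partial i (fun x => - f x) = fun x => - partial i f x.
Proof.
by move=> sf; apply/funext => x; apply: deriveN; exact: smooth_derivable.
Qed.

Lemma partial_sub i f g : smooth f -> smooth g ->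
  partial i (fun x => f x - g x) = fun x => partial i f x - partial i g x.
Proof.
move=> sf sg; rewrite (partial_add i sf (smooth_opp sg)).
by rewrite (partial_opp i sg).
Qed.

Lemma partial_cst i (c : R) : partial i (fun=> c) = fun=> 0.
Proof. by apply/funext => x; exact: derive_cst. Qed.

Lemma partial_sum (I : Type) (r : seq I) i (f : I -> R3 R -> R) :
  (forall k, smooth (f k)) ->
  partial i (fun x => \sum_(k <- r) f k x) = fun x => \sum_(k <- r) partial i (f k) x.
Proof.
move=> sf; elim: r => [|a r IH].
  by under eq_fun do rewrite big_nil; rewrite partial_cst; apply/funext=> x; rewrite big_nil.
under eq_fun do rewrite big_cons.
rewrite (partial_add i (sf a) (smooth_sum r sf)).
by rewrite IH; apply/funext => x; rewrite big_cons.
Qed.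

Lemma derive_translate (a : R3 R) f x v :
  (derivable f (x + a) v -> derivable (fun y => f (y + a)) x v) /\
  'D_v (fun y => f (y + a)) x = 'D_v f (x + a).
Proof.
have E : (fun h : R => h^-1 *: (((fun y => f (y + a)) \o shift x) (h *: v) - f (x + a)))
   = (fun h => h^-1 *: ((f \o shift (x + a)) (h *: v) - f (x + a))).
  by apply/funext => h /=; rewrite addrA.
by rewrite /derivable /derive E.
Qed.

Lemma Cn_translate n (a : R3 R) f : Cn n f -> Cn n (fun x => f (x + a)).
Proof.
have ca g : continuous g -> continuous (fun x : R3 R => g (x + a) : R).
  move=> cg x; apply: (@continuous_comp _ _ _ (fun x : R3 R => x + a) g); last exact: cg.
  by apply: continuousD => //; exact: cst_continuous.
elim: n f => [|n IH] f cf; first by split => //; apply: ca; case: cf.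
apply: (@CnS _ _ (fun i x => partial i f (x + a))) => [|i x|i].
- by apply: ca; exact: (Cn_continuous cf).
- have [h1 h2] := derive_translate a f x (e_ i).
  have [d _] := Cn_is_derive i (x + a) cf.
  by apply: DeriveDef; [exact: h1|rewrite h2].
- by apply: IH; exact: Cn_partial.
Qed.

Lemma smooth_translate (a : R3 R) f : smooth f -> smooth (fun x => f (x + a)).
Proof. by move=> /smoothP sf; apply/smoothP => n; exact: Cn_translate. Qed.

Lemma partial_translate i (a : R3 R) f :
  partial i (fun x => f (x + a)) = fun x => partial i f (x + a).
Proof. by apply/funext => x; exact: (derive_translate a f x (e_ i)).2. Qed.

Fixpoint C1n (n : nat) (b : R -> R) : Prop :=
  continuous b /\
  match n with
  | 0 => True
  | n'.+1 => (forall x, derivable b x 1) /\ C1n n' (derive1 b)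
  end.

Lemma C1nS n (b db : R -> R) : (forall x, is_derive x (1:R) b (db x)) -> C1n n db -> C1n n.+1 b.
Proof.
move=> hd hn; split.
  by move=> x; apply/differentiable_continuous/derivable1_diffP; have [] := hd x.
split; first by move=> x; have [] := hd x.
have -> // : derive1 b = db by apply/funext => x; rewrite derive1E; exact: derive_val.
Qed.

Lemma coord3_unit i j : coord3 i (e_ j) = (i == j)%:R.
Proof.
by case: i => -[|[|[|//]]] hi; case: j => -[|[|[|//]]] hj.
Qed.

Lemma coord3_add i (x y : R3 R) : coord3 i (x + y) = coord3 i x + coord3 i y.
Proof. by case: i => -[|[|[|//]]]. Qed.

Lemma coord3_scale i (c : R) (x : R3 R) : coord3 i (c *: x) = c * coord3 i x.
Proof. by case: i => -[|[|[|//]]]. Qed.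

Lemma coord3_continuous i : continuous (@coord3 R i).
Proof.
have c1 : continuous (fun x : R3 R => x.1) by move=> x; exact: cvg_fst.
have c2 : continuous (fun x : R3 R => x.2) by move=> x; exact: cvg_snd.
case: i => -[|[|[|//]]] hi x; rewrite /coord3/=.
- by apply: (@continuous_comp _ _ _ (fun x : R3 R => x.1) fst); [exact: c1|exact: cvg_fst].
- by apply: (@continuous_comp _ _ _ (fun x : R3 R => x.1) snd); [exact: c1|exact: cvg_snd].
- exact: c2.
Qed.

Lemma is_derive_coord i j (b : R -> R) (x : R3 R) : derivable b (coord3 i x) 1 ->
  is_derive x (e_ j) (fun x => b (coord3 i x)) ((i == j)%:R * derive1 b (coord3 i x)).
Proof.
move=> db.
pose q h := h^-1 *: (((fun x => b (coord3 i x)) \o shift x) (h *: e_ j) - b (coord3 i x)).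
have qE : q = fun h => h^-1 *: (b (h * (i == j)%:R + coord3 i x) - b (coord3 i x)).
  by apply/funext => h; rewrite /q/= coord3_add coord3_scale coord3_unit.
have [ij|ij] := eqVneq i j; last first.
  have q0 : q = fun=> 0.
    by rewrite qE (negbTE ij); apply/funext => h; rewrite mulr0 add0r subrr scaler0.
  apply: DeriveDef; rewrite /derivable /derive -/q q0; first exact: is_cvg_cst.
  by rewrite mul0r lim_cst.
have q1 : q = fun h => h^-1 *: ((b \o shift (coord3 i x)) (h *: 1) - b (coord3 i x)).
  rewrite qE ij eqxx; apply/funext => h /=; by rewrite mulr1 /GRing.scale/= mulr1.
apply: DeriveDef; rewrite /derivable /derive -/q q1; first exact: db.
by rewrite mul1r derive1E.
Qed.

Lemma Cn_coord n i (b : R -> R) : C1n n b -> Cn n (fun x => b (coord3 i x)).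
Proof.
have ca (b0 : R -> R) : continuous b0 -> continuous (fun x : R3 R => b0 (coord3 i x)).
  move=> cb x; apply: (@continuous_comp _ _ _ (@coord3 R i) b0); last exact: cb.
  exact: coord3_continuous.
elim: n b => [|n IH] b; first by case=> cb _; split => //; exact: ca.
case=> cb [db hb].
apply: (@CnS _ _ (fun j x => (i == j)%:R * derive1 b (coord3 i x))) => [|j x|j].
- exact: ca.
- exact: is_derive_coord.
- by apply: Cn_mul; [exact: Cn_cst|exact: IH].
Qed.

End SmoothCalculus.

(** * One-dimensional cutoffs *)

Section Flat.
Variable R : realType.
Implicit Types p q : {poly R}.

(* The derivatives of [exp (- 1 / x)] on the positive axis are of the form [p (1 / x) exp (- 1 / x)]
   with [p] a polynomial. *)
Definition flat p (x : R) : R := if 0 < x then p.[x^-1] * expR (- x^-1) else 0.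

(** With [y = 1 / x], the chain rule multiplies [(p' - p)(y) exp (- y)] by [- y ^ 2]. *)
Definition flat_deriv p := 'X^2 * (p - p^`()).

(** A single term of the exponential series suffices: [y ^ (k + 2) / (k + 2)! <= exp y]. *)
Lemma pow_expRN_le (k : nat) (y : R) : 0 < y ->
  y ^+ k * expR (- y) <= (k.+2)`!%:R * y ^- 2.
Proof.
move=> y0; rewrite expRN ler_pdivrMr ?expR_gt0//.
have h := expR_ge1Dxn k.+1 (ltW y0).
have f0 : 0 < (k.+2)`!%:R :> R by rewrite ltr0n fact_gt0.
have : y ^+ k.+2 / (k.+2)`!%:R <= expR y by apply: le_trans h; rewrite lerDr.
rewrite ler_pdivrMr// => h2.
have -> : y ^+ k = y ^+ k.+2 * y ^- 2.
  by rewrite -addn2 exprD mulfK// expf_neq0// gt_eqF.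
by rewrite [leRHS]mulrAC ler_wpM2r ?invr_ge0 ?exprn_ge0 ?(ltW y0)// mulrC.
Qed.

(** Quadratic decay at 0 is what makes the difference quotients of [flat p] at 0 tend to 0, for
    every [p] and hence for all derivatives. *)
Lemma flat_le p : exists C, 0 <= C /\ forall x, 0 < x -> `|flat p x| <= C * x ^+ 2.
Proof.
exists (\sum_(k < size p) `|p`_k| * (k.+2)`!%:R); split.
  by apply: sumr_ge0 => k _; rewrite mulr_ge0.
move=> x x0; rewrite /flat x0 horner_coef mulr_suml mulr_suml.
apply: le_trans (ler_norm_sum _ _ _) _; apply: ler_sum => k _.
have y0 : 0 < x^-1 by rewrite invr_gt0.
rewrite -!mulrA normrM ler_wpM2l// ger0_norm; last first.
  by rewrite mulr_ge0 ?expR_ge0// exprn_ge0// ltW.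
by apply: le_trans (pow_expRN_le k y0) _; rewrite exprVn invrK.
Qed.

Lemma flat_is_derive_pos p (x : R) : 0 < x ->
  is_derive x (1 : R) (fun x => p.[x^-1] * expR (- x^-1)) (flat (flat_deriv p) x).
Proof.
move=> x0.
have dV : is_derive x (1 : R) (fun x : R => x^-1) (- x ^- 2).
  have xn0 : x != 0 by rewrite gt_eqF.
  have d := is_deriveV (f := fun x : R => x) (x := x) (v := 1) xn0 (is_derive_id x 1).
  by apply: (is_derive_eq d); rewrite /GRing.scale/= mulr1.
have dN : is_derive x (1 : R) (fun x : R => - x^-1) (x ^- 2).
  by apply: (is_derive_eq (is_deriveN dV)); rewrite opprK.
have d1 : is_derive x (1 : R) (fun x : R => p.[x^-1]) (p^`().[x^-1] * (- x ^- 2)).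
  have dp : is_derive (x^-1) (1 : R) (fun y : R => p.[y]) (p^`().[x^-1]) by exact: is_derive_poly.
  exact: (is_derive1_comp dp dV).
have d2 : is_derive x (1 : R) (fun x : R => expR (- x^-1)) (expR (- x^-1) * x ^- 2).
  exact: (@is_derive1_comp R expR (fun x => - x^-1) x _ _ (is_derive_expR (- x^-1)) dN).
apply: (is_derive_eq (is_deriveM d1 d2)).
rewrite /flat x0 /flat_deriv !hornerE /GRing.scale/= -!exprVn; ring.
Qed.

Lemma flat_is_derive p x : is_derive x (1 : R) (flat p) (flat (flat_deriv p) x).
Proof.
have [x0|x0|<-] := ltgtP 0 x.
- apply: near_eq_is_derive (flat_is_derive_pos p x0).
  near=> y; rewrite /flat ifT//; near: y; exact: lt_nbhsr.
- rewrite [X in is_derive _ _ _ X](_ : _ = 0); last first.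
    by rewrite /flat ltNge (ltW x0).
  apply: (near_eq_is_derive (f := fun=> 0)).
    near=> y; rewrite /flat ifF//; apply/negbTE; rewrite -leNgt.
    by apply: ltW; near: y; exact: lt_nbhsl.
have -> : flat (flat_deriv p) 0 = 0 by rewrite /flat ltxx.
have [C [C0 hC]] := flat_le p.
have : h^-1 *: ((flat p \o shift 0) (h *: 1) - flat p 0) @[h --> 0^'] --> (0 : R).
  apply/cvgrPdist_le => e e0; near=> h.
  have -> : h^-1 *: ((flat p \o shift 0) (h *: 1) - flat p 0) = h^-1 * flat p h.
    have -> : flat p 0 = 0 by rewrite /flat ltxx.
    rewrite subr0 /= addr0 (_ : h *: 1 = h)//.
    exact: mulr1.
  rewrite sub0r normrN normrM normfV.
  have hn0 : h != 0 by near: h; exact: nbhs_dnbhs_neq.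
  have [h0|h0] := ltP 0 h; last first.
    by rewrite /flat ltNge h0/= normr0 mulr0 ltW.
  have habs : `|h| = h by rewrite gtr0_norm.
  apply: (@le_trans _ _ (h^-1 * (C * h ^+ 2))).
    by rewrite habs ler_wpM2l ?invr_ge0 ?(ltW h0)// hC.
  rewrite mulrCA expr2 mulKf// -[h]habs.
  apply: (@le_trans _ _ ((C + 1) * `|h|)); first by rewrite ler_wpM2r// lerDl.
  rewrite -ler_pdivlMl ?ltr_wpDl//.
  near: h; apply: dnbhs0_le; rewrite mulr_gt0// invr_gt0 ltr_wpDl//.
move=> h; apply: DeriveDef; first by apply/cvg_ex; exists 0.
exact/cvg_lim.
Unshelve. all: by end_near. Qed.

Lemma flat_C1n n p : C1n n (flat p).
Proof.
elim: n p => [|n IH] p.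
  split => // x; apply/differentiable_continuous/derivable1_diffP.
  by have [] := flat_is_derive p x.
by apply: (C1nS (db := flat (flat_deriv p))) => // x; exact: flat_is_derive.
Qed.

End Flat.

(** * Steps and cutoffs of one variable, with uniform bounds on their derivatives *)

Section Cutoffs.
Variable R : realType.
Implicit Types (b f g : R -> R).

Lemma C1n_continuous n b : C1n n b -> continuous b.
Proof. by case: n => [|n] []. Qed.

Lemma C1nW n b : C1n n.+1 b -> C1n n b.
Proof.
elim: n b => [|n IH] b; first by case=> c _; split.
case=> c [d h]; split => //; split => //; exact: IH.
Qed.

Lemma C1n_is_derive n b x : C1n n.+1 b -> is_derive x (1 : R) b (derive1 b x).
Proof. by case=> _ [d _]; apply: DeriveDef => //; rewrite derive1E. Qed.

Lemma C1n_derive1 n b : C1n n.+1 b -> C1n n (derive1 b).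
Proof. by case=> _ []. Qed.

Lemma C1n_cst n (c : R) : C1n n (fun=> c).
Proof.
elim: n c => [|n IH] c; first by split => // x; exact: cst_continuous.
have d0 (x : R) : is_derive x (1 : R) (fun _ : R => c) (0 : R) by exact: is_derive_cst.
exact: (C1nS d0 (IH 0)).
Qed.

Lemma C1n_add n f g : C1n n f -> C1n n g -> C1n n (fun x => f x + g x).
Proof.
elim: n f g => [|n IH] f g cf cg.
  split => // x.
  exact: (continuousD (C1n_continuous cf (x := x)) (C1n_continuous cg (x := x))).
apply: (C1nS (db := fun x => derive1 f x + derive1 g x)) => [x|].
  exact: (is_deriveD (C1n_is_derive x cf) (C1n_is_derive x cg)).
by apply: IH; exact: C1n_derive1.
Qed.

Lemma C1n_mul n f g : C1n n f -> C1n n g -> C1n n (fun x => f x * g x).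
Proof.
elim: n f g => [|n IH] f g cf cg.
  split => // x.
  exact: (continuousM (C1n_continuous cf (x := x)) (C1n_continuous cg (x := x))).
apply: (C1nS (db := fun x => f x * derive1 g x + g x * derive1 f x)) => [x|].
  exact: (is_deriveM (C1n_is_derive x cf) (C1n_is_derive x cg)).
apply: C1n_add; apply: IH; (exact: C1nW || exact: C1n_derive1).
Qed.

Lemma C1n_inv n f : (forall x, f x != 0) -> C1n n f -> C1n n (fun x => (f x)^-1).
Proof.
move=> f0; elim: n => [|n IH] cf.
  split => // x; exact: (continuousV (f0 x) (C1n_continuous cf (x := x))).
apply: (C1nS (db := fun x => (- 1) * ((f x)^-1 * (f x)^-1) * derive1 f x)) => [x|].
  apply: (is_derive_eq (is_deriveV (f0 x) (C1n_is_derive x cf))).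
  by rewrite /GRing.scale/= mulN1r expr2 invfM.
have h := IH (C1nW cf).
apply: C1n_mul; last exact: C1n_derive1.
by apply: C1n_mul; [exact: C1n_cst|exact: C1n_mul].
Qed.

Lemma is_derive_affine (c d x : R) : is_derive x (1 : R) (fun x => c * x + d) c.
Proof.
have h1 : is_derive x (1 : R) (fun x : R => c *: x) (c *: 1).
  exact: is_deriveZ.
have h2 : is_derive x (1 : R) (fun _ : R => d) (0 : R) by exact: is_derive_cst.
by apply: (is_derive_eq (is_deriveD h1 h2)); rewrite addr0 /GRing.scale/= mulr1.
Qed.

Lemma C1n_affine n (c d : R) b : C1n n b -> C1n n (fun x => b (c * x + d)).
Proof.
elim: n b => [|n IH] b cb.
  split => // x.
  apply: (@continuous_comp _ _ _ (fun x : R => c * x + d) b).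
    apply/differentiable_continuous/derivable1_diffP.
    by have [] := is_derive_affine c d x.
  exact: (C1n_continuous cb).
have h x : is_derive x (1 : R) (fun x => b (c * x + d)) (derive1 b (c * x + d) * c).
  exact: (@is_derive1_comp R b (fun x => c * x + d) x _ _
    (C1n_is_derive (c * x + d) cb) (is_derive_affine c d x)).
apply: (C1nS h).
apply: C1n_mul; last exact: C1n_cst.
by apply: IH; exact: C1n_derive1.
Qed.

Definition expflat : R -> R := flat (1 : {poly R}).

Lemma expflat_gt0 x : 0 < x -> 0 < expflat x.
Proof. by move=> x0; rewrite /expflat /flat x0 hornerC mul1r expR_gt0. Qed.

Lemma expflat_le0 x : x <= 0 -> expflat x = 0.
Proof. by move=> x0; rewrite /expflat /flat ltNge x0. Qed.

Lemma expflat_ge0 x : 0 <= expflat x.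
Proof. by have [x0|/expflat_gt0/ltW//] := leP x 0; rewrite expflat_le0. Qed.

(** The classical smooth transition from 0 on the negative axis to 1 beyond 1. The reflection is
    written [(- 1) * x + 1] to match [C1n_affine]. *)
Definition step x := expflat x * (expflat x + expflat ((- 1) * x + 1))^-1.

Lemma step_den_gt0 x : 0 < expflat x + expflat ((- 1) * x + 1).
Proof.
have [x0|x0] := leP x 0.
  by rewrite ltr_wpDl ?expflat_ge0// expflat_gt0//; lra.
by rewrite ltr_wpDr ?expflat_ge0// expflat_gt0.
Qed.

Lemma step_C1n n : C1n n step.
Proof.
have e1 : C1n n expflat by exact: flat_C1n.
apply: C1n_mul => //; apply: C1n_inv; first by move=> x; rewrite gt_eqF// step_den_gt0.
by apply: C1n_add => //; exact: C1n_affine.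
Qed.

Lemma step_le0 x : x <= 0 -> step x = 0.
Proof. by move=> x0; rewrite /step expflat_le0// mul0r. Qed.

Lemma step_ge1 x : 1 <= x -> step x = 1.
Proof.
move=> x1; rewrite /step (@expflat_le0 (_ + _)) ?addr0; last by lra.
by rewrite divff// gt_eqF// expflat_gt0//; lra.
Qed.

Lemma step_ge0 x : 0 <= step x.
Proof. by rewrite divr_ge0 ?expflat_ge0// ltW// step_den_gt0. Qed.

Lemma step_le1 x : step x <= 1.
Proof. by rewrite ler_pdivrMr ?step_den_gt0// mul1r lerDl expflat_ge0. Qed.

Lemma derive1_near_cst f (c x : R) : (\near x, f x = c) -> derive1 f x = 0.
Proof.
move=> h; rewrite derive1E.
have c0 : is_derive x (1 : R) (fun _ : R => c) (0 : R) by exact: is_derive_cst.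
have d : is_derive x (1 : R) f 0.
  by apply: near_eq_is_derive c0; near=> y; apply/esym; near: y.
exact: derive_val.
Unshelve. all: by end_near. Qed.

Lemma derive1_cst_left f (c a : R) : (forall x, x <= a -> f x = c) ->
  forall x, x < a -> derive1 f x = 0.
Proof.
move=> h x xa; apply: (@derive1_near_cst _ c); near=> y.
by apply: h; apply: ltW; near: y; exact: lt_nbhsl.
Unshelve. all: by end_near. Qed.

Lemma derive1_cst_right f (c a : R) : (forall x, a <= x -> f x = c) ->
  forall x, a < x -> derive1 f x = 0.
Proof.
move=> h x xa; apply: (@derive1_near_cst _ c); near=> y.
by apply: h; apply: ltW; near: y; exact: lt_nbhsr.
Unshelve. all: by end_near. Qed.

Lemma continuous_eq0_right f (a : R) : continuous f -> (forall x, a < x -> f x = 0) -> f a = 0.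
Proof.
move=> cf h; apply/eqP; apply: contraT => fa.
have /cvgrPdist_lt/(_ `|f a|) := cf a.
rewrite normr_gt0 => /(_ fa) [e /= e0 he].
have : ball_ Num.norm a e (a + e / 2).
  by rewrite /= opprD addNKr normrN gtr0_norm ?divr_gt0// ltr_pdivrMr// ltr_pMr// ltr1n.
move=> /he; rewrite (h (a + e / 2)) ?subr0 ?ltxx// ltrDl divr_gt0//.
Qed.

Lemma continuous_eq0_left f (a : R) : continuous f -> (forall x, x < a -> f x = 0) -> f a = 0.
Proof.
move=> cf h; apply/eqP; apply: contraT => fa.
have /cvgrPdist_lt/(_ `|f a|) := cf a.
rewrite normr_gt0 => /(_ fa) [e /= e0 he].
have : ball_ Num.norm a e (a - e / 2).
  by rewrite /= opprB addrC subrK gtr0_norm ?divr_gt0// ltr_pdivrMr// ltr_pMr// ltr1n.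
by move=> /he; rewrite (h (a - e / 2)) ?subr0 ?ltxx// ltrBlDr ltrDl divr_gt0.
Qed.

Lemma dstep_le0 x : x <= 0 -> derive1 step x = 0.
Proof.
rewrite le_eqVlt => /predU1P[->|]; last by move: x; exact: (derive1_cst_left step_le0).
apply: continuous_eq0_left; last exact: (derive1_cst_left step_le0).
exact: (C1n_continuous (C1n_derive1 (step_C1n 1))).
Qed.

Lemma dstep_ge1 x : 1 <= x -> derive1 step x = 0.
Proof.
rewrite le_eqVlt => /predU1P[<-|]; last by move: x; exact: (derive1_cst_right step_ge1).
apply: continuous_eq0_right; last exact: (derive1_cst_right step_ge1).
exact: (C1n_continuous (C1n_derive1 (step_C1n 1))).
Qed.

Lemma bounded_of_support01 f : continuous f -> (forall x, x < 0 -> f x = 0) ->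
  (forall x, 1 < x -> f x = 0) -> exists M, forall x, `|f x| <= M.
Proof.
move=> cf h0 h1.
have /compact_bounded[M [Mr hM]] : compact (f @` `[0, 1]%classic).
  apply: continuous_compact; last exact: segment_compact.
  exact: continuous_subspaceT.
exists (`|M| + 1) => x.
have [/h0->|x0] := ltP x 0; first by rewrite normr0 addr_ge0.
have [/h1->|x1] := ltP 1 x; first by rewrite normr0 addr_ge0.
have := hM (`|M| + 1); rewrite (le_lt_trans (ler_norm M)) ?ltrDl// => /(_ isT (f x)).
by apply; exists x => //=; rewrite in_itv/= x0 x1.
Qed.

Lemma step_bounds : exists C, [/\ 1 <= C, forall x, `|derive1 step x| <= C &
  forall x, `|derive1 (derive1 step) x| <= C].
Proof.
have c1 := C1n_derive1 (step_C1n 2); have c2 := C1n_derive1 c1.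
have [M1 h1] : exists M, forall x, `|derive1 step x| <= M.
  apply: bounded_of_support01; first exact: (C1n_continuous c1).
    by move=> x /ltW; exact: dstep_le0.
  by move=> x /ltW; exact: dstep_ge1.
have [M2 h2] : exists M, forall x, `|derive1 (derive1 step) x| <= M.
  apply: bounded_of_support01; first exact: (C1n_continuous c2).
    exact: (derive1_cst_left dstep_le0).
  exact: (derive1_cst_right dstep_ge1).
exists (`|M1| + `|M2| + 1); split.
- by rewrite lerDr addr_ge0.
- by move=> x; apply: le_trans (h1 x) _; have := ler_norm M1; have := normr_ge0 M2; lra.
- by move=> x; apply: le_trans (h2 x) _; have := ler_norm M2; have := normr_ge0 M1; lra.
Qed.

(** The argument [(x + s + d) / d] vanishes at [- s - d] and reaches 1 at [- s], and the other one
    is its mirror image: the product is 1 on [[- s, s]] and 0 outside [[- s - d, s + d]]. *)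
Definition cut1 (s d x : R) : R :=
  step (d^-1 * x + (s + d) / d) * step ((- d^-1) * x + (s + d) / d).

Definition dcut1 (s d x : R) : R :=
  d^-1 * (derive1 step (d^-1 * x + (s + d) / d) * step ((- d^-1) * x + (s + d) / d)
        - step (d^-1 * x + (s + d) / d) * derive1 step ((- d^-1) * x + (s + d) / d)).

Lemma cut1_C1n s d n : C1n n (cut1 s d).
Proof. by apply: C1n_mul; apply: C1n_affine; exact: step_C1n. Qed.

Lemma derive1_affine n b (c k : R) : C1n n.+1 b ->
  derive1 (fun x => b (c * x + k)) = fun x => derive1 b (c * x + k) * c.
Proof.
move=> cb; apply/funext => x; rewrite [LHS]derive1E.
have d := @is_derive1_comp R b (fun x => c * x + k) x _ _
    (C1n_is_derive (c * x + k) cb) (is_derive_affine c k x).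
exact: (@derive_val _ _ _ _ _ _ _ d).
Qed.

Lemma derive1_mul n f g : C1n n.+1 f -> C1n n.+1 g ->
  derive1 (fun x => f x * g x) = fun x => f x * derive1 g x + g x * derive1 f x.
Proof.
move=> cf cg; apply/funext => x; rewrite [LHS]derive1E.
have d := is_deriveM (C1n_is_derive x cf) (C1n_is_derive x cg).
exact: (@derive_val _ _ _ _ _ _ _ d).
Qed.

Lemma derive1_cut1 s d : derive1 (cut1 s d) = dcut1 s d.
Proof.
have c1 := step_C1n 1.
rewrite /cut1 (derive1_mul (C1n_affine _ _ c1) (C1n_affine _ _ c1)).
rewrite (derive1_affine d^-1 ((s + d) / d) c1) (derive1_affine (- d^-1) ((s + d) / d) c1).
apply/funext => x; rewrite /dcut1; ring.
Qed.

Lemma cut1_arg (s d x : R) : 0 < d -> `|x| <= s ->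
  1 <= d^-1 * x + (s + d) / d /\ 1 <= - d^-1 * x + (s + d) / d.
Proof.
move=> d0; rewrite ler_norml => /andP[h1 h2].
have -> : d^-1 * x + (s + d) / d = (x + s + d) / d by field; rewrite gt_eqF.
have -> : - d^-1 * x + (s + d) / d = (s + d - x) / d by field; rewrite gt_eqF.
by rewrite !ler_pdivlMr// !mul1r; split; lra.
Qed.

Lemma cut1_eq1 (s d x : R) : 0 < d -> `|x| <= s -> cut1 s d x = 1.
Proof. by move=> d0 /(cut1_arg d0)[h1 h2]; rewrite /cut1 !step_ge1// mulr1. Qed.

Lemma dcut1_eq0 (s d x : R) : 0 < d -> `|x| <= s -> dcut1 s d x = 0.
Proof.
by move=> d0 /(cut1_arg d0)[h1 h2]; rewrite /dcut1 !dstep_ge1// mul0r mulr0 subrr mulr0.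
Qed.

Lemma cut1_arg2 (s d x : R) : 0 < d -> s + d <= `|x| ->
  d^-1 * x + (s + d) / d <= 0 \/ - d^-1 * x + (s + d) / d <= 0.
Proof.
move=> d0.
have -> : d^-1 * x + (s + d) / d = (x + s + d) / d by field; rewrite gt_eqF.
have -> : - d^-1 * x + (s + d) / d = (s + d - x) / d by field; rewrite gt_eqF.
rewrite !ler_pdivrMr// !mul0r ler_normr => /orP[]; by [right; lra|left; lra].
Qed.

Lemma cut1_eq0 (s d x : R) : 0 < d -> s + d <= `|x| -> cut1 s d x = 0.
Proof.
by move=> d0 /(cut1_arg2 d0)[h|h]; rewrite /cut1 (step_le0 h) ?mul0r ?mulr0.
Qed.

Lemma dcut1_eq0' (s d x : R) : 0 < d -> s + d <= `|x| -> dcut1 s d x = 0.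
Proof.
by move=> d0 /(cut1_arg2 d0)[h|h];
  rewrite /dcut1 (step_le0 h) (dstep_le0 h) ?mul0r ?mulr0 subrr mulr0.
Qed.

Lemma cut1_ge0 (s d x : R) : 0 <= cut1 s d x.
Proof. by rewrite mulr_ge0 ?step_ge0. Qed.

Lemma cut1_le1 (s d x : R) : cut1 s d x <= 1.
Proof. by rewrite mulr_ile1 ?step_ge0 ?step_le1. Qed.

(** The arguments of the steps have slope [1 / d] or [- 1 / d], hence a factor [1 / d] per
    derivative, with a constant that depends neither on [s] nor on [d]. *)
Lemma cut1_bounds : exists C, 1 <= C /\ forall s d : R, 0 < d -> forall x,
  `|derive1 (cut1 s d) x| <= C / d /\ `|derive1 (derive1 (cut1 s d)) x| <= C / d ^+ 2.
Proof.
have [C [C1 h1 h2]] := step_bounds.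
have sn y : `|step y| <= 1 by rewrite ger0_norm ?step_ge0 ?step_le1.
have C0 : 0 <= C by lra.
(* The second derivative of the product contributes [C + 2 C ^ 2 + C], at most [4 C ^ 2] because
   [1 <= C]. *)
exists (4 * C ^+ 2); split.
  by have : 1 <= C ^+ 2 by [rewrite expr_ge1]; lra.
move=> s d d0 x.
have i0 : 0 <= d^-1 by rewrite invr_ge0 ltW.
have CC : C <= C ^+ 2 by rewrite expr2 ler_peMr.
have c2 := step_C1n 2; have c1 := C1n_derive1 c2.
set a := d^-1 * x + (s + d) / d; set a' := - d^-1 * x + (s + d) / d.
split.
  rewrite derive1_cut1 /dcut1 -/a -/a' normrM ger0_norm// mulrC ler_wpM2r//.
  apply: le_trans (ler_normB _ _) _; rewrite (normrM (derive1 step a)) (normrM (step a)).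
  have k1 := ler_pM (normr_ge0 _) (normr_ge0 _) (h1 a) (sn a').
  have k2 := ler_pM (normr_ge0 _) (normr_ge0 _) (sn a) (h1 a').
  apply: le_trans (lerD k1 k2) _; rewrite mul1r mulr1; clear -C0 CC; lra.
have E : derive1 (derive1 (cut1 s d)) x = d^-1 ^+ 2 *
   (derive1 (derive1 step) a * step a' - 2 * (derive1 step a * derive1 step a')
      + step a * derive1 (derive1 step) a').
  have p1 : C1n 1 (fun x => step (d^-1 * x + (s + d) / d)) by apply: C1n_affine; exact: step_C1n.
  have p2 : C1n 1 (fun x => step (- d^-1 * x + (s + d) / d)) by apply: C1n_affine; exact: step_C1n.
  have q1 : C1n 1 (fun x => derive1 step (d^-1 * x + (s + d) / d)) by apply: C1n_affine.
  have q2 : C1n 1 (fun x => derive1 step (- d^-1 * x + (s + d) / d)) by apply: C1n_affine.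
  have -> : derive1 (cut1 s d) = fun x => (fun=> d^-1) x *
     ((derive1 step (d^-1 * x + (s + d) / d) * step (- d^-1 * x + (s + d) / d))
    + ((fun=> -1) x * (step (d^-1 * x + (s + d) / d) * derive1 step (- d^-1 * x + (s + d) / d)))).
    by rewrite derive1_cut1; apply/funext => y; rewrite /dcut1 mulN1r.
  have m1 := C1n_mul q1 p2; have m2 := C1n_mul p1 q2.
  have m3 := C1n_mul (C1n_cst 1 (-1)) m2.
  rewrite (derive1_mul (C1n_cst 1 d^-1) (C1n_add m1 m3)).
  have dD : derive1 (fun x => derive1 step (d^-1 * x + (s + d) / d) * step (- d^-1 * x + (s + d) / d)
    + (fun=> -1) x * (step (d^-1 * x + (s + d) / d) * derive1 step (- d^-1 * x + (s + d) / d))) x =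
    derive1 (fun x => derive1 step (d^-1 * x + (s + d) / d) * step (- d^-1 * x + (s + d) / d)) x
    + derive1 (fun x => (fun=> -1) x * (step (d^-1 * x + (s + d) / d) * derive1 step (- d^-1 * x + (s + d) / d))) x.
    rewrite [LHS]derive1E.
    have dd := is_deriveD (C1n_is_derive x m1) (C1n_is_derive x m3).
    exact: (@derive_val _ _ _ _ _ _ _ dd).
  rewrite dD (derive1_mul q1 p2) (derive1_mul (C1n_cst 1 (-1)) m2) (derive1_mul p1 q2).
  rewrite (derive1_affine d^-1 ((s + d) / d) (step_C1n 1)).
  rewrite (derive1_affine (- d^-1) ((s + d) / d) (step_C1n 1)).
  rewrite (derive1_affine d^-1 ((s + d) / d) c1).
  rewrite (derive1_affine (- d^-1) ((s + d) / d) c1).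
  have cst0 (k : R) : derive1 (fun=> k) x = 0.
    by rewrite derive1E; exact: derive_cst.
  rewrite !cst0 -/a -/a'; clearbody a a'.
  move: (derive1 (derive1 step) a) (derive1 (derive1 step) a') (derive1 step a)
    (derive1 step a') (step a) (step a') d^-1 => A A' B B' S S' D; cbv beta; ring.
rewrite E normrM ger0_norm ?exprn_ge0// exprVn mulrC ler_wpM2r ?invr_ge0 ?exprn_ge0 ?(ltW d0)//.
apply: le_trans (ler_normD _ _) _; apply: le_trans (lerD (ler_normB _ _) (lexx _)) _.
rewrite (normrM 2) (normrM (derive1 step a)) (normrM (step a)).
rewrite (normrM (derive1 (derive1 step) a)) (@ger0_norm _ 2)//.
have k1 := ler_pM (normr_ge0 _) (normr_ge0 _) (h2 a) (sn a').
have k2 := ler_pM (normr_ge0 _) (normr_ge0 _) (sn a) (h2 a').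
have k3 := ler_pM (normr_ge0 _) (normr_ge0 _) (h1 a) (h1 a').
have k4 := @ler_wpM2l R 2 (ler0n _ 2) _ _ k3.
apply: le_trans (lerD (lerD k1 k4) k2) _; rewrite mul1r mulr1 -expr2.
clear -C0 CC; lra.
Qed.

End Cutoffs.

(** * Integrals depending smoothly on a parameter *)

Section ParamIntegral.
Variable R : realType.
Local Notation e_ i := (unit_vector R i).

Definition dist1 (x y : R3 R) : R :=
  `|x.1.1 - y.1.1| + `|x.1.2 - y.1.2| + `|x.2 - y.2|.

(** Boundedness and Lipschitz continuity are preserved by integration against an integrable kernel,
    the constant being multiplied by its L1 norm. Continuity of all derivatives of such integrals
    thus follows without a limit theorem. *)
Definition LB (f : R3 R -> R) : Prop :=
  exists M, [/\ 0 <= M, forall x, `|f x| <= M & forall x y, `|f x - f y| <= M * dist1 x y].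

Fixpoint CB (n : nat) (f : R3 R -> R) : Prop :=
  LB f /\
  match n with
  | 0 => True
  | n'.+1 => forall i, (forall x, derivable f x (e_ i)) /\ CB n' (partial i f)
  end.

Lemma dist1_add x y z : dist1 (x + z) (y + z) = dist1 x y.
Proof.
have E (a b c : R) : a + c - (b + c) = a - b by ring.
by rewrite /dist1 (E x.1.1 y.1.1 z.1.1) (E x.1.2 y.1.2 z.1.2) (E x.2 y.2 z.2).
Qed.

Lemma LB_continuous f : LB f -> continuous f.
Proof.
case=> M [M0 _ hM] x; apply/cvgrPdist_le => e e0.
have d0 : 0 < e / (3 * M + 1) by rewrite divr_gt0// ltr_wpDl// mulr_ge0.
suff : nbhs (x : R3 R) [set y | `|f x - f y| <= e] by [].
apply/nbhs_ballP; exists (e / (3 * M + 1)) => //= y [[b1 b2] b3].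
apply: le_trans (hM x y) _.
apply: (@le_trans _ _ (M * (3 * (e / (3 * M + 1))))).
  rewrite ler_wpM2l// /dist1.
  have -> : 3 * (e / (3 * M + 1)) = e / (3 * M + 1) + e / (3 * M + 1) + e / (3 * M + 1) by ring.
  by rewrite !lerD//; apply: ltW.
have -> : M * (3 * (e / (3 * M + 1))) = (3 * M * e) / (3 * M + 1) by ring.
have p : 0 < 3 * M + 1 by rewrite ltr_wpDl// mulr_ge0.
by rewrite ler_pdivrMr// mulrDr mulr1 [e * _]mulrC lerDl ltW.
Qed.

Lemma CB_Cn n f : CB n f -> Cn n f.
Proof.
elim: n f => [|n IH] f; first by case=> /LB_continuous.
case=> /LB_continuous c h; split => // i; have [d hc] := h i; split => //; exact: IH.
Qed.

Lemma line_is_derive f i (x : R3 R) (t : R) : derivable f (x + t *: e_ i) (e_ i) ->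
  is_derive t (1 : R) (fun t => f (x + t *: e_ i)) (partial i f (x + t *: e_ i)).
Proof.
move=> d.
have E : (fun h : R => h^-1 *: (((fun t => f (x + t *: e_ i)) \o shift t) (h *: 1) - f (x + t *: e_ i)))
  = (fun h => h^-1 *: ((f \o shift (x + t *: e_ i)) (h *: e_ i) - f (x + t *: e_ i))).
  apply/funext => h /=; congr (_ *: (f _ - _)).
  by rewrite (_ : h *: 1 = h) ?scalerDl; [rewrite addrCA|exact: mulr1].
by apply: DeriveDef; rewrite /derivable /partial /derive E.
Qed.

Lemma line_lipschitz f i M (x : R3 R) (t : R) : (forall x, derivable f x (e_ i)) ->
  (forall x, `|partial i f x| <= M) -> `|f (x + t *: e_ i) - f x| <= M * `|t|.
Proof.
move=> df bM.
pose F := fun t => f (x + t *: e_ i); pose dF := fun t => partial i f (x + t *: e_ i).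
have dd s : is_derive s (1 : R) F (dF s) by exact: line_is_derive.
have F0 : F 0 = f x by rewrite /F scale0r addr0.
have cF : continuous F.
  by move=> s; apply/differentiable_continuous/derivable1_diffP; have [] := dd s.
rewrite -F0 -/(F t).
have [t0|t0|->] := ltgtP t 0; last by rewrite subrr !normr0 mulr0.
  have [c _ h] := MVT t0 (fun s _ => dd s) (continuous_subspaceT cF).
  by rewrite distrC h sub0r normrM normrN; apply: ler_wpM2r => //; exact: bM.
have [c _ h] := MVT t0 (fun s _ => dd s) (continuous_subspaceT cF).
by rewrite h subr0 normrM; apply: ler_wpM2r => //; exact: bM.
Qed.

(** The complement of a box is open, so outside the box [f] vanishes in a neighbourhood and not only
    at the point. *)
Lemma partial_support (f : R3 R -> R) a c i x : (forall x, f x != 0 -> bx a c x) ->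
  partial i f x != 0 -> bx a c x.
Proof.
move=> fN h; apply: contrapT => nb; move: h.
have oc : open (~` bx a c : set (R3 R)).
  by rewrite openC; apply: compact_closed; [exact: norm_hausdorff|exact: bx_compact].
have z0 : is_derive x (e_ i) (fun _ : R3 R => 0 : R) (0 : R) by exact: is_derive_cst.
have d : is_derive x (e_ i) f 0.
  apply: near_eq_is_derive z0.
  have : nbhs x (~` bx a c : set (R3 R)) by apply: open_nbhs_nbhs.
  apply: filterS => y /= ny; apply/esym/eqP; by apply: contraT => /fN/ny.
by rewrite /partial (@derive_val _ _ _ _ _ _ _ d) eqxx.
Qed.

Lemma smooth_LB f N : smooth f -> (forall x, f x != 0 -> bx N N x) -> LB f.
Proof.
move=> sf fN.
have [M0 [M00 h0]] := compact_support_bounded (smooth_continuous sf) fN.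
have pN i x : partial i f x != 0 -> bx N N x by exact: partial_support.
have hi i : exists M, 0 <= M /\ forall x, `|partial i f x| <= M.
  exact: (compact_support_bounded (smooth_continuous (smooth_partial i sf)) (pN i)).
have [M1 [M10 h1]] := hi ord0; have [M2 [M20 h2]] := hi (inord 1); have [M3 [M30 h3]] := hi (inord 2).
exists (M0 + M1 + M2 + M3); split.
- by rewrite !addr_ge0.
- move=> x; apply: le_trans (h0 x) _; clear -M10 M20 M30; lra.
move=> x y.
(* The points [y], [y1], [y2], [x] differ in one coordinate at a time, so the mean value theorem
   along an axis applies to each step. *)
pose y1 : R3 R := ((x.1.1, y.1.2), y.2); pose y2 : R3 R := ((x.1.1, x.1.2), y.2).
have E1 : y1 = y + (x.1.1 - y.1.1) *: e_ ord0.
  apply/pair_equal_spec; split; first apply/pair_equal_spec; first split.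
  - by rewrite /= /GRing.scale/= mulr1 addrC subrK.
  - by rewrite /= /GRing.scale/= mulr0 addr0.
  - by rewrite /= /GRing.scale/= mulr0 addr0.
have E2 : y2 = y1 + (x.1.2 - y.1.2) *: e_ (inord 1).
  apply/pair_equal_spec; split; first apply/pair_equal_spec; first split.
  - by rewrite /= /GRing.scale/= inordK// mulr0 addr0.
  - by rewrite /= /GRing.scale/= inordK// mulr1 addrC subrK.
  - by rewrite /= /GRing.scale/= inordK// mulr0 addr0.
have E3 : x = y2 + (x.2 - y.2) *: e_ (inord 2).
  rewrite [LHS]surjective_pairing [x.1]surjective_pairing.
  apply/pair_equal_spec; split; first apply/pair_equal_spec; first split.
  - by rewrite /= /GRing.scale/= inordK// mulr0 addr0.
  - by rewrite /= /GRing.scale/= inordK// mulr0 addr0.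
  - by rewrite /= /GRing.scale/= inordK// mulr1 addrC subrK.
have sd i z : derivable f z (e_ i) by exact: smooth_derivable.
have k1 := line_lipschitz y (x.1.1 - y.1.1) (sd ord0) h1.
have k2 := line_lipschitz y1 (x.1.2 - y.1.2) (sd _) h2.
have k3 := line_lipschitz y2 (x.2 - y.2) (sd _) h3.
rewrite -E1 in k1; rewrite -E2 in k2; rewrite -E3 in k3.
have -> : f x - f y = (f x - f y2) + (f y2 - f y1) + (f y1 - f y) by ring.
apply: le_trans (ler_normD _ _) _; apply: le_trans (lerD (ler_normD _ _) (lexx _)) _.
apply: le_trans (lerD (lerD k3 k2) k1) _.
have mono a M' : 0 <= a -> M' <= M0 + M1 + M2 + M3 -> M' * a <= (M0 + M1 + M2 + M3) * a.
  by move=> ? ?; rewrite ler_wpM2r.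
rewrite /dist1 !mulrDr.
have a1 : M1 * `|x.1.1 - y.1.1| <= (M0 + M1 + M2 + M3) * `|x.1.1 - y.1.1|.
  by apply: mono => //; clear -M00 M10 M20 M30; lra.
have a2 : M2 * `|x.1.2 - y.1.2| <= (M0 + M1 + M2 + M3) * `|x.1.2 - y.1.2|.
  by apply: mono => //; clear -M00 M10 M20 M30; lra.
have a3 : M3 * `|x.2 - y.2| <= (M0 + M1 + M2 + M3) * `|x.2 - y.2|.
  by apply: mono => //; clear -M00 M10 M20 M30; lra.
clear -a1 a2 a3; lra.
Qed.

Lemma smooth_CB n f N : smooth f -> (forall x, f x != 0 -> bx N N x) -> CB n f.
Proof.
elim: n f => [|n IH] f sf fN; first by split => //; exact: smooth_LB fN.
split; first exact: smooth_LB fN.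
move=> i; split; first by move=> x; exact: smooth_derivable.
by apply: IH; [exact: smooth_partial|move=> x; exact: partial_support].
Qed.

Context d (T : measurableType d) (mu : {measure set T -> \bar R}).
Variables (c : T -> R) (g : T -> R3 R).
Hypothesis ic : mu.-integrable setT (EFin \o c).
Hypothesis mg : measurable_fun setT (g : T -> T3 R).

(** A superposition of translates of [f]. With [T] the space and [g] the opposite it is a
    convolution, with [T] the line and [g s = s *: e_ i] an average along an axis; both inherit
    smoothness from here. *)
Definition pint (f : R3 R -> R) (x : R3 R) : R := \int[mu]_s (c s * f (x + g s)).

Lemma pint_integrable (f : R3 R -> R) M x : continuous f -> (forall x, `|f x| <= M) ->
  mu.-integrable setT (EFin \o (fun s => c s * f (x + g s))).
Proof.
move=> cf fM; apply: (@le_integrable _ _ _ mu setT measurableT _ (fun s => M%:E * (c s)%:E)%E).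
- apply/measurable_EFinP; apply: measurable_funM.
    by have /integrableP[/measurable_EFinP] := ic.
  have mf : measurable_fun setT (fun y : T3 R => f (x + y) : R).
    apply: cont3_measurable => y; apply: (@continuous_comp _ _ _ (fun y : R3 R => x + y) f); last exact: cf.
    by apply: continuousD => //; exact: cst_continuous.
  exact: (measurableT_comp mf mg).
- move=> s _; rewrite -EFinM /= lee_fin !normrM mulrC ler_wpM2r//.
  by apply: le_trans (fM _) _; exact: ler_norm.
- exact: integrableZl.
Qed.

Lemma pint_LB f : LB f -> LB (pint f).
Proof.
move=> [M [M0 hb hl]].
have cf : continuous f by apply: LB_continuous; exists M.
have icn : mu.-integrable setT (EFin \o (fun s => `|c s|)).
  by have := integrable_norm ic.
pose C := \int[mu]_s `|c s|.
have C0 : 0 <= C by apply: Rintegral_ge0.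
have key (k : T -> R) (D : R) : mu.-integrable setT (EFin \o (fun s => c s * k s)) ->
    (forall s, `|k s| <= D) -> `|\int[mu]_s (c s * k s)| <= C * D.
  move=> ik kD; apply: le_trans (le_normr_Rintegral measurableT ik) _.
  rewrite /C -RintegralZr//; apply: le_Rintegral => //.
  - by have := integrable_norm ik.
  - rewrite (_ : _ \o _ = fun s => (D%:E * `|c s|%:E)%E); first exact: integrableZl.
    by apply/funext => s /=; rewrite mulrC EFinM.
  - by move=> s _; rewrite normrM ler_wpM2l.
exists (C * M); split; first exact: mulr_ge0.
  by move=> x; apply: key => //; exact: pint_integrable.
move=> x y; rewrite -mulrA.
have ix := pint_integrable x cf hb; have iy := pint_integrable y cf hb.
rewrite /pint -RintegralB//.
rewrite (_ : (fun s => _) = fun s => c s * (f (x + g s) - f (y + g s))); last first.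
  by apply/funext => s; rewrite mulrBr.
apply: key.
  rewrite (_ : _ \o _ = (fun s => (c s * f (x + g s))%:E - (c s * f (y + g s))%:E)%E).
    exact: integrableB.
  by apply/funext => s /=; rewrite mulrBr.
move=> s; apply: le_trans (hl _ _) _; rewrite ler_wpM2l//.
by rewrite dist1_add.
Qed.

(** On the line through [x] in direction [e_ i] there is one real parameter; differentiation under
    the integral is dominated by [|c|] times the global bound on [partial i f], and the interval
    []-1, 1[] is an arbitrary neighbourhood of 0. *)
Lemma pint_is_derive f i x : LB f -> (forall y, derivable f y (e_ i)) -> LB (partial i f) ->
  is_derive x (e_ i) (pint f) (pint (partial i f) x).
Proof.
move=> [M [M0 hb hl]] df [M' [M'0 hb' hl']].
have cf : continuous f by apply: LB_continuous; exists M.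
pose F t s := c s * f (x + g s + t *: e_ i).
have FE t : \int[mu]_s F t s = pint f (x + t *: e_ i).
  by congr Rintegral; apply/funext => s; rewrite /F addrAC.
have dF t s : is_derive t (1 : R) (F^~ s) (c s * partial i f (x + g s + t *: e_ i)).
  have := @is_deriveZ _ _ _ _ (c s) _ _ _ (line_is_derive (df (x + g s + t *: e_ i))).
  exact.
have icn : mu.-integrable setT (EFin \o (fun s => `|c s|)).
  by have := integrable_norm ic.
have I0 : (`]-1, 1[%classic : set R) 0 by rewrite /= in_itv/= ltrN10 ltr01.
have iF t : (`]-1, 1[%classic : set R) t -> mu.-integrable setT (EFin \o F t).
  move=> _; have := pint_integrable (x + t *: e_ i) cf hb.
  by apply: eq_integrable => // s _ /=; rewrite /F addrAC.
have dF1 t s : (`]-1, 1[%classic : set R) t -> setT s -> derivable (F^~ s) t 1.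
  by move=> _ _; have [] := dF t s.
have iG : mu.-integrable setT (EFin \o (fun s => `|c s| * M')).
  rewrite (_ : _ \o _ = fun s => (M'%:E * `|c s|%:E)%E); first exact: integrableZl.
  by apply/funext => s /=; rewrite mulrC EFinM.
have p1E t s : partial1of2 F t s = c s * partial i f (x + g s + t *: e_ i).
  by rewrite partial1of2E; exact: (@derive_val _ _ _ _ _ _ _ (dF t s)).
have Gub t s : (`]-1, 1[%classic : set R) t -> setT s -> `|partial1of2 F t s| <= `|c s| * M'.
  by move=> _ _; rewrite p1E normrM ler_wpM2l.
have G0 s : 0 <= `|c s| * M' by rewrite mulr_ge0.
have h := cvg_differentiation_under_integral measurableT I0 iF dF1 G0 iG Gub.
have E : (fun h : R => h^-1 *: ((pint f \o shift x) (h *: e_ i) - pint f x))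
   = (fun h => h^-1 *: (\int[mu]_y F (h + 0) y - \int[mu]_y F 0 y)).
  by apply/funext => t; rewrite !FE /= addr0 scale0r addr0 [_ + x]addrC.
have E2 : \int[mu]_y partial1of2 F 0 y = pint (partial i f) x.
  by congr Rintegral; apply/funext => s; rewrite p1E scale0r addr0.
rewrite E2 -E in h.
by apply: DeriveDef; [apply/cvg_ex; exists (pint (partial i f) x)|exact/cvg_lim].
Qed.

Lemma pint_CB n f : CB n f -> CB n (pint f).
Proof.
elim: n f => [|n IH] f; first by case=> h _; split => //; exact: pint_LB.
case=> hf h; split; first exact: pint_LB.
move=> i; have [di ci] := h i.
have lp : LB (partial i f) by case: n ci {IH h} => [|n] [].
have dd x := pint_is_derive x hf di lp.
split; first by move=> x; have [] := dd x.
have -> : partial i (pint f) = pint (partial i f).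
  by apply/funext => x; exact: (@derive_val _ _ _ _ _ _ _ (dd x)).
exact: IH.
Qed.

Lemma pint_smooth f N : smooth f -> (forall x, f x != 0 -> bx N N x) -> smooth (pint f).
Proof. by move=> sf fN; apply/smoothP => n; apply/CB_Cn/pint_CB; exact: smooth_CB fN. Qed.

Lemma partial_pint f N i : smooth f -> (forall x, f x != 0 -> bx N N x) ->
  partial i (pint f) = pint (partial i f).
Proof.
move=> sf fN; apply/funext => x.
have dd := pint_is_derive x (smooth_LB sf fN) (fun y => smooth_derivable (i := i) (x := y) sf)
  (smooth_LB (smooth_partial i sf) (fun y => partial_support fN (x := y) (i := i))).
exact: (@derive_val _ _ _ _ _ _ _ dd).
Qed.

End ParamIntegral.

(** * L2 and L4 bounds *)

Section L2.
Context d (T : measurableType d) (R : realType) (mu : {measure set T -> \bar R}).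
Implicit Types f g h : T -> R.

Definition L2 f := measurable_fun setT f /\ (\int[mu]_x (f x ^+ 2)%:E < +oo)%E.
Definition sq f : R := \int[mu]_x (f x ^+ 2).

Lemma measurable_sqE f : measurable_fun setT f -> measurable_fun setT (fun x => (f x ^+ 2)%:E).
Proof. by move=> mf; apply/measurable_EFinP; exact: measurable_funX. Qed.

Lemma L2_sq_integrable f : L2 f -> mu.-integrable setT (EFin \o (fun x => f x ^+ 2)).
Proof.
case=> mf hf; apply/integrableP; split; first exact: measurable_sqE.
under eq_integral => x _ do rewrite /= ger0_norm ?sqr_ge0//.
exact: hf.
Qed.

Lemma sqE f : L2 f -> (\int[mu]_x (f x ^+ 2)%:E = (sq f)%:E)%E.
Proof.
move=> lf; rewrite /sq /Rintegral fineK//; apply: integrable_fin_num => //.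
exact: L2_sq_integrable.
Qed.

Lemma sq_ge0 f : 0 <= sq f.
Proof. by apply: Rintegral_ge0 => x _; exact: sqr_ge0. Qed.

Lemma L2_dom f g : measurable_fun setT f -> L2 g -> (forall x, `|f x| <= `|g x|) -> L2 f.
Proof.
move=> mf [mg hg] fg; split => //; apply: le_lt_trans hg.
apply: ge0_le_integral => //.
- by move=> x _; rewrite lee_fin sqr_ge0.
- exact: measurable_sqE.
- exact: measurable_sqE.
- by move=> x _; rewrite lee_fin -(real_normK (num_real (f x))) -(real_normK (num_real (g x))) lerXn2r ?nnegrE.
Qed.

Lemma sq_le f g : L2 f -> L2 g -> (forall x, `|f x| <= `|g x|) -> sq f <= sq g.
Proof.
move=> lf lg fg; apply: le_Rintegral => //; try exact: L2_sq_integrable.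
by move=> x _; rewrite -(real_normK (num_real (f x))) -(real_normK (num_real (g x))) lerXn2r ?nnegrE.
Qed.

Lemma L2_scale (k : R) f : L2 f -> L2 (fun x => k * f x).
Proof.
move=> lf; have [mf _] := lf; split; first exact: measurable_funM.
rewrite (_ : (\int[mu]_x _)%E = (k ^+ 2 * sq f)%:E) ?ltry//.
under eq_integral do rewrite exprMn EFinM.
rewrite integralZl//; last exact: L2_sq_integrable.
by rewrite sqE// EFinM.
Qed.

Lemma sq_scale (k : R) f : L2 f -> sq (fun x => k * f x) = k ^+ 2 * sq f.
Proof.
move=> lf; rewrite /sq -RintegralZl//; last exact: L2_sq_integrable.
by congr Rintegral; apply/funext => x; rewrite exprMn.
Qed.

Lemma sqrD_le (a b : R) : (a + b) ^+ 2 <= 2 * a ^+ 2 + 2 * b ^+ 2.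
Proof. by have := sqr_ge0 (a - b); rewrite sqrrB sqrrD; lra. Qed.

Lemma L2_add f g : L2 f -> L2 g -> L2 (fun x => f x + g x).
Proof.
move=> lf lg; have [mf _] := lf; have [mg _] := lg.
split; first exact: measurable_funD.
apply: (@le_lt_trans _ _ (\int[mu]_x ((2 * f x ^+ 2)%:E + (2 * g x ^+ 2)%:E))%E).
  apply: ge0_le_integral => //.
  - by move=> x _; rewrite lee_fin sqr_ge0.
  - by apply: measurable_sqE; exact: measurable_funD.
  - apply: emeasurable_funD; apply/measurable_EFinP; apply: measurable_funM => //;
      exact: measurable_funX.
  - by move=> x _; rewrite -EFinD lee_fin sqrD_le.
have i2 k : L2 k -> mu.-integrable setT (fun x => (2 * k x ^+ 2)%:E).
  by move=> lk; have := integrableZl measurableT 2 (L2_sq_integrable lk).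
rewrite integralD//; [|exact: i2|exact: i2].
have fin k : L2 k -> (\int[mu]_x (2 * k x ^+ 2)%:E \is a fin_num)%E.
  by move=> lk; apply: integrable_fin_num => //; exact: i2.
by rewrite -(fineK (fin _ lf)) -(fineK (fin _ lg)) -EFinD ltry.
Qed.

Lemma sq_add f g : L2 f -> L2 g -> sq (fun x => f x + g x) <= 2 * sq f + 2 * sq g.
Proof.
move=> lf lg.
have i2 k : L2 k -> mu.-integrable setT (EFin \o (fun x => 2 * k x ^+ 2)).
  by move=> lk; have := integrableZl measurableT 2 (L2_sq_integrable lk).
rewrite /sq -RintegralZl//; last exact: L2_sq_integrable.
rewrite -(RintegralZl 2 measurableT (L2_sq_integrable lg)) -RintegralD//; [|exact: i2|exact: i2].
apply: le_Rintegral => //.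
- by apply: L2_sq_integrable; exact: L2_add.
- by have := integrableD measurableT (i2 _ lf) (i2 _ lg).
- by move=> x _; exact: sqrD_le.
Qed.

Lemma L2_opp f : L2 f -> L2 (fun x => - f x).
Proof.
move=> lf; have := L2_scale (-1) lf.
by rewrite (_ : (fun x => -1 * f x) = fun x => - f x)//; apply/funext => x; rewrite mulN1r.
Qed.

Lemma L2_sub f g : L2 f -> L2 g -> L2 (fun x => f x - g x).
Proof. by move=> lf lg; exact: L2_add lf (L2_opp lg). Qed.

Lemma sq_sub f g : L2 f -> L2 g -> sq (fun x => f x - g x) <= 2 * sq f + 2 * sq g.
Proof.
move=> lf lg; apply: le_trans (sq_add lf (L2_opp lg)) _.
by rewrite (_ : sq (fun x => - g x) = sq g)//; congr Rintegral; apply/funext => x; rewrite sqrrN.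
Qed.

Lemma L2_bmul (b : T -> R) (M : R) f : measurable_fun setT b -> (forall x, `|b x| <= M) ->
  L2 f -> L2 (fun x => b x * f x).
Proof.
move=> mb bM lf; have [mf _] := lf.
apply: (L2_dom (g := fun x => M * f x)); [exact: measurable_funM|exact: L2_scale|].
by move=> x; rewrite !normrM ler_wpM2r// (le_trans (bM x)) ?ler_norm.
Qed.

Lemma sq_bmul (b : T -> R) (M : R) f : measurable_fun setT b -> (forall x, `|b x| <= M) ->
  L2 f -> sq (fun x => b x * f x) <= M ^+ 2 * sq f.
Proof.
move=> mb bM lf; rewrite -sq_scale//; apply: sq_le.
- exact: L2_bmul bM lf.
- exact: L2_scale.
- by move=> x; rewrite !normrM ler_wpM2r// (le_trans (bM x)) ?ler_norm.
Qed.

Lemma L2_mul_integrable f g : L2 f -> L2 g -> mu.-integrable setT (EFin \o (fun x => f x * g x)).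
Proof.
move=> lf lg; have [mf _] := lf; have [mg _] := lg.
apply: (@le_integrable _ _ _ mu setT measurableT _ (fun x => (f x ^+ 2)%:E + (g x ^+ 2)%:E)%E).
- by apply/measurable_EFinP; exact: measurable_funM.
- move=> x _; rewrite -EFinD /= lee_fin normrM [leRHS]ger0_norm ?addr_ge0 ?sqr_ge0//.
  have := sqr_ge0 (`|f x| - `|g x|); rewrite sqrrB !real_normK ?num_real//.
  have := mulr_ge0 (normr_ge0 (f x)) (normr_ge0 (g x)).
  by lra.
- by apply: integrableD => //; exact: L2_sq_integrable.
Qed.

(** The optimal choice is [l = c / a]. If [a = 0] and [0 < c], the choice [l = (b + 1) / c] gives
    [2 c <= c], which is absurd. Applied to [2 |f g| <= l f ^ 2 + g ^ 2 / l], this yields the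
    Cauchy-Schwarz inequality without dividing by norms. *)
Lemma sqr_le_of_forall (a b c : R) : 0 <= a -> 0 <= b -> 0 <= c ->
  (forall l, 0 < l -> 2 * c <= l * a + b / l) -> c ^+ 2 <= a * b.
Proof.
move=> a0 b0 c0 h.
have [->|cn0] := eqVneq c 0; first by rewrite expr0n/= mulr_ge0.
have cp : 0 < c by rewrite lt_neqAle eq_sym cn0.
have [a00|an0] := eqVneq a 0.
  have := h ((b + 1) / c); rewrite a00 mulr0 add0r divr_gt0 ?ltr_wpDl// => /(_ isT).
  rewrite invf_div mulrCA.
  have : b / (b + 1) <= 1 by rewrite ler_pdivrMr ?mul1r ?lerDl// ltr_wpDl.
  by move=> h1 h2; have := ler_wpM2l c0 h1; lra.
have ap : 0 < a by rewrite lt_neqAle eq_sym an0.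
have := h (c / a) (divr_gt0 cp ap).
rewrite divfK// invf_div => h1.
have : c <= b * (a / c) by lra.
by rewrite mulrA ler_pdivlMr// expr2 mulrC => ?; rewrite [a * b]mulrC.
Qed.

Lemma cauchy_schwarz f g : L2 f -> L2 g ->
  (\int[mu]_x `|f x * g x|) ^+ 2 <= sq f * sq g.
Proof.
move=> lf lg; apply: sqr_le_of_forall; rewrite ?sq_ge0//.
  by apply: Rintegral_ge0.
move=> l l0; rewrite mulrC [l * _]mulrC.
have i0 := integrable_norm (L2_mul_integrable lf lg).
have i1 : mu.-integrable setT (EFin \o (fun x => `|f x * g x| * 2)).
  by have := integrableZr measurableT 2 i0.
have i2 : mu.-integrable setT (EFin \o (fun x => f x ^+ 2 * l)).
  by have := integrableZr measurableT l (L2_sq_integrable lf).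
have i3 : mu.-integrable setT (EFin \o (fun x => g x ^+ 2 * l^-1)).
  by have := integrableZr measurableT l^-1 (L2_sq_integrable lg).
rewrite /sq -RintegralZr// -RintegralZr//; last exact: L2_sq_integrable.
rewrite -RintegralZr//; last exact: L2_sq_integrable.
rewrite -RintegralD//; apply: le_Rintegral => //.
  by have := integrableD measurableT i2 i3.
move=> x _; rewrite normrM.
have := sqr_ge0 (`|f x| * l - `|g x|).
rewrite sqrrB exprMn !real_normK ?num_real// => h.
have -> : f x ^+ 2 * l + g x ^+ 2 / l = (f x ^+ 2 * l ^+ 2 + g x ^+ 2) / l.
  by field; rewrite gt_eqF.
by rewrite ler_pdivlMr//; lra.
Qed.

Lemma CS_le f g (A B : R) : L2 f -> L2 g -> 0 <= A -> 0 <= B ->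
  sq f <= A ^+ 2 -> sq g <= B ^+ 2 -> \int[mu]_x `|f x * g x| <= A * B.
Proof.
move=> lf lg A0 B0 fA gB.
have n0 : 0 <= \int[mu]_x `|f x * g x| by apply: Rintegral_ge0.
rewrite -(@ler_pXn2r _ 2)// ?nnegrE ?mulr_ge0//.
apply: le_trans (cauchy_schwarz lf lg) _; rewrite exprMn.
by apply: ler_pM => //; exact: sq_ge0.
Qed.

Lemma CS_le_norm f g (A B : R) : L2 f -> L2 g -> 0 <= A -> 0 <= B ->
  sq f <= A ^+ 2 -> sq g <= B ^+ 2 -> `|\int[mu]_x (f x * g x)| <= A * B.
Proof.
move=> lf lg A0 B0 fA gB; apply: le_trans (CS_le lf lg A0 B0 fA gB).
by apply: le_normr_Rintegral => //; exact: L2_mul_integrable.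
Qed.

Definition L4 f := measurable_fun setT f /\ L2 (fun x => f x ^+ 2).
Definition qd f : R := sq (fun x => f x ^+ 2).

Lemma qdE f : qd f = \int[mu]_x (f x ^+ 4).
Proof. by congr Rintegral; apply/funext => x; rewrite -exprM. Qed.

Lemma L4_mul f g : L4 f -> L4 g -> L2 (fun x => f x * g x).
Proof.
move=> [mf lf] [mg lg].
apply: (L2_dom (g := fun x => f x ^+ 2 + g x ^+ 2)); first exact: measurable_funM.
  exact: L2_add.
move=> x; rewrite normrM [leRHS]ger0_norm ?addr_ge0 ?sqr_ge0//.
have := sqr_ge0 (`|f x| - `|g x|); rewrite sqrrB !real_normK ?num_real//.
by have := mulr_ge0 (normr_ge0 (f x)) (normr_ge0 (g x)); lra.
Qed.

Lemma sq_mul_le f g (A B : R) : L4 f -> L4 g -> 0 <= A -> 0 <= B ->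
  qd f <= A ^+ 4 -> qd g <= B ^+ 4 -> sq (fun x => f x * g x) <= (A * B) ^+ 2.
Proof.
move=> [mf lf] [mg lg] A0 B0 fA gB.
have := CS_le lf lg (sqr_ge0 A) (sqr_ge0 B); rewrite -!exprM => /(_ fA gB).
rewrite exprMn; apply: le_trans; rewrite le_eqVlt; apply/orP; left; apply/eqP.
by congr Rintegral; apply/funext => x; rewrite exprMn ger0_norm// mulr_ge0// sqr_ge0.
Qed.

Lemma L4_scale (k : R) f : L4 f -> L4 (fun x => k * f x).
Proof.
move=> [mf lf]; split; first exact: measurable_funM.
rewrite (_ : (fun x => _) = fun x => k ^+ 2 * (f x ^+ 2)); first exact: L2_scale.
by apply/funext => x; rewrite exprMn.
Qed.

Lemma L4_dom f g : measurable_fun setT f -> L4 g -> (forall x, `|f x| <= `|g x|) -> L4 f.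
Proof.
move=> mf [mg lg] fg; split => //.
apply: L2_dom lg _; first exact: measurable_funX.
by move=> x; rewrite !normrX lerXn2r ?nnegrE.
Qed.

Lemma qd_le f g : L4 f -> L4 g -> (forall x, `|f x| <= `|g x|) -> qd f <= qd g.
Proof.
move=> [mf lf] [mg lg] fg; apply: sq_le => // x.
by rewrite !normrX lerXn2r ?nnegrE.
Qed.

Lemma L4_add f g : L4 f -> L4 g -> L4 (fun x => f x + g x).
Proof.
move=> [mf lf] [mg lg]; split; first exact: measurable_funD.
apply: (L2_dom (g := fun x => 2 * f x ^+ 2 + 2 * g x ^+ 2)).
- by apply: measurable_funX; exact: measurable_funD.
- by apply: L2_add; exact: L2_scale.
by move=> x; rewrite ger0_norm ?sqr_ge0// ger0_norm ?sqrD_le// addr_ge0// mulr_ge0// sqr_ge0.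
Qed.

Lemma qd_add f g : L4 f -> L4 g -> qd (fun x => f x + g x) <= 8 * qd f + 8 * qd g.
Proof.
move=> lf lg; have [mf l2f] := lf; have [mg l2g] := lg.
apply: (@le_trans _ _ (sq (fun x => 2 * f x ^+ 2 + 2 * g x ^+ 2))).
  apply: sq_le; first exact: (L4_add lf lg).2.
    by apply: L2_add; exact: L2_scale.
  by move=> x; rewrite ger0_norm ?sqr_ge0// ger0_norm ?sqrD_le// addr_ge0// mulr_ge0// sqr_ge0.
apply: le_trans (sq_add _ _) _; [exact: L2_scale|exact: L2_scale|].
by rewrite !sq_scale// /qd; lra.
Qed.

End L2.

Lemma measurable_Rintegral_param d1 d2 (X : measurableType d1) (T : measurableType d2)
    (R : realType) (mu : {sigma_finite_measure set T -> \bar R}) (G : X * T -> R) :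
  measurable_fun setT G -> measurable_fun setT (fun x => \int[mu]_s G (x, s)).
Proof.
move=> mG; apply: (measurableT_comp (@fine_measurable R _ measurableT)).
rewrite (_ : (fun x => _) = fun x => ((\int[mu]_s ((EFin \o G)^\+ (x, s))) -
   (\int[mu]_s ((EFin \o G)^\- (x, s))))%E); last first.
  apply/funext => x; rewrite [LHS]integralE; by congr (_ - _)%E; apply: eq_integral => s _; rewrite ?funeposE ?funenegE.
have mE : measurable_fun setT (EFin \o G) by exact/measurable_EFinP.
apply: emeasurable_funB.
  apply: (@measurable_fun_fubini_tonelli_F _ _ _ _ _ mu) => //.
  exact: measurable_funepos.
apply: (@measurable_fun_fubini_tonelli_F _ _ _ _ _ mu) => //.
exact: measurable_funeneg.
Qed.

Lemma measurable_tr3_pair d (T : measurableType d) (R : realType) (g : T -> R3 R) :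
  measurable_fun setT (g : T -> T3 R) ->
  measurable_fun setT (fun z : T3 R * T => tr3 (g z.2) z.1 : T3 R).
Proof.
move=> mg.
have m1 := @measurable_fst _ _ (T3 R) T; have m2 := measurableT_comp mg (@measurable_snd _ _ (T3 R) T).
have p1 := @measurable_fst _ _ (T2 R) (measurableTypeR R).
have p2 := @measurable_snd _ _ (T2 R) (measurableTypeR R).
have q1 := @measurable_fst _ _ (measurableTypeR R) (measurableTypeR R).
have q2 := @measurable_snd _ _ (measurableTypeR R) (measurableTypeR R).
apply: (@measurable_fun_pair _ _ _ (T3 R * T)%type (T2 R) (measurableTypeR R)
  (fun z => (z.1.1.1 + (g z.2).1.1, z.1.1.2 + (g z.2).1.2)) (fun z => z.1.2 + (g z.2).2)).
  apply: (@measurable_fun_pair _ _ _ (T3 R * T)%type (measurableTypeR R) (measurableTypeR R)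
    (fun z => z.1.1.1 + (g z.2).1.1) (fun z => z.1.1.2 + (g z.2).1.2)).
    apply: measurable_funD.
      exact: (measurableT_comp q1 (measurableT_comp p1 m1)).
    exact: (measurableT_comp q1 (measurableT_comp p1 m2)).
  apply: measurable_funD.
    exact: (measurableT_comp q2 (measurableT_comp p1 m1)).
  exact: (measurableT_comp q2 (measurableT_comp p1 m2)).
apply: measurable_funD.
  exact: (measurableT_comp p2 m1).
exact: (measurableT_comp p2 m2).
Qed.

(** * Superpositions in L2: the inequalities of Minkowski and Young *)

Section Minkowski.
Context d (T : measurableType d) (R : realType) (mu : {sigma_finite_measure set T -> \bar R}).
Variables (c : T -> R) (C : R).
Hypothesis mc : measurable_fun setT c.
Hypothesis C0 : 0 < C.
Hypothesis cC : (\int[mu]_s `|c s|%:E <= C%:E)%E.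

(** Cauchy-Schwarz after splitting [|c f|] into [sqrt |c|] and [sqrt |c| |f|]; there is nothing to
    prove when the right-hand side is infinite. *)
Lemma sqr_Rintegral_le (f : T -> R) : measurable_fun setT f ->
  (((\int[mu]_s (c s * f s)) ^+ 2)%:E <= C%:E * \int[mu]_s (`|c s| * f s ^+ 2)%:E)%E.
Proof.
move=> mf.
have mcf : measurable_fun setT (fun s => `|c s| * f s ^+ 2).
  by apply: measurable_funM; [exact: measurableT_comp|exact: measurable_funX].
have h0 : (0 <= \int[mu]_s (`|c s| * f s ^+ 2)%:E)%E.
  by apply: integral_ge0 => s _; rewrite lee_fin mulr_ge0// sqr_ge0.
have [->|hfin] := eqVneq (\int[mu]_s (`|c s| * f s ^+ 2)%:E)%E +oo%E.
  by rewrite gt0_muley ?lte_fin// leey.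
pose r s := Num.sqrt `|c s|; pose k s := Num.sqrt `|c s| * `|f s|.
have mr : measurable_fun setT r.
  have ms : measurable_fun setT (Num.sqrt : R -> R).
    by apply: continuous_measurable_fun => x; exact: sqrt_continuous.
  have ma : measurable_fun setT (fun s => `|c s|) by exact: measurableT_comp.
  exact: (measurableT_comp ms ma).
have rr s : r s ^+ 2 = `|c s| by rewrite sqr_sqrtr.
have kk s : k s ^+ 2 = `|c s| * f s ^+ 2 by rewrite exprMn sqr_sqrtr// real_normK ?num_real.
have lr : L2 mu r.
  split => //; under eq_integral do rewrite rr.
  exact: le_lt_trans cC (ltry _).
have lk : L2 mu k.
  split; first by apply: measurable_funM => //; exact: measurableT_comp.
  by under eq_integral do rewrite kk; rewrite ltey.
have sr : sq mu r <= C.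
  by rewrite -lee_fin -sqE//; under eq_integral do rewrite rr.
have E : (\int[mu]_s (`|c s| * f s ^+ 2)%:E = (sq mu k)%:E)%E.
  by rewrite -sqE//; under [RHS]eq_integral do rewrite kk.
rewrite E -EFinM lee_fin.
have rk s : r s * k s = `|c s * f s|.
  by rewrite /r /k mulrA -expr2 sqr_sqrtr// normrM.
apply: (@le_trans _ _ ((\int[mu]_s `|r s * k s|) ^+ 2)); last first.
  by apply: le_trans (cauchy_schwarz lr lk) _; rewrite ler_wpM2r// sq_ge0.
rewrite -(real_normK (num_real (\int[mu]_s (c s * f s)))) lerXn2r ?nnegrE//.
  by apply: Rintegral_ge0.
have icf : mu.-integrable setT (EFin \o (fun s => c s * f s)).
  have := L2_mul_integrable lr lk; move=> /integrableP[_ hh].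
  apply/integrableP; split; first by apply/measurable_EFinP; exact: measurable_funM.
  by move: hh; under eq_integral => s _ do rewrite /= rk normr_id.
apply: le_trans (le_normr_Rintegral measurableT icf) _.
by rewrite le_eqVlt; apply/orP; left; apply/eqP; congr Rintegral; apply/funext => s; rewrite rk normr_id.
Qed.

(** The pointwise bound [sqr_Rintegral_le] is integrated in [x] and the two integrals are exchanged.
    This squared form avoids roots and loses nothing when all [F ^~ s] satisfy the same L2 bound. *)
Lemma minkowski (F : T3 R -> T -> R) :
  measurable_fun setT (fun z : T3 R * T => F z.1 z.2) ->
  (\int[@leb3 R]_x ((\int[mu]_s (c s * F x s)) ^+ 2)%:E <=
   C%:E * \int[mu]_s (`|c s|%:E * \int[@leb3 R]_x (F x s ^+ 2)%:E))%E.
Proof.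
move=> mF.
have mFx x : measurable_fun setT (F x) by exact: (measurable_pairl x mF).
have mFs s : measurable_fun setT (F ^~ s) by exact: (measurable_pairr s mF).
have mc2 : measurable_fun setT (fun z : T3 R * T => c z.2).
  exact: (measurableT_comp mc measurable_snd).
have mG : measurable_fun setT (fun z : T3 R * T => (`|c z.2| * F z.1 z.2 ^+ 2)%:E).
  apply/measurable_EFinP; apply: measurable_funM; last exact: measurable_funX.
  exact: measurableT_comp.
have G0 z : (0 <= (`|c z.2| * F z.1 z.2 ^+ 2)%:E)%E by rewrite lee_fin mulr_ge0// sqr_ge0.
have m1 : measurable_fun setT (fun x => \int[mu]_s (`|c s| * F x s ^+ 2)%:E)%E.
  exact: (@measurable_fun_fubini_tonelli_F _ _ _ _ _ mu (fun z => (`|c z.2| * F z.1 z.2 ^+ 2)%:E)).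
have m2 : measurable_fun setT (fun x => ((\int[mu]_s (c s * F x s)) ^+ 2)%:E).
  apply/measurable_EFinP; apply: measurable_funX.
  apply: (@measurable_Rintegral_param _ _ _ _ _ mu (fun z => c z.2 * F z.1 z.2)).
  exact: measurable_funM.
apply: (@le_trans _ _ (\int[@leb3 R]_x (C%:E * \int[mu]_s (`|c s| * F x s ^+ 2)%:E))%E).
  apply: ge0_le_integral => //.
  - by move=> x _; rewrite lee_fin sqr_ge0.
  - exact: measurable_funeM.
  - by move=> x _; exact: sqr_Rintegral_le.
rewrite ge0_integralZl_EFin//; last 2 first.
- by move=> x _; apply: integral_ge0 => s _; exact: (G0 (x, s)).
- exact: ltW.
rewrite lee_pmul2l//.
rewrite (fubini_tonelli (m1 := @leb3 R) (m2 := mu) (fun z => (`|c z.2| * F z.1 z.2 ^+ 2)%:E))//=.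
rewrite le_eqVlt; apply/orP; left; apply/eqP; apply: eq_integral => s _.
rewrite -ge0_integralZl_EFin//.
- by move=> x _; rewrite lee_fin sqr_ge0.
- by apply/measurable_EFinP; exact: measurable_funX.
Qed.

(** By translation invariance all inner integrals in [minkowski] are the same, so only the L1 norm
    of [c] remains. *)
Lemma young_translate (g : T -> R3 R) (f : T3 R -> R) :
  measurable_fun setT (g : T -> T3 R) -> measurable_fun setT f ->
  (\int[@leb3 R]_x ((\int[mu]_s (c s * f (tr3 (g s) x))) ^+ 2)%:E <=
   (C ^+ 2)%:E * \int[@leb3 R]_x (f x ^+ 2)%:E)%E.
Proof.
move=> mg mf.
have mt := measurable_tr3_pair mg.
apply: le_trans (minkowski (F := fun x s => f (tr3 (g s) x)) _) _.
  exact: (measurableT_comp mf mt).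
have E s : (\int[@leb3 R]_x (f (tr3 (g s) x) ^+ 2)%:E = \int[@leb3 R]_x (f x ^+ 2)%:E)%E.
  apply: (ge0_integral_tr3 (F := fun x => (f x ^+ 2)%:E)).
    exact: measurable_sqE.
  by move=> x; rewrite lee_fin sqr_ge0.
under eq_integral do rewrite E.
set I := (\int[@leb3 R]_x (f x ^+ 2)%:E)%E.
have I0 : (0 <= I)%E by apply: integral_ge0 => x _; rewrite lee_fin sqr_ge0.
rewrite ge0_integralZr//.
  rewrite expr2 EFinM -muleA; apply: lee_pmul => //.
  - by rewrite lee_fin ltW.
  - by apply: mule_ge0 => //; apply: integral_ge0.
  - by apply: lee_pmul => //; exact: integral_ge0.
by apply/measurable_EFinP; exact: measurableT_comp.
Qed.

End Minkowski.

(** * Continuity of translations in L2 *)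

Section TranslationContinuity.
Variable R : realType.
Local Notation mu := (@leb3 R).

(** The squared modulus of continuity of translations in L2, extended-valued so that it can be
    written before integrability is known. *)
Definition osc (f : T3 R -> R) (z : R3 R) : \bar R :=
  (\int[mu]_x ((f (tr3 z x) - f x) ^+ 2)%:E)%E.

Definition tcont (f : T3 R -> R) : Prop :=
  forall e : R, 0 < e -> exists2 t, 0 < t & forall z, bx t t z -> (osc f z <= e%:E)%E.

Lemma measurable_comp_tr3 (f : T3 R -> R) z :
  measurable_fun setT f -> measurable_fun setT (fun x => f (tr3 z x)).
Proof. by move=> mf; exact: (measurableT_comp mf (measurable_tr3 z)). Qed.

Lemma L2_tr3 f z : L2 mu f -> L2 mu (fun x => f (tr3 z x)).
Proof.
move=> [mf hf]; split; first exact: measurable_comp_tr3.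
rewrite (ge0_integral_tr3 z (F := fun x => (f x ^+ 2)%:E))//.
  exact: measurable_sqE.
by move=> x; rewrite lee_fin sqr_ge0.
Qed.

Lemma sq_tr3 f z : L2 mu f -> sq mu (fun x => f (tr3 z x)) = sq mu f.
Proof.
move=> [mf hf]; congr fine.
apply: (ge0_integral_tr3 z (F := fun x => (f x ^+ 2)%:E)).
  exact: measurable_sqE.
by move=> x; rewrite lee_fin sqr_ge0.
Qed.

Lemma oscE f z : L2 mu f -> osc f z = (sq mu (fun x => f (tr3 z x) - f x))%:E.
Proof. by move=> lf; rewrite -sqE//; apply: L2_sub => //; exact: L2_tr3. Qed.

Lemma osc_add f g z : L2 mu f -> L2 mu g ->
  (osc (fun x => f x + g x)%R z <= 2%:E * osc f z + 2%:E * osc g z)%E.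
Proof.
move=> lf lg; rewrite !oscE//; last exact: L2_add.
rewrite -!EFinM -EFinD lee_fin.
have -> : (fun x => f (tr3 z x) + g (tr3 z x) - (f x + g x)) =
  fun x => (f (tr3 z x) - f x) + (g (tr3 z x) - g x).
  by apply/funext => x; rewrite opprD addrACA.
by apply: sq_add; apply: L2_sub => //; exact: L2_tr3.
Qed.

Lemma osc_le f z : L2 mu f -> (osc f z <= (4 * sq mu f)%:E)%E.
Proof.
move=> lf; rewrite oscE// lee_fin.
apply: le_trans (sq_sub (L2_tr3 z lf) lf) _.
by rewrite sq_tr3//; lra.
Qed.

Lemma tcont_add f g : L2 mu f -> L2 mu g -> tcont f -> tcont g -> tcont (fun x => f x + g x).
Proof.
move=> lf lg tf tg e e0.
have e4 : 0 < e / 4 by rewrite divr_gt0.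
have [t1 t10 h1] := tf _ e4; have [t2 t20 h2] := tg _ e4.
exists (Num.min t1 t2); first by rewrite lt_min t10.
move=> z bz; apply: le_trans (osc_add z lf lg) _.
have -> : e%:E = (2%:E * (e / 4)%:E + 2%:E * (e / 4)%:E)%E by rewrite -!EFinM -EFinD; congr EFin; field.
apply: leeD; apply: lee_pmul => //.
- by apply: integral_ge0 => x _; rewrite lee_fin sqr_ge0.
- by apply: h1; apply: bx_sub bz; rewrite ge_min lexx.
- by apply: integral_ge0 => x _; rewrite lee_fin sqr_ge0.
- by apply: h2; apply: bx_sub bz; rewrite ge_min lexx orbT.
Qed.

Lemma tcont_scale k f : L2 mu f -> tcont f -> tcont (fun x => k * f x).
Proof.
move=> lf tf e e0.
have e1 : 0 < e / (k ^+ 2 + 1) by rewrite divr_gt0// ltr_wpDl// sqr_ge0.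
have [t t0 h] := tf _ e1; exists t => // z bz.
have := h z bz; rewrite !oscE//; last exact: L2_scale.
rewrite !lee_fin => hh.
have -> : (fun x => k * f (tr3 z x) - k * f x) = fun x => k * (f (tr3 z x) - f x).
  by apply/funext => x; rewrite mulrBr.
rewrite sq_scale; last by apply: L2_sub => //; exact: L2_tr3.
apply: le_trans (ler_wpM2l (sqr_ge0 k) hh) _.
rewrite mulrCA ger_pMr// ler_pdivrMr ?mul1r ?lerDl//.
by rewrite ltr_wpDl// sqr_ge0.
Qed.

(** Because [osc] is at most four times [sq], uniformly in the translation, the property is closed
    in L2. The constants come from [2 * 4 * (e / 16) + 2 * (e / 4) = e]. *)
Lemma tcont_lim f : L2 mu f ->
  (forall e : R, 0 < e -> exists g, [/\ L2 mu g, tcont g & sq mu (fun x => f x - g x) <= e]) ->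
  tcont f.
Proof.
move=> lf H e e0.
have e16 : 0 < e / 16 by rewrite divr_gt0.
have e4 : 0 < e / 4 by rewrite divr_gt0.
have [g [lg tg fg]] := H _ e16; have [t t0 h] := tg _ e4; exists t => // z bz.
have lfg : L2 mu (fun x => f x - g x) by exact: L2_sub.
have fE : f = fun x => (f x - g x) + g x by apply/funext => x; rewrite subrK.
rewrite fE; apply: le_trans (osc_add z lfg lg) _.
have -> : e%:E = (2%:E * (e / 4)%:E + 2%:E * (e / 4)%:E)%E by rewrite -!EFinM -EFinD; congr EFin; field.
apply: leeD; apply: lee_pmul => //.
- by apply: integral_ge0 => x _; rewrite lee_fin sqr_ge0.
- by apply: le_trans (osc_le z lfg) _; rewrite lee_fin; lra.
- by apply: integral_ge0 => x _; rewrite lee_fin sqr_ge0.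
- exact: h.
Qed.

Variables (a c : R).
Local Notation Q := (bx a c).

Lemma Q_fin (A : set (T3 R)) : measurable A -> (mu (A `&` Q) < +oo)%E.
Proof.
move=> mA; have hb := bx_measurable a c.
apply: (@le_lt_trans _ _ (mu Q)).
  by apply: le_measure; rewrite ?inE//; exact: measurableI.
have sub : Q `<=` bx (Num.max a 0) (Num.max c 0) by apply: bx_sub; rewrite le_max lexx.
apply: (@le_lt_trans _ _ (mu (bx (Num.max a 0) (Num.max c 0)))).
  by apply: le_measure => //; rewrite inE//; exact: bx_measurable.
by rewrite leb3_bx ?ltry// le_max lexx orbT.
Qed.

Lemma indic_sqr (A : set (T3 R)) x : (\1_A x ^+ 2 = \1_A x :> R).
Proof. by rewrite indicE; case: (x \in A); rewrite /= ?expr1n ?expr0n. Qed.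

Lemma L2_indic (A : set (T3 R)) : measurable A -> (mu A < +oo)%E -> L2 mu (\1_A : T3 R -> R).
Proof.
move=> mA fA; split; first exact: measurable_indic.
under eq_integral do rewrite indic_sqr.
by rewrite integral_indic// setIT.
Qed.

(* A point of [O] stays in [O] under small translations, so by dominated convergence the part
   of [O] leaving [O] is small; the part entering [O] has the same measure. *)
Lemma osc_indic_open (O : set (T3 R)) : open (O : set (R3 R)) -> (mu O < +oo)%E ->
  tcont (\1_O : T3 R -> R).
Proof.
move=> oO fO e e0; apply: contrapT => nH.
have mO : measurable O by exact: open3_measurable.
have bad n : exists z, bx n.+1%:R^-1 n.+1%:R^-1 z /\ ~ (osc (\1_O : T3 R -> R) z <= e%:E)%E.
  apply: contrapT => nz; apply: nH; exists n.+1%:R^-1; first by rewrite invr_gt0 ltr0n.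
  by move=> z bz; apply: contrapT => no; apply: nz; exists z.
have [z hz] := choice bad.
have lO := L2_indic mO fO.
pose h n x : R := \1_O x * (1 - \1_O (tr3 (z n) x)).
have mh n : measurable_fun setT (h n).
  apply: measurable_funM; first exact: measurable_indic.
  by apply: measurable_funB => //; apply: measurable_comp_tr3; exact: measurable_indic.
have ptw (x : T3 R) : h n x @[n --> \oo] --> (0 : R).
  have [Ox|nO] := boolP (x \in O); last first.
    by under eq_fun do rewrite /h indicE (negbTE nO) mul0r; exact: cvg_cst.
  have /nbhs_ballP[t /= t0 tO] : nbhs (x : R3 R) O.
    by apply: open_nbhs_nbhs; split => //; move: Ox; rewrite inE.
  apply: (@cvg_trans _ ((fun=> 0 : R) @ \oo)); last exact: cvg_cst.
  apply: near_eq_cvg; near=> n; rewrite /h.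
  have -> : (\1_O (tr3 (z n) x) : R) = 1.
    rewrite indicE mem_set//; apply: tO.
    have [[b1 b2 b3] _] := hz n.
    have nt : n.+1%:R^-1 < t.
      by near: n; exact: near_infty_natSinv_lt (PosNum t0).
    by split; [split|]; rewrite /ball/= /tr3/= opprD addrA subrr add0r normrN; exact: le_lt_trans nt.
  by rewrite subrr mulr0.
have cv : (\int[mu]_x (h n x)%:E)%E @[n --> \oo] --> (\int[mu]_x (cst 0%:E x))%E.
  apply: (@dominated_cvg _ _ _ mu setT measurableT (fun n x => (h n x)%:E) (cst 0%:E) (fun x => (\1_O x)%:E)).
  - by move=> n; exact/measurable_EFinP.
  - by move=> x _; apply: cvg_EFin; [exact: nearW|exact: ptw].
  - by [].
  - have := L2_sq_integrable lO; apply: eq_integrable => // x _.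
    by rewrite /= indic_sqr.
  - move=> n x _; rewrite lee_fin /h normrM ger0_norm// ger0_norm; last first.
      by rewrite subr_ge0 indicE; case: (_ \in _).
    by rewrite ler_piMr// lerBlDr lerDl.
rewrite integral0 in cv.
have : \forall n \near \oo, (\int[mu]_x (h n x)%:E < (e / 2)%:E)%E.
  have := cv [set y | (y < (e / 2)%:E)%E]; apply.
  by apply: (@open_ereal_lt' _ 0 (e / 2)%:E); rewrite lte_fin divr_gt0.
case=> n _ /(_ n (leqnn n)) /= hn.
have [_ []] := hz n.
have ih : mu.-integrable setT (EFin \o h n).
  have ii := L2_mul_integrable lO (L2_sub lO (L2_tr3 (z n) lO)).
  apply: eq_integrable ii => // x _; rewrite /= /h mulrBr mulrBr mulr1.
  by rewrite -expr2 indic_sqr.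
have E x : (\1_O (tr3 (z n) x) - \1_O x) ^+ 2 = 2 * h n x + (\1_O (tr3 (z n) x) ^+ 2 - \1_O x ^+ 2) :> R.
  rewrite !indic_sqr /h; rewrite !indicE.
  by case: (x \in O); case: (tr3 (z n) x \in O); rewrite /=; ring.
rewrite oscE// lee_fin /sq.
have is1 := L2_sq_integrable (L2_tr3 (z n) lO).
have is2 := L2_sq_integrable lO.
have i2h : mu.-integrable setT (EFin \o (fun x => 2 * h n x)).
  by have := integrableZl measurableT 2 ih.
have i12 : mu.-integrable setT (EFin \o (fun x => (\1_O (tr3 (z n) x) ^+ 2 - \1_O x ^+ 2 : R))).
  by have := integrableB measurableT is1 is2.
under eq_Rintegral do rewrite E.
rewrite RintegralD// RintegralB// -/(sq mu (fun x => \1_O (tr3 (z n) x))) -/(sq mu (\1_O : T3 R -> R)).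
rewrite sq_tr3// subrr addr0 RintegralZl//.
have : \int[mu]_x h n x <= e / 2.
  by rewrite -lee_fin /Rintegral fineK ?ltW//; exact: integrable_fin_num.
by lra.
Unshelve. all: by end_near. Qed.

End TranslationContinuity.

(** * Passage from open sets to measurable sets and to L2 functions *)

Section TranslationContinuityL2.
Variable R : realType.
Local Notation mu := (@leb3 R).

(** Dynkin induction needs a generating family stable under intersection. The coordinates are
    measurable for the sigma-algebra generated by the open sets, so the identity is measurable from
    it to the product sigma-algebra. *)
Lemma measurable3_open : @measurable _ (T3 R) = <<s [set O : set (T3 R) | open (O : set (R3 R))] >>.
Proof.
set G := [set O : set (T3 R) | open (O : set (R3 R))].
apply/seteqP; split; last first.
  apply: smallest_sub; first exact: sigma_algebra_measurable.
  by move=> O; exact: open3_measurable.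
pose S := g_sigma_algebraType G.
have coord (h : R3 R -> R) : continuous h -> measurable_fun setT (h : S -> measurableTypeR R).
  move=> ch; apply: (measurability (@RGenOpens.G R) (RGenOpens.measurableE R)).
  move=> _ [_ [x [y ->]] <-]; rewrite setTI; apply: sub_sigma_algebra.
  by apply: open_comp => //; exact: interval_open.
have c1 : continuous (fun x : R3 R => x.1) by move=> x; exact: cvg_fst.
have mid : measurable_fun setT (fun s : S => (((s : R3 R).1.1, (s : R3 R).1.2), (s : R3 R).2) : T3 R).
  apply: (@measurable_fun_pair _ _ _ S (T2 R) (measurableTypeR R)
    (fun s => ((s : R3 R).1.1, (s : R3 R).1.2)) (fun s => (s : R3 R).2)).
    apply: (@measurable_fun_pair _ _ _ S (measurableTypeR R) (measurableTypeR R)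
      (fun s => (s : R3 R).1.1) (fun s => (s : R3 R).1.2)).
      apply: (coord (fun x => x.1.1)) => x.
      by apply: (@continuous_comp _ _ _ (fun x : R3 R => x.1) fst); [exact: c1|exact: cvg_fst].
    apply: (coord (fun x => x.1.2)) => x.
    by apply: (@continuous_comp _ _ _ (fun x : R3 R => x.1) snd); [exact: c1|exact: cvg_snd].
  by apply: (coord (fun x => x.2)) => x; exact: cvg_snd.
move=> A mA; have := mid measurableT A mA; rewrite setTI.
rewrite (_ : _ @^-1` A = A)//.
by apply/seteqP; split=> -[[x y] z].
Qed.

Lemma tcont0 : tcont (fun=> 0 : R).
Proof.
move=> e e0; exists 1 => // z _; rewrite /osc.
under eq_integral do rewrite subrr expr0n/=.
by rewrite integral0 lee_fin ltW.
Qed.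

Lemma L2_zero : L2 mu (fun=> 0 : R).
Proof. by split => //; under eq_integral do rewrite expr0n/=; rewrite integral0. Qed.

Lemma tcont_sum (I : Type) (r : seq I) (F : I -> T3 R -> R) :
  (forall k, L2 mu (F k) /\ tcont (F k)) ->
  L2 mu (fun x => \sum_(k <- r) F k x) /\ tcont (fun x => \sum_(k <- r) F k x).
Proof.
move=> H; elim: r => [|k r [IH1 IH2]].
  under eq_fun do rewrite big_nil; split; [exact: L2_zero|exact: tcont0].
have [h1 h2] := H k.
by under eq_fun do rewrite big_cons; split; [exact: L2_add|exact: tcont_add].
Qed.

Variable a : R.
(** Intersecting with a fixed open cube keeps all measures finite, so that complements can be
    handled by subtraction, and keeps open sets open. *)
Definition obx : set (R3 R) := [set x | [/\ `|x.1.1| < a, `|x.1.2| < a & `|x.2| < a]].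
Local Notation Q := obx.

Lemma obx_open : open Q.
Proof.
have c1 : continuous (fun x : R3 R => x.1) by move=> x; exact: cvg_fst.
have op (h : R3 R -> R) : continuous h -> open [set x : R3 R | `|h x| < a].
  move=> ch; rewrite (_ : mkset _ = h @^-1` `]-a, a[%classic).
    by apply: open_comp => //; exact: interval_open.
  by apply/seteqP; split=> x /=; rewrite in_itv/= ltr_norml.
rewrite (_ : Q = [set x : R3 R | `|x.1.1| < a] `&` [set x : R3 R | `|x.1.2| < a] `&`
   [set x : R3 R | `|x.2| < a]); last first.
  by apply/seteqP; split=> x /=; [case|case=> -[]].
apply: openI; first apply: openI.
- apply: op => x.
  by apply: (@continuous_comp _ _ _ (fun x : R3 R => x.1) fst); [exact: c1|exact: cvg_fst].
- apply: op => x.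
  by apply: (@continuous_comp _ _ _ (fun x : R3 R => x.1) snd); [exact: c1|exact: cvg_snd].
- by apply: op => x; exact: cvg_snd.
Qed.

Lemma obx_measurable : measurable (Q : set (T3 R)).
Proof. by apply: open3_measurable; exact: obx_open. Qed.

Lemma obxI_fin (A : set (T3 R)) : measurable A -> (mu (A `&` Q) < +oo)%E.
Proof.
move=> mA; apply: (@le_lt_trans _ _ (mu (A `&` bx a a))); last exact: Q_fin.
apply: le_measure; rewrite ?inE.
- by apply: measurableI => //; exact: obx_measurable.
- by apply: measurableI => //; exact: bx_measurable.
- by move=> x [Ax [h1 h2 h3]]; split => //; split; exact: ltW.
Qed.

Lemma L2_indicQ (A : set (T3 R)) : measurable A -> L2 mu (\1_(A `&` Q) : T3 R -> R).
Proof.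
move=> mA; apply: L2_indic; last exact: obxI_fin.
by apply: measurableI => //; exact: obx_measurable.
Qed.

(** The partial sums [S N] of the indicators converge in L2, being dominated by the indicator of
    [Q]; disjointness makes [S N] equal to 1 on [F k] as soon as [k < N]. *)
Lemma tcont_bigcup (F : (set (T3 R))^nat) : (forall n, measurable (F n)) ->
  trivIset setT F -> (forall n, tcont (\1_(F n `&` Q) : T3 R -> R)) ->
  tcont (\1_((\bigcup_k F k) `&` Q) : T3 R -> R).
Proof.
move=> mF tF tcF.
have mU : measurable (\bigcup_k F k) by exact: bigcupT_measurable.
pose S N (x : T3 R) : R := \sum_(k <- iota 0 N) \1_(F k `&` Q) x.
have hS N : L2 mu (S N) /\ tcont (S N).
  by apply: tcont_sum => k; split; [exact: L2_indicQ|exact: tcF].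
have SE N x k : F k x -> Q x -> S N x = (k < N)%:R.
  move=> Fk Qx; rewrite /S.
  have E j : \1_(F j `&` Q) x = (j == k)%:R :> R.
    rewrite indicE; congr (_ %:R); have [->|jk] := eqVneq j k; first by rewrite mem_set.
    by rewrite memNset// => -[Fj _]; move/eqP: jk; apply; apply: (tF j k) => //; exists x.
  under eq_bigr do rewrite E.
  have -> : \sum_(j <- iota 0 N) (j == k)%:R = (count_mem k (iota 0 N))%:R :> R.
    by rewrite -sum1_count natr_sum [RHS]big_mkcond; apply: eq_bigr => j _ /=; case: (j == k).
  by rewrite count_uniq_mem ?iota_uniq// mem_iota/= add0n.
have S0 N x : ~ ((\bigcup_k F k) `&` Q) x -> S N x = 0.
  move=> nx; rewrite /S big1// => k _; rewrite indicE memNset// => -[Fk Qx].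
  by apply: nx; split => //; exists k.
have hb N x : `|\1_((\bigcup_k F k) `&` Q) x - S N x| <= \1_Q x :> R.
  rewrite [X in `|X - _|]indicE.
  have [/set_mem [[k _ Fk] Qx]|nx] := boolP (x \in _).
    by rewrite (SE N x k)// indicE mem_set//; case: (k < N)%N; rewrite ?subrr ?subr0 ?normr0 ?normr1.
  rewrite S0 ?subrr ?normr0 ?indicE ?ler0n//.
  by move=> h; move: nx; rewrite mem_set.
apply: tcont_lim; first exact: L2_indicQ.
move=> e e0.
have lQ : L2 mu (\1_Q : T3 R -> R).
  apply: L2_indic; first exact: obx_measurable.
  by have := obxI_fin measurableT; rewrite setTI.
have lD N : L2 mu (fun x => \1_((\bigcup_k F k) `&` Q) x - S N x).
  by apply: L2_sub; [exact: L2_indicQ|exact: (hS N).1].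
have cv : (\int[mu]_x ((\1_((\bigcup_k F k) `&` Q) x - S N x) ^+ 2)%:E)%E @[N --> \oo] --> (\int[mu]_x (cst 0%:E x))%E.
  apply: (@dominated_cvg _ _ _ mu setT measurableT
     (fun N x => ((\1_((\bigcup_k F k) `&` Q) x - S N x) ^+ 2)%:E) (cst 0%:E) (fun x => (\1_Q x ^+ 2)%:E)).
  - by move=> N; apply: measurable_sqE; have [] := lD N.
  - move=> x _; apply: cvg_EFin; first exact: nearW.
    apply: (@cvg_trans _ ((fun=> 0 : R) @ \oo)); last exact: cvg_cst.
    apply: near_eq_cvg.
    have [[[k _ Fk] Qx]|nx] := pselect (((\bigcup_k F k) `&` Q) x).
      exists k.+1 => // N /= kN; rewrite (SE N x k)// kN indicE mem_set ?subrr ?expr0n//.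
      by split => //; exists k.
    by near=> N; rewrite /= (S0 N x nx) indicE memNset// subrr expr0n.
  - by [].
  - exact: L2_sq_integrable.
  - move=> M x _; rewrite lee_fin ger0_norm ?sqr_ge0//.
    rewrite -(real_normK (num_real (_ - S M x))) lerXn2r ?nnegrE//.
rewrite integral0 in cv.
have : \forall N \near \oo, (\int[mu]_x ((\1_((\bigcup_k F k) `&` Q) x - S N x) ^+ 2)%:E < e%:E)%E.
  have := cv [set y | (y < e%:E)%E]; apply.
  by apply: (@open_ereal_lt' _ 0 e%:E); rewrite lte_fin.
case=> N _ /(_ N (leqnn N)) /= hN.
have [h1 h2] := hS N.
by exists (S N); split => //; rewrite -lee_fin -sqE ?ltW.
Unshelve. all: by end_near. Qed.

(** The sets with this property form a Dynkin class containing the open sets, which are stable under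
    intersection. *)
Lemma tcont_indic (A : set (T3 R)) : measurable A -> tcont (\1_(A `&` Q) : T3 R -> R).
Proof.
move=> mA.
apply: (dynkin_induction (G := [set O : set (T3 R) | open (O : set (R3 R))])
   (P := fun A => tcont (\1_(A `&` Q) : T3 R -> R)) measurable3_open).
- by move=> X Y; exact: openI.
- rewrite setTI; apply: osc_indic_open; first exact: obx_open.
  by have := obxI_fin measurableT; rewrite setTI.
- move=> O oO; apply: osc_indic_open; first by apply: openI => //; exact: obx_open.
  by apply: obxI_fin; exact: open3_measurable.
- move=> S mS tS.
  have -> : (\1_(~` S `&` Q) : T3 R -> R) = fun x => \1_([set: T3 R] `&` Q) x + (-1) * \1_(S `&` Q) x.
    apply/funext => x; rewrite !indicE !in_setI in_setC in_setT.
    by case: (x \in S); case: (x \in Q); rewrite /=; ring.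
  apply: tcont_add.
  - exact: L2_indicQ.
  - by apply: L2_scale; exact: L2_indicQ.
  - rewrite setTI; apply: osc_indic_open; first exact: obx_open.
    by have := obxI_fin measurableT; rewrite setTI.
  - by apply: tcont_scale => //; exact: L2_indicQ.
- by move=> F mF tF tcF; exact: tcont_bigcup.
- by rewrite -measurable3_open.
Qed.

Import HBNNSimple.

(** Increasing simple functions below [f] converge to it in L2 with dominant [f ^ 2]; each is a
    finite combination of indicators of subsets of [Q], the value 0 being treated apart since its
    level set need not lie in [Q]. *)
Lemma tcont_ge0 (f : T3 R -> R) : L2 mu f -> (forall x, 0 <= f x) -> (forall x, f x != 0 -> Q x) ->
  tcont f.
Proof.
move=> lf f0 fQ; have [mf _] := lf.
have mE : measurable_fun setT (EFin \o f) by exact/measurable_EFinP.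
pose g n := nnsfun_approx measurableT mE n.
have gf n x : 0 <= g n x <= f x.
  rewrite fun_ge0/= /g nnsfun_approxE -lee_fin.
  by apply: (@le_approx _ _ _ setT (EFin \o f)) => // y _; rewrite lee_fin.
have gQ n x : g n x != 0 -> Q x.
  move=> gx; apply: fQ; apply: contraNN gx => /eqP fx.
  by have := gf n x; rewrite fx -eq_le eq_sym.
have mg n : measurable_fun setT (g n : T3 R -> R) by exact: measurable_funP.
have lg n : L2 mu (g n : T3 R -> R).
  apply: L2_dom lf _ => // x; have /andP[g0 gfx] := gf n x.
  by rewrite !ger0_norm.
have tg n : tcont (g n : T3 R -> R).
  have -> : (g n : T3 R -> R) = fun x => \sum_(y <- finmap.enum_fset (fset_set (range (g n))))
       y * \1_(g n @^-1` [set y]) x.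
    apply/funext => x; rewrite (fimfunE (g n) x) fsbig_finite//.
  apply: (@tcont_sum _ _ (fun y x => y * \1_(g n @^-1` [set y]) x) _).2 => y.
  have [->|y0] := eqVneq y 0.
    have -> : (fun x => 0 * \1_(g n @^-1` [set 0]) x) = (fun=> 0 : R).
      by apply/funext => x; rewrite mul0r.
    by split; [exact: L2_zero|exact: tcont0].
  have mA : measurable (g n @^-1` [set y]).
    by rewrite -[X in measurable X]setTI; apply: mg => //; exact: measurable_set1.
  have AQ : g n @^-1` [set y] = g n @^-1` [set y] `&` Q.
    by apply/seteqP; split=> [x /= gy|x []//]; split => //; apply: (gQ n); rewrite gy.
  rewrite AQ; split; first by apply: L2_scale; exact: L2_indicQ.
  by apply: tcont_scale; [exact: L2_indicQ|exact: tcont_indic].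
apply: tcont_lim => // e e0.
have cv : (\int[mu]_x ((f x - g n x) ^+ 2)%:E)%E @[n --> \oo] --> (\int[mu]_x (cst 0%:E x))%E.
  apply: (@dominated_cvg _ _ _ mu setT measurableT
     (fun n x => ((f x - g n x) ^+ 2)%:E) (cst 0%:E) (fun x => (f x ^+ 2)%:E)).
  - by move=> n; apply: measurable_sqE; exact: measurable_funB.
  - move=> x _; apply: cvg_EFin; first exact: nearW.
    have h : g n x @[n --> \oo] --> f x.
      have hh : (g n x)%:E @[n --> \oo] --> (f x)%:E.
        apply: (@cvg_nnsfun_approx _ _ _ setT measurableT (EFin \o f) mE _ x) => //.
        by move=> y _; rewrite lee_fin.
      exact: (fine_cvg hh).
    have h2 : f x - g n x @[n --> \oo] --> 0.
      by rewrite -(subrr (f x)); apply: cvgB => //; exact: cvg_cst.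
    have h3 := cvgM h2 h2; rewrite mulr0 in h3.
    have h4 : (f x - g n x) ^+ 2 @[n --> \oo] --> 0.
      by under eq_fun do rewrite expr2; exact: h3.
    exact: h4.
  - by [].
  - exact: L2_sq_integrable.
  - move=> n x _; have /andP[g0 gfx] := gf n x.
    rewrite lee_fin ger0_norm ?sqr_ge0// lerXn2r ?nnegrE ?subr_ge0//.
    by rewrite lerBlDr lerDl.
rewrite integral0 in cv.
have : \forall N \near \oo, (\int[mu]_x ((f x - g N x) ^+ 2)%:E < e%:E)%E.
  have := cv [set y | (y < e%:E)%E]; apply.
  by apply: (@open_ereal_lt' _ 0 e%:E); rewrite lte_fin.
case=> N _ /(_ N (leqnn N)) /= hN.
exists (g N); split => //; rewrite -lee_fin -sqE ?ltW//.
exact: L2_sub.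
Unshelve. all: by end_near. Qed.

Lemma tcont_L2 (f : T3 R -> R) : L2 mu f -> (forall x, f x != 0 -> Q x) -> tcont f.
Proof.
move=> lf fQ; have [mf _] := lf.
pose fp x := Num.max (f x) 0; pose fn x := Num.max (- f x) 0.
have fE : f = fun x => fp x + (-1) * fn x.
  apply/funext => x; rewrite /fp /fn mulN1r.
  by have [h|h] := ltP (f x) 0; have [k|k] := ltP (- f x) 0; lra.
have lp : L2 mu fp.
  apply: L2_dom lf _; first exact: measurable_maxr.
  by move=> x; rewrite /fp; case: (ltP (f x) 0) => h; rewrite ?normr0.
have ln : L2 mu fn.
  apply: L2_dom lf _; first by apply: measurable_maxr => //; exact: measurableT_comp.
  by move=> x; rewrite /fn; case: (ltP (- f x) 0) => h; rewrite ?normr0 ?normrN.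
rewrite fE; apply: tcont_add => //; first exact: L2_scale.
  apply: tcont_ge0 => // x; first by rewrite /fp le_max lexx orbT.
  move=> h; apply: fQ; apply: contraNN h => /eqP h; by rewrite /fp h maxxx.
apply: tcont_scale => //; apply: tcont_ge0 => // x; first by rewrite /fn le_max lexx orbT.
move=> h; apply: fQ; apply: contraNN h => /eqP h; by rewrite /fn h oppr0 maxxx.
Qed.

End TranslationContinuityL2.

(** * Mollification *)

Section Mollifier.
Variable R : realType.
Local Notation mu := (@leb3 R).
Local Notation e_ i := (unit_vector R i).

Lemma tr3E (a x : R3 R) : tr3 a x = x + a. Proof. by []. Qed.

Lemma tr3C (a x : R3 R) : tr3 a x = tr3 x a.
Proof. by rewrite !tr3E addrC. Qed.

Lemma sub_tr3 (x z : R3 R) : x + - tr3 x z = - z.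
Proof.
case: x z => [[x1 x2] x3] [[z1 z2] z3]; apply/pair_equal_spec; split.
  by apply/pair_equal_spec; split; rewrite /tr3 /=; ring.
by rewrite /tr3 /=; ring.
Qed.

Lemma Rintegral_tr3 (G : T3 R -> R) a : measurable_fun setT G ->
  \int[mu]_x G (tr3 a x) = \int[mu]_x G x.
Proof.
move=> mG; congr fine; rewrite integralE [RHS]integralE.
have mE : measurable_fun setT (EFin \o G) by exact/measurable_EFinP.
congr (_ - _)%E.
  rewrite -(ge0_integral_tr3 a (measurable_funepos mE))//.
  by apply: eq_integral => x _; rewrite !funeposE.
rewrite -(ge0_integral_tr3 a (measurable_funeneg mE))//.
by apply: eq_integral => x _; rewrite !funenegE.
Qed.

(** Even, so that convolution with the mollifier is also an average of translates, and not
    normalised: the integral is divided out in [moll]. *)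
Definition bump (x : R) : R := expflat (x + 1) * expflat ((- 1) * x + 1).

Lemma bump_C1n n : C1n n bump.
Proof.
have e1 : C1n n (@expflat R) by exact: flat_C1n.
apply: C1n_mul; last exact: C1n_affine.
have := C1n_affine 1 1 e1.
by under eq_fun do rewrite mul1r.
Qed.

Lemma bump_even x : bump (- x) = bump x.
Proof. by rewrite /bump mulrC !mulN1r opprK. Qed.

Lemma bump_ge0 x : 0 <= bump x.
Proof. by rewrite mulr_ge0 ?expflat_ge0. Qed.

Lemma bump_gt0 x : `|x| < 1 -> 0 < bump x.
Proof.
by rewrite ltr_norml => /andP[h1 h2]; rewrite mulr_gt0 ?expflat_gt0//; lra.
Qed.

Lemma bump_eq0 x : 1 <= `|x| -> bump x = 0.
Proof.
rewrite ler_normr => /orP[h|h]; rewrite /bump.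
  by rewrite (@expflat_le0 _ (_ * _ + 1)) ?mulr0//; lra.
by rewrite expflat_le0 ?mul0r//; lra.
Qed.

Definition moll0 (t : R) (x : R3 R) : R :=
  bump (t^-1 * coord3 ord0 x + 0) * (bump (t^-1 * coord3 (inord 1) x + 0) *
  bump (t^-1 * coord3 (inord 2) x + 0)).

Lemma moll0E t x : moll0 t x = bump (x.1.1 / t) * (bump (x.1.2 / t) * bump (x.2 / t)).
Proof. by rewrite /moll0 /coord3 !inordK//= !addr0 ![t^-1 * _]mulrC. Qed.

Lemma moll0_smooth t : smooth (moll0 t).
Proof.
apply/smoothP => n; apply: Cn_mul; last apply: Cn_mul;
  by apply: (Cn_coord _ (b := fun y => bump (t^-1 * y + 0))); apply: C1n_affine; exact: bump_C1n.
Qed.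

Lemma moll0_ge0 t x : 0 <= moll0 t x.
Proof. by rewrite moll0E; apply: mulr_ge0; [|apply: mulr_ge0]; exact: bump_ge0. Qed.

Lemma moll0_even t x : moll0 t (- x) = moll0 t x.
Proof. by rewrite !moll0E /= !mulNr !bump_even. Qed.

Lemma moll0_support t x : 0 < t -> moll0 t x != 0 -> bx t t x.
Proof.
move=> t0; have H (y : R) : bump (y / t) != 0 -> `|y| <= t.
  move=> h; rewrite leNgt; apply: contraNN h => h; rewrite bump_eq0//.
  by rewrite normrM normfV (gtr0_norm t0) ler_pdivlMr// mul1r ltW.
rewrite moll0E mulf_eq0 negb_or => /andP[/H h1].
by rewrite mulf_eq0 negb_or => /andP[/H h2 /H h3].
Qed.

Lemma moll0_L2 t : 0 < t -> L2 mu (moll0 t).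
Proof.
move=> t0.
have [M [M0 hM]] := compact_support_bounded (smooth_continuous (moll0_smooth t))
   (fun x => moll0_support t0 (x := x)).
have l1 : L2 mu (\1_(bx t t) : T3 R -> R).
  apply: L2_indic; first exact: bx_measurable.
  by have := Q_fin t t measurableT; rewrite setTI.
apply: L2_dom (L2_scale M l1) _.
  by apply: cont3_measurable; apply: smooth_continuous; exact: moll0_smooth.
move=> x; have [->|h] := eqVneq (moll0 t x) 0; first by rewrite normr0.
rewrite indicE mem_set ?mulr1; last exact: moll0_support h.
by apply: le_trans (hM x) _; exact: ler_norm.
Qed.

Lemma test_integrable (f : R3 R -> R) N : continuous f -> (forall x, f x != 0 -> bx N N x) ->
  mu.-integrable setT (EFin \o f).
Proof.
move=> cf fN.
have [M [M0 hM]] := compact_support_bounded cf fN.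
apply: (@le_integrable _ _ _ mu setT measurableT _ (fun x => M%:E * (\1_(bx N N) x)%:E)%E).
- by apply/measurable_EFinP; exact: cont3_measurable.
- move=> x _; rewrite -EFinM /= lee_fin; have [->|h] := eqVneq (f x) 0; first by rewrite normr0.
  rewrite indicE mem_set ?mulr1; last exact: fN.
  by apply: le_trans (hM x) _; exact: ler_norm.
- apply: integrableZl => //.
  have l1 : L2 mu (\1_(bx N N) : T3 R -> R).
    apply: L2_indic; first exact: bx_measurable.
    by have := Q_fin N N measurableT; rewrite setTI.
  by apply: eq_integrable (L2_sq_integrable l1) => // x _; rewrite /= indic_sqr.
Qed.

(** A nonnegative function of zero integral vanishes almost everywhere, while [moll0 t] is positive
    on a box of positive volume. *)
Lemma moll0_int_gt0 t : 0 < t -> 0 < \int[mu]_x moll0 t x.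
Proof.
move=> t0.
have ii : mu.-integrable setT (EFin \o moll0 t).
  apply: (@test_integrable _ t); first exact: (smooth_continuous (moll0_smooth t)).
  by move=> x; exact: moll0_support.
rewrite lt_neqAle Rintegral_ge0 ?andbT; last by move=> x _; exact: moll0_ge0.
apply/eqP => h.
have h0 : (\int[mu]_x `|(moll0 t x)%:E| = 0)%E.
  transitivity (\int[mu]_x (moll0 t x)%:E)%E.
    by apply: eq_integral => x _; rewrite gee0_abs// lee_fin moll0_ge0.
  have fin := integrable_fin_num measurableT ii.
  by rewrite -(fineK fin); congr EFin; rewrite -/(Rintegral mu setT (moll0 t)) -h.
have mm : measurable_fun setT (EFin \o (moll0 t : T3 R -> R)).
  by case/integrableP : ii.
have [N [mN N0 hN]] := (ae_eq_integral_abs mu measurableT mm).1 h0.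
have sub : bx (t / 2) (t / 2) `<=` N.
  move=> x [b1 b2 b3]; apply: hN => /= hx; have : moll0 t x = 0 by case: (hx I).
  apply/eqP; rewrite gt_eqF// moll0E.
  have H (y : R) : `|y| <= t / 2 -> 0 < bump (y / t).
    move=> h1; apply: bump_gt0; rewrite normrM normfV (gtr0_norm t0) ltr_pdivrMr// mul1r.
    by apply: le_lt_trans h1 _; rewrite ltr_pdivrMr// ltr_pMr// ltr1n.
  by apply: mulr_gt0; [|apply: mulr_gt0]; exact: H.
have : (mu (bx (t / 2) (t / 2)) <= mu N)%E.
  by apply: le_measure; rewrite ?inE//; exact: bx_measurable.
rewrite N0 leb3_bx ?divr_ge0 ?(ltW t0)// lee_fin leNgt.
by rewrite pmulr_rgt0 ?exprn_gt0 ?mulr_gt0 ?divr_gt0.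
Qed.

Definition moll (t : R) (x : R3 R) : R := (\int[mu]_y moll0 t y)^-1 * moll0 t x.

Lemma moll_smooth t : smooth (moll t).
Proof. exact: (smooth_mul (smooth_cst _) (moll0_smooth t)). Qed.

Lemma moll_ge0 t x : 0 < t -> 0 <= moll t x.
Proof. by move=> t0; rewrite mulr_ge0 ?moll0_ge0// invr_ge0 ltW// moll0_int_gt0. Qed.

Lemma moll_even t x : moll t (- x) = moll t x.
Proof. by rewrite /moll moll0_even. Qed.

Lemma moll_support t x : 0 < t -> moll t x != 0 -> bx t t x.
Proof. by move=> t0; rewrite mulf_eq0 negb_or => /andP[_]; exact: moll0_support. Qed.

Lemma moll_integrable t : 0 < t -> mu.-integrable setT (EFin \o moll t).
Proof.
move=> t0; apply: (@test_integrable _ t); first exact: (smooth_continuous (moll_smooth t)).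
by move=> x; exact: moll_support.
Qed.

Lemma moll_int1 t : 0 < t -> \int[mu]_x moll t x = 1.
Proof.
move=> t0; rewrite RintegralZl//.
  by rewrite mulVf// gt_eqF// moll0_int_gt0.
apply: (@test_integrable _ t); first exact: (smooth_continuous (moll0_smooth t)).
by move=> x; exact: moll0_support.
Qed.

Lemma moll_int1E t : 0 < t -> (\int[mu]_x (moll t x)%:E = 1%:E)%E.
Proof.
move=> t0; rewrite -(fineK (integrable_fin_num measurableT (moll_integrable t0))).
by congr EFin; exact: moll_int1.
Qed.

(** Written as a [pint] with kernel [f] and translations by [- y]: [f] only has to be integrable,
    and all derivatives fall on the mollifier. *)
Definition mol (t : R) (f : T3 R -> R) (x : R3 R) : R := \int[mu]_y (f y * moll t (x + - y)).

(** The change of variables [y = x + z] and the evenness of the kernel exchange the two roles: the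
    definition serves for derivatives, this form for L2 bounds. *)
Lemma molE t f x : measurable_fun setT f ->
  mol t f x = \int[mu]_z (moll t z * f (tr3 z x)).
Proof.
move=> mf; rewrite /mol.
rewrite -(@Rintegral_tr3 (fun y => f y * moll t (x + - y)) x).
  congr Rintegral; apply/funext => z; rewrite [RHS]mulrC [tr3 z x]tr3C; congr (_ * _).
  transitivity (moll t (- z)); last exact: moll_even.
  by congr (moll t _); exact: sub_tr3.
apply: measurable_funM => //; apply: cont3_measurable => y.
apply: (@continuous_comp _ _ _ (fun y : R3 R => x + - y) (moll t)); last first.
  exact: (smooth_continuous (moll_smooth t)).
by apply: continuousB => //; exact: cst_continuous.
Qed.

Lemma measurable_opp3 : measurable_fun setT ((fun y => - y : R3 R) : T3 R -> T3 R).
Proof.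
apply: (@measurable_fun_pair _ _ _ (T3 R) (T2 R) (measurableTypeR R)
  (fun x => (- x.1.1, - x.1.2)) (fun x => - x.2)); last first.
  by apply: measurableT_comp => //; exact: measurable_snd.
apply: (@measurable_fun_pair _ _ _ (T3 R) (measurableTypeR R) (measurableTypeR R)
  (fun x => - x.1.1) (fun x => - x.1.2)).
  by apply: measurableT_comp => //; exact: (measurableT_comp measurable_fst measurable_fst).
by apply: measurableT_comp => //; exact: (measurableT_comp measurable_snd measurable_fst).
Qed.

Lemma mol_smooth t f : 0 < t -> mu.-integrable setT (EFin \o f) -> smooth (mol t f).
Proof.
move=> t0 iF; apply: (pint_smooth iF measurable_opp3 (moll_smooth t)).
by move=> x; exact: moll_support.
Qed.

Lemma partial_mol t f i : 0 < t -> mu.-integrable setT (EFin \o f) ->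
  partial i (mol t f) = fun x => \int[mu]_y (f y * partial i (moll t) (x + - y)).
Proof.
move=> t0 iF; apply: (partial_pint iF measurable_opp3 i (moll_smooth t)).
by move=> x; exact: moll_support.
Qed.

Lemma mol_L2 t f : 0 < t -> L2 mu f -> L2 mu (mol t f) /\ sq mu (mol t f) <= sq mu f.
Proof.
move=> t0 lf; have [mf _] := lf.
have mm : measurable_fun setT (moll t : T3 R -> R).
  by apply: cont3_measurable; exact: (smooth_continuous (moll_smooth t)).
have c1 : (\int[mu]_s `|moll t s|%:E <= 1%:E)%E.
  under eq_integral do rewrite ger0_norm ?moll_ge0//.
  by rewrite moll_int1E.
have mid : measurable_fun setT ((fun y => y) : T3 R -> T3 R) by exact: measurable_id.
have h := young_translate (mu := mu) mm ltr01 c1 mid mf.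
have mo : measurable_fun setT (mol t f : T3 R -> R).
  rewrite (_ : mol t f = fun x => \int[mu]_z (moll t z * f (tr3 z x))); last first.
    by apply/funext => x; exact: molE.
  apply: (@measurable_Rintegral_param _ _ _ _ _ mu (fun z => moll t z.2 * f (tr3 z.2 z.1))).
  apply: measurable_funM; first exact: (measurableT_comp mm measurable_snd).
  have mt : measurable_fun setT (fun z : T3 R * T3 R => tr3 z.2 z.1 : T3 R).
    exact: (measurable_tr3_pair (g := fun y => y)).
  exact: (measurableT_comp mf mt).
have E : (\int[mu]_x (mol t f x ^+ 2)%:E <= \int[mu]_x (f x ^+ 2)%:E)%E.
  apply: le_trans (_ : _ <= (1 ^+ 2)%:E * \int[mu]_x (f x ^+ 2)%:E)%E _.
    apply: le_trans h; rewrite le_eqVlt; apply/orP; left; apply/eqP.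
    by apply: eq_integral => x _; rewrite molE.
  by rewrite expr1n mul1e.
have lm : L2 mu (mol t f) by split => //; apply: le_lt_trans E _; case: lf.
by split => //; rewrite -lee_fin -!sqE.
Qed.

(** The kernel has integral 1, so [mol t f - f] is an average of the differences [f (x + z) - f x]
    over [z] in [bx t t], and [minkowski] bounds it by the worst [osc]. *)
Lemma mol_close t f (e : R) : 0 < t -> L2 mu f ->
  (forall z, bx t t z -> (osc f z <= e%:E)%E) -> sq mu (fun x => mol t f x - f x) <= e.
Proof.
move=> t0 lf hosc; have [mf _] := lf.
have [lm _] := mol_L2 t0 lf.
have mm : measurable_fun setT (moll t : T3 R -> R).
  by apply: cont3_measurable; exact: (smooth_continuous (moll_smooth t)).
have c1 : (\int[mu]_s `|moll t s|%:E <= 1%:E)%E.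
  under eq_integral do rewrite ger0_norm ?moll_ge0//.
  by rewrite moll_int1E.
have mt : measurable_fun setT (fun z : T3 R * T3 R => tr3 z.2 z.1 : T3 R).
  exact: (measurable_tr3_pair (g := fun y => y)).
have mF : measurable_fun setT (fun z : T3 R * T3 R => f (tr3 z.2 z.1) - f z.1).
  apply: measurable_funB; first exact: (measurableT_comp mf mt).
  exact: (measurableT_comp mf measurable_fst).
have h := @minkowski _ _ _ mu (moll t) 1 mm ltr01 c1 (fun x z => f (tr3 z x) - f x) mF.
rewrite -lee_fin -sqE; last exact: L2_sub.
have lmo : L2 mu (moll t) by apply: L2_scale; exact: moll0_L2.
have E x : mol t f x - f x = \int[mu]_z (moll t z * (f (tr3 z x) - f x)).
  have i1 : mu.-integrable setT (EFin \o (fun z => moll t z * f (tr3 z x))).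
    apply: L2_mul_integrable => //.
    rewrite (_ : (fun z => f (tr3 z x)) = fun z => f (tr3 x z)); first exact: L2_tr3.
    by apply/funext => z; rewrite tr3C.
  have i2 : mu.-integrable setT (EFin \o (fun z => moll t z * f x)).
    by have := integrableZr measurableT (f x) (moll_integrable t0).
  under eq_Rintegral do rewrite mulrBr.
  rewrite RintegralB// -molE//; congr (_ - _).
  by rewrite RintegralZr ?moll_int1 ?mul1r//; exact: moll_integrable.
under eq_integral do rewrite E.
apply: le_trans h _; rewrite mul1e.
apply: le_trans (_ : _ <= \int[mu]_s (moll t s * e)%:E)%E _.
  apply: ge0_le_integral => //.
  - by move=> s _; apply: mule_ge0 => //; apply: integral_ge0 => x _; rewrite lee_fin sqr_ge0.
  - apply: emeasurable_funM; first by apply/measurable_EFinP; exact: measurableT_comp.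
    apply: (@measurable_fun_fubini_tonelli_G _ _ _ _ _ mu
      (fun z : T3 R * T3 R => ((f (tr3 z.2 z.1) - f z.1) ^+ 2)%:E)).
      by apply: measurable_sqE.
    by move=> x; rewrite lee_fin sqr_ge0.
  - by apply/measurable_EFinP; exact: measurable_funM.
  - move=> s _; rewrite ger0_norm ?moll_ge0//.
    rewrite (EFinM (moll t s)); have [->|hs] := eqVneq (moll t s) 0; first by rewrite !(mul0e, mul0r).
    apply: lee_wpmul2l; first by rewrite lee_fin moll_ge0.
    by apply: hosc; exact: moll_support hs.
under eq_integral do rewrite mulrC EFinM.
rewrite integralZl//; last exact: moll_integrable.
by rewrite moll_int1E// mule1.
Qed.

End Mollifier.

(** * Ladyzhenskaya's inequality *)

Section Ladyzhenskaya.
Variable R : realType.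
Local Notation mu := (@leb3 R).
Local Notation e_ i := (unit_vector R i).
Local Notation i1 := (inord 1 : 'I_3).
Local Notation i2 := (inord 2 : 'I_3).

Lemma ge0_le_int d (T : measurableType d) (m : {measure set T -> \bar R}) (f g : T -> \bar R) :
  measurable_fun setT f -> measurable_fun setT g ->
  (forall x, 0 <= f x)%E -> (forall x, f x <= g x)%E -> (\int[m]_x f x <= \int[m]_x g x)%E.
Proof. by move=> mf mg f0 fg; apply: ge0_le_integral. Qed.

Lemma mul2_le_sqrD (a b : R) : 2 * (a * b) <= a ^+ 2 + b ^+ 2.
Proof. by have := sqr_ge0 (a - b); rewrite sqrrB; lra. Qed.

Lemma slice_arith (a b m d0 d1 K : R) : a ^+ 2 <= m * d0 -> b ^+ 2 <= m * d1 -> m <= K ->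
  0 <= d0 -> 0 <= d1 -> 2 * a * (2 * b) <= 2 * K * (d0 + d1).
Proof.
move=> a2 b2 mK d00 d10; have ab := mul2_le_sqrD a b.
have k1 := ler_wpM2r d00 mK; have k2 := ler_wpM2r d10 mK.
by lra.
Qed.

Lemma contM (T : topologicalType) (f g : T -> R) :
  continuous f -> continuous g -> continuous (fun x => f x * g x).
Proof. by move=> cf cg x; exact: (continuousM (cf x) (cg x)). Qed.

Lemma cont_norm (T : topologicalType) (f : T -> R) :
  continuous f -> continuous (fun x => `|f x|).
Proof.
by move=> cf x; apply: (@continuous_comp _ _ _ f Num.norm); [exact: cf|exact: norm_continuous].
Qed.

Lemma cont_cst (T : topologicalType) (k : R) : continuous (fun _ : T => k).
Proof. by move=> x; exact: cst_continuous. Qed.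

Lemma leb2_tonelliyx (G : T2 R -> \bar R) : measurable_fun setT G -> (forall p, 0 <= G p)%E ->
  (\int[@leb2 R]_p G p = \int[@leb R]_y \int[@leb R]_x G (x, y))%E.
Proof. by move=> mG G0; exact: (fubini_tonelli2 (m1 := @leb R) (m2 := @leb R) G mG G0). Qed.

Lemma leb2_tonellixy (G : T2 R -> \bar R) : measurable_fun setT G -> (forall p, 0 <= G p)%E ->
  (\int[@leb2 R]_p G p = \int[@leb R]_x \int[@leb R]_y G (x, y))%E.
Proof. by move=> mG G0; exact: (fubini_tonelli1 (m1 := @leb R) (m2 := @leb R) G mG G0). Qed.

(** [F] vanishes at the point [a], chosen to the left of its support, so [F t ^ 2] is the integral
    of [2 F F'] from [a] to [t]. *)
Lemma line_sqr_le (F dF : R -> R) (N : R) : (forall t, is_derive t (1 : R) F (dF t)) ->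
  continuous dF -> (forall t, F t != 0 -> `|t| <= N) ->
  forall t, ((F t ^+ 2)%:E <= \int[@leb R]_s (2 * `|F s * dF s|)%:E)%E.
Proof.
move=> hd cd hN t.
have cF : continuous F.
  by move=> s; apply/differentiable_continuous/derivable1_diffP; have [] := hd s.
have cc : continuous (fun s => 2 * `|F s * dF s|).
  by apply: contM; [exact: cont_cst|apply: cont_norm; exact: contM].
have mm : measurable_fun setT (fun s : measurableTypeR R => (2 * `|F s * dF s|)%:E).
  by apply/measurable_EFinP; exact: (continuous_measurable_fun cc).
have [->|Ft] := eqVneq (F t) 0.
  by rewrite expr0n/=; apply: integral_ge0 => s _; rewrite lee_fin.
have tN := hN t Ft.
pose a := - (`|N| + 1).
have at_ : a < t.
  rewrite /a; move: tN; rewrite ler_norml => /andP[h _].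
  by have := ler_norm N; lra.
have Fa : F a = 0.
  apply/eqP; apply: contraT => /hN; rewrite /a normrN ger0_norm ?addr_ge0//.
  by have := ler_norm N; lra.
have d2 s : is_derive s (1 : R) (fun s => F s ^+ 2) (2 * (F s * dF s)).
  rewrite (_ : (fun s => F s ^+ 2) = F * F); last by apply/funext => z; rewrite expr2.
  by apply: (is_derive_eq (is_deriveM (hd s) (hd s))); rewrite /GRing.scale/=; ring.
have c2 : continuous (fun s => 2 * (F s * dF s)).
  by apply: contM; [exact: cont_cst|exact: contM].
have cF2 : continuous (fun s => F s ^+ 2).
  by move=> s; apply/differentiable_continuous/derivable1_diffP; have [] := d2 s.
have ftc : (\int[@leb R]_(s in `[a, t]) (2 * (F s * dF s))%:E = (F t ^+ 2)%:E - (F a ^+ 2)%:E)%E.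
  apply: (@continuous_FTC2 _ (fun s => 2 * (F s * dF s)) (fun s => F s ^+ 2)) => //.
  - exact: continuous_subspaceT.
  - split.
    + by move=> s _; have [] := d2 s.
    + by apply: cvg_at_right_filter; exact: cF2.
    + by apply: cvg_at_left_filter; exact: cF2.
  - by move=> s _; rewrite derive1E; exact: (@derive_val _ _ _ _ _ _ _ (d2 s)).
rewrite Fa expr0n/= sube0 in ftc; rewrite -ftc.
apply: (@le_trans _ _ (\int[@leb R]_(s in `[a, t]) (2 * `|F s * dF s|)%:E)%E).
  apply: le_integral => //.
  - apply: continuous_compact_integrable; first exact: segment_compact.
    exact: continuous_subspaceT.
  - apply: continuous_compact_integrable; first exact: segment_compact.
    exact: continuous_subspaceT.
  - by move=> s _; rewrite lee_fin ler_wpM2l// ler_norm.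
apply: ge0_subset_integral => //.
Qed.

Lemma line0E (x y z : R) : ((0, y), z) + x *: e_ ord0 = ((x, y), z) :> R3 R.
Proof.
apply/pair_equal_spec; split; first apply/pair_equal_spec; first split.
- by rewrite /= /GRing.scale/= mulr1 add0r.
- by rewrite /= /GRing.scale/= mulr0 addr0.
- by rewrite /= /GRing.scale/= mulr0 addr0.
Qed.

Lemma line1E (x y z : R) : ((x, 0), z) + y *: e_ i1 = ((x, y), z) :> R3 R.
Proof.
apply/pair_equal_spec; split; first apply/pair_equal_spec; first split.
- by rewrite /= /GRing.scale/= inordK// mulr0 addr0.
- by rewrite /= /GRing.scale/= inordK// mulr1 add0r.
- by rewrite /= /GRing.scale/= inordK// mulr0 addr0.
Qed.

Lemma line2E (x y z : R) : ((x, y), 0) + z *: e_ i2 = ((x, y), z) :> R3 R.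
Proof.
apply/pair_equal_spec; split; first apply/pair_equal_spec; first split.
- by rewrite /= /GRing.scale/= inordK// mulr0 addr0.
- by rewrite /= /GRing.scale/= inordK// mulr0 addr0.
- by rewrite /= /GRing.scale/= inordK// mulr1 add0r.
Qed.

Lemma continuous_line (f : R3 R -> R) i (x : R3 R) : smooth f ->
  continuous (fun t : R => f (x + t *: e_ i)).
Proof.
move=> sf t; apply/differentiable_continuous/derivable1_diffP.
by have [] := line_is_derive (smooth_derivable (i := i) (x := x + t *: e_ i) sf).
Qed.

Variables (f : R3 R -> R) (N : R).
Hypothesis sf : smooth f.
Hypothesis fN : forall x, f x != 0 -> bx N N x.

Let h i (x : R3 R) : R := 2 * `|f x * partial i f x|.

Let ch i : continuous (h i).
Proof.
apply: contM; first exact: cont_cst.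
apply: cont_norm; apply: contM; first exact: (smooth_continuous sf).
exact: (smooth_continuous (smooth_partial i sf)).
Qed.

Let mh i : measurable_fun setT (fun x : T3 R => (h i x)%:E).
Proof. by apply/measurable_EFinP; apply: cont3_measurable; exact: ch. Qed.

Let h0 i x : (0 <= (h i x)%:E)%E. Proof. by rewrite lee_fin mulr_ge0. Qed.

Lemma sqr_le_line0 x y z : ((f ((x, y), z) ^+ 2)%:E <= \int[@leb R]_s (h ord0 ((s, y), z))%:E)%E.
Proof.
have E s : f (((0, y), z) + s *: e_ ord0) = f ((s, y), z) by rewrite line0E.
have E' s : partial ord0 f (((0, y), z) + s *: e_ ord0) = partial ord0 f ((s, y), z) by rewrite line0E.
have := @line_sqr_le (fun s => f (((0, y), z) + s *: e_ ord0))
   (fun s => partial ord0 f (((0, y), z) + s *: e_ ord0)) N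
   (fun t => line_is_derive (smooth_derivable sf))
   (continuous_line (x := _) (smooth_partial ord0 sf)) _ x.
rewrite E; under eq_integral do rewrite E E'; apply.
by move=> t; rewrite E => /fN[].
Qed.

Lemma sqr_le_line1 x y z : ((f ((x, y), z) ^+ 2)%:E <= \int[@leb R]_s (h i1 ((x, s), z))%:E)%E.
Proof.
have E s : f (((x, 0), z) + s *: e_ i1) = f ((x, s), z) by rewrite line1E.
have E' s : partial i1 f (((x, 0), z) + s *: e_ i1) = partial i1 f ((x, s), z) by rewrite line1E.
have := @line_sqr_le (fun s => f (((x, 0), z) + s *: e_ i1))
   (fun s => partial i1 f (((x, 0), z) + s *: e_ i1)) N
   (fun t => line_is_derive (smooth_derivable sf))
   (continuous_line (x := _) (smooth_partial i1 sf)) _ y.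
rewrite E; under eq_integral do rewrite E E'; apply.
by move=> t; rewrite E => /fN[].
Qed.

Lemma sqr_le_line2 x y z : ((f ((x, y), z) ^+ 2)%:E <= \int[@leb R]_s (h i2 ((x, y), s))%:E)%E.
Proof.
have E s : f (((x, y), 0) + s *: e_ i2) = f ((x, y), s) by rewrite line2E.
have E' s : partial i2 f (((x, y), 0) + s *: e_ i2) = partial i2 f ((x, y), s) by rewrite line2E.
have := @line_sqr_le (fun s => f (((x, y), 0) + s *: e_ i2))
   (fun s => partial i2 f (((x, y), 0) + s *: e_ i2)) N
   (fun t => line_is_derive (smooth_derivable sf))
   (continuous_line (x := _) (smooth_partial i2 sf)) _ z.
rewrite E; under eq_integral do rewrite E E'; apply.
by move=> t; rewrite E => /fN[].
Qed.

Lemma measurable_slice2 (G : R3 R -> R) z : continuous G ->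
  measurable_fun setT (fun p : T2 R => G (p, z)).
Proof.
move=> cG; apply: (measurable_pairr z (f := G : T3 R -> R)); exact: cont3_measurable.
Qed.

(** On a horizontal plane one factor [f ^ 2] is bounded by a function of [y] alone and the other by
    a function of [x] alone, and the integral of their product factorises. *)
Lemma slice_quad_le z : (\int[@leb2 R]_p (f (p, z) ^+ 4)%:E <=
  (\int[@leb2 R]_p (h ord0 (p, z))%:E) * (\int[@leb2 R]_p (h i1 (p, z))%:E))%E.
Proof.
have mhz i : measurable_fun setT (fun p : T2 R => (h i (p, z))%:E).
  exact: (measurable_pairr z (mh i)).
have mf4 : measurable_fun setT (fun p : T2 R => (f (p, z) ^+ 4)%:E).
  by apply/measurable_EFinP; apply: measurable_funX; apply: measurable_slice2; exact: smooth_continuous.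
have E1 := leb2_tonelliyx (mhz ord0) (fun p => h0 ord0 (p, z)).
have E2 := leb2_tonellixy (mhz i1) (fun p => h0 i1 (p, z)).
have f40 p : (0 <= (f (p, z) ^+ 4)%:E)%E by rewrite lee_fin exprn_even_ge0.
have E4 := leb2_tonelliyx mf4 f40.
pose P1 y := (\int[@leb R]_x (h ord0 ((x, y), z))%:E)%E.
pose P2 x := (\int[@leb R]_y (h i1 ((x, y), z))%:E)%E.
have P10 y : (0 <= P1 y)%E by apply: integral_ge0 => x _; exact: h0.
have P20 y : (0 <= P2 y)%E by apply: integral_ge0 => x _; exact: h0.
have mP1 : measurable_fun setT P1.
  exact: (@measurable_fun_fubini_tonelli_G _ _ _ _ _ (@leb R) (fun p => (h ord0 (p, z))%:E) (mhz ord0)).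
have mP2 : measurable_fun setT P2.
  exact: (@measurable_fun_fubini_tonelli_F _ _ _ _ _ (@leb R) (fun p => (h i1 (p, z))%:E) (mhz i1)).
have P2i0 : (0 <= \int[@leb R]_x P2 x)%E by apply: integral_ge0 => x _; exact: P20.
have EZ y : (\int[@leb R]_x (P1 y * P2 x) = P1 y * \int[@leb R]_x P2 x)%E.
  exact: (ge0_integralZl (@leb R) measurableT mP2 (fun x _ => P20 x) (P10 y)).
have EP : (\int[@leb R]_y \int[@leb R]_x (P1 y * P2 x) =
    (\int[@leb R]_y P1 y) * (\int[@leb R]_x P2 x))%E.
  under eq_integral do rewrite EZ.
  exact: (ge0_integralZr (@leb R) measurableT mP1 (fun y _ => P10 y) P2i0).
rewrite E4; apply: (@le_trans _ _ (\int[@leb R]_y \int[@leb R]_x (P1 y * P2 x))%E); last first.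
  by rewrite EP E1 E2.
apply: ge0_le_int.
- exact: (@measurable_fun_fubini_tonelli_G _ _ _ _ _ (@leb R) (fun p => (f (p, z) ^+ 4)%:E) mf4).
- rewrite (_ : (fun y => _) = fun y => (P1 y * \int[@leb R]_x P2 x)%E).
    exact: (emeasurable_funM mP1 (measurable_cst _)).
  by apply/funext => y; rewrite EZ.
- by move=> y; apply: integral_ge0 => x _; rewrite lee_fin exprn_even_ge0.
move=> y; apply: ge0_le_int.
- exact: (measurable_pairr y mf4).
- exact: (emeasurable_funM (measurable_cst _) mP2).
- by move=> x; rewrite lee_fin exprn_even_ge0.
move=> x; rewrite (_ : f (x, y, z) ^+ 4 = f (x, y, z) ^+ 2 * f (x, y, z) ^+ 2); last by rewrite -exprD.
rewrite EFinM; apply: lee_pmul; rewrite ?lee_fin ?sqr_ge0//.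
  exact: sqr_le_line0.
exact: sqr_le_line1.
Qed.

Lemma slice_L2 (G : R3 R -> R) z : continuous G -> (forall x, G x != 0 -> bx N N x) ->
  L2 (@leb2 R) (fun p => G (p, z)).
Proof.
move=> cG GN; have [M [M0 hM]] := compact_support_bounded cG GN.
pose J : set (measurableTypeR R) := `[- N, N]%classic.
pose I : set (T2 R) := J `*` J.
have mJ : measurable J by exact: measurable_itv.
have mI : measurable I by exact: measurableX.
have fJ : (@leb R J < +oo)%E.
  by rewrite lebesgue_measure_itv/=; case: ifP => _ //; rewrite -EFinB ltry.
have fI : (@leb2 R I < +oo)%E.
  have -> : (@leb2 R I = @leb R J * @leb R J)%E by exact: product_measure1E.
  by rewrite lte_mul_pinfty// ge0_fin_numE.
have lI : L2 (@leb2 R) (\1_I : T2 R -> R).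
  split; first exact: measurable_indic.
  rewrite (_ : (fun x => _) = fun x => (\1_I x)%:E); first by rewrite integral_indic// setIT.
  by apply/funext => x; rewrite indicE; case: (x \in I); rewrite /= ?expr1n ?expr0n.
apply: L2_dom (L2_scale M lI) _; first exact: measurable_slice2.
move=> p; have [->|hp] := eqVneq (G (p, z)) 0; first by rewrite normr0.
rewrite indicE mem_set ?mulr1; first by apply: le_trans (hM _) _; exact: ler_norm.
by have [h1 h2 _] := GN _ hp; split; rewrite /J /= in_itv/= -ler_norml.
Qed.

Lemma cont_support_L2 (G : R3 R -> R) : continuous G -> (forall x, G x != 0 -> bx N N x) ->
  L2 mu G.
Proof.
move=> cG GN; have [M [M0 hM]] := compact_support_bounded cG GN.
have lI : L2 mu (\1_(bx N N) : T3 R -> R).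
  split; first by apply: measurable_indic; exact: bx_measurable.
  rewrite (_ : (fun x => _) = fun x => (\1_(bx N N) x)%:E); last first.
    by apply/funext => x; rewrite indicE; case: (x \in _); rewrite /= ?expr1n ?expr0n.
  rewrite integral_indic//; last exact: bx_measurable.
  have sub : bx N N `<=` bx (Num.max N 0) (Num.max N 0) by apply: bx_sub; rewrite le_max lexx.
  rewrite setIT; apply: (@le_lt_trans _ _ (mu (bx (Num.max N 0) (Num.max N 0)))).
    by apply: le_measure => //; rewrite inE; exact: bx_measurable.
  by rewrite leb3_bx ?ltry// le_max lexx orbT.
apply: L2_dom (L2_scale M lI) _; first exact: cont3_measurable.
move=> x; have [->|hx] := eqVneq (G x) 0; first by rewrite normr0.
by rewrite indicE mem_set ?mulr1; [apply: le_trans (hM _) _; exact: ler_norm|exact: GN].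
Qed.

(** The planar inequality on horizontal slices is combined with a uniform bound: integrating the
    vertical derivative shows that the squared L2 norm [m z] on the plane at height [z] is at most
    [2 A B]. Cauchy-Schwarz on each plane and integration in [z] give the constant 8, rounded up to
    16. *)
Lemma ladyzhenskaya (A B : R) : 0 <= A -> 0 <= B -> sq mu f <= A ^+ 2 ->
  (forall i, sq mu (partial i f) <= B ^+ 2) -> L4 mu f /\ qd mu f <= 16 * A * B ^+ 3.
Proof.
move=> A0 B0 fA dB.
have pN i x : partial i f x != 0 -> bx N N x by exact: partial_support.
have cf := smooth_continuous sf.
have cp i := smooth_continuous (smooth_partial i sf).
have lf : L2 mu f by exact: cont_support_L2.
have lp i : L2 mu (partial i f) by apply: cont_support_L2 => // x; exact: pN.
have mf : measurable_fun setT (f : T3 R -> R) by exact: cont3_measurable.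
have f4 : L4 mu f.
  split => //; apply: cont_support_L2; first by under eq_fun do rewrite expr2; exact: contM.
  by move=> x; rewrite expf_eq0/= => /fN.
split => //.
pose m z := sq (@leb2 R) (fun p => f (p, z)).
pose d i z := sq (@leb2 R) (fun p => partial i f (p, z)).
have lfz z : L2 (@leb2 R) (fun p => f (p, z)) by exact: slice_L2.
have lpz i z : L2 (@leb2 R) (fun p => partial i f (p, z)).
  by apply: slice_L2 => // x; exact: pN.
have M3 : \int[mu]_x (2 * `|f x * partial i2 f x|) <= 2 * (A * B).
  rewrite RintegralZl//; last by have := integrable_norm (L2_mul_integrable lf (lp i2)).
  by rewrite ler_wpM2l//; exact: CS_le.
have M3E : (\int[mu]_x (h i2 x)%:E <= (2 * (A * B))%:E)%E.
  have ii : mu.-integrable setT (fun x => (h i2 x)%:E).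
    have i0 := integrable_norm (L2_mul_integrable lf (lp i2)).
    by have := integrableZl measurableT 2 i0.
  by rewrite -(fineK (integrable_fin_num measurableT ii)) lee_fin.
have mz z : m z <= 2 * (A * B).
  rewrite -lee_fin -sqE//; apply: le_trans M3E.
  rewrite (_ : (\int[mu]_x (h i2 x)%:E = \int[@leb2 R]_p \int[@leb R]_s (h i2 (p, s))%:E)%E); last first.
    exact: (fubini_tonelli1 (m1 := @leb2 R) (m2 := @leb R) _ (mh i2) (h0 i2)).
  apply: ge0_le_int.
  - by apply: measurable_sqE; case: (lfz z).
  - exact: (@measurable_fun_fubini_tonelli_F _ _ _ _ _ (@leb R) (fun x => (h i2 x)%:E) (mh i2)).
  - by move=> p; rewrite lee_fin sqr_ge0.
  - by move=> -[x y]; exact: sqr_le_line2.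
have Ai i z : (\int[@leb2 R]_p (h i (p, z))%:E = (2 * \int[@leb2 R]_p `|f (p, z) * partial i f (p, z)|)%:E)%E.
  have i0 := integrable_norm (L2_mul_integrable (lfz z) (lpz i z)).
  have i3 : (@leb2 R).-integrable setT (fun p => (h i (p, z))%:E).
    by have := integrableZl measurableT 2 i0.
  by rewrite -(fineK (integrable_fin_num measurableT i3)) -RintegralZl.
have slice z : (\int[@leb2 R]_p (f (p, z) ^+ 4)%:E <= (4 * (A * B) * (d ord0 z + d i1 z))%:E)%E.
  apply: le_trans (slice_quad_le z) _; rewrite !Ai -EFinM lee_fin.
  set a := \int[@leb2 R]_p _; set b := \int[@leb2 R]_p _.
  have a2 : a ^+ 2 <= m z * d ord0 z by exact: cauchy_schwarz.
  have b2 : b ^+ 2 <= m z * d i1 z by exact: cauchy_schwarz.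
  have -> : 4 * (A * B) = 2 * (2 * (A * B)) by ring.
  exact: (slice_arith a2 b2 (mz z) (sq_ge0 _ _) (sq_ge0 _ _)).
have D i : (\int[@leb R]_z (d i z)%:E = (sq mu (partial i f))%:E)%E.
  rewrite -sqE// [RHS](fubini_tonelli2 (m1 := @leb2 R) (m2 := @leb R) (fun x => (partial i f x ^+ 2)%:E)).
  - by apply: eq_integral => z _; rewrite -sqE.
  - by apply: measurable_sqE; case: (lp i).
  - by move=> x; rewrite lee_fin sqr_ge0.
have mD i : measurable_fun setT (fun z => (d i z)%:E).
  rewrite (_ : (fun z => _) = fun z => (\int[@leb2 R]_p (partial i f (p, z) ^+ 2)%:E)%E).
    apply: (@measurable_fun_fubini_tonelli_G _ _ _ _ _ (@leb2 R) (fun x => (partial i f x ^+ 2)%:E)).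
      by apply: measurable_sqE; case: (lp i).
    by move=> x; rewrite lee_fin sqr_ge0.
  by apply/funext => z; rewrite -sqE.
have mf4 : measurable_fun setT (fun x : T3 R => (f x ^+ 4)%:E).
  by apply/measurable_EFinP; exact: measurable_funX.
have f40 x : (0 <= (f x ^+ 4)%:E)%E by rewrite lee_fin exprn_even_ge0.
have AB : 0 <= 4 * (A * B) by rewrite !mulr_ge0.
have key : (\int[mu]_x (f x ^+ 4)%:E <= (4 * (A * B) * (sq mu (partial ord0 f) + sq mu (partial i1 f)))%:E)%E.
  rewrite (_ : (\int[mu]_x (f x ^+ 4)%:E = \int[@leb R]_z \int[@leb2 R]_p (f (p, z) ^+ 4)%:E)%E); last first.
    exact: (fubini_tonelli2 (m1 := @leb2 R) (m2 := @leb R) _ mf4 f40).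
  apply: (@le_trans _ _ (\int[@leb R]_z ((4 * (A * B))%:E * ((d ord0 z)%:E + (d i1 z)%:E)))%E).
    apply: ge0_le_int.
    - exact: (@measurable_fun_fubini_tonelli_G _ _ _ _ _ (@leb2 R) (fun x => (f x ^+ 4)%:E) mf4).
    - exact: (measurable_funeM _ (emeasurable_funD (mD ord0) (mD i1))).
    - by move=> z; apply: integral_ge0 => p _; exact: f40.
    - by move=> z; rewrite -EFinD -EFinM; exact: slice.
  rewrite ge0_integralZl_EFin//; last first.
  - exact: (emeasurable_funD (mD ord0) (mD i1)).
  - by move=> z _; rewrite -EFinD lee_fin addr_ge0 ?sq_ge0.
  have d0 i z : (0 <= (d i z)%:E)%E by rewrite lee_fin sq_ge0.
  have ED : (\int[@leb R]_z ((d ord0 z)%:E + (d i1 z)%:E) =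
      \int[@leb R]_z (d ord0 z)%:E + \int[@leb R]_z (d i1 z)%:E)%E.
    exact: (ge0_integralD (@leb R) measurableT (fun z _ => d0 ord0 z) (mD ord0) (fun z _ => d0 i1 z) (mD i1)).
  apply: (@le_trans _ _ ((4 * (A * B))%:E * ((sq mu (partial ord0 f))%:E + (sq mu (partial i1 f))%:E))%E).
    apply: lee_wpmul2l; first by rewrite lee_fin.
    by rewrite le_eqVlt; apply/orP; left; apply/eqP; apply: etrans ED _; congr (_ + _)%E; exact: D.
  by rewrite -EFinD -EFinM.
rewrite qdE -lee_fin /Rintegral fineK; last first.
  rewrite ge0_fin_numE; first exact: le_lt_trans key (ltry _).
  by apply: integral_ge0 => x _; exact: f40.
apply: le_trans key _; rewrite lee_fin.
have k1 := ler_wpM2l AB (lerD (dB ord0) (dB i1)).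
apply: le_trans k1 _.
have -> : 4 * (A * B) * (B ^+ 2 + B ^+ 2) = 8 * (A * B ^+ 3) by ring.
have -> : 16 * A * B ^+ 3 = 16 * (A * B ^+ 3) by ring.
by rewrite ler_wpM2r ?mulr_ge0 ?exprn_ge0// ler_nat.
Qed.

End Ladyzhenskaya.

(** * Averages along coordinate directions *)

Section TestFunctions.
Variable R : realType.
Local Notation mu := (@leb3 R).
Local Notation e_ i := (unit_vector R i).
Implicit Types f g : R3 R -> R.

Lemma test_smooth f : test_function f -> smooth f.
Proof. by case. Qed.

Lemma test_bx f : test_function f -> exists N, 0 < N /\ forall x, f x != 0 -> bx N N x.
Proof. by case/test_functionP. Qed.

Lemma bx_test f N : smooth f -> (forall x, f x != 0 -> bx N N x) -> test_function f.
Proof. by move=> sf fN; split => //; exact: bounded_support fN. Qed.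

Lemma test_continuous f : test_function f -> continuous f.
Proof. by case=> /smooth_continuous. Qed.

Lemma test_measurable f : test_function f -> measurable_fun setT (f : T3 R -> R).
Proof. by move=> /test_continuous/cont3_measurable. Qed.

Lemma test_L2 f : test_function f -> L2 mu f.
Proof.
move=> tf; have [N [_ fN]] := test_bx tf.
exact: (cont_support_L2 (test_continuous tf) fN).
Qed.

Lemma test_mulr f g : smooth g -> test_function f -> test_function (fun x => g x * f x).
Proof.
move=> sg tf; have [N [_ fN]] := test_bx tf.
apply: (@bx_test _ N); first exact: smooth_mul sg (test_smooth tf).
by move=> x; rewrite mulf_eq0 negb_or => /andP[_ /fN].
Qed.

Lemma test_sqr f : test_function f -> test_function (fun x => f x ^+ 2).
Proof.
by move=> tf; under eq_fun do rewrite expr2; apply: test_mulr => //; exact: test_smooth.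
Qed.

Lemma test_L4 f : test_function f -> L4 mu f.
Proof. by move=> tf; split; [exact: test_measurable|apply: test_L2; exact: test_sqr]. Qed.

Lemma test_add f g : test_function f -> test_function g -> test_function (fun x => f x + g x).
Proof.
move=> tf tg; have [N [_ fN]] := test_bx tf; have [M [_ gM]] := test_bx tg.
apply: (@bx_test _ (Num.max N M)); first exact: smooth_add (test_smooth tf) (test_smooth tg).
move=> x; have [f0|fx _] := eqVneq (f x) 0.
  by rewrite f0 add0r => /gM; apply: bx_sub; rewrite le_max lexx orbT.
by apply: bx_sub (fN x fx); rewrite le_max lexx.
Qed.

Lemma test_opp f : test_function f -> test_function (fun x => - f x).
Proof.
move=> tf; under eq_fun do rewrite -mulN1r.
by apply: (@test_mulr f (fun=> -1)) => //; exact: smooth_cst.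
Qed.

Lemma test_sub f g : test_function f -> test_function g -> test_function (fun x => f x - g x).
Proof. by move=> tf tg; apply: test_add => //; exact: test_opp. Qed.

Lemma test_sum (I : Type) (r : seq I) (F : I -> R3 R -> R) : (forall k, test_function (F k)) ->
  test_function (fun x => \sum_(k <- r) F k x).
Proof.
move=> tF; elim: r => [|k r IH].
  under eq_fun do rewrite big_nil; apply: (@bx_test _ 0); first exact: smooth_cst.
  by move=> x; rewrite eqxx.
by under eq_fun do rewrite big_cons; exact: test_add.
Qed.

Lemma test_partial f i : test_function f -> test_function (partial i f).
Proof.
move=> tf; have [N [_ fN]] := test_bx tf.
apply: (@bx_test _ N); first exact: smooth_partial (test_smooth tf).
by move=> x; exact: partial_support.
Qed.

Lemma bx_shift N M (x a : R3 R) : bx N N (x + a) -> bx M M a -> bx (N + M) (N + M) x.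
Proof.
have k (p q : R) : `|p + q| <= N -> `|q| <= M -> `|p| <= N + M.
  by move=> h1 h2; have := ler_normB (p + q) q; rewrite addrK; lra.
move=> [h1 h2 h3] [k1 k2 k3]; split.
- exact: k h1 k1.
- exact: k h2 k2.
- exact: k h3 k3.
Qed.

Lemma bx_scale_unit i (s h : R) : 0 <= s <= h -> bx h h (s *: e_ i).
Proof.
move=> /andP[s0 sh].
have k (b : bool) : `|s *: (b%:R : R)| <= h.
  rewrite /GRing.scale/=; case: b; rewrite ?mulr1 ?mulr0 ?normr0 ?ger0_norm//.
  exact: le_trans sh.
by split; exact: k.
Qed.

Lemma test_translate f a : test_function f -> test_function (fun x => f (x + a)).
Proof.
move=> tf; have [N [_ fN]] := test_bx tf.
pose M := `|a.1.1| + `|a.1.2| + `|a.2|.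
apply: (@bx_test _ (N + M)); first exact: smooth_translate (test_smooth tf).
move=> x /fN h; apply: (bx_shift h).
have := normr_ge0 a.1.1; have := normr_ge0 a.1.2; have := normr_ge0 a.2.
by move=> ? ? ?; split; rewrite /M; lra.
Qed.

End TestFunctions.

(** * Averages of test functions against kernels on an interval *)

Section Averages.
Variable R : realType.
Local Notation mu := (@leb3 R).
Local Notation e_ i := (unit_vector R i).
Implicit Types f g : R3 R -> R.

(** Such a kernel has L1 norm at most [M h], which is therefore the norm of the averaging operator
    in L2 and, through squares, in L4. *)
Definition kern (h M : R) (c : R -> R) : Prop :=
  [/\ 0 < h, 0 < M, measurable_fun setT c & forall s, `|c s| <= M * \1_(`[0, h]) s].

Definition avg i (c : R -> R) f : R3 R -> R :=
  pint (@leb R) c (fun s => s *: e_ i) f.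

Lemma measurable_line i : measurable_fun setT ((fun s => s *: e_ i) : measurableTypeR R -> T3 R).
Proof.
have m (b : bool) : measurable_fun setT ((fun s => s *: (b%:R : R)) : measurableTypeR R -> measurableTypeR R).
  by apply: measurable_funM => //; exact: measurable_id.
apply: (@measurable_fun_pair _ _ _ (measurableTypeR R) (T2 R) (measurableTypeR R)
  (fun s => (s *: _, s *: _)) (fun s => s *: _)); last exact: m.
by apply: (@measurable_fun_pair _ _ _ (measurableTypeR R) (measurableTypeR R) (measurableTypeR R)
  (fun s => s *: _) (fun s => s *: _)); exact: m.
Qed.

Section OneKernel.
Variables (h M : R) (c : R -> R).
Hypothesis hc : kern h M c.

Lemma kern_bound : (\int[@leb R]_s `|c s|%:E <= (M * h)%:E)%E.
Proof.
have [h0 M0 mc cM] := hc.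
apply: (@le_trans _ _ (\int[@leb R]_s (M%:E * (\1_`[0%R, h] s)%:E))%E).
  apply: ge0_le_int => //.
  - by apply/measurable_EFinP; exact: measurableT_comp.
  - by apply: measurable_funeM; apply/measurable_EFinP.
rewrite ge0_integralZl_EFin//; last 2 first.
- by apply/measurable_EFinP.
- exact: ltW.
have e : (@leb R `[0%R, h]%classic = h%:E)%E by rewrite lebesgue_measure_itv/= lte_fin h0 sube0.
rewrite integral_indic// setIT EFinM; apply: lee_pmul => //; first by rewrite lee_fin ltW.
by rewrite -e.
Qed.

Lemma kern_integrable : (@leb R).-integrable setT (EFin \o c).
Proof.
have [h0 M0 mc cM] := hc; apply/integrableP; split; first exact/measurable_EFinP.
exact: le_lt_trans kern_bound (ltry _).
Qed.

Lemma avg_support i f x : avg i c f x != 0 -> exists s, 0 <= s <= h /\ f (x + s *: e_ i) != 0.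
Proof.
have [h0 M0 mc cM] := hc.
move=> nz; apply: contrapT => hn; move: nz; rewrite /avg /pint.
rewrite (_ : (fun s => _) = fun=> 0); first by rewrite Rintegral_cst// mul0r eqxx.
apply/funext => s; have [f0|fx] := eqVneq (f (x + s *: e_ i)) 0; first by rewrite f0 mulr0.
have := cM s; rewrite indicE; case: (boolP (s \in _)) => [sI|_].
  by exfalso; apply: hn; exists s; split => //; move: sI; rewrite inE /= in_itv.
by rewrite mulr0 normr_le0 => /eqP ->; rewrite mul0r.
Qed.

Lemma test_avg i f : test_function f -> test_function (avg i c f).
Proof.
move=> tf; have [N [_ fN]] := test_bx tf.
apply: (@bx_test _ _ (N + h)).
  exact: (pint_smooth kern_integrable (measurable_line i) (test_smooth tf) fN).
move=> x /avg_support[s [sh /fN]] hb; apply: (bx_shift hb).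
exact: bx_scale_unit.
Qed.

Lemma partial_avg i j f : test_function f -> partial j (avg i c f) = avg i c (partial j f).
Proof.
move=> tf; have [N [_ fN]] := test_bx tf.
exact: (partial_pint kern_integrable (measurable_line i) j (test_smooth tf) fN).
Qed.

Lemma avg_sq i f : test_function f -> sq mu (avg i c f) <= (M * h) ^+ 2 * sq mu f.
Proof.
move=> tf; have [h0 M0 mc cM] := hc.
have := young_translate (mu := @leb R) mc (mulr_gt0 M0 h0) kern_bound (measurable_line i) (test_measurable tf).
move=> k; have {k} : (\int[mu]_x (avg i c f x ^+ 2)%:E <=
  ((M * h) ^+ 2)%:E * \int[mu]_x (f x ^+ 2)%:E)%E by exact: k.
by rewrite (sqE (test_L2 tf)) (sqE (test_L2 (test_avg i tf))) -EFinM lee_fin.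
Qed.

Lemma kern_norm : kern h M (fun s => `|c s|).
Proof.
have [h0 M0 mc cM] := hc; split => //; first exact: measurableT_comp.
by move=> s; rewrite normr_id.
Qed.

Lemma avg_sqr_le i f x : test_function f ->
  (avg i c f x) ^+ 2 <= (M * h) * avg i (fun s => `|c s|) (fun y => f y ^+ 2) x.
Proof.
move=> tf; have [h0 M0 mc cM] := hc.
have m1 : measurable_fun setT (fun s : measurableTypeR R => f (x + s *: e_ i)).
  have := measurableT_comp (measurable_comp_tr3 x (test_measurable tf)) (measurable_line i).
  by under eq_fun do rewrite /= tr3C.
have := sqr_Rintegral_le (mu := @leb R) mc (mulr_gt0 M0 h0) kern_bound m1.
have [N [_ fN]] := test_bx (test_sqr tf).
have [B [_ fB]] := compact_support_bounded (test_continuous (test_sqr tf)) fN.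
have ii := pint_integrable
   (integrable_norm kern_integrable : (@leb R).-integrable setT (EFin \o (fun s => `|c s|)))
   (measurable_line i) x (test_continuous (test_sqr tf)) fB.
have E : (\int[@leb R]_s (`|c s| * f (x + s *: e_ i) ^+ 2)%:E =
    (avg i (fun s => `|c s|) (fun y => f y ^+ 2) x)%:E)%E.
  by apply/esym; apply: fineK; exact: (integrable_fin_num measurableT ii).
by rewrite E -EFinM lee_fin.
Qed.

End OneKernel.

(** By the pointwise Jensen bound [avg_sqr_le], the square of an average is controlled by the
    average of [f ^ 2]; the L2 bound for the latter gives the second factor [(M h) ^ 2]. *)
Lemma avg_qd i h M c f : kern h M c -> test_function f ->
  qd mu (avg i c f) <= (M * h) ^+ 4 * qd mu f.
Proof.
move=> hc tf; have [h0 M0 mc cM] := hc.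
have tf2 := test_sqr tf.
have ta := test_avg (kern_norm hc) i tf2.
have a0 x : 0 <= avg i (fun s => `|c s|) (fun y => f y ^+ 2) x.
  by apply: Rintegral_ge0 => s _; rewrite mulr_ge0// sqr_ge0.
have Mh0 : 0 <= M * h by rewrite mulr_ge0// ltW.
have := @sq_le _ _ _ mu _ _ (test_L2 (test_sqr (test_avg hc i tf))) (L2_scale (M * h) (test_L2 ta)).
rewrite sq_scale; last exact: test_L2.
have h2 := avg_sq (kern_norm hc) i tf2.
move=> h1; have {}h1 := h1 (fun x => _).
apply: le_trans (h1 _) _ => [x|].
  rewrite (ger0_norm (sqr_ge0 _)) ger0_norm; first exact: avg_sqr_le.
  exact: mulr_ge0.
rewrite (exprD (M * h) 2 2) -mulrA.
by rewrite ler_wpM2l ?sqr_ge0.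
Qed.

End Averages.

(** * Affine kernels and primitives along an axis *)

Section Kernels.
Variable R : realType.
Local Notation mu := (@leb3 R).
Local Notation e_ i := (unit_vector R i).
Implicit Types f g : R3 R -> R.

(** All kernels needed below are affine on [[0, h]], so that a single integration by parts,
    [avg_ftc], treats them together. *)
Definition kaff (a b h s : R) : R := (a * s + b) * \1_(`[0, h]) s.

Lemma kaff_kern a b h M : 0 < h -> 0 < M -> (forall s, 0 <= s <= h -> `|a * s + b| <= M) ->
  kern h M (kaff a b h).
Proof.
move=> h0 M0 hM; split => //.
  apply: measurable_funM; last by [].
  by apply: measurable_funD => //; apply: measurable_funM => //; exact: measurable_id.
move=> s; rewrite /kaff normrM indicE; case: (boolP (s \in _)) => [|_].
  by rewrite inE /= in_itv/= normr1 !mulr1; exact: hM.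
by rewrite normr0 !mulr0.
Qed.

Lemma avg_kaff_line a b h i f x : avg i (kaff a b h) f x =
  \int[@leb R]_(s in `[0, h]) ((a * s + b) * f (x + s *: e_ i)).
Proof.
rewrite [RHS]Rintegral_mkcond /avg /pint patch_indic; congr Rintegral.
by apply/funext => s /=; rewrite /kaff mulrAC.
Qed.

(** The fundamental theorem of calculus for [(a s + b) f (x + s e_i)] on [[0, h]]; the factor [a]
    comes from differentiating the kernel. *)
Lemma avg_ftc a b h i f x : 0 < h -> test_function f ->
  avg i (kaff a b h) (partial i f) x =
  (a * h + b) * f (x + h *: e_ i) - b * f x - a * avg i (kaff 0 1 h) f x.
Proof.
move=> h0 tf; rewrite !avg_kaff_line.
have sf := test_smooth tf.
pose F (s : R) := f (x + s *: e_ i); pose dF s := partial i f (x + s *: e_ i).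
have cF : continuous F by exact: continuous_line.
have cdF : continuous dF by exact: (continuous_line (x := x) (smooth_partial i sf)).
have caf : continuous (fun s : R => a * s + b).
  move=> s; apply: continuousD; last exact: cst_continuous.
  by apply: contM; [exact: cont_cst|move=> y; exact: cvg_id].
have dFF s : is_derive s (1:R) F (dF s) by exact: line_is_derive (smooth_derivable sf).
have dG s : is_derive s (1:R) (fun s => (a * s + b) * F s) (a * F s + (a * s + b) * dF s).
  apply: (is_derive_eq (is_deriveM (is_derive_affine a b s) (dFF s))).
  by rewrite /GRing.scale/= addrC [F s * a]mulrC.
have cG' : continuous (fun s => a * F s + (a * s + b) * dF s).
  have c1 : continuous (fun s => a * F s) by apply: contM => //; exact: cont_cst.
  have c2 : continuous (fun s => (a * s + b) * dF s) by apply: contM.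
  by move=> s; exact: (continuousD (c1 s) (c2 s)).
have cG : continuous (fun s => (a * s + b) * F s) by exact: contM.
have ii (k : R -> R) : continuous k -> (@leb R).-integrable `[0, h] (EFin \o k).
  move=> ck; apply: continuous_compact_integrable; first exact: segment_compact.
  exact: continuous_subspaceT.
have ftc : (\int[@leb R]_(s in `[0%R, h]) (a * F s + (a * s + b) * dF s)%:E =
    ((a * h + b) * F h)%:E - ((a * 0 + b) * F 0)%:E)%E.
  apply: (@continuous_FTC2 _ (fun s => a * F s + (a * s + b) * dF s) (fun s => (a * s + b) * F s)) => //.
  - exact: continuous_subspaceT.
  - split.
    + by move=> s _; have [] := dG s.
    + by apply: cvg_at_right_filter; exact: cG.
    + by apply: cvg_at_left_filter; exact: cG.
  - by move=> s _; rewrite derive1E; exact: (@derive_val _ _ _ _ _ _ _ (dG s)).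
have E : \int[@leb R]_(s in `[0, h]) (a * F s + (a * s + b) * dF s) =
    (a * h + b) * F h - b * F 0.
  by rewrite /Rintegral ftc mulr0 add0r.
have c0F : continuous (fun s : R => (0 * s + 1) * F s).
  by rewrite (_ : (fun s => _) = F)//; apply/funext => s; rewrite mul0r add0r mul1r.
have F0 : F 0 = f x by rewrite /F scale0r addr0.
rewrite -F0 -E; apply/eqP; rewrite eq_sym subr_eq; apply/eqP.
rewrite RintegralD//; last 2 first.
- by apply: (ii (fun s => a * F s)); apply: contM => //; exact: cont_cst.
- by apply: (ii (fun s => (a * s + b) * dF s)); apply: contM.
rewrite addrC; congr (_ + _).
rewrite -RintegralZl//; last by exact: (ii (fun s => (0 * s + 1) * F s)).
by congr Rintegral; apply/funext => s; rewrite mul0r add0r mul1r.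
Qed.

(** [Mk h] takes the mean over a length [h]. [Kk h] and [Jk h] are the kernels producing primitives
    along [e_ i] of [f] minus its mean and of [f] minus its translate by [h], respectively. *)
Definition Mk (h : R) := kaff 0 h^-1 h.
Definition Kk (h : R) := kaff h^-1 (-1) h.
Definition Jk (h : R) := kaff 0 (-1) h.

Lemma Mk_kern h : 0 < h -> kern h h^-1 (Mk h).
Proof.
move=> h0; apply: kaff_kern; rewrite ?invr_gt0// => s _.
by rewrite mul0r add0r ger0_norm// invr_ge0 ltW.
Qed.

Lemma Kk_kern h : 0 < h -> kern h 1 (Kk h).
Proof.
move=> h0; apply: kaff_kern => // s /andP[s0 sh].
have : h^-1 * s <= 1 by rewrite mulrC ler_pdivrMr// mul1r.
have : 0 <= h^-1 * s by rewrite mulr_ge0// invr_ge0 ltW.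
by rewrite ler_norml => a1 a2; apply/andP; split; lra.
Qed.

Lemma Jk_kern h : 0 < h -> kern h 1 (Jk h).
Proof. by move=> h0; apply: kaff_kern => // s _; rewrite mul0r add0r normrN1. Qed.

Lemma partial_Mk h i f x : 0 < h -> test_function f ->
  partial i (avg i (Mk h) f) x = h^-1 * (f (x + h *: e_ i) - f x).
Proof.
move=> h0 tf; rewrite (partial_avg (Mk_kern h0))// avg_ftc//.
by rewrite !mul0r add0r subr0 mulrBr.
Qed.

Lemma partial_Jk h i f x : 0 < h -> test_function f ->
  partial i (avg i (Jk h) f) x = f x - f (x + h *: e_ i).
Proof.
move=> h0 tf; rewrite (partial_avg (Jk_kern h0))// avg_ftc//; ring.
Qed.

Lemma partial_Kk h i f x : 0 < h -> test_function f ->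
  partial i (avg i (Kk h) f) x = f x - avg i (Mk h) f x.
Proof.
move=> h0 tf; rewrite (partial_avg (Kk_kern h0))// avg_ftc// mulVf ?gt_eqF//.
have -> : avg i (Mk h) f x = h^-1 * avg i (kaff 0 1 h) f x.
  rewrite !avg_kaff_line -RintegralZl//; last first.
    apply: continuous_compact_integrable; first exact: segment_compact.
    apply: continuous_subspaceT; apply: contM; last exact: (continuous_line (x := x) (test_smooth tf)).
    rewrite (_ : (fun s => _) = fun=> 1); first exact: cont_cst.
    by apply/funext => s; rewrite mul0r add0r.
  by congr Rintegral; apply/funext => s; rewrite !mul0r !add0r mul1r.
ring.
Qed.

End Kernels.

(** * Pointwise bounds for functions averaged in all three directions *)

Section SupBound.
Variable R : realType.
Local Notation mu := (@leb3 R).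
Local Notation e_ i := (unit_vector R i).
Local Notation i1 := (inord 1 : 'I_3).
Local Notation i2 := (inord 2 : 'I_3).
Implicit Types f g : R3 R -> R.

Lemma avg_sqr_line i h M c f x : kern h M c -> test_function f ->
  ((avg i c f x ^+ 2)%:E <= (M * h * M)%:E * \int[@leb R]_s (f (x + s *: e_ i) ^+ 2)%:E)%E.
Proof.
move=> hc tf; have [h0 M0 mc cM] := hc.
have Mh : 0 <= M * h by rewrite mulr_ge0// ltW.
have tf2 := test_sqr tf.
have le1 := avg_sqr_le hc i x tf.
have [N [_ fN]] := test_bx tf2.
have [B [_ fB]] := compact_support_bounded (test_continuous tf2) fN.
have ii := pint_integrable (kern_integrable (kern_norm hc)) (measurable_line i) x (test_continuous tf2) fB.
have E : ((avg i (fun s => `|c s|) (fun y => f y ^+ 2) x)%:E =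
   \int[@leb R]_s (`|c s| * f (x + s *: e_ i) ^+ 2)%:E)%E.
  by apply: fineK; exact: (integrable_fin_num measurableT ii).
have mf : measurable_fun setT (fun s : measurableTypeR R => (f (x + s *: e_ i) ^+ 2)%:E).
  apply/measurable_EFinP.
  have := measurableT_comp (measurable_comp_tr3 x (test_measurable tf2)) (measurable_line i).
  by under eq_fun do rewrite /= tr3C.
apply: (@le_trans _ _ ((M * h)%:E * (avg i (fun s => `|c s|) (fun y => f y ^+ 2) x)%:E)%E).
  by rewrite -EFinM lee_fin.
rewrite [in leRHS]EFinM -muleA; apply: lee_pmul => //; rewrite ?lee_fin//.
  by apply: Rintegral_ge0 => s _; rewrite mulr_ge0// sqr_ge0.
rewrite E -ge0_integralZl_EFin//; last 2 first.
- by move=> s _; rewrite lee_fin sqr_ge0.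
- exact: ltW.
apply: ge0_le_int.
- by apply/measurable_EFinP; have /measurable_int/measurable_EFinP := ii.
- exact: measurable_funeM.
- by move=> s; rewrite lee_fin mulr_ge0// sqr_ge0.
- move=> s; rewrite -EFinM lee_fin ler_wpM2r ?sqr_ge0//.
  apply: le_trans (cM s) _; rewrite -[leRHS]mulr1 ler_wpM2l ?(ltW M0)// indicE.
Qed.

(** Each average bounds the square of a value by a line integral of the square of the averaged
    function; after three directions these line integrals make up the full L2 norm. This replaces a
    Sobolev embedding. *)
Lemma iterated_avg_sup h M h' M' L M'' c c' c'' g x :
  kern h M c -> kern h' M' c' -> kern L M'' c'' -> test_function g ->
  avg i2 c'' (avg i1 c' (avg ord0 c g)) x ^+ 2 <=
    M'' * L * M'' * ((M' * h' * M') * ((M * h * M) * sq mu g)).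
Proof.
move=> hc hc' hc'' tg.
have tg1 := test_avg hc ord0 tg; have tg2 := test_avg hc' i1 tg1.
pose F (y : T3 R) := (g (tr3 x y) ^+ 2)%:E.
have mF : measurable_fun setT F.
  apply/measurable_EFinP; exact: (measurable_comp_tr3 x (test_measurable (test_sqr tg))).
have F0 y : (0 <= F y)%E by rewrite lee_fin sqr_ge0.
have IF : (\int[mu]_y F y = (sq mu g)%:E)%E.
  rewrite -(sqE (test_L2 tg)); apply: (ge0_integral_tr3 x (F := fun y => (g y ^+ 2)%:E)).
    by apply: measurable_sqE; exact: test_measurable.
  by move=> y; rewrite lee_fin sqr_ge0.
pose F1 (p : T2 R) := (\int[@leb R]_r F ((r, p.1), p.2))%E.
have mF1 : measurable_fun setT F1.
  apply: (@measurable_fun_fubini_tonelli_F _ _ _ _ _ (@leb R)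
    (fun q : T2 R * measurableTypeR R => F ((q.2, q.1.1), q.1.2))) => //.
  apply: (measurableT_comp mF).
  apply: (@measurable_fun_pair _ _ _ (T2 R * measurableTypeR R)%type (T2 R) (measurableTypeR R)
    (fun q => (q.2, q.1.1)) (fun q => q.1.2)); last exact: (measurableT_comp measurable_snd measurable_fst).
  apply: (@measurable_fun_pair _ _ _ (T2 R * measurableTypeR R)%type (measurableTypeR R) (measurableTypeR R)
    (fun q => q.2) (fun q => q.1.1)); first exact: measurable_snd.
  exact: (measurableT_comp measurable_fst measurable_fst).
have F10 p : (0 <= F1 p)%E by exact: integral_ge0.
pose F2 (z : measurableTypeR R) := (\int[@leb R]_y F1 (y, z))%E.
have mF2 : measurable_fun setT F2.
  exact: (@measurable_fun_fubini_tonelli_G _ _ _ _ _ (@leb R) F1).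
have pos k N : kern k N c \/ kern k N c' -> 0 <= N * k * N.
  by case=> -[k0 N0 _ _]; rewrite !mulr_ge0// ltW.
have K1 : 0 <= M * h * M by apply: pos; left.
have K2 : 0 <= M' * h' * M' by apply: pos; right.
have K3 : 0 <= M'' * L * M'' by case: hc'' => ? ? _ _; rewrite !mulr_ge0// ltW.
have xE r y z : ((x + z *: e_ i2) + y *: e_ i1) + r *: e_ ord0 = tr3 x ((r, y), z) :> R3 R.
  by apply/pair_equal_spec; split; [apply/pair_equal_spec; split|];
    rewrite /= /GRing.scale/= ?inordK//= ?mulr0 ?mulr1 ?addr0 addrC.
have s1 y z : ((avg ord0 c g ((x + z *: e_ i2) + y *: e_ i1) ^+ 2)%:E <= (M * h * M)%:E * F1 (y, z))%E.
  apply: le_trans (avg_sqr_line ord0 _ hc tg) _.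
  by rewrite /F1; under eq_integral do rewrite xE.
have mz z : measurable_fun setT (fun y => F1 (y, z)) by exact: (measurable_pairr z mF1).
have s2 z : ((avg i1 c' (avg ord0 c g) (x + z *: e_ i2) ^+ 2)%:E <=
    (M' * h' * M')%:E * ((M * h * M)%:E * F2 z))%E.
  apply: le_trans (avg_sqr_line i1 _ hc' tg1) _.
  rewrite lee_wpmul2l ?lee_fin//.
  rewrite /F2 -(ge0_integralZl_EFin (@leb R) measurableT (fun y _ => F10 (y, z)) (mz z) K1).
  apply: ge0_le_int => [||y|y]; [|exact: (measurable_funeM _ (mz z))|by rewrite lee_fin sqr_ge0|exact: s1].
  apply/measurable_EFinP.
  have := measurableT_comp (measurable_comp_tr3 (x + z *: e_ i2) (test_measurable (test_sqr tg1))) (measurable_line i1).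
  by under eq_fun do rewrite /= tr3C.
rewrite -lee_fin; apply: le_trans (avg_sqr_line i2 _ hc'' tg2) _.
rewrite [leRHS]EFinM lee_wpmul2l ?lee_fin//.
rewrite [leRHS]EFinM [X in (_ * X)%E]EFinM -IF (tonelli3 mF)//.
have F20 z : (0 <= F2 z)%E by exact: integral_ge0.
rewrite -(ge0_integralZl_EFin (@leb R) measurableT (fun z _ => F20 z) mF2 K1).
have F21 z : (0 <= (M * h * M)%:E * F2 z)%E by rewrite mule_ge0.
rewrite -(ge0_integralZl_EFin (@leb R) measurableT (fun z _ => F21 z) (measurable_funeM _ mF2) K2).
apply: ge0_le_int => [||z|z]; [|exact: (measurable_funeM _ (measurable_funeM _ mF2))|
  by rewrite lee_fin sqr_ge0|exact: s2].
apply/measurable_EFinP.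
have := measurableT_comp (measurable_comp_tr3 x (test_measurable (test_sqr tg2))) (measurable_line i2).
by under eq_fun do rewrite /= tr3C.
Qed.

End SupBound.

(** * A calculus of L2 and L4 bounds *)

Section Bounds.
Context d (T : measurableType d) (R : realType) (mu : {measure set T -> \bar R}).
Implicit Types f g : T -> R.

(** The L2 norm of [f] is at most [A], stated without a root; membership and [0 <= A] are bundled so
    that bounds can be added and multiplied directly. *)
Definition le2 f (A : R) : Prop := [/\ L2 mu f, 0 <= A & sq mu f <= A ^+ 2].
Definition le4 f (A : R) : Prop := [/\ L4 mu f, 0 <= A & qd mu f <= A ^+ 4].

Lemma le2_weaken f A B : le2 f A -> A <= B -> le2 f B.
Proof.
move=> [lf A0 fA] AB; have B0 := le_trans A0 AB; split => //.
by apply: le_trans fA _; rewrite lerXn2r.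
Qed.

Lemma le2_dom f g A : measurable_fun setT f -> le2 g A -> (forall x, `|f x| <= `|g x|) -> le2 f A.
Proof.
move=> mf [lg A0 gA] fg; have lf := L2_dom mf lg fg; split => //.
exact: le_trans (sq_le lf lg fg) gA.
Qed.

Lemma le2_int f g A B : le2 f A -> le2 g B -> `|\int[mu]_x (f x * g x)| <= A * B.
Proof. by move=> [lf A0 fA] [lg B0 gB]; exact: CS_le_norm. Qed.

Lemma le2_integrable f g A B : le2 f A -> le2 g B ->
  mu.-integrable setT (EFin \o (fun x => f x * g x)).
Proof. by move=> [lf _ _] [lg _ _]; exact: L2_mul_integrable. Qed.

Lemma le2_add f g A B : le2 f A -> le2 g B -> le2 (fun x => f x + g x) (A + B).
Proof.
move=> hf hg; have [lf A0 fA] := hf; have [lg B0 gB] := hg.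
split; [exact: L2_add|exact: addr_ge0|].
have i1 := L2_sq_integrable lf; have i2 := L2_sq_integrable lg.
have i3 := L2_mul_integrable lf lg.
have i3' : mu.-integrable setT (EFin \o (fun x => 2 * (f x * g x))).
  by have := integrableZl measurableT 2 i3.
have i4 : mu.-integrable setT (EFin \o (fun x => f x ^+ 2 + 2 * (f x * g x))).
  by have := integrableD measurableT i1 i3'.
have -> : sq mu (fun x => f x + g x) = sq mu f + 2 * (\int[mu]_x (f x * g x)) + sq mu g.
  rewrite /sq -RintegralZl// -RintegralD// -RintegralD//.
  by congr Rintegral; apply/funext => x; ring.
have := le2_int hf hg; move: (\int[mu]_x _) => I; rewrite ler_norml => /andP[_ h].
clear -fA gB h; nra.
Qed.

Lemma le2_scale f A k : le2 f A -> le2 (fun x => k * f x) (`|k| * A).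
Proof.
move=> [lf A0 fA]; split; [exact: L2_scale|exact: mulr_ge0|].
by rewrite sq_scale// exprMn real_normK ?num_real// ler_wpM2l// sqr_ge0.
Qed.

Lemma le2_opp f A : le2 f A -> le2 (fun x => - f x) A.
Proof.
by move=> h; have := le2_scale (-1) h; rewrite normrN1 mul1r; under eq_fun do rewrite mulN1r.
Qed.

Lemma le2_sub f g A B : le2 f A -> le2 g B -> le2 (fun x => f x - g x) (A + B).
Proof. by move=> hf hg; apply: le2_add => //; exact: le2_opp. Qed.

Lemma le2_bmul (b : T -> R) M f A : 0 <= M -> measurable_fun setT b -> (forall x, `|b x| <= M) ->
  le2 f A -> le2 (fun x => b x * f x) (M * A).
Proof.
move=> M0 mb bM [lf A0 fA]; split; [exact: L2_bmul bM lf|exact: mulr_ge0|].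
by apply: le_trans (sq_bmul mb bM lf) _; rewrite exprMn ler_wpM2l// sqr_ge0.
Qed.

Lemma le2_zero : le2 (fun=> 0) 0.
Proof.
split => //; last by rewrite /sq expr0n/= Rintegral_cst// mul0r.
split => //; rewrite (_ : (fun _ : T => _) = cst 0%E) ?integral0//.
by apply/funext => x; rewrite expr0n.
Qed.

Lemma le2_sum (I : Type) (r : seq I) (F : I -> T -> R) (A : I -> R) :
  (forall k, le2 (F k) (A k)) -> le2 (fun x => \sum_(k <- r) F k x) (\sum_(k <- r) A k).
Proof.
move=> h; elim: r => [|k r IH].
  by rewrite big_nil; under eq_fun do rewrite big_nil; exact: le2_zero.
by rewrite big_cons; under eq_fun do rewrite big_cons; exact: le2_add.
Qed.

Lemma le2_sum3 (F : 'I_3 -> T -> R) A : (forall k, le2 (F k) A) ->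
  le2 (fun x => \sum_(k < 3) F k x) (3 * A).
Proof.
move=> h; have := le2_sum (index_enum 'I_3) h.
by rewrite (_ : \sum_(k <- _) A = 3 * A)// !big_ord_recl big_ord0; ring.
Qed.

Lemma le4_weaken f A B : le4 f A -> A <= B -> le4 f B.
Proof.
move=> [lf A0 fA] AB; have B0 := le_trans A0 AB; split => //.
by apply: le_trans fA _; rewrite lerXn2r.
Qed.

Lemma le4_dom f g A : measurable_fun setT f -> le4 g A -> (forall x, `|f x| <= `|g x|) -> le4 f A.
Proof.
move=> mf [lg A0 gA] fg; have lf := L4_dom mf lg fg; split => //.
exact: le_trans (qd_le lf lg fg) gA.
Qed.

Lemma le4_mul f g A B : le4 f A -> le4 g B -> le2 (fun x => f x * g x) (A * B).
Proof.
move=> [lf A0 fA] [lg B0 gB]; split; [exact: L4_mul|exact: mulr_ge0|exact: sq_mul_le].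
Qed.

Lemma le4_scale f A k : le4 f A -> le4 (fun x => k * f x) (`|k| * A).
Proof.
move=> [lf A0 fA]; split; [exact: L4_scale|exact: mulr_ge0|].
rewrite /qd; have -> : (fun x => (k * f x) ^+ 2) = (fun x => k ^+ 2 * (f x ^+ 2)).
  by apply/funext => x; rewrite exprMn.
have [_ lf2] := lf; rewrite sq_scale// [leRHS]exprMn.
have -> : `|k| ^+ 4 = (k ^+ 2) ^+ 2.
  by rewrite -exprM (_ : 4%N = (2 * 2)%N)// exprM real_normK ?num_real// -exprM.
by rewrite ler_wpM2l// sqr_ge0.
Qed.

(** The factor 2 is the price of [(a + b) ^ 4 <= 8 a ^ 4 + 8 b ^ 4] in place of the triangle
    inequality of L4. *)
Lemma le4_add f g A B : le4 f A -> le4 g B -> le4 (fun x => f x + g x) (2 * (A + B)).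
Proof.
move=> [lf A0 fA] [lg B0 gB]; split; [exact: L4_add|by rewrite mulr_ge0// addr_ge0|].
apply: le_trans (qd_add lf lg) _.
have AB := addr_ge0 A0 B0.
have h1 : A ^+ 4 <= (A + B) ^+ 4 by rewrite lerXn2r// lerDl.
have h2 : B ^+ 4 <= (A + B) ^+ 4 by rewrite lerXn2r// lerDr.
rewrite exprMn; move: ((A + B) ^+ 4) h1 h2 => X h1 h2.
have -> : (2 : R) ^+ 4 = 16 by ring.
clear -fA gB h1 h2; lra.
Qed.

Lemma le4_bmul (b : T -> R) M f A : 0 <= M -> measurable_fun setT b -> (forall x, `|b x| <= M) ->
  le4 f A -> le4 (fun x => b x * f x) (M * A).
Proof.
move=> M0 mb bM hf; have := le4_scale M hf; rewrite ger0_norm// => h.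
apply: le4_dom h _ => [|x]; first by apply: measurable_funM => //; have [[]] := hf.
by rewrite !normrM ler_wpM2r// (le_trans (bM x))// ler_norm.
Qed.

Lemma minn_lip (a b N : R) : `|Num.min a N - Num.min b N| <= `|a - b|.
Proof.
case: (leP a N) => h1; case: (leP b N) => h2; rewrite ?subrr ?normr0//.
- rewrite !ler0_norm ?opprB; lra.
- rewrite !ger0_norm ; lra.
Qed.

Lemma trunc_sqr_lip (a b N : R) : 0 <= N ->
  `|Num.min `|a| N ^+ 2 - Num.min `|b| N ^+ 2| <= 2 * N * `|a - b|.
Proof.
move=> N0; rewrite subr_sqr normrM mulrC; apply: ler_pM => //.
  have pos (c : R) : 0 <= Num.min `|c| N by rewrite le_min normr_ge0.
  have leN (c : R) : Num.min `|c| N <= N by rewrite ge_min lexx orbT.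
  by rewrite ger0_norm ?addr_ge0//; have := leN a; have := leN b; lra.
apply: le_trans (minn_lip _ _ _) _; exact: ler_dist_dist.
Qed.

(* Truncation at height [N] turns L2-closeness into L2-closeness of the
   squares, so the L4 bound passes to the limit before [N] is sent to infinity. *)
Lemma le4_lim f C : measurable_fun setT f -> 0 <= C ->
  (forall e, 0 < e -> exists g, le4 g C /\ le2 (fun x => f x - g x) e) -> le4 f C.
Proof.
move=> mf C0 h.
pose t N (g : T -> R) x := Num.min `|g x| N ^+ 2.
have mt N g : measurable_fun setT g -> measurable_fun setT (t N g).
  move=> mg; apply: measurable_funX; apply: measurable_minr => //; exact: measurableT_comp.
have tle N x (g : T -> R) : 0 <= N -> `|t N g x| <= `|g x ^+ 2|.
  move=> N0; rewrite !ger0_norm ?sqr_ge0// -[leRHS]real_normK ?num_real//.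
  by rewrite lerXn2r ?nnegrE ?le_min ?normr_ge0// ge_min lexx.
have key N : 0 <= N -> le2 (t N f) (C ^+ 2).
  move=> N0.
  have key2 e : 0 < e -> le2 (t N f) (C ^+ 2 + 2 * N * e).
    move=> e0; have [g [g4 ge]] := h e e0.
    have [[mg lg2] _ gC] := g4.
    have tg : le2 (t N g) (C ^+ 2).
      apply: (@le2_dom _ (fun x => g x ^+ 2)); [exact: mt| |by move=> x; exact: tle].
      by split; [by []|exact: sqr_ge0|rewrite -exprM].
    have td : le2 (fun x => t N f x - t N g x) (2 * N * e).
      have := le2_scale (2 * N) ge; rewrite ger0_norm ?mulr_ge0// => hh.
      apply: le2_dom hh _ => [|x]; first by apply: measurable_funB; exact: mt.
      by rewrite normrM (@ger0_norm _ (2 * N)) ?mulr_ge0//; exact: trunc_sqr_lip.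
    have := le2_add tg td.
    by under eq_fun do rewrite addrC subrK.
  have [l _ _] := key2 1 ltr01; split; [by []|exact: sqr_ge0|].
  apply/ler_addgt0Pr => e e0.
  pose K := 2 * N; have K0 : 0 <= K by rewrite mulr_ge0.
  pose D := K * (2 * C ^+ 2 + K) + 1.
  have D0 : 0 < D by rewrite ltr_wpDl// mulr_ge0// addr_ge0// mulr_ge0// sqr_ge0.
  pose w := Num.min 1 (e / D).
  have w0 : 0 < w by rewrite lt_min ltr01 divr_gt0.
  have [_ _ hw] := key2 w w0; apply: le_trans hw _.
  have -> : (C ^+ 2 + 2 * N * w) ^+ 2 = (C ^+ 2) ^+ 2 + (w * (K * (2 * C ^+ 2)) + (K * w) ^+ 2).
    by rewrite /K; ring.
  rewrite lerD2l.
  have w1 : w <= 1 by rewrite ge_min lexx.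
  have wD : w * D <= e by rewrite -ler_pdivlMr// ge_min lexx orbT.
  apply: le_trans wD; rewrite /D -/K.
  have C2 : 0 <= C ^+ 2 by rewrite sqr_ge0.
  have k1 : (K * w) ^+ 2 <= w * (K * K).
    have -> : (K * w) ^+ 2 = w * (w * (K * K)) by ring.
    by rewrite ler_wpM2l ?(ltW w0)// ler_piMl// mulr_ge0.
  clear -k1 w0; nra.
suff E : (\int[mu]_x ((f x ^+ 2) ^+ 2)%:E <= ((C ^+ 2) ^+ 2)%:E)%E.
  have l2 : L2 mu (fun x => f x ^+ 2).
    by split; [exact: measurable_funX|exact: le_lt_trans E (ltry _)].
  by split => //; rewrite (exprM C 2 2) -lee_fin /qd -sqE.
have cv x : (fun n : nat => ((t n%:R f x) ^+ 2)%:E) @ \oo --> ((f x ^+ 2) ^+ 2)%:E.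
  apply: cvg_near_cst; near=> n; congr (_%:E); congr (_ ^+ 2).
  rewrite /t min_l ?real_normK ?num_real//.
  near: n; exact: nbhs_infty_ger.
have mm n : measurable_fun setT (fun x => ((t n%:R f x) ^+ 2)%:E).
  by apply: measurable_sqE; exact: mt.
have cvi := @cvg_monotone_convergence _ _ _ mu setT measurableT (fun n x => ((t n%:R f x) ^+ 2)%:E) mm _ _.
have {}cvi : (\int[mu]_x ((t n%:R f x) ^+ 2)%:E)%E @[n --> \oo] -->
    (\int[mu]_x limn (fun n : nat => ((t n%:R f x) ^+ 2)%:E))%E.
  apply: cvi => [n x _|x _ m n mn]; first by rewrite lee_fin sqr_ge0.
  rewrite lee_fin; apply: lerXn2r; rewrite ?nnegrE ?sqr_ge0//.
  have pos k : 0 <= Num.min `|f x| k%:R by rewrite le_min normr_ge0/=.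
  apply: lerXn2r; rewrite ?nnegrE ?pos//.
  have : (m%:R : R) <= n%:R by rewrite ler_nat.
  by case: (leP `|f x| m%:R); case: (leP `|f x| n%:R) => // ? ? ?; lra.
have -> : (\int[mu]_x ((f x ^+ 2) ^+ 2)%:E =
   limn (fun n : nat => \int[mu]_x ((t n%:R f x) ^+ 2)%:E))%E.
  apply/esym/cvg_lim => //; rewrite (eq_integral (fun x => limn (fun n : nat => ((t n%:R f x) ^+ 2)%:E))).
    exact: cvi.
  by move=> x _; apply/esym/cvg_lim => //; exact: cv.
apply: lime_le; first by apply/cvg_ex; eexists; exact: cvi.
by apply: nearW => n; have [l _ hl] := key n%:R (ler0n _ _); rewrite sqE// lee_fin.
Unshelve. all: by end_near.
Qed.

End Bounds.

(** * Smooth solenoidal approximation *)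

Section RealIntegral.
Context d (T : measurableType d) (R : realType) (mu : {measure set T -> \bar R}).
Implicit Types f g : T -> R.

Definition itg f : Prop := mu.-integrable setT (EFin \o f).

Lemma itg_scale k f : itg f -> itg (fun x => k * f x).
Proof. by move=> h; have := integrableZl measurableT k h. Qed.

Lemma itg_add f g : itg f -> itg g -> itg (fun x => f x + g x).
Proof. by move=> h1 h2; have := integrableD measurableT h1 h2. Qed.

Lemma itg_opp f : itg f -> itg (fun x => - f x).
Proof. by move=> h; have := itg_scale (-1) h; under eq_fun do rewrite mulN1r. Qed.

Lemma itg_sub f g : itg f -> itg g -> itg (fun x => f x - g x).
Proof. by move=> h1 h2; apply: itg_add => //; exact: itg_opp. Qed.

Lemma itg_zero : itg (fun=> 0).
Proof. by apply: (integrable0 mu setT). Qed.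

Lemma itg_sum (I : Type) (r : seq I) (F : I -> T -> R) : (forall k, itg (F k)) ->
  itg (fun x => \sum_(k <- r) F k x).
Proof.
move=> h; elim: r => [|k r IH].
  by under eq_fun do rewrite big_nil; exact: itg_zero.
by under eq_fun do rewrite big_cons; exact: itg_add.
Qed.

Lemma int_opp f : itg f -> \int[mu]_x (- f x) = - \int[mu]_x f x.
Proof.
move=> h; rewrite -mulN1r -RintegralZl//.
by congr Rintegral; apply/funext => x; rewrite mulN1r.
Qed.

Lemma int_add f g : itg f -> itg g -> \int[mu]_x (f x + g x) = \int[mu]_x f x + \int[mu]_x g x.
Proof. by move=> h1 h2; rewrite RintegralD. Qed.

Lemma int_sub f g : itg f -> itg g -> \int[mu]_x (f x - g x) = \int[mu]_x f x - \int[mu]_x g x.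
Proof. by move=> h1 h2; rewrite RintegralB. Qed.

Lemma int_scale k f : itg f -> \int[mu]_x (k * f x) = k * \int[mu]_x f x.
Proof. by move=> h; rewrite RintegralZl. Qed.

Lemma int_sum (I : Type) (r : seq I) (F : I -> T -> R) : (forall k, itg (F k)) ->
  \int[mu]_x (\sum_(k <- r) F k x) = \sum_(k <- r) \int[mu]_x F k x.
Proof.
move=> h; elim: r => [|k r IH].
  rewrite big_nil (_ : (fun x => _) = fun=> 0); first by rewrite Rintegral_cst// mul0r.
  by apply/funext => x; rewrite big_nil.
rewrite big_cons -IH -int_add//; last exact: itg_sum.
by congr Rintegral; apply/funext => x; rewrite big_cons.
Qed.

End RealIntegral.

Section Approximation.
Variable R : realType.
Local Notation mu := (@leb3 R).
Local Notation e_ i := (unit_vector R i).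

Definition cutb (a : R) (f : R3 R -> R) : T3 R -> R := fun x => \1_(bx a a) x * f x.

Definition loc2 (f : R3 R -> R) : Prop :=
  measurable_fun setT (f : T3 R -> R) /\ forall a, L2 mu (cutb a f).

Lemma cutb_in a f x : bx a a x -> cutb a f x = f x.
Proof. by move=> h; rewrite /cutb indicE mem_set// mul1r. Qed.

Lemma cutb_support a f x : cutb a f x != 0 -> bx a a x.
Proof.
rewrite /cutb indicE; case: (boolP (x \in _)) => [|_]; first by rewrite inE.
by rewrite mul0r eqxx.
Qed.

Lemma cutb_itg a f : loc2 f -> itg mu (cutb a f).
Proof.
move=> [_ hf].
have l1 : L2 mu (\1_(bx a a) : T3 R -> R).
  apply: L2_indic; first exact: bx_measurable.
  by have := Q_fin a a measurableT; rewrite setTI.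
rewrite /itg (_ : cutb a f = fun x => \1_(bx a a) x * cutb a f x); first exact: L2_mul_integrable.
by apply/funext => x; rewrite /cutb mulrA -expr2 indic_sqr.
Qed.

Lemma cutb_tcont a f : 0 <= a -> loc2 f -> tcont (cutb a f).
Proof.
move=> a0 [_ hf]; apply: (@tcont_L2 _ (a + 1)) => // x /cutb_support[h1 h2 h3].
by split; lra.
Qed.

Lemma tcont_common (I : finType) (F : I -> T3 R -> R) (e : R) : (forall i, tcont (F i)) -> 0 < e ->
  exists t, [/\ 0 < t, t <= 1 & forall i z, bx t t z -> (osc (F i) z <= e%:E)%E].
Proof.
move=> hF e0.
have /choice[t ht] i : exists t, 0 < t /\ forall z, bx t t z -> (osc (F i) z <= e%:E)%E.
  by have [t t0 h] := hF i e e0; exists t.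
exists (\big[Num.min/1]_i t i); split.
- by apply: lt_bigmin => // i _; exact: (ht i).1.
- exact: bigmin_le_id.
- move=> i z hz; apply: (ht i).2; apply: bx_sub hz; exact: bigmin_le.
Qed.

(** This sign turns a derivative of the kernel [moll t (x - y)] in [x] into minus its derivative in
    [y], as in the definition of a weak derivative. *)
Lemma partial_even (f : R3 R -> R) i x : smooth f -> (forall y, f (- y) = f y) ->
  partial i f (- x) = - partial i f x.
Proof.
move=> sf ef.
have d1 := line_is_derive (smooth_derivable (i := i) (x := - x + 0 *: e_ i) sf).
have d2 : is_derive (- 0 : R) (1 : R) (fun t => f (x + t *: e_ i)) (partial i f x).
  have := line_is_derive (smooth_derivable (i := i) (x := x + (- 0) *: e_ i) sf).
  by rewrite oppr0 scale0r addr0.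
have d3 : is_derive (0 : R) (1 : R) (fun t => - t) (-1).
  exact: (is_deriveN (is_derive_id _ _)).
have d4 := @is_derive1_comp R (fun t => f (x + t *: e_ i)) (fun t => - t) 0 _ _ d2 d3.
have E : (fun t => f (- x + t *: e_ i)) = ((fun t => f (x + t *: e_ i)) \o (fun t => - t)).
  by apply/funext => t /=; rewrite -ef opprD opprK scaleNr.
rewrite E scale0r addr0 in d1.
have := @derive_val _ _ _ _ _ _ _ d1; rewrite (@derive_val _ _ _ _ _ _ _ d4) => <-.
by rewrite /GRing.scale/= mulrN1.
Qed.

Lemma mol_support t (f : R3 R -> R) x : 0 < t -> mol t f x != 0 -> exists y, f y != 0 /\ bx t t (x - y).
Proof.
move=> t0 nz; apply: contrapT => hn; move: nz; rewrite /mol.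
rewrite (_ : (fun y => _) = fun=> 0); first by rewrite Rintegral_cst// mul0r eqxx.
apply/funext => y; have [->|fy] := eqVneq (f y) 0; first by rewrite mul0r.
have [->|my] := eqVneq (moll t (x + - y)) 0; first by rewrite mulr0.
by exfalso; apply: hn; exists y; split => //; exact: moll_support my.
Qed.

Section Weak.
Variables (a b t : R).
Hypothesis t0 : 0 < t.
Hypothesis abt : b + t <= a.
Variable x : R3 R.
Hypothesis xb : bx b b x.

(** As a function of [y], the mollifier centred at [x] is a test function to which weak derivatives
    and the divergence condition apply. By [abt] and [xb] it lives in the cube where [cutb a f]
    coincides with [f], so the truncation is not felt at [x]. *)
Definition tmoll (y : R3 R) : R := moll t (y - x).

Lemma tmoll_test : test_function tmoll.
Proof.
apply: (@test_translate _ (moll t) (- x)); apply: bx_test (moll_smooth t) _.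
by move=> y; exact: moll_support.
Qed.

Lemma tmollE y : moll t (x + - y) = tmoll y.
Proof. by rewrite -moll_even opprD opprK addrC. Qed.

Lemma partial_tmoll i y : partial i (moll t) (x + - y) = - partial i tmoll y.
Proof.
rewrite /tmoll partial_translate -(partial_even i (y - x) (moll_smooth t)).
  by rewrite opprB.
exact: moll_even.
Qed.

Lemma near_x y : bx t t (y - x) -> bx a a y.
Proof.
have k (p q : R) : `|q| <= b -> `|p - q| <= t -> `|p| <= a.
  by move=> h1 h2; have := ler_normD (p - q) q; rewrite subrK; have := abt; lra.
case: xb => ? ? ? [? ? ?]; split.
- exact: (k _ x.1.1).
- exact: (k _ x.1.2).
- exact: (k _ x.2).
Qed.

Lemma cutb_mul (f g : R3 R -> R) y : (g y != 0 -> bx t t (y - x)) -> cutb a f y * g y = f y * g y.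
Proof.
move=> h; have [->|gy] := eqVneq (g y) 0; first by rewrite !mulr0.
by rewrite cutb_in//; apply: near_x; exact: h.
Qed.

Lemma tmoll_near y : tmoll y != 0 -> bx t t (y - x).
Proof. exact: moll_support. Qed.

Lemma partial_tmoll_near i y : partial i tmoll y != 0 -> bx t t (y - x).
Proof.
rewrite /tmoll partial_translate => h; apply: partial_support h.
by move=> z; exact: moll_support.
Qed.

Lemma partial_tmoll_itg i f : loc2 f -> itg mu (fun y => f y * partial i tmoll y).
Proof.
move=> [_ lf]; rewrite /itg.
rewrite (_ : (fun y => _) = fun y => cutb a f y * partial i tmoll y); last first.
  by apply/funext => y; rewrite cutb_mul//; exact: partial_tmoll_near.
apply: L2_mul_integrable; first exact: lf.
by apply: test_L2; apply: test_partial; exact: tmoll_test.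
Qed.

Lemma partial_mol_cutb i f : loc2 f ->
  partial i (mol t (cutb a f)) x = - \int[mu]_y (f y * partial i tmoll y).
Proof.
move=> lf; rewrite partial_mol//; last exact: cutb_itg.
rewrite -int_opp; last exact: partial_tmoll_itg.
congr Rintegral; apply/funext => y; rewrite partial_tmoll -mulrN.
by rewrite (@cutb_mul f (fun y => - partial i tmoll y))// oppr_eq0; exact: partial_tmoll_near.
Qed.

Lemma mol_cutb f : mol t (cutb a f) x = \int[mu]_y (f y * tmoll y).
Proof.
by congr Rintegral; apply/funext => y; rewrite tmollE cutb_mul//; exact: tmoll_near.
Qed.

Lemma mol_weak_partial i f Df : loc2 f -> weak_partial i f Df ->
  partial i (mol t (cutb a f)) x = mol t (cutb a Df) x.
Proof.
by move=> lf wf; rewrite partial_mol_cutb// (wf _ tmoll_test) opprK mol_cutb.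
Qed.

Lemma mol_divergence (u : 'I_3 -> R3 R -> R) : (forall k, loc2 (u k)) -> divergence_free u ->
  \sum_(k < 3) partial k (mol t (cutb a (u k))) x = 0.
Proof.
move=> lu du; rewrite (eq_bigr _ (fun k _ => partial_mol_cutb k (lu k))).
rewrite sumrN -int_sum; last by move=> k; exact: partial_tmoll_itg.
by rewrite (du _ tmoll_test) oppr0.
Qed.

End Weak.

Variables (u : 'I_3 -> R3 R -> R) (Du : 'I_3 -> 'I_3 -> R3 R -> R) (R0 : R).
Hypothesis lu : forall k, loc2 (u k).
Hypothesis lDu : forall k j, loc2 (Du k j).
Hypothesis wu : forall k j, weak_partial j (u k) (Du k j).
Hypothesis du : divergence_free u.
Hypothesis u0 : forall k (x : R3 R), R0 < `|x.2| -> u k x = 0.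
Hypothesis R00 : 0 < R0.

(** Truncation to the cube of half-side [b + 1] makes the mollified field compactly supported. Its
    effect is confined to distance [t <= 1] from the faces of that cube, which is why everything is
    asserted over half-side [b]; continuity of translations makes the errors at most [e]. *)
Lemma approximation (b e : R) : R0 + 1 <= b -> 0 < e ->
  exists U : 'I_3 -> R3 R -> R,
  [/\ forall k, test_function (U k),
      forall k x, U k x != 0 -> `|x.2| <= R0 + 1,
      forall x : R3 R, `|x.1.1| <= b -> `|x.1.2| <= b -> \sum_(k < 3) partial k (U k) x = 0,
      forall k, le2 mu (cutb b (fun x => U k x - u k x)) e &
      forall k j, le2 mu (cutb b (fun x => partial j (U k) x - Du k j x)) e].
Proof.
move=> Rb e0; pose a := b + 1.
have a0 : 0 <= a by rewrite /a; have := R00; lra.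
have e20 : 0 < e ^+ 2 by rewrite exprn_gt0.
have [t1 [t10 t11 h1]] := tcont_common (fun k => cutb_tcont a0 (lu k)) e20.
have [t2 [t20 t21 h2]] := tcont_common (fun kj : 'I_3 * 'I_3 => cutb_tcont a0 (lDu kj.1 kj.2)) e20.
pose t := Num.min t1 t2.
have t0 : 0 < t by rewrite lt_min t10.
have tt1 : t <= 1 by rewrite ge_min t11.
have abt : b + t <= a by rewrite /a lerD2l.
have c1 k : sq mu (fun x => mol t (cutb a (u k)) x - cutb a (u k) x) <= e ^+ 2.
  apply: mol_close => //; first exact: (lu k).2.
  by move=> z hz; apply: h1; apply: bx_sub hz; rewrite ge_min lexx.
have c2 k j : sq mu (fun x => mol t (cutb a (Du k j)) x - cutb a (Du k j) x) <= e ^+ 2.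
  apply: mol_close => //; first exact: (lDu k j).2.
  by move=> z hz; apply: (h2 (k, j)); apply: bx_sub hz; rewrite ge_min lexx orbT.
have tU k : test_function (mol t (cutb a (u k))).
  apply: (@bx_test _ _ (a + t)); first by apply: mol_smooth => //; exact: cutb_itg.
  move=> x /(mol_support t0)[y [/cutb_support hy hxy]].
  have K (p q : R) : `|q| <= a -> `|p - q| <= t -> `|p| <= a + t.
    by move=> k1 k2; have := ler_normD (p - q) q; rewrite subrK; lra.
  case: hy hxy => ? ? ? [? ? ?]; split.
  - exact: (K _ y.1.1).
  - exact: (K _ y.1.2).
  - exact: (K _ y.2).
have vU k x : mol t (cutb a (u k)) x != 0 -> `|x.2| <= R0 + 1.
  move=> /(mol_support t0)[y [hy [_ _ h3]]].
  have y2 : `|y.2| <= R0.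
    by rewrite leNgt; apply/negP => /(u0 k) h; move: hy; rewrite /cutb h mulr0 eqxx.
  by have := ler_normD (x.2 - y.2) y.2; rewrite subrK; move: h3; rewrite /=; lra.
have wk A C D : L2 mu A -> L2 mu C -> measurable_fun setT (D : T3 R -> R) ->
    (forall x, bx b b x -> D x = A x - C x) -> sq mu (fun x => A x - C x) <= e ^+ 2 ->
    le2 mu (cutb b D) e.
  move=> lA lC mD hD hs; apply: (@le2_dom _ _ _ _ _ (fun x => A x - C x)).
  - by apply: measurable_funM => //; exact: measurable_indic (bx_measurable _ _).
  - by split; [exact: L2_sub|exact: ltW|].
  - move=> x; have [D0|nz] := eqVneq (cutb b D x) 0; first by rewrite D0 normr0.
    by have hx := cutb_support nz; rewrite cutb_in// hD.
exists (fun k => mol t (cutb a (u k))); split => //.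
(* The divergence is needed at all heights: above [b], which is at least [R0 + 1], the fields [U k]
   and their derivatives vanish. *)
- move=> x x1 x2; have [x3|x3] := leP `|x.2| b.
    exact: (mol_divergence t0 abt (And3 x1 x2 x3)).
  rewrite big1// => k _; apply/eqP; apply: contraT => nz.
  have [N [_ hN]] := test_bx (tU k).
  have : bx N (R0 + 1) x.
    apply: partial_support nz => y hy; split.
    - by case: (hN y hy).
    - by case: (hN y hy).
    - exact: vU hy.
  by case=> _ _; lra.
- move=> k; apply: (wk (mol t (cutb a (u k))) (cutb a (u k))) => //.
  + exact: test_L2.
  + exact: (lu k).2.
  + by apply: measurable_funB; [exact: test_measurable|exact: (lu k).1].
  + move=> x hx; rewrite (@cutb_in a)//; apply: bx_sub hx; rewrite /a; lra.
- move=> k j; apply: (wk (mol t (cutb a (Du k j))) (cutb a (Du k j))) => //.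
  + by apply: (mol_L2 t0 _).1; exact: (lDu k j).2.
  + exact: (lDu k j).2.
  + apply: measurable_funB; last exact: (lDu k j).1.
    by apply: test_measurable; apply: test_partial.
  + move=> x hx; rewrite (@cutb_in a); last by apply: bx_sub hx; rewrite /a; lra.
    by congr (_ - _); exact: (mol_weak_partial t0 abt hx (lu k) (wu k j)).
Qed.

End Approximation.

(** * Solenoidal correction of cut-off fields *)

Section Cutoff.
Variable R : realType.
Local Notation mu := (@leb3 R).
Local Notation e_ i := (unit_vector R i).
Local Notation i1 := (inord 1 : 'I_3).
Local Notation i2 := (inord 2 : 'I_3).

Lemma I3_cases (k : 'I_3) : [\/ k = ord0, k = i1 | k = i2].
Proof.
case: k => -[|[|[|//]]] hk; [apply: Or31|apply: Or32|apply: Or33]; apply: val_inj => //=;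
  by rewrite inordK.
Qed.

Lemma sum3E (V : nmodType) (F : 'I_3 -> V) : \sum_(k < 3) F k = F ord0 + F i1 + F i2.
Proof.
rewrite !big_ord_recl big_ord0 addr0 addrA; congr (_ + F _ + F _); apply: val_inj;
  by rewrite /= inordK.
Qed.

(** Only the horizontal variables are cut off; vertical confinement is inherited from the field it
    multiplies. *)
Definition hcut (s d : R) (x : R3 R) : R := cut1 s d (coord3 ord0 x) * cut1 s d (coord3 i1 x).

Lemma coord3_i0 (x : R3 R) : coord3 ord0 x = x.1.1. Proof. by []. Qed.
Lemma coord3_i1 (x : R3 R) : coord3 i1 x = x.1.2. Proof. by rewrite /coord3 inordK. Qed.
Lemma coord3_i2 (x : R3 R) : coord3 i2 x = x.2. Proof. by rewrite /coord3 inordK. Qed.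

Lemma cut1_coord_smooth (s d : R) i : smooth (fun x : R3 R => cut1 s d (coord3 i x)).
Proof. by apply/smoothP => n; apply: Cn_coord; exact: cut1_C1n. Qed.

Lemma hcut_smooth (s d : R) : smooth (hcut s d).
Proof. by apply: smooth_mul; exact: cut1_coord_smooth. Qed.

Lemma hcut_ge0 (s d : R) x : 0 <= hcut s d x.
Proof. by apply: mulr_ge0; exact: cut1_ge0. Qed.

Lemma hcut_le1 (s d : R) x : hcut s d x <= 1.
Proof. by apply: mulr_ile1; rewrite ?cut1_ge0 ?cut1_le1. Qed.

Lemma hcut_norm (s d : R) x : `|hcut s d x| <= 1.
Proof. by rewrite ger0_norm ?hcut_ge0 ?hcut_le1. Qed.

Lemma hcut_eq1 (s d : R) x : 0 < d -> `|x.1.1| <= s -> `|x.1.2| <= s -> hcut s d x = 1.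
Proof. by move=> d0 h1 h2; rewrite /hcut coord3_i0 coord3_i1 !cut1_eq1// mulr1. Qed.

Lemma hcut_neq0 (s d : R) x : 0 < d -> hcut s d x != 0 -> `|x.1.1| <= s + d /\ `|x.1.2| <= s + d.
Proof.
move=> d0; rewrite /hcut coord3_i0 coord3_i1 mulf_eq0 negb_or => /andP[h1 h2].
split; rewrite leNgt; apply/negP => /ltW h; [move: h1|move: h2]; by rewrite cut1_eq0// eqxx.
Qed.

Lemma partial_cut1 (s d : R) i j :
  partial j (fun x : R3 R => cut1 s d (coord3 i x)) = fun x => (i == j)%:R * derive1 (cut1 s d) (coord3 i x).
Proof.
apply/funext => x; apply: (@derive_val _ _ _ _ _ _ _ (is_derive_coord j _)).
by case: (C1n_is_derive (coord3 i x) (@cut1_C1n R s d 1)).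
Qed.

Lemma partial_hcut (s d : R) j : partial j (hcut s d) = fun x =>
  cut1 s d (coord3 ord0 x) * ((i1 == j)%:R * derive1 (cut1 s d) (coord3 i1 x)) +
  cut1 s d (coord3 i1 x) * ((ord0 == j)%:R * derive1 (cut1 s d) (coord3 ord0 x)).
Proof.
rewrite (partial_mul j (cut1_coord_smooth s d ord0) (cut1_coord_smooth s d i1)).
by rewrite !partial_cut1.
Qed.

Lemma dcut1_coord_smooth (s d : R) i : smooth (fun x : R3 R => derive1 (cut1 s d) (coord3 i x)).
Proof. by apply/smoothP => n; apply: Cn_coord; apply: C1n_derive1; exact: cut1_C1n. Qed.

Lemma partial_dcut1 (s d : R) i j :
  partial j (fun x : R3 R => derive1 (cut1 s d) (coord3 i x)) =
  fun x => (i == j)%:R * derive1 (derive1 (cut1 s d)) (coord3 i x).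
Proof.
apply/funext => x; apply: (@derive_val _ _ _ _ _ _ _ (is_derive_coord j _)).
by case: (C1n_is_derive (coord3 i x) (C1n_derive1 (@cut1_C1n R s d 2))).
Qed.

Lemma partial_cut_dcut (s d b : R) i k l :
  partial i (fun x => cut1 s d (coord3 k x) * (b * derive1 (cut1 s d) (coord3 l x))) =
  fun x => cut1 s d (coord3 k x) * (b * ((l == i)%:R * derive1 (derive1 (cut1 s d)) (coord3 l x))) +
    (b * derive1 (cut1 s d) (coord3 l x)) * ((k == i)%:R * derive1 (cut1 s d) (coord3 k x)).
Proof.
have sb := smooth_mul (smooth_cst b) (dcut1_coord_smooth s d l).
rewrite (partial_mul i (cut1_coord_smooth s d k) sb) partial_cut1; apply/funext => x.
by rewrite (partial_mul i (smooth_cst b) (dcut1_coord_smooth s d l)) partial_cst partial_dcut1 mulr0 addr0.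
Qed.

Lemma partial_hcut_support (s d : R) j x : 0 < d -> partial j (hcut s d) x != 0 ->
  `|x.1.1| <= s + d /\ `|x.1.2| <= s + d.
Proof.
move=> d0; rewrite partial_hcut coord3_i0 coord3_i1 derive1_cut1 => h.
split; rewrite leNgt; apply/negP => /ltW k; move: h;
  by rewrite (cut1_eq0 d0 k) (dcut1_eq0' d0 k) !mulr0 !mul0r ?addr0 ?add0r eqxx.
Qed.

Lemma hcut_bounds : exists C : R, 1 <= C /\ forall s d, 0 < d ->
  (forall j x, `|partial j (hcut s d) x| <= C / d) /\
  (forall i j x, `|partial i (partial j (hcut s d)) x| <= C / d ^+ 2).
Proof.
have [C [C1 hC]] := cut1_bounds R.
have C0 : 0 <= C by apply: le_trans C1.
exists (4 * C ^+ 2); split; first by nra.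
move=> s d d0.
have cb i (x : R3 R) : `|cut1 s d (coord3 i x)| <= 1 by rewrite ger0_norm ?cut1_ge0 ?cut1_le1.
have d1 i (x : R3 R) := (hC s d d0 (coord3 i x)).1.
have d2 i (x : R3 R) := (hC s d d0 (coord3 i x)).2.
have bn (b : bool) : `|b%:R : R| <= 1 by case: b; rewrite ?normr1 ?normr0.
have Cd : 0 <= C / d by rewrite divr_ge0// ltW.
have Cd2 : 0 <= C / d ^+ 2 by rewrite divr_ge0// sqr_ge0.
have mm (b : bool) (p q P Q : R) : `|p| <= P -> `|q| <= Q -> `|p * (b%:R * q)| <= P * Q.
  move=> h1 h2; rewrite normrM; apply: ler_pM => //; rewrite normrM.
  by rewrite -[Q]mul1r; apply: ler_pM.
split=> [j x|i j x].
  rewrite partial_hcut; apply: le_trans (ler_normD _ _) _.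
  apply: le_trans (lerD (mm _ _ _ _ _ (cb _ _) (d1 _ _)) (mm _ _ _ _ _ (cb _ _) (d1 _ _))) _.
  rewrite !mul1r -mulrDl ler_wpM2r ?invr_ge0 ?(ltW d0)//; nra.
rewrite partial_hcut.
have sc (b : bool) k : smooth (fun x : R3 R => b%:R * derive1 (cut1 s d) (coord3 k x)).
  by apply: smooth_mul; [exact: smooth_cst|exact: dcut1_coord_smooth].
have sm (b : bool) k l := smooth_mul (cut1_coord_smooth s d k) (sc b l).
rewrite [partial i _](partial_add i (sm (i1 == j) ord0 i1) (sm (ord0 == j) i1 ord0)) !partial_cut_dcut.
have mb (b b' : bool) k : `|b%:R * (b'%:R * derive1 (derive1 (cut1 s d)) (coord3 k x))| <= C / d ^+ 2.
  rewrite normrM -[leRHS]mul1r; apply: ler_pM => //; rewrite normrM -[leRHS]mul1r; exact: ler_pM.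
have md (b : bool) k : `|b%:R * derive1 (cut1 s d) (coord3 k x)| <= C / d.
  by rewrite normrM -[leRHS]mul1r; apply: ler_pM.
have mp (p q P Q : R) : `|p| <= P -> `|q| <= Q -> `|p * q| <= P * Q.
  by move=> h1 h2; rewrite normrM; exact: ler_pM.
apply: le_trans (ler_normD _ _) _.
apply: le_trans (lerD (ler_normD _ _) (ler_normD _ _)) _.
apply: le_trans (lerD (lerD (mp _ _ _ _ (cb _ _) (mb _ _ _)) (mp _ _ _ _ (md _ _) (md _ _)))
  (lerD (mp _ _ _ _ (cb _ _) (mb _ _ _)) (mp _ _ _ _ (md _ _) (md _ _)))) _.
have -> : C / d * (C / d) = C ^+ 2 / d ^+ 2 by rewrite expr2 expr2 invfM mulrACA.
rewrite mul1r -!mulrDl ler_wpM2r ?invr_ge0 ?sqr_ge0//; nra.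
Qed.

End Cutoff.

(** * The corrector, its divergence and its norms *)

Section Corrector.
Variable R : realType.
Local Notation mu := (@leb3 R).
Local Notation e_ i := (unit_vector R i).
Local Notation i1 := (inord 1 : 'I_3).
Local Notation i2 := (inord 2 : 'I_3).
Implicit Types f g : R3 R -> R.

Lemma avg_bx01 i h M c f a b : kern h M c -> i != i2 -> (forall x, f x != 0 -> bx a b x) ->
  forall x, avg i c f x != 0 -> bx (a + h) b x.
Proof.
move=> hc i2n hf x /(avg_support hc)[s [/andP[s0 sh] /hf]] [h1 h2 h3].
have K (p : R) (e : bool) : `|p + s *: (e%:R : R)| <= a -> `|p| <= a + h.
  move=> k; have := ler_normB (p + s *: (e%:R : R)) (s *: (e%:R : R)); rewrite addrK.
  have : `|s *: (e%:R : R)| <= h.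
    by rewrite /GRing.scale/=; case: e {k}; rewrite ?mulr1 ?mulr0 ?normr0 ?ger0_norm//; exact: le_trans sh.
  by move: k; lra.
split; [exact: K h1|exact: K h2|].
move: h3; rewrite /= (_ : (i == 2 :> nat) = false) ?scaler0 ?addr0//.
by apply/negbTE; apply: contra i2n => /eqP e; apply/eqP/val_inj; rewrite /= inordK.
Qed.

Lemma avg_bx2 h M c f a b : kern h M c -> (forall x, f x != 0 -> bx a b x) ->
  forall x, avg i2 c f x != 0 -> bx a (b + h) x.
Proof.
move=> hc hf x /(avg_support hc)[s [/andP[s0 sh] /hf]] [h1 h2 h3].
move: h1 h2 h3; rewrite /= inordK// !scaler0 !addr0 => h1 h2 h3; split => //.
have := ler_normB (x.2 + s *: (1 : R)) (s *: (1:R)); rewrite addrK.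
move: h3; rewrite /GRing.scale/= mulr1 (ger0_norm s0); lra.
Qed.

Lemma le2_avg i h M c f A : kern h M c -> test_function f -> le2 mu f A ->
  le2 mu (avg i c f) (M * h * A).
Proof.
move=> hc tf [lf A0 fA]; have [h0 M0 _ _] := hc.
split; [exact: test_L2 (test_avg hc i tf)|by rewrite !mulr_ge0// ltW|].
apply: le_trans (avg_sq hc i tf) _; rewrite [leRHS]exprMn.
by rewrite ler_wpM2l// sqr_ge0.
Qed.

Lemma le4_avg i h M c f A : kern h M c -> test_function f -> le4 mu f A ->
  le4 mu (avg i c f) (M * h * A).
Proof.
move=> hc tf [lf A0 fA]; have [h0 M0 _ _] := hc.
split; [exact: test_L4 (test_avg hc i tf)|by rewrite !mulr_ge0// ltW|].
apply: le_trans (avg_qd i hc tf) _; rewrite [leRHS]exprMn.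
by rewrite ler_wpM2l// exprn_even_ge0.
Qed.

Lemma le2_translate f a A : le2 mu f A -> le2 mu (fun x => f (x + a)) A.
Proof.
move=> [lf A0 fA]; split => //; first exact: (L2_tr3 a lf).
by have -> : sq mu (fun x => f (x + a)) = sq mu f by exact: (sq_tr3 a lf).
Qed.

Variables (h L : R).
Hypotheses (h0 : 0 < h) (L0 : 0 < L).

Let Mh : h^-1 * h = 1. Proof. by rewrite mulVf// gt_eqF. Qed.

Lemma le2_Mk i f A : test_function f -> le2 mu f A -> le2 mu (avg i (Mk h) f) A.
Proof. by move=> tf /(le2_avg i (Mk_kern h0) tf); rewrite Mh mul1r. Qed.

Lemma le4_Mk i f A : test_function f -> le4 mu f A -> le4 mu (avg i (Mk h) f) A.
Proof. by move=> tf /(le4_avg i (Mk_kern h0) tf); rewrite Mh mul1r. Qed.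

Definition corr1 g := avg ord0 (Mk h) g.
Definition corr2 g := avg i1 (Mk h) (corr1 g).

(* With [M = corr2 h] the horizontal average, the three components telescope:
   [g - M0 g], [M0 g - M g] and [M g - M g (. + L e_2)]. Only the last one, already
   averaged horizontally, is integrated over the full height [L]. *)
Definition corr (g : R3 R -> R) (k : 'I_3) : R3 R -> R :=
  if k == ord0 then avg ord0 (Kk h) g else
  if k == i1 then avg i1 (Kk h) (corr1 g) else avg i2 (Jk L) (corr2 g).

Lemma i1n0 : (i1 == ord0) = false. Proof. by rewrite -val_eqE /= inordK. Qed.
Lemma i2n0 : (i2 == ord0) = false. Proof. by rewrite -val_eqE /= inordK. Qed.
Lemma i2n1 : (i2 == i1) = false. Proof. by rewrite -val_eqE /= !inordK. Qed.

Lemma corr_0 g : corr g ord0 = avg ord0 (Kk h) g. Proof. by []. Qed.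
Lemma corr_1 g : corr g i1 = avg i1 (Kk h) (corr1 g).
Proof. by rewrite /corr i1n0 eqxx. Qed.
Lemma corr_2 g : corr g i2 = avg i2 (Jk L) (corr2 g).
Proof. by rewrite /corr i2n0 i2n1. Qed.

Lemma test_corr1 g : test_function g -> test_function (corr1 g).
Proof. by move=> tg; exact: (test_avg (Mk_kern h0)). Qed.

Lemma test_corr2 g : test_function g -> test_function (corr2 g).
Proof. by move=> tg; apply: (test_avg (Mk_kern h0)); exact: test_corr1. Qed.

Lemma test_corr g k : test_function g -> test_function (corr g k).
Proof.
move=> tg; case: (I3_cases k) => ->; rewrite ?corr_0 ?corr_1 ?corr_2.
- exact: (test_avg (Kk_kern h0)).
- by apply: (test_avg (Kk_kern h0)); exact: test_corr1.
- by apply: (test_avg (Jk_kern L0)); exact: test_corr2.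
Qed.

Lemma corr2_support g a b : (forall x, g x != 0 -> bx a b x) ->
  forall x, corr2 g x != 0 -> bx (a + h + h) b x.
Proof.
move=> hg; apply: (avg_bx01 (Mk_kern h0)); first by rewrite eq_sym i2n1.
by apply: (avg_bx01 (Mk_kern h0)) => //; rewrite eq_sym i2n0.
Qed.

Lemma corr_support g k a b : (forall x, g x != 0 -> bx a b x) ->
  forall x, corr g k x != 0 -> bx (a + h + h) (b + L) x.
Proof.
move=> hg; have a0 : a + h <= a + h + h by rewrite lerDl ltW.
have b0 : b <= b + L by rewrite lerDl ltW.
case: (I3_cases k) => -> x; rewrite ?corr_0 ?corr_1 ?corr_2.
- move=> /(avg_bx01 (Kk_kern h0) (i := ord0)) -/(_ _ _ _ hg); rewrite eq_sym i2n0 => /(_ isT).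
  exact: bx_sub.
- move=> /(avg_bx01 (Kk_kern h0) (i := i1)) -/(_ (a + h) b); rewrite eq_sym i2n1 => /(_ isT) hh.
  apply: (bx_sub (lexx _) b0); apply: hh.
  by apply: (avg_bx01 (Mk_kern h0)) => //; rewrite eq_sym i2n0.
- apply: (avg_bx2 (Jk_kern L0)); exact: corr2_support.
Qed.

Lemma avg_sum i h' M c I (r : seq I) (F : I -> R3 R -> R) : kern h' M c ->
  (forall k, test_function (F k)) ->
  avg i c (fun x => \sum_(k <- r) F k x) = fun x => \sum_(k <- r) avg i c (F k) x.
Proof.
move=> hc tF; apply/funext => x; rewrite /avg /pint -int_sum.
  by congr Rintegral; apply/funext => s; rewrite big_distrr.
move=> k; have [N [_ fN]] := test_bx (tF k).
have [B [_ fB]] := compact_support_bounded (test_continuous (tF k)) fN.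
exact: (pint_integrable (kern_integrable hc) (measurable_line i) x (test_continuous (tF k)) fB).
Qed.

Lemma telescope4 (a b c d : R) : (a - b) + (b - c) + (c - d) = a - d.
Proof. by ring. Qed.

Lemma partial_corr2 g k : test_function g -> partial k (corr2 g) = corr2 (partial k g).
Proof.
move=> tg; rewrite /corr2 (partial_avg (Mk_kern h0) i1 k (test_corr1 tg)).
by rewrite /corr1 (partial_avg (Mk_kern h0) ord0 k tg).
Qed.

Lemma partial_corr_sum g x : test_function g ->
  \sum_(k < 3) partial k (corr g k) x = g x - corr2 g (x + L *: e_ i2).
Proof.
move=> tg; rewrite sum3E corr_0 corr_1 corr_2.
rewrite partial_Kk// partial_Kk//; last exact: test_corr1.
rewrite partial_Jk//; last exact: test_corr2.
exact: telescope4.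
Qed.

(** The corrector leaves [corr2 g] at the shifted point. Horizontal averages and translations
    commute with derivatives, so this remainder is the divergence of the averaged and shifted field
    [corr2 (P k)], which is subtracted as well. *)
Lemma corrected_divergence (P : 'I_3 -> R3 R -> R) g x : (forall k, test_function (P k)) ->
  test_function g -> (forall x, \sum_(k < 3) partial k (P k) x = g x) ->
  \sum_(k < 3) partial k (fun x => P k x - corr g k x - corr2 (P k) (x + L *: e_ i2)) x = 0.
Proof.
move=> tP tg hP.
have tPk k : test_function (partial k (P k)) by exact: test_partial.
rewrite (eq_bigr (fun k => partial k (P k) x - partial k (corr g k) x -
    corr2 (partial k (P k)) (x + L *: e_ i2))); last first.
  move=> k _.
  have t1 := test_smooth (tP k); have t2 := test_smooth (test_corr k tg).
  have t3 := test_smooth (test_translate (L *: e_ i2) (test_corr2 (tP k))).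
  rewrite (partial_sub k (smooth_sub t1 t2) t3) (partial_sub k t1 t2) partial_translate.
  by rewrite partial_corr2.
rewrite !sumrB hP partial_corr_sum//.
have -> : \sum_(k < 3) corr2 (partial k (P k)) (x + L *: e_ i2) = corr2 g (x + L *: e_ i2).
  have -> : g = fun x => \sum_(k < 3) partial k (P k) x by apply/funext => y; rewrite hP.
  rewrite /corr2 /corr1 (avg_sum _ _ (Mk_kern h0))// (avg_sum _ _ (Mk_kern h0))//.
  by move=> k; exact: test_corr1.
by rewrite subKr subrr.
Qed.

(** The kernel [Kk h] has L1 norm at most [h]: the derivative stays on [g], but with a factor [h]
    that can be made small. *)
Lemma le2_partial_corr01 g k j G : test_function g -> k != i2 -> le2 mu (partial j g) G ->
  le2 mu (partial j (corr g k)) (h * G).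
Proof.
move=> tg k2 hG; have tp := test_partial j tg.
move: k2; case: (I3_cases k) => ->; rewrite ?corr_0 ?corr_1 ?eqxx// => _.
  rewrite (partial_avg (Kk_kern h0))//.
  by have := le2_avg ord0 (Kk_kern h0) tp hG; rewrite mul1r.
rewrite (partial_avg (Kk_kern h0)); last exact: test_corr1.
rewrite /corr1 (partial_avg (Mk_kern h0))//.
by have := le2_avg i1 (Kk_kern h0) (test_corr1 tp) (le2_Mk ord0 tp hG); rewrite mul1r.
Qed.

Lemma le4_corr01 g k G : test_function g -> k != i2 -> le4 mu g G -> le4 mu (corr g k) (h * G).
Proof.
move=> tg k2 hG.
move: k2; case: (I3_cases k) => ->; rewrite ?corr_0 ?corr_1 ?eqxx// => _.
  by have := le4_avg ord0 (Kk_kern h0) tg hG; rewrite mul1r.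
by have := le4_avg i1 (Kk_kern h0) (test_corr1 tg) (le4_Mk ord0 tg hG); rewrite mul1r.
Qed.

Lemma le2_diff f i A : le2 mu f A -> le2 mu (fun x => h^-1 * (f (x + h *: e_ i) - f x)) (2 * A / h).
Proof.
move=> hf; have := le2_scale h^-1 (le2_sub (le2_translate (h *: e_ i) hf) hf).
by rewrite ger0_norm ?invr_ge0 ?(ltW h0)//; move=> /le2_weaken; apply; rewrite le_eqVlt; apply/orP; left; apply/eqP; ring.
Qed.

Lemma test_diff f i : test_function f -> test_function (fun x => h^-1 * (f (x + h *: e_ i) - f x)).
Proof.
move=> tf; apply: (@test_mulr _ _ (fun=> h^-1)); first exact: smooth_cst.
by apply: test_sub => //; exact: test_translate.
Qed.

(** Horizontal derivatives fall on the mean [Mk h] and become difference quotients, so a factor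
    [2 / h] replaces a derivative of [g]; the vertical derivative merely undoes the integration in
    height. *)
Lemma le2_partial_corr2 g j G : test_function g -> le2 mu g G ->
  le2 mu (partial j (corr g i2)) (2 * L * G / h + 2 * G).
Proof.
move=> tg hG; have [_ G0 _] := hG; rewrite corr_2.
have w1 : 2 * L * G / h <= 2 * L * G / h + 2 * G by rewrite lerDl mulr_ge0.
have w2 : 2 * G <= 2 * L * G / h + 2 * G by rewrite lerDr divr_ge0// ?(ltW h0)// !mulr_ge0// ltW.
have E : L * (2 * G / h) = 2 * L * G / h by ring.
case: (I3_cases j) => ->.
- rewrite (partial_avg (Jk_kern L0)); last exact: test_corr2.
  rewrite /corr2 (partial_avg (Mk_kern h0)); last exact: test_corr1.
  have -> : partial ord0 (corr1 g) = fun x => h^-1 * (g (x + h *: e_ ord0) - g x).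
    by apply/funext => x; rewrite partial_Mk.
  have td := test_diff ord0 tg.
  have := le2_avg i2 (Jk_kern L0) (test_avg (Mk_kern h0) i1 td) (le2_Mk i1 td (le2_diff ord0 hG)).
  by rewrite mul1r E => /le2_weaken; apply.
- rewrite (partial_avg (Jk_kern L0)); last exact: test_corr2.
  have tc := test_corr1 tg.
  have -> : partial i1 (corr2 g) = fun x => h^-1 * (corr1 g (x + h *: e_ i1) - corr1 g x).
    by apply/funext => x; rewrite partial_Mk.
  have td := test_diff i1 tc.
  have := le2_avg i2 (Jk_kern L0) td (le2_diff i1 (le2_Mk ord0 tg hG)).
  by rewrite mul1r E => /le2_weaken; apply.
- have tc := test_corr2 tg.
  have -> : partial i2 (avg i2 (Jk L) (corr2 g)) = fun x => corr2 g x - corr2 g (x + L *: e_ i2).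
    by apply/funext => x; rewrite partial_Jk.
  have hc := le2_Mk i1 (test_corr1 tg) (le2_Mk ord0 tg hG).
  have := le2_sub hc (le2_translate (L *: e_ i2) hc).
  by move=> /le2_weaken; apply; have -> : G + G = 2 * G by ring.
Qed.

(** The vertical component is averaged in all three directions, so [iterated_avg_sup] applies. The
    exact factor is the square root of [L]; [1 <= L] rounds it up to [L]. *)
Lemma corr2_sup g G x : test_function g -> le2 mu g G -> 1 <= L ->
  `|corr g i2 x| <= L * G / h.
Proof.
move=> tg [lg G0 gG] L1; rewrite corr_2.
have hi : 0 <= h^-1 by rewrite invr_ge0 ltW.
have Q0 : 0 <= L * G / h by rewrite mulr_ge0// mulr_ge0// ltW.
rewrite -(ler_pXn2r (n := 2))// ?nnegrE// real_normK ?num_real//.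
apply: le_trans (iterated_avg_sup x (Mk_kern h0) (Mk_kern h0) (Jk_kern L0) tg) _.
rewrite Mh !mul1r mulr1.
have -> : (L * G / h) ^+ 2 = L ^+ 2 * (h^-1 * (h^-1 * G ^+ 2)) by ring.
apply: ler_pM.
- exact: ltW.
- by rewrite !mulr_ge0// sq_ge0.
- by rewrite expr2 ler_peMl// ltW.
- by rewrite !ler_wpM2l.
Qed.

End Corrector.

(** * Local energy estimate *)

Section WeakForm.
Variable R : realType.
Local Notation mu := (@leb3 R).
Local Notation e_ i := (unit_vector R i).
Local Notation i1 := (inord 1 : 'I_3).
Local Notation i2 := (inord 2 : 'I_3).

Lemma loc2_test_itg (f psi : R3 R -> R) : loc2 f -> test_function psi ->
  itg mu (fun x => f x * psi x).
Proof.
move=> [_ lf] tp; have [N [_ hN]] := test_bx tp.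
rewrite /itg (_ : (fun x => _) = fun x => cutb N f x * psi x); last first.
  apply/funext => x; have [->|px] := eqVneq (psi x) 0; first by rewrite !mulr0.
  by rewrite cutb_in//; exact: hN.
by apply: L2_mul_integrable; [exact: lf|exact: test_L2].
Qed.

Lemma loc2_mul_test_itg (f g psi : R3 R -> R) : loc2 f -> loc2 g -> test_function psi ->
  itg mu (fun x => f x * g x * psi x).
Proof.
move=> [_ lf] [_ lg] tp; have [N [_ hN]] := test_bx tp.
have [M [_ hM]] := compact_support_bounded (test_continuous tp) hN.
rewrite /itg (_ : (fun x => _) = fun x => cutb N f x * (psi x * cutb N g x)); last first.
  apply/funext => x; have [->|px] := eqVneq (psi x) 0; first by rewrite mul0r !mulr0.
  by rewrite !cutb_in//; [ring|exact: hN|exact: hN].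
by apply: L2_mul_integrable; [exact: lf|exact: (@L2_bmul _ _ _ mu psi M (cutb N g) (test_measurable tp) hM (lg N))].
Qed.

Variables (u : 'I_3 -> R3 R -> R) (Du : 'I_3 -> 'I_3 -> R3 R -> R) (R0 : R).
Hypothesis lu : forall k, loc2 (u k).
Hypothesis lDu : forall k j, loc2 (Du k j).
Hypothesis wu : forall k j, weak_partial j (u k) (Du k j).
Hypothesis u0 : forall k (x : R3 R), R0 < `|x.2| -> u k x = 0.
Hypothesis R00 : 0 < R0.

(** [visc], [conv] and their sum [nsform] form the component [k] of the weak formulation without the
    pressure, split by direction so that each integral is estimated separately. *)
Definition visc k j (psi : R3 R -> R) : R := \int[mu]_x (Du k j x * partial j psi x).
Definition conv k j (psi : R3 R -> R) : R := \int[mu]_x (u j x * Du k j x * psi x).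
Definition nsform k (psi : R3 R -> R) : R := \sum_(j < 3) (visc k j psi + conv k j psi).

Lemma nsformE k psi : test_function psi -> nsform k psi =
  \int[mu]_x (\sum_(j < 3) Du k j x * partial j psi x + (\sum_(j < 3) u j x * Du k j x) * psi x).
Proof.
move=> tp; rewrite /nsform big_split/= -!int_sum; last 2 first.
- by move=> j; apply: loc2_mul_test_itg.
- by move=> j; apply: loc2_test_itg => //; exact: test_partial.
rewrite -int_add.
- by congr Rintegral; apply/funext => x; rewrite mulr_suml.
- by apply: itg_sum => j; apply: loc2_test_itg => //; exact: test_partial.
- by apply: itg_sum => j; apply: loc2_mul_test_itg.
Qed.

Lemma nsform_sub k f g : test_function f -> test_function g ->
  nsform k (fun x => f x - g x) = nsform k f - nsform k g.
Proof.
move=> tf tg; rewrite /nsform -sumrB; apply: eq_bigr => j _.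
have -> : visc k j (fun x => f x - g x) = visc k j f - visc k j g.
  rewrite /visc -int_sub; try by apply: loc2_test_itg => //; exact: test_partial.
  rewrite (partial_sub j (test_smooth tf) (test_smooth tg)).
  by congr Rintegral; apply/funext => x; rewrite mulrBr.
have -> : conv k j (fun x => f x - g x) = conv k j f - conv k j g.
  rewrite /conv -int_sub; try by apply: loc2_mul_test_itg.
  by congr Rintegral; apply/funext => x; rewrite mulrBr.
by rewrite opprD addrACA.
Qed.

(* The translated field lives where [u] vanishes, so only the viscous part could
   contribute, and integrating by parts moves both derivatives away from [u]. *)
Lemma nsform_far k theta L : test_function theta ->
  (forall x, theta x != 0 -> `|x.2| <= R0 + 1) -> 2 * R0 + 2 <= L ->
  nsform k (fun x => theta (x + L *: e_ i2)) = 0.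
Proof.
move=> tt ht hL; pose a := L *: e_ i2.
have ta : test_function (fun x => theta (x + a)) by exact: test_translate.
have a2 : a.2 = L by rewrite /a /= inordK// /GRing.scale/= mulr1.
have far x : `|(x + a).2| <= R0 + 1 -> R0 < `|x.2|.
  have -> : (x + a).2 = x.2 + L by rewrite -a2.
  rewrite ler_norml => /andP[_ h]; by have := R00; have := ler_norm (- x.2); rewrite normrN; lra.
rewrite /nsform big1// => j _.
have -> : conv k j (fun x => theta (x + a)) = 0.
  rewrite /conv (_ : (fun x => _) = fun=> 0); first by rewrite Rintegral_cst// mul0r.
  apply/funext => x; have [->|nz] := eqVneq (theta (x + a)) 0; first by rewrite mulr0.
  by rewrite u0 ?mul0r//; apply: far; exact: ht.
rewrite addr0; apply/eqP; rewrite -oppr_eq0; apply/eqP.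
have tp := test_partial j ta.
rewrite /visc -(wu k j tp) (_ : (fun x => _) = fun=> 0); first by rewrite Rintegral_cst// mul0r.
apply/funext => x; rewrite !partial_translate.
have [->|nz] := eqVneq (partial j (partial j theta) (x + a)) 0; first by rewrite mulr0.
rewrite u0 ?mul0r//; apply: far.
have [N [_ hN]] := test_bx tt.
have hb y : theta y != 0 -> bx N (R0 + 1) y by move=> ty; case: (hN y ty) => ? ? _; split => //; exact: ht.
by case: (partial_support (fun y => partial_support hb (x := y)) nz).
Qed.

Hypothesis Heq : forall V : 'I_3 -> R3 R -> R, (forall k, test_function (V k)) ->
  (forall x, \sum_(k < 3) partial k (V k) x = 0) -> \sum_(k < 3) nsform k (V k) = 0.

(** The field [P] minus its corrector minus the shifted average is solenoidal, hence annihilated by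
    the equation, and the shifted part contributes nothing by [nsform_far]. *)
Lemma nsform_corr h L P g : 0 < h -> 2 * R0 + 2 <= L -> (forall k, test_function (P k)) ->
  test_function g -> (forall x, \sum_(k < 3) partial k (P k) x = g x) ->
  (forall k x, P k x != 0 -> `|x.2| <= R0 + 1) ->
  \sum_(k < 3) nsform k (P k) = \sum_(k < 3) nsform k (corr h L g k).
Proof.
move=> h0 hL tP tg dP sP.
have L0 : 0 < L by have := R00; lra.
have tc k := test_corr h0 L0 k tg.
have t2 k := test_corr2 h0 (tP k).
have tt k := test_translate (L *: e_ i2) (t2 k).
have := @Heq (fun k x => P k x - corr h L g k x - corr2 h (P k) (x + L *: e_ i2)).
move=> /(_ _ _) H; have {}H := H (fun k => test_sub (test_sub (tP k) (tc k)) (tt k))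
  (fun x => corrected_divergence h0 L0 x tP tg dP).
rewrite (eq_bigr (fun k => nsform k (P k) - nsform k (corr h L g k))) in H.
  by apply/eqP; rewrite -subr_eq0 -sumrB; apply/eqP.
move=> k _; rewrite nsform_sub//; last exact: test_sub.
rewrite nsform_sub// nsform_far ?subr0//.
have [N [_ hN]] := test_bx (tP k).
move=> x; apply: contraTle => hx; rewrite negbK; apply/eqP.
apply: contrapT => /eqP nz.
have hb y : P k y != 0 -> bx N (R0 + 1) y by move=> ty; case: (hN y ty) => ? ? _; split => //; exact: sP ty.
by case: (corr2_support h0 hb nz) => _ _; rewrite leNgt hx.
Qed.

End WeakForm.

Lemma le_of_balance (R : realType) (X T w E N1 N2 : R) : X + E - 2^-1 * T = w ->
  `|E| <= N1 -> `|w| <= N2 -> X <= 2^-1 * `|T| + (N2 + N1).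
Proof.
move=> h hE hw; have := ler_norm T; have := ler_norm (- E); have := ler_norm w.
by rewrite normrN; lra.
Qed.

(** * Energy balance between the squares of half-sides [s] and [s + dl] *)

Section LocalEstimate.
Variable R : realType.
Local Notation mu := (@leb3 R).
Local Notation i2 := (inord 2 : 'I_3).

Variables (u : 'I_3 -> R3 R -> R) (Du : 'I_3 -> 'I_3 -> R3 R -> R) (R0 : R).
Hypothesis lu : forall k, loc2 (u k).
Hypothesis lDu : forall k j, loc2 (Du k j).
Hypothesis wu : forall k j, weak_partial j (u k) (Du k j).
Hypothesis du : divergence_free u.
Hypothesis u0 : forall k (x : R3 R), R0 < `|x.2| -> u k x = 0.
Hypothesis R00 : 0 < R0.

Hypothesis Heq : forall V : 'I_3 -> R3 R -> R, (forall k, test_function (V k)) ->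
  (forall x, \sum_(k < 3) partial k (V k) x = 0) -> \sum_(k < 3) nsform u Du k (V k) = 0.

Variable C : R.
Hypothesis C1 : 1 <= C.
Hypothesis hC : forall s d, 0 < d ->
  (forall j x, `|partial j (@hcut R s d) x| <= C / d) /\
  (forall i j x, `|partial i (partial j (@hcut R s d)) x| <= C / d ^+ 2).

(** [A] and [B] bound the L2 norms of the components of [u] and of their derivatives on the larger
    box. [Q ^ 4] dominates [A B ^ 3], so by Ladyzhenskaya's inequality [Q] bounds the L4 norm up to
    a constant. The condition [A / dl <= B] lets terms with a differentiated cutoff be absorbed into
    those with a gradient. *)
Variables (s dl A B Q : R).
Hypotheses (s0 : 0 <= s) (dl0 : 0 < dl) (A0 : 0 < A) (B0 : 0 < B) (AB : A / dl <= B).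
Hypotheses (Q0 : 0 <= Q) (QE : A * B ^+ 3 <= Q ^+ 4).

Let H := R0 + 1.
(** Starting from height [R0 + 1], the corrector spreads by [L = 3 (R0 + 1)]; the height [5 H]
    leaves room for it. *)
Let box : set (R3 R) := bx (s + dl) (5 * H).

Definition ind (f : R3 R -> R) : T3 R -> R := fun x => \1_(bx (s + dl) (5 * (R0 + 1))) x * f x.

Hypothesis hu : forall k, le2 mu (ind (u k)) A.
Hypothesis hDu : forall k j, le2 mu (ind (Du k j)) B.

(** [phi] lives over half-side [s + dl / 4]. The two horizontal averages widen this by
    [2 h <= dl / 4], so the corrector lives over [s + dl / 2], where [chi] equals 1; [chi] itself
    vanishes beyond [s + 3 dl / 4], inside the box. *)
Let phi := @hcut R s (dl / 4).
Let chi := @hcut R (s + dl / 2) (dl / 4).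

Lemma ind_id (f g : R3 R -> R) x : (g x != 0 -> box x) -> ind f x * g x = f x * g x.
Proof.
have [->|gx /(_ isT) bxx] := eqVneq (g x) 0; first by rewrite !mulr0.
by rewrite /ind indicE mem_set// mul1r.
Qed.

Lemma measurable_ind (f : R3 R -> R) : measurable_fun setT (f : T3 R -> R) -> measurable_fun setT (ind f).
Proof. by move=> mf; apply: measurable_funM => //; exact: measurable_indic (bx_measurable _ _). Qed.

Let d40 : 0 < dl / 4. Proof. by rewrite divr_gt0. Qed.

Lemma bound_dphi j x : `|partial j phi x| <= 4 * C / dl.
Proof. by have := (hC s d40).1 j x; rewrite invf_div (_ : C * (4 / dl) = 4 * C / dl)//; ring. Qed.

Lemma bound_dchi j x : `|partial j chi x| <= 4 * C / dl.
Proof. by have := (hC (s + dl / 2) d40).1 j x; rewrite invf_div (_ : C * (4 / dl) = 4 * C / dl)//; ring. Qed.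

Lemma bound_ddphi i j x : `|partial i (partial j phi) x| <= 16 * C / dl ^+ 2.
Proof.
have := (hC s d40).2 i j x; congr (_ <= _).
by rewrite expr_div_n invf_div mulrCA mulrA (_ : 4 ^+ 2 = 16 :> R)//; ring.
Qed.

Let sphi : smooth phi. Proof. exact: hcut_smooth. Qed.
Let schi : smooth chi. Proof. exact: hcut_smooth. Qed.

Lemma phi_supp x : phi x != 0 -> `|x.1.1| <= s + dl / 4 /\ `|x.1.2| <= s + dl / 4.
Proof. exact: hcut_neq0. Qed.

Lemma dphi_supp j x : partial j phi x != 0 -> `|x.1.1| <= s + dl / 4 /\ `|x.1.2| <= s + dl / 4.
Proof. exact: partial_hcut_support. Qed.

(** [partial_support] needs a box, but [phi] is not supported in one, being constant in the vertical
    variable. Multiplying by a vertical cutoff equal to 1 up to the height of [x], with zero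
    derivative there, restores a box without changing the derivative at [x]. *)
Lemma ddphi_supp i j x : partial i (partial j phi) x != 0 ->
  `|x.1.1| <= s + dl / 4 /\ `|x.1.2| <= s + dl / 4.
Proof.
move=> nz; pose N := `|x.2| + 1.
pose z y : R := cut1 `|x.2| 1 (coord3 i2 y).
have sz : smooth z by exact: cut1_coord_smooth.
have sd := smooth_partial j sphi.
have E : partial i (fun y => z y * partial j phi y) x = partial i (partial j phi) x.
  rewrite (partial_mul i sz sd) /z partial_cut1 coord3_i2 cut1_eq1// mul1r.
  by rewrite derive1_cut1 dcut1_eq0// mulr0 mulr0 addr0.
have hb y : z y * partial j phi y != 0 -> bx (s + dl / 4) N y.
  rewrite mulf_eq0 negb_or => /andP[h /dphi_supp[h1 h2]]; split => //.
  rewrite leNgt; apply/negP => /ltW k; move: h.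
  by rewrite /z coord3_i2 cut1_eq0// eqxx.
by rewrite -E in nz; case: (partial_support hb nz).
Qed.

Lemma chi_id (f g : R3 R -> R) x : (g x != 0 -> `|x.1.1| <= s + dl / 2 /\ `|x.1.2| <= s + dl / 2) ->
  chi x * f x * g x = f x * g x.
Proof.
have [->|gx /(_ isT)[h1 h2]] := eqVneq (g x) 0; first by rewrite !mulr0.
by rewrite /chi hcut_eq1// mul1r.
Qed.

Definition diss k j : R := \int[mu]_x (phi x * (ind (Du k j) x * ind (Du k j) x)).
(** Twice the transport of kinetic energy through the cutoff; since only [partial j phi] occurs, it
    sees the zone where the cutoff varies. *)
Definition flux k j : R := \int[mu]_x (u j x * partial j phi x * (u k x * u k x)).

Section Mollified.
Variables (U : 'I_3 -> R3 R -> R) (e : R).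
Hypothesis tU : forall k, test_function (U k).
Hypothesis vU : forall k x, U k x != 0 -> `|x.2| <= R0 + 1.
Hypothesis dU : forall x : R3 R, `|x.1.1| <= s + dl -> `|x.1.2| <= s + dl ->
  \sum_(k < 3) partial k (U k) x = 0.
Hypothesis eU : forall k, le2 mu (ind (fun x => U k x - u k x)) e.
Hypothesis edU : forall k j, le2 mu (ind (fun x => partial j (U k) x - Du k j x)) e.
Hypotheses (eA : e <= A) (eB : e <= B).

Lemma H_le : H <= 5 * H. Proof. by rewrite /H; have := R00; lra. Qed.

Lemma le2_indU k : le2 mu (ind (U k)) (2 * A).
Proof.
have h := le2_add (eU k) (hu k).
rewrite (_ : ind (U k) = fun x => ind (fun x => U k x - u k x) x + ind (u k) x); last first.
  by apply/funext => x; rewrite /ind -mulrDr subrK.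
by apply: le2_weaken h _; have := eA; lra.
Qed.

Lemma le2_inddU k j : le2 mu (ind (partial j (U k))) (2 * B).
Proof.
have h := le2_add (edU k j) (hDu k j).
rewrite (_ : ind _ = fun x => ind (fun x => partial j (U k) x - Du k j x) x + ind (Du k j) x); last first.
  by apply/funext => x; rewrite /ind -mulrDr subrK.
by apply: le2_weaken h _; have := eB; lra.
Qed.

Lemma dU_supp k j x : partial j (U k) x != 0 -> `|x.2| <= R0 + 1.
Proof.
have [N [_ hN]] := test_bx (tU k).
have hb y : U k y != 0 -> bx N (R0 + 1) y by move=> ty; case: (hN y ty) => ? ? _; split => //; exact: vU ty.
by move=> /(partial_support hb)[].
Qed.

Lemma le2_mul_ind (b f : R3 R -> R) (M F : R) : 0 <= M ->
  measurable_fun setT (b : T3 R -> R) -> measurable_fun setT (f : T3 R -> R) ->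
  (forall x, `|b x| <= M) -> (forall x, b x * f x != 0 -> box x) -> le2 mu (ind f) F ->
  le2 mu (fun x => b x * f x) (M * F).
Proof.
move=> M0 mb mf bM hb hF; apply: le2_dom (le2_bmul M0 mb bM hF) _ => [|x].
  exact: measurable_funM.
have [->|nz] := eqVneq (b x * f x) 0; first by rewrite normr0.
by rewrite /ind indicE mem_set ?mul1r//; exact: hb.
Qed.

Let msm (f : R3 R -> R) : smooth f -> measurable_fun setT (f : T3 R -> R).
Proof. by move=> /smooth_continuous/cont3_measurable. Qed.

Let mt (f : R3 R -> R) : test_function f -> measurable_fun setT (f : T3 R -> R).
Proof. exact: test_measurable. Qed.

Lemma test_chiU k : test_function (fun x => chi x * U k x).
Proof. exact: test_mulr. Qed.

Lemma box_of (a : R) (x : R3 R) : a <= dl -> `|x.1.1| <= s + a -> `|x.1.2| <= s + a -> `|x.2| <= R0 + 1 -> box x.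
Proof.
by move=> ad h1 h2 h3; split; [lra|lra|exact: le_trans h3 H_le].
Qed.

(** Ladyzhenskaya's inequality for [chi U], whose derivatives are bounded by [(2 + 8 C) B] thanks to
    [A / dl <= B]. The constant [4 + 16 C] is twice [2 + 8 C], which absorbs the numerical factor 32
    in the fourth power. *)
Lemma chiU_le4 k : le4 mu (fun x => chi x * U k x) ((4 + 16 * C) * Q).
Proof.
have C0 : 0 < C by have := C1; lra.
have q1 : dl / 2 + dl / 4 <= dl by have := dl0; lra.
have b1 x : chi x * U k x != 0 -> box x.
  rewrite mulf_eq0 negb_or => /andP[/hcut_neq0 -/(_ d40) [h1 h2] /vU h3].
  by apply: (box_of q1) => //; rewrite addrA.
have h1 : le2 mu (fun x => chi x * U k x) (2 * A).
  rewrite -[2 * A]mul1r; apply: le2_mul_ind => //; [exact: msm|exact: mt| |exact: le2_indU].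
  exact: hcut_norm.
have h2 j : le2 mu (partial j (fun x => chi x * U k x)) ((2 + 8 * C) * B).
  rewrite (partial_mul j schi (test_smooth (tU k))).
  have k1 : le2 mu (fun x => chi x * partial j (U k) x) (1 * (2 * B)).
    apply: le2_mul_ind => //; [exact: msm|exact: (mt (test_partial j (tU k)))|exact: hcut_norm| |exact: le2_inddU].
    move=> x; rewrite mulf_eq0 negb_or => /andP[/hcut_neq0 -/(_ d40) [k1 k2] /dU_supp h3].
    by apply: (box_of q1) => //; rewrite addrA.
  have k2 : le2 mu (fun x => partial j chi x * U k x) (4 * C / dl * (2 * A)).
    apply: le2_mul_ind => //; [|exact: (msm (smooth_partial j schi))|exact: mt|exact: bound_dchi| |exact: le2_indU].
      by rewrite divr_ge0 ?mulr_ge0// ltW// dl0.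
    move=> x; rewrite mulf_eq0 negb_or => /andP[/(partial_hcut_support d40) [k2 k3] /vU h3].
    by apply: (box_of q1) => //; rewrite addrA.
  rewrite (_ : (fun x => _) = fun x => chi x * partial j (U k) x + partial j chi x * U k x); last first.
    by apply/funext => x; rewrite [U k x * _]mulrC.
  apply: le2_weaken (le2_add k1 k2) _.
  have -> : 4 * C / dl * (2 * A) = 8 * C * (A / dl) by ring.
  have : 8 * C * (A / dl) <= 8 * C * B by rewrite ler_wpM2l// ?AB// mulr_ge0// ltW.
  by move=> ?; lra.
have [N [_ hN]] := test_bx (test_chiU k).
have [l1 a0 e1] := h1.
have b00 : 0 <= (2 + 8 * C) * B by rewrite mulr_ge0 ?(ltW B0)//; lra.
have [l4 q4] := ladyzhenskaya (test_smooth (test_chiU k)) hN a0 b00 e1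
  (fun j => let: And3 _ _ p := h2 j in p).
split => //; first by rewrite mulr_ge0//; have := Q0; lra.
apply: le_trans q4 _; rewrite [leRHS]exprMn.
have -> : 16 * (2 * A) * ((2 + 8 * C) * B) ^+ 3 = (32 * (2 + 8 * C) ^+ 3) * (A * B ^+ 3) by ring.
apply: ler_pM.
- by rewrite mulr_ge0// exprn_ge0//; lra.
- by rewrite mulr_ge0 ?exprn_ge0 ?(ltW A0) ?(ltW B0).
- have -> : (4 + 16 * C) ^+ 4 = 16 * (2 + 8 * C) * (2 + 8 * C) ^+ 3 by ring.
  apply: ler_wpM2r; first by rewrite exprn_ge0//; lra.
  lra.
- exact: QE.
Qed.

Let C0 : 0 < C. Proof. by have := C1; lra. Qed.
Let Cd0 : 0 <= 4 * C / dl. Proof. by rewrite divr_ge0 ?mulr_ge0// ltW. Qed.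
Let Cd20 : 0 <= 16 * C / dl ^+ 2. Proof. by rewrite divr_ge0 ?mulr_ge0 ?sqr_ge0// ltW. Qed.

(** The divergence of [phi U] ([div_P]): where [phi] is nonzero, [U] is solenoidal and only the
    derivative of the cutoff remains. *)
Definition gflux : R3 R -> R := fun x => \sum_(j < 3) U j x * partial j phi x.

Lemma gflux_test : test_function gflux.
Proof.
apply: test_sum => j; under eq_fun do rewrite mulrC.
exact: (test_mulr (smooth_partial j sphi) (tU j)).
Qed.

Lemma gflux_supp x : gflux x != 0 -> bx (s + dl / 4) (R0 + 1) x.
Proof.
move=> nz; apply: contrapT => nb; move: nz; rewrite /gflux big1 ?eqxx// => j _.
have [->|ux] := eqVneq (U j x) 0; first by rewrite mul0r.
have [->|px] := eqVneq (partial j phi x) 0; first by rewrite mulr0.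
by exfalso; apply: nb; have [h1 h2] := dphi_supp px; split => //; exact: vU ux.
Qed.

Let q4 : dl / 4 <= dl. Proof. by have := dl0; lra. Qed.

Lemma gflux_le2 : le2 mu gflux (24 * C * A / dl).
Proof.
have h j : le2 mu (fun x => U j x * partial j phi x) (4 * C / dl * (2 * A)).
  under eq_fun do rewrite mulrC.
  apply: le2_mul_ind => //; [exact: (msm (smooth_partial j sphi))|exact: mt|exact: bound_dphi| |exact: le2_indU].
  move=> x; rewrite mulf_eq0 negb_or => /andP[/dphi_supp [k1 k2] /vU k3].
  exact: (box_of q4).
by apply: le2_weaken (le2_sum3 h) _; rewrite le_eqVlt; apply/orP; left; apply/eqP; ring.
Qed.

Lemma gflux_dle2 i : le2 mu (partial i gflux) (120 * C * B / dl).
Proof.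
have sp j := smooth_partial j sphi.
have h j : le2 mu (partial i (fun x => U j x * partial j phi x))
    (16 * C / dl ^+ 2 * (2 * A) + 4 * C / dl * (2 * B)).
  rewrite (partial_mul i (test_smooth (tU j)) (sp j)); apply: le2_add.
    under eq_fun do rewrite mulrC.
    apply: le2_mul_ind => //; [exact: (msm (smooth_partial i (sp j)))|exact: mt|exact: bound_ddphi| |exact: le2_indU].
    move=> x; rewrite mulf_eq0 negb_or => /andP[k /vU k3].
    have [k1 k2] : `|x.1.1| <= s + dl / 4 /\ `|x.1.2| <= s + dl / 4 by exact: ddphi_supp k.
    exact: (box_of q4).
  apply: le2_mul_ind => //; [exact: (msm (sp j))|exact: (mt (test_partial i (tU j)))|exact: bound_dphi| |exact: le2_inddU].
  move=> x; rewrite mulf_eq0 negb_or => /andP[/dphi_supp [k1 k2] /dU_supp k3].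
  exact: (box_of q4).
have -> : partial i gflux = fun x => \sum_(j < 3) partial i (fun x => U j x * partial j phi x) x.
  apply: (partial_sum (index_enum 'I_3) i) => j.
  exact: smooth_mul (test_smooth (tU j)) (sp j).
apply: le2_weaken (le2_sum3 h) _.
have -> : 16 * C / dl ^+ 2 * (2 * A) = 32 * C / dl * (A / dl).
  by field; rewrite gt_eqF.
have : 32 * C / dl * (A / dl) <= 32 * C / dl * B.
  by rewrite ler_wpM2l// divr_ge0 ?mulr_ge0// ltW.
have -> : 120 * C * B / dl = 3 * (32 * C / dl * B + 4 * C / dl * (2 * B)) by ring.
by move=> ?; rewrite ler_wpM2l// lerD2r.
Qed.

(** On the support of the derivatives of [phi] the cutoff [chi] is 1, so [U] may be replaced by
    [chi U], whose L4 norm is controlled. The constant 40 is 4 times the factor 10 produced by two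
    uses of [le4_add]. *)
Lemma gflux_le4 : le4 mu gflux (40 * C / dl * ((4 + 16 * C) * Q)).
Proof.
pose F j x := partial j phi x * (chi x * U j x).
have h j : le4 mu (F j) (4 * C / dl * ((4 + 16 * C) * Q)).
  apply: le4_bmul => //; [exact: (msm (smooth_partial j sphi))|exact: bound_dphi|exact: chiU_le4].
have -> : gflux = fun x => (F ord0 x + F (inord 1) x) + F (inord 2) x.
  have E j x : U j x * partial j phi x = F j x.
    rewrite /F mulrC -[RHS]mulrC chi_id 1?mulrC// => /dphi_supp[k1 k2].
    by have := dl0; split; lra.
  by apply/funext => x; rewrite /gflux sum3E !E.
have h3 := le4_add (le4_add (h ord0) (h (inord 1))) (h (inord 2)).
by apply: le4_weaken h3 _; rewrite le_eqVlt; apply/orP; left; apply/eqP; ring.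
Qed.

Let K := (4 + 16 * C) * Q.
(** The same L4 bound for [u] itself; it is supplied by [chiu_le4], which passes to the limit in
    [chiU_le4]. *)
Hypothesis chiu4 : forall k, le4 mu (fun x => chi x * u k x) K.

Lemma prod_le2 (p f g : T3 R -> R) (a b : R) : (forall x, p x = f x * g x) ->
  le2 mu f a -> le2 mu g b -> itg mu p /\ `|\int[mu]_x p x| <= a * b.
Proof.
move=> pE hf hg; rewrite (_ : p = fun x => f x * g x); last by apply/funext.
by split; [exact: le2_integrable hf hg|exact: le2_int].
Qed.

Variable h : R.
Hypotheses (h0 : 0 < h) (hd : h <= dl / 8).

Let L := 3 * (R0 + 1).
Let G0 := 24 * C * A / dl.
Let G1 := 120 * C * B / dl.
Let G4 := 40 * C / dl * K.
Let W k := corr h L gflux k.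

Let L1 : 1 <= L. Proof. by rewrite /L; have := R00; lra. Qed.
Let L0 : 0 < L. Proof. by have := L1; lra. Qed.
Let tW k : test_function (W k). Proof. exact: (test_corr h0 L0 k gflux_test). Qed.

Lemma corr_supp k x : W k x != 0 -> bx (s + dl / 2) (4 * (R0 + 1)) x.
Proof.
move=> /(corr_support h0 L0 gflux_supp); apply: bx_sub.
  by have := hd; lra.
by rewrite /L; lra.
Qed.

Let small_box : bx (s + dl / 2) (4 * (R0 + 1)) `<=` box.
Proof. by apply: bx_sub; [have := dl0; lra|rewrite /H; have := R00; lra]. Qed.

Lemma corr_box k x : W k x != 0 -> box x.
Proof. by move=> /corr_supp/small_box. Qed.

Lemma dcorr_box k j x : partial j (W k) x != 0 -> box x.
Proof. by move=> /(partial_support (@corr_supp k))/small_box. Qed.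

Lemma visc_corr_le k j G : le2 mu (partial j (W k)) G -> `|visc Du k j (W k)| <= B * G.
Proof.
move=> hG; apply: (prod_le2 _ (hDu k j) hG).2 => x.
by rewrite ind_id//; exact: dcorr_box.
Qed.

(** Hölder's inequality with exponents 2, 4, 4; the horizontal components have an L4 norm carrying
    the factor [h]. *)
Lemma conv_corr_le k j : k != i2 -> `|conv u Du k j (W k)| <= B * (K * (h * G4)).
Proof.
move=> k2; have w4 := le4_corr01 L h0 gflux_test k2 gflux_le4.
apply: (prod_le2 _ (hDu k j) (le4_mul (chiu4 j) w4)).2 => x.
rewrite (@ind_id _ (fun x => chi x * u j x * W k x)).
  rewrite chi_id; first by rewrite mulrCA mulrA.
  by move=> /corr_supp[].
by rewrite mulf_eq0 negb_or => /andP[_ /corr_box].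
Qed.

(** The vertical component carries no factor [h]. An L4 bound for it would give [B Q ^ 2 / dl], of
    degree 5/2 in [B], which cannot be absorbed; its sup bound, with [u] and [Du] in L2, gives
    degree 1 in [B] at the cost of [1 / h]. *)
Lemma conv_corr2_le j : `|conv u Du i2 j (W i2)| <= B * (L * G0 / h * A).
Proof.
have sup x := corr2_sup h0 L0 x gflux_test gflux_le2 L1.
have G00 : 0 <= G0 by have [_ p _] := gflux_le2.
have LG : 0 <= L * G0 / h by rewrite divr_ge0 ?(ltW h0)// mulr_ge0// ltW.
apply: (prod_le2 _ (hDu i2 j) (le2_bmul LG (test_measurable (tW i2)) sup (hu j))).2 => x.
rewrite (@ind_id _ (fun x => W i2 x * ind (u j) x)).
  rewrite [W i2 x * _]mulrC ind_id; first by rewrite mulrCA mulrA.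
  exact: corr_box.
by rewrite mulf_eq0 negb_or => /andP[/corr_box].
Qed.

Let P k : R3 R -> R := fun x => phi x * U k x.
Let tP k : test_function (P k). Proof. exact: test_mulr. Qed.

Let phi_box (x : R3 R) : phi x != 0 -> `|x.2| <= R0 + 1 -> box x.
Proof. by move=> /phi_supp[h1 h2] h3; exact: (box_of q4). Qed.

Lemma div_P x : \sum_(k < 3) partial k (P k) x = gflux x.
Proof.
rewrite (eq_bigr (fun k => phi x * partial k (U k) x + U k x * partial k phi x)); last first.
  by move=> k _; rewrite /P (partial_mul k sphi (test_smooth (tU k))).
rewrite big_split/= -mulr_sumr.
have [->|px] := eqVneq (phi x) 0; first by rewrite mul0r add0r.
have [h1 h2] := phi_supp px.
by rewrite dU ?mulr0 ?add0r//; have := dl0; lra.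
Qed.

Let e0 : 0 <= e. Proof. by have [_ p _] := eU ord0. Qed.
Let K0 : 0 <= K. Proof. by have [_ p _] := chiu4 ord0. Qed.

Let mphi : measurable_fun setT (phi : T3 R -> R). Proof. exact: msm. Qed.
Let phi1 x : `|phi x| <= 1. Proof. exact: hcut_norm. Qed.

Let phi_half x : phi x != 0 -> `|x.1.1| <= s + dl / 2 /\ `|x.1.2| <= s + dl / 2.
Proof. by move=> /phi_supp[h1 h2]; have := dl0; split; lra. Qed.

Let dphi_half j x : partial j phi x != 0 -> `|x.1.1| <= s + dl / 2 /\ `|x.1.2| <= s + dl / 2.
Proof. by move=> /dphi_supp[h1 h2]; have := dl0; split; lra. Qed.

Let le2_phi f F : le2 mu f F -> le2 mu (fun x => phi x * f x) F.
Proof. by move=> hf; have := le2_bmul ler01 mphi phi1 hf; rewrite mul1r. Qed.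

Let u_out k x : `|x.2| <= R0 + 1 \/ u k x = 0.
Proof.
have [hx|hx] := leP `|x.2| (R0 + 1); first by left.
by right; apply: u0; lra.
Qed.

Let boxP x : box x \/ ~ box x.
Proof. by case: (pselect (box x)); [left|right]. Qed.

Let ind_in f x : box x -> ind f x = f x.
Proof. by move=> bx_; rewrite /ind indicE mem_set// mul1r. Qed.

Let ind_out f x : ~ box x -> ind f x = 0.
Proof. by move=> bx_; rewrite /ind indicE memNset// mul0r. Qed.

Let P_box k x : P k x != 0 -> bx (s + dl / 4) (R0 + 1) x.
Proof. by rewrite mulf_eq0 negb_or => /andP[/phi_supp[p1 p2] /vU p3]. Qed.

Let dP_out k j x : ~ box x -> partial j (P k) x = 0.
Proof.
move=> nb; apply: contrapT => /eqP nz; apply: nb.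
have [h1 h2 h3] := partial_support (@P_box k) nz; exact: (box_of q4).
Qed.

(** Replacing [partial j U] by [Du] in the main term costs a multiple of [e]; the term in which the
    derivative falls on the cutoff does not vanish with [e]. *)
Lemma visc_P k j : exists E : R, `|E| <= B * e + B * (4 * C / dl * (2 * A)) /\
  visc Du k j (P k) = diss k j + E.
Proof.
pose D := Du k j; pose V x := partial j (U k) x - Du k j x.
have [ia ba] : itg mu (fun x => ind D x * (phi x * ind V x)) /\
    `|\int[mu]_x (ind D x * (phi x * ind V x))| <= B * e.
  by apply: (prod_le2 _ (hDu k j) (le2_phi (edU k j))).
have h2 : le2 mu (fun x => partial j phi x * ind (U k) x) (4 * C / dl * (2 * A)).
  exact: (le2_bmul Cd0 (msm (smooth_partial j sphi)) (bound_dphi j) (le2_indU k)).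
have [ib bb] : itg mu (fun x => ind D x * (partial j phi x * ind (U k) x)) /\
    `|\int[mu]_x (ind D x * (partial j phi x * ind (U k) x))| <= B * (4 * C / dl * (2 * A)).
  by apply: (prod_le2 _ (hDu k j) h2).
have [ic _] : itg mu (fun x => phi x * (ind D x * ind D x)) /\
    `|\int[mu]_x (phi x * (ind D x * ind D x))| <= B * B.
  by apply: (prod_le2 _ (le2_phi (hDu k j)) (hDu k j)) => x; rewrite mulrA.
exists (\int[mu]_x (ind D x * (phi x * ind V x)) + \int[mu]_x (ind D x * (partial j phi x * ind (U k) x))).
split; first by apply: le_trans (ler_normD _ _) _; exact: lerD.
rewrite -int_add// -int_add//; last exact: itg_add.
congr Rintegral; apply/funext => x.
have [xb|xb] := boxP x; last by rewrite dP_out// !ind_out// !mulr0 !addr0.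
rewrite !ind_in// /P (partial_mul j sphi (test_smooth (tU k))) /V -/D.
by move: (D x) (phi x) (partial j (U k) x) (U k x) (partial j phi x) => *; ring.
Qed.

Let hK : 0 <= K * K. Proof. exact: mulr_ge0. Qed.

(** [Du] is replaced by [partial j U], so that [U_k partial j U_k] is half the derivative of
    [U_k ^ 2], while [u_j] is kept as the transporting field. The integral against the full
    derivative of [phi U_k ^ 2] is set apart because it cancels only after summation over [j]. *)
Lemma conv_P k j : exists E : R, `|E| <= e * (K * K) + e * (4 * C / dl * (2 * K * K)) /\
  conv u Du k j (P k) = E - 2^-1 * flux k j +
    2^-1 * \int[mu]_x (u j x * partial j (fun x => phi x * (U k x * U k x)) x).
Proof.
pose D := Du k j; pose V x := partial j (U k) x - Du k j x; pose Z x := U k x - u k x.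
pose cu k x := chi x * u k x; pose cU k x := chi x * U k x.
have [ia ba] : itg mu (fun x => ind V x * (phi x * (cu j x * cU k x))) /\
    `|\int[mu]_x (ind V x * (phi x * (cu j x * cU k x)))| <= e * (K * K).
  by apply: (prod_le2 _ (edU k j) (le2_phi (le4_mul (chiu4 j) (chiU_le4 k)))).
have dphi_le2 f F : le2 mu f F -> le2 mu (fun x => partial j phi x * f x) (4 * C / dl * F).
  exact: (le2_bmul Cd0 (msm (smooth_partial j sphi)) (bound_dphi j)).
have hs : le2 mu (fun x => cu j x * cU k x + cu j x * cu k x) (2 * K * K).
  have := le2_add (le4_mul (chiu4 j) (chiU_le4 k)) (le4_mul (chiu4 j) (chiu4 k)).
  by rewrite (_ : K * K + K * K = 2 * K * K)//; ring.
have [ib bb] : itg mu (fun x => ind Z x * (partial j phi x * (cu j x * cU k x + cu j x * cu k x))) /\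
    `|\int[mu]_x (ind Z x * (partial j phi x * (cu j x * cU k x + cu j x * cu k x)))|
    <= e * (4 * C / dl * (2 * K * K)).
  by apply: (prod_le2 _ (eU k) (dphi_le2 _ _ hs)).
have fluxE : (fun x => u j x * partial j phi x * (u k x * u k x)) =
    (fun x => ind (u k) x * (partial j phi x * (cu j x * cu k x))).
  apply/funext => x; have [xb|xb] := boxP x.
    rewrite ind_in//; have [->|nz] := eqVneq (partial j phi x) 0; first by rewrite mulr0 !mul0r mulr0.
    have [h1 h2] := dphi_half nz; rewrite /cu /chi hcut_eq1// !mul1r.
    by move: (u j x) (u k x) (partial j phi x) => *; ring.
  rewrite ind_out// mul0r; have [->|nz] := eqVneq (partial j phi x) 0; first by rewrite mulr0 mul0r.
  have [hx|->] := u_out j x; last by rewrite !mul0r.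
  by exfalso; apply: xb; have [h1 h2] := dphi_supp nz; exact: (box_of q4).
have [ic _] : itg mu (fun x => u j x * partial j phi x * (u k x * u k x)) /\
    `|\int[mu]_x (u j x * partial j phi x * (u k x * u k x))| <= A * (4 * C / dl * (K * K)).
  by apply: (prod_le2 _ (hu k) (dphi_le2 _ _ (le4_mul (chiu4 j) (chiu4 k)))) => x; move: (congr1 (@^~ x) fluxE) => /= ->.
have tUU : test_function (fun x => phi x * (U k x * U k x)).
  exact: (test_mulr sphi (test_mulr (test_smooth (tU k)) (tU k))).
have id_ : itg mu (fun x => u j x * partial j (fun x => phi x * (U k x * U k x)) x).
  by apply: loc2_test_itg; [exact: lu|exact: test_partial].
(* The two errors come from [Du = partial j U - V] and from [U_k ^ 2 - u_k ^ 2 = Z (U_k + u_k)]. *)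
exists (- (\int[mu]_x (ind V x * (phi x * (cu j x * cU k x)))) -
   2^-1 * \int[mu]_x (ind Z x * (partial j phi x * (cu j x * cU k x + cu j x * cu k x)))).
split.
  apply: le_trans (ler_normB _ _) _; rewrite normrN; apply: lerD => //.
  rewrite normrM; apply: le_trans bb; rewrite -[leRHS]mul1r ler_wpM2r//.
  by rewrite ger0_norm; lra.
rewrite /flux -int_opp// -!int_scale// -!int_sub//; try exact: itg_opp; try exact: itg_scale.
  rewrite -int_add//; [|by apply: itg_sub; [apply: itg_sub; [exact: itg_opp|exact: itg_scale]|exact: itg_scale]|exact: itg_scale].
  congr Rintegral; apply/funext => x.
  have E : partial j (fun x => phi x * (U k x * U k x)) x =
      phi x * (2 * (U k x * partial j (U k) x)) + U k x * U k x * partial j phi x.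
    rewrite (partial_mul j sphi (smooth_mul (test_smooth (tU k)) (test_smooth (tU k)))).
    rewrite (partial_mul j (test_smooth (tU k)) (test_smooth (tU k))).
    by move: (phi x) (partial j (U k) x) (U k x) (partial j phi x) => *; ring.
  rewrite E /P.
  have [h3|uz] := u_out j x; last first.
    rewrite /cu uz; move: (ind V x) (ind Z x) (cU k x) (phi x) (chi x) (Du k j x) (u k x) (U k x).
    by move: (partial j (U k) x) (partial j phi x) => *; ring.
  have [->|nz] := eqVneq (phi x) 0; last first.
    have xb : box x by exact: phi_box.
    have [h1 h2] := phi_half nz.
    rewrite !ind_in// /cu /cU /chi !hcut_eq1// !mul1r /V /Z.
    by move: (u j x) (u k x) (Du k j x) (phi x) (partial j (U k) x) (U k x) (partial j phi x) => *; field.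
  have [->|nz] := eqVneq (partial j phi x) 0.
    move: (ind V x) (ind Z x) (cU k x) (cu j x) (cu k x) (Du k j x) (u k x) (u j x) (U k x).
    by move: (partial j (U k) x) => *; ring.
  have [h1 h2] := dphi_supp nz; have xb : box x by exact: (box_of q4).
  have [k1 k2] := dphi_half nz.
  rewrite !ind_in// /cu /cU /chi !hcut_eq1// !mul1r /V /Z.
  by move: (u j x) (u k x) (Du k j x) (partial j (U k) x) (U k x) (partial j phi x) => *; ring.
by apply: itg_sub; [exact: itg_opp|exact: itg_scale].
Qed.

Lemma sum33_le (F : 'I_3 -> 'I_3 -> R) M : (forall k j, `|F k j| <= M) ->
  `|\sum_(k < 3) \sum_(j < 3) F k j| <= 9 * M.
Proof.
move=> hF; apply: le_trans (ler_norm_sum _ _ _) _.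
have h1 k : `|\sum_(j < 3) F k j| <= 3 * M.
  apply: le_trans (ler_norm_sum _ _ _) _.
  rewrite sum3E; have := hF k ord0; have := hF k (inord 1); have := hF k (inord 2); lra.
rewrite sum3E; have := h1 ord0; have := h1 (inord 1); have := h1 (inord 2); lra.
Qed.

(** [phi U_k ^ 2] is an admissible test function for the divergence condition on [u]; the
    cancellation is exact because the transporting field was not mollified. *)
Lemma convective_zero k : \sum_(j < 3) \int[mu]_x (u j x * partial j (fun x => phi x * (U k x * U k x)) x) = 0.
Proof.
have tUU : test_function (fun x => phi x * (U k x * U k x)).
  exact: (test_mulr sphi (test_mulr (test_smooth (tU k)) (tU k))).
apply: etrans (du tUU); rewrite int_sum// => j.
by apply: loc2_test_itg; [exact: lu|exact: test_partial].
Qed.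

Lemma nsform_corr_le k : `|nsform u Du k (W k)| <=
  if k == i2 then 3 * (B * (2 * L * G0 / h + 2 * G0) + B * (L * G0 / h * A))
  else 3 * (B * (h * G1) + B * (K * (h * G4))).
Proof.
have key (M N : R) : (forall j, `|visc Du k j (W k)| <= M) -> (forall j, `|conv u Du k j (W k)| <= N) ->
    `|nsform u Du k (W k)| <= 3 * (M + N).
  move=> hM hN; rewrite /nsform; apply: le_trans (ler_norm_sum _ _ _) _.
  have hj j : `|visc Du k j (W k) + conv u Du k j (W k)| <= M + N.
    by apply: le_trans (ler_normD _ _) _; exact: lerD.
  by rewrite sum3E; have := hj ord0; have := hj (inord 1); have := hj (inord 2); lra.
have [k2|k2] := eqVneq k i2.
  subst k; apply: key => j; last exact: conv_corr2_le.
  by apply: visc_corr_le; exact: (le2_partial_corr2 h0 L0 j gflux_test gflux_le2).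
apply: key => j; last exact: conv_corr_le.
by apply: visc_corr_le; exact: (le2_partial_corr01 L h0 gflux_test k2 (gflux_dle2 j)).
Qed.

(** [err0] collects what survives as [e] tends to 0: the two horizontal components of the corrector,
    the vertical one, and the derivative of the cutoff in the viscous term. [err1] is the
    coefficient of [e]. *)
Definition err0 : R := 6 * (B * (h * G1) + B * (K * (h * G4))) +
  3 * (B * (2 * L * G0 / h + 2 * G0) + B * (L * G0 / h * A)) + 9 * (B * (4 * C / dl * (2 * A))).
Definition err1 : R := 9 * (B + K * K + 4 * C / dl * (2 * K * K)).

Lemma mollified_estimate : \sum_(k < 3) \sum_(j < 3) diss k j <=
  2^-1 * `|\sum_(k < 3) \sum_(j < 3) flux k j| + err0 + e * err1.
Proof.
pose Y k j := \int[mu]_x (u j x * partial j (fun x => phi x * (U k x * U k x)) x).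
pose Ev k j := visc Du k j (P k) - diss k j.
pose Ec k j := conv u Du k j (P k) + 2^-1 * flux k j - 2^-1 * Y k j.
have hEv k j : `|Ev k j| <= B * e + B * (4 * C / dl * (2 * A)).
  by have [E [hE EE]] := visc_P k j; rewrite /Ev EE addrAC subrr add0r.
have hEc k j : `|Ec k j| <= e * (K * K) + e * (4 * C / dl * (2 * K * K)).
  have [E [hE EE]] := conv_P k j; rewrite -/(Y k j) in EE; rewrite /Ec EE.
  by move: (flux k j) (Y k j) => f y; rewrite (_ : _ + _ - _ = E)//; ring.
have Psupp k x : P k x != 0 -> `|x.2| <= R0 + 1 by move=> /P_box[].
have hL : 2 * R0 + 2 <= L by rewrite /L; have := R00; lra.
have := nsform_corr lu lDu wu u0 R00 Heq h0 hL tP gflux_test div_P Psupp.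
have -> : \sum_(k < 3) nsform u Du k (P k) = \sum_(k < 3) \sum_(j < 3) diss k j +
    \sum_(k < 3) \sum_(j < 3) (Ev k j + Ec k j) - 2^-1 * \sum_(k < 3) \sum_(j < 3) flux k j.
  transitivity (\sum_(k < 3) \sum_(j < 3) (diss k j + (Ev k j + Ec k j) - 2^-1 * flux k j + 2^-1 * Y k j)).
    apply: eq_bigr => k _; apply: eq_bigr => j _; rewrite /Ev /Ec.
    by move: (visc Du k j (P k)) (conv u Du k j (P k)) (diss k j) (flux k j) (Y k j) => *; ring.
  rewrite mulr_sumr -sumrN -!big_split/=; apply: eq_bigr => k _.
  rewrite big_split/= -[X in _ + X]mulr_sumr convective_zero mulr0 addr0.
  by rewrite mulr_sumr -sumrN -!big_split.
have hE : `|\sum_(k < 3) \sum_(j < 3) (Ev k j + Ec k j)| <=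
    9 * (B * e + B * (4 * C / dl * (2 * A)) + (e * (K * K) + e * (4 * C / dl * (2 * K * K)))).
  by apply: sum33_le => k j; apply: le_trans (ler_normD _ _) _; exact: lerD.
have hW : `|\sum_(k < 3) nsform u Du k (corr h L gflux k)| <= 6 * (B * (h * G1) + B * (K * (h * G4))) +
  3 * (B * (2 * L * G0 / h + 2 * G0) + B * (L * G0 / h * A)).
  apply: le_trans (ler_norm_sum _ _ _) _; rewrite sum3E.
  have a1 := nsform_corr_le ord0; have a2 := nsform_corr_le (inord 1); have a3 := nsform_corr_le i2.
  move: a1 a2 a3; rewrite eqxx eq_sym i2n0 eq_sym i2n1 /W.
  move: `|_| `|_| `|_| (B * (h * G1)) (B * (K * (h * G4))) (B * (2 * L * G0 / h + 2 * G0)) (B * (L * G0 / h * A)).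
  by move=> *; lra.
move=> /le_of_balance/(_ hE hW)/le_trans; apply; rewrite -[leRHS]addrA lerD2l /err0 /err1.
rewrite le_eqVlt; apply/orP; left; apply/eqP.
move: (B * (h * G1)) (B * (K * (h * G4))) (B * (2 * L * G0 / h + 2 * G0)) (B * (L * G0 / h * A)).
by move: (4 * C / dl * (2 * A)) (4 * C / dl * (2 * K * K)) (K * K) => *; ring.
Qed.

End Mollified.

Lemma measurable_chi_mul (f : R3 R -> R) : measurable_fun setT (f : T3 R -> R) ->
  measurable_fun setT ((fun x => chi x * f x) : T3 R -> R).
Proof. by move=> mf; apply: measurable_funM => //; apply: cont3_measurable; exact: smooth_continuous. Qed.

Lemma approximation_ind e : 0 < e -> exists U : 'I_3 -> R3 R -> R,
  [/\ forall k, test_function (U k),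
      forall k x, U k x != 0 -> `|x.2| <= R0 + 1,
      forall x : R3 R, `|x.1.1| <= s + dl -> `|x.1.2| <= s + dl -> \sum_(k < 3) partial k (U k) x = 0,
      forall k, le2 mu (ind (fun x => U k x - u k x)) e &
      forall k j, le2 mu (ind (fun x => partial j (U k) x - Du k j x)) e].
Proof.
move=> e0; pose b := s + dl + 5 * H.
have H1 : 1 <= H by rewrite /H; have := R00; lra.
have sb : s + dl <= b by rewrite /b; lra.
have hb : 5 * H <= b by rewrite /b; have := s0; have := dl0; lra.
have Rb : R0 + 1 <= b by rewrite -/H; lra.
have [U [tU vU dU eU edU]] := approximation lu lDu wu du u0 R00 Rb e0.
have cut_ind (f : R3 R -> R) : measurable_fun setT (f : T3 R -> R) -> le2 mu (cutb b f) e -> le2 mu (ind f) e.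
  move=> mf hf; apply: le2_dom hf _ => [|x]; first exact: measurable_ind.
  rewrite /ind /cutb !normrM ler_wpM2r// !indicE !ger0_norm//.
  have [xb|_] := boolP (x \in bx (s + dl) _); last by rewrite ler0n.
  by rewrite mem_set//; move: xb; rewrite inE; apply: bx_sub; rewrite -?/H.
exists U; split => //.
- by move=> x h1 h2; apply: dU; lra.
- move=> k; apply: cut_ind => //; apply: measurable_funB; first exact: test_measurable.
  exact: (lu k).1.
- move=> k j; apply: cut_ind => //; apply: measurable_funB; last exact: (lDu k j).1.
  by apply: test_measurable; exact: test_partial.
Qed.

(** The L4 bound of the approximations is uniform once their errors are below [A] and [B], so
    [le4_lim] transfers it to [u]. *)
Lemma chiu_le4 k : le4 mu (fun x => chi x * u k x) ((4 + 16 * C) * Q).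
Proof.
have K0 : 0 <= (4 + 16 * C) * Q by rewrite mulr_ge0//; have := C1; lra.
apply: le4_lim => //; first by apply: measurable_chi_mul; exact: (lu k).1.
move=> e e0; pose e' := Num.min e (Num.min A B).
have e'0 : 0 < e' by rewrite !lt_min e0 A0 B0.
have [U [tU vU dU eU edU]] := approximation_ind e'0.
have e'e : e' <= e by rewrite ge_min lexx.
have e'A : e' <= A by rewrite !ge_min lexx orbT.
have e'B : e' <= B by rewrite !ge_min lexx !orbT.
exists (fun x => chi x * U k x); split; first exact: (chiU_le4 tU vU eU edU e'A e'B).
apply: le2_weaken e'e; apply: (@le2_dom _ _ _ _ _ (ind (fun x => U k x - u k x))) => //.
  apply: measurable_funB; apply: measurable_chi_mul; first exact: (lu k).1.
  exact: test_measurable.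
move=> x; rewrite -mulrBr -normrN -mulrN opprB.
have [->|nz] := eqVneq (chi x * (U k x - u k x)) 0; first by rewrite normr0.
rewrite /ind indicE mem_set; last first.
  move: nz; rewrite mulf_eq0 negb_or => /andP[/(hcut_neq0 d40)[h1 h2] nz].
  have q1 : dl / 2 + dl / 4 <= dl by have := dl0; lra.
  apply: (box_of q1); rewrite ?addrA//.
  have [hx|hx] := leP `|x.2| (R0 + 1) => //; exfalso; move: nz.
  have -> : u k x = 0 by apply: u0; lra.
  have [->|/vU] := eqVneq (U k x) 0; first by rewrite subrr eqxx.
  by rewrite leNgt hx.
rewrite mul1r normrM ler_piMl//; exact: hcut_norm.
Qed.

(** Apart from the term [e err1], nothing in [mollified_estimate] depends on the approximation, so
    [e] is chosen with [e (err1 + 1) <= w] for an arbitrary [w]. *)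
Lemma local_estimate h : 0 < h -> h <= dl / 8 -> \sum_(k < 3) \sum_(j < 3) diss k j <=
  2^-1 * `|\sum_(k < 3) \sum_(j < 3) flux k j| + err0 h.
Proof.
move=> h0 hd; apply/ler_addgt0Pr => w w0.
have E1 : 0 <= err1.
  have C0 : 0 < C by have := C1; lra.
  have K0 : 0 <= (4 + 16 * C) * Q by rewrite mulr_ge0//; lra.
  rewrite /err1; apply: mulr_ge0 => //; apply: addr_ge0.
    by apply: addr_ge0; [exact: ltW|exact: mulr_ge0].
  apply: mulr_ge0; first by rewrite divr_ge0 ?mulr_ge0// ltW.
  by rewrite mulr_ge0// mulr_ge0.
pose e := Num.min (w / (err1 + 1)) (Num.min A B).
have e10 : 0 < err1 + 1 by rewrite ltr_wpDl.
have e0 : 0 < e by rewrite !lt_min divr_gt0// A0 B0.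
have [U [tU vU dU eU edU]] := approximation_ind e0.
have eA : e <= A by rewrite !ge_min lexx orbT.
have eB : e <= B by rewrite !ge_min lexx !orbT.
apply: le_trans (mollified_estimate tU vU dU eU edU eA eB chiu_le4 h0 hd) _.
rewrite lerD2l; apply: (@le_trans _ _ (e * (err1 + 1))).
  by rewrite ler_wpM2l ?(ltW e0)// lerDl.
by rewrite -ler_pdivlMr// ge_min lexx.
Qed.

End LocalEstimate.

(** * Decay of the Dirichlet energy *)

Section EnergyInequalities.
Variable R : realType.
Implicit Types a b c d x y : R.

Lemma young2 (eta y b : R) : 0 < eta -> y * b ^+ 2 <= eta * b ^+ 4 + y ^+ 2 / eta.
Proof.
move=> e0; have -> : y = eta * (y / eta) by rewrite mulrCA divff ?mulr1 ?gt_eqF.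
move: (y / eta) => z.
have -> : (eta * z) ^+ 2 / eta = eta * z ^+ 2 by field; rewrite gt_eqF.
have -> : eta * z * b ^+ 2 = eta * (z * b ^+ 2) by ring.
rewrite -mulrDr ler_wpM2l ?(ltW e0)//.
have -> : b ^+ 4 = (b ^+ 2) ^+ 2 by rewrite -exprM.
move: (b ^+ 2) => w; rewrite -subr_ge0.
rewrite (_ : _ - _ = 3 / 4 * (z - w) ^+ 2 + 1 / 4 * (z + w) ^+ 2); last by field.
by apply: addr_ge0; apply: mulr_ge0; rewrite ?sqr_ge0//; lra.
Qed.

(** After the scaling [y = eta z], the larger of [z] and [b] dominates [z b ^ 3]; no weighted mean
    inequality is needed. *)
Lemma young4 (eta y b : R) : 0 < eta -> 0 <= y -> 0 <= b ->
  y * b ^+ 3 <= eta * b ^+ 4 + y ^+ 4 / eta ^+ 3.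
Proof.
move=> e0 y0 b0; have -> : y = eta * (y / eta) by rewrite mulrCA divff ?mulr1 ?gt_eqF.
have : 0 <= y / eta by rewrite divr_ge0// ltW.
move: (y / eta) => z z0.
have -> : (eta * z) ^+ 4 / eta ^+ 3 = eta * z ^+ 4 by field; rewrite gt_eqF.
have -> : eta * z * b ^+ 3 = eta * (z * b ^+ 3) by ring.
rewrite -mulrDr ler_wpM2l ?(ltW e0)//.
have [zb|bz] := leP z b.
  have h : z * b ^+ 3 <= b ^+ 4 by rewrite [leRHS]exprS ler_wpM2r// exprn_ge0.
  by apply: (le_trans h); rewrite lerDl exprn_ge0.
have h : z * b ^+ 3 <= z ^+ 4 by rewrite [leRHS]exprS ler_wpM2l// lerXn2r// ltW.
by apply: (le_trans h); rewrite lerDr exprn_ge0.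
Qed.

(* The averaging length [h] is [theta d / (1 + sqrt (A B))]. *)
Lemma choose_averaging (c ep : R) : 0 < c -> 0 < ep -> exists c', 0 < c' /\
  forall A B d, 0 < A -> 0 < B -> 0 < d -> exists h Q, [/\ 0 < h, h <= d / 8, 0 <= Q,
    Q ^+ 4 = A * B ^+ 3 &
    c * (h / d * B ^+ 2 + h / d * (B * Q ^+ 2) + A * B / (d * h) + A * B / d + A ^+ 2 * B / (d * h))
    <= ep * B ^+ 2 + c' * (A ^+ 2 / d ^+ 2 + A ^+ 2 / d ^+ 4 + A ^+ 4 / d ^+ 4 + A ^+ 6 / d ^+ 8
        + A ^+ 10 / d ^+ 8)].
Proof.
move=> c0 ep0.
(* [th] makes the two terms in [h / d] cost at most half of [ep] ([h1]); [et] is tuned so that five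
   uses of Young's inequality cost the other half ([h2]). *)
pose th := Num.min (8^-1) (ep / (4 * c)).
have th0 : 0 < th by rewrite lt_min invr_gt0 ltr0n divr_gt0// mulr_gt0.
pose et := th * ep / (10 * c).
have et0 : 0 < et by rewrite divr_gt0 ?mulr_gt0.
have th1 : th <= 1 by rewrite ge_min invf_le1 ?ltr0n// ler1n.
have h1 : c * (2 * th) <= ep / 2.
  have : th <= ep / (4 * c) by rewrite ge_min lexx orbT.
  by rewrite ler_pdivlMr ?mulr_gt0//; lra.
have h2 : c * (5 * (et / th)) = ep / 2 by rewrite /et; field; rewrite !gt_eqF.
pose c' := c * ((th * et)^-1 + (th * et ^+ 3)^-1 + et^-1).
exists c'; split.
  by rewrite mulr_gt0// !addr_gt0// invr_gt0// mulr_gt0// exprn_gt0.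
move=> A B d A0 B0 d0.
(* With square roots as unknowns, [Q ^ 2 = a b ^ 3] and [h] involves only [a b], so the terms become
   monomials up to the factor [w = 1 + a b]; the quantity to absorb, [B ^ 2], is [b ^ 4]. *)
pose a := Num.sqrt A; pose b := Num.sqrt B.
have a0 : 0 < a by rewrite sqrtr_gt0.
have b0 : 0 < b by rewrite sqrtr_gt0.
have AE : A = a ^+ 2 by rewrite sqr_sqrtr// ltW.
have BE : B = b ^+ 2 by rewrite sqr_sqrtr// ltW.
pose Q := Num.sqrt (a * b ^+ 3).
have QE : Q ^+ 2 = a * b ^+ 3 by rewrite sqr_sqrtr// mulr_ge0 ?exprn_ge0// ltW.
pose w := 1 + a * b.
have w1 : 1 <= w by rewrite lerDl mulr_ge0// ltW.
have w0 : 0 < w by apply: lt_le_trans w1.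
pose h := th * d / w.
have h0 : 0 < h by rewrite divr_gt0// mulr_gt0.
exists h, Q; split => //.
- rewrite /h ler_pdivrMr//; apply: (@le_trans _ _ (d / 8)).
    rewrite mulrC ler_wpM2l ?(ltW d0)// /th ge_min lexx//.
  by rewrite ler_peMr// divr_ge0// ltW.
- exact: sqrtr_ge0.
- by rewrite (exprM Q 2 2) QE AE BE; ring.
have hd : h / d = th / w by rewrite /h; field; rewrite !gt_eqF.
have hi : (d * h)^-1 = w / (th * d ^+ 2) by rewrite /h; field; rewrite !gt_eqF.
rewrite hd QE !hi AE BE.
have T1 : th / w * (b ^+ 2) ^+ 2 <= th * b ^+ 4.
  rewrite -exprM ler_wpM2r ?exprn_ge0 ?(ltW b0)// ler_pdivrMr// ler_peMr// ltW//.
have T2 : th / w * (b ^+ 2 * (a * b ^+ 3)) <= th * b ^+ 4.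
  have -> : th / w * (b ^+ 2 * (a * b ^+ 3)) = th * b ^+ 4 * (a * b / w) by ring.
  rewrite ler_piMr ?mulr_ge0 ?exprn_ge0 ?(ltW th0) ?(ltW b0)//.
  by rewrite ler_pdivrMr// mul1r lerDr.
(* Coefficients of [b ^ 2] and [b ^ 3] in the terms without small factor: both degrees are below 4,
   so Young's inequality absorbs them. The highest resulting power, from [x2 ^ 4] and [x4 ^ 4], is
   [d ^ (- 8)], whence the exponent 8 of the iteration. *)
pose x1 := a ^+ 2 / d ^+ 2; pose x2 := a ^+ 3 / d ^+ 2; pose x3 := a ^+ 4 / d ^+ 2.
pose x4 := a ^+ 5 / d ^+ 2; pose x5 := a ^+ 2 / d.
have E3 : a ^+ 2 * b ^+ 2 * (w / (th * d ^+ 2)) = th^-1 * (x1 * b ^+ 2 + x2 * b ^+ 3).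
  by rewrite /x1 /x2 /w; field; rewrite !gt_eqF.
have E4 : (a ^+ 2) ^+ 2 * b ^+ 2 * (w / (th * d ^+ 2)) = th^-1 * (x3 * b ^+ 2 + x4 * b ^+ 3).
  by rewrite /x3 /x4 /w; field; rewrite !gt_eqF.
have E5 : a ^+ 2 * b ^+ 2 / d = x5 * b ^+ 2 by rewrite /x5 mulrAC.
rewrite E3 E4 E5.
have xp n m : 0 <= a ^+ n / d ^+ m by rewrite divr_ge0 ?exprn_ge0// ltW.
have Y1 := young2 x1 b et0.
have Y2 := young4 et0 (xp 3 2) (ltW b0).
have Y3 := young2 x3 b et0.
have Y4 := young4 et0 (xp 5 2) (ltW b0).
have Y5 := young2 x5 b et0.
rewrite -/x2 in Y2; rewrite -/x4 in Y4.
have thi : 0 <= th^-1 by rewrite invr_ge0 ltW.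
have Z1 := ler_wpM2l thi (lerD Y1 Y2).
have Z2 := ler_wpM2l thi (lerD Y3 Y4).
have b4 : 0 <= b ^+ 4 by rewrite exprn_ge0// ltW.
have thi1 : 1 <= th^-1 by rewrite invr_ge1// unitfE gt_eqF.
have Y5' : x5 * b ^+ 2 <= et / th * b ^+ 4 + x5 ^+ 2 / et.
  apply: le_trans Y5 _; rewrite lerD2r ler_wpM2r// ler_pdivlMr//.
  by rewrite ler_piMr// ltW.
apply: (@le_trans _ _ (c * ((2 * th + 5 * (et / th)) * b ^+ 4 +
    ((th * et)^-1 * (x1 ^+ 2 + x3 ^+ 2) + (th * et ^+ 3)^-1 * (x2 ^+ 4 + x4 ^+ 4) + et^-1 * x5 ^+ 2)))).
  rewrite ler_wpM2l ?(ltW c0)//.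
  have -> : (th * et)^-1 * (x1 ^+ 2 + x3 ^+ 2) = th^-1 * (x1 ^+ 2 / et) + th^-1 * (x3 ^+ 2 / et).
    by rewrite invfM; ring.
  have -> : (th * et ^+ 3)^-1 * (x2 ^+ 4 + x4 ^+ 4) = th^-1 * (x2 ^+ 4 / et ^+ 3) + th^-1 * (x4 ^+ 4 / et ^+ 3).
    by rewrite invfM; ring.
  have -> : et^-1 * x5 ^+ 2 = x5 ^+ 2 / et by rewrite mulrC.
  move: T1 T2 Z1 Z2 Y5'; rewrite !mulrDr.
  have -> : th^-1 * (et * b ^+ 4) = et / th * b ^+ 4 by ring.
  move: (th / w * _) (th / w * _) (x5 * b ^+ 2) (x5 ^+ 2 / et) => p1 p2 p3 p4.
  move: (th^-1 * (x1 * _)) (th^-1 * (x2 * _)) (th^-1 * (x3 * _)) (th^-1 * (x4 * _)) => q1 q2 q3 q4.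
  move: (th^-1 * _) (th^-1 * _) (th^-1 * _) (th^-1 * _) => r1 r2 r3 r4.
  rewrite [(2 * th + _) * _]mulrDl -[2 * th * _]mulrA -[5 * _ * _]mulrA.
  move: (th * b ^+ 4) (et / th * b ^+ 4) => s1 s2 *; lra.
have K1 : c * ((2 * th + 5 * (et / th)) * b ^+ 4) <= ep * (b ^+ 2) ^+ 2.
  have -> : (b ^+ 2) ^+ 2 = b ^+ 4 by rewrite -exprM.
  have -> : c * ((2 * th + 5 * (et / th)) * b ^+ 4) = (c * (2 * th) + c * (5 * (et / th))) * b ^+ 4 by ring.
  by rewrite ler_wpM2r// h2; lra.
rewrite mulrDr lerD//.
have X1 : x1 ^+ 2 = (a ^+ 2) ^+ 2 / d ^+ 4 by rewrite /x1; field; rewrite gt_eqF.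
have X2 : x2 ^+ 4 = (a ^+ 2) ^+ 6 / d ^+ 8 by rewrite /x2; field; rewrite gt_eqF.
have X3 : x3 ^+ 2 = (a ^+ 2) ^+ 4 / d ^+ 4 by rewrite /x3; field; rewrite gt_eqF.
have X4 : x4 ^+ 4 = (a ^+ 2) ^+ 10 / d ^+ 8 by rewrite /x4; field; rewrite gt_eqF.
have X5 : x5 ^+ 2 = (a ^+ 2) ^+ 2 / d ^+ 2 by rewrite /x5; field; rewrite gt_eqF.
rewrite X1 X2 X3 X4 X5 /c' -mulrA ler_wpM2l ?(ltW c0)//.
have yp n m : 0 <= (a ^+ 2) ^+ n / d ^+ m by rewrite divr_ge0 ?exprn_ge0// ltW.
move: (yp 2 4) (yp 6 8) (yp 4 4) (yp 10 8) (yp 2 2).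
move: (_ / _) (_ / _) (_ / _) (_ / _) (_ / _) => y1 y2 y3 y4 y5.
have : 0 <= (th * et)^-1 by rewrite invr_ge0 mulr_ge0// ltW.
have : 0 <= (th * et ^+ 3)^-1 by rewrite invr_ge0 mulr_ge0 ?exprn_ge0// ltW.
have : 0 <= et^-1 by rewrite invr_ge0 ltW.
by move: (_^-1) (_^-1) (_^-1) => k1 k2 k3 *; nra.
Qed.

(* Hole filling: [c = 2 * 2 ^+ 8] beats the factor [2 ^+ 8] lost when the distance
   of [s] to [2 * r] is halved. *)
Lemma iteration (f : R -> R) (c r M G : R) : c = 2 * 2 ^+ 8 -> 0 < r -> 0 <= M -> 0 <= G ->
  (forall s, r <= s < 2 * r -> f s <= M) ->
  (forall s t, r <= s -> s < t -> t < 2 * r -> f s <= f t / c + G / (t - s) ^+ 8) ->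
  f r <= c * G / r ^+ 8.
Proof.
move=> cE r0 M0 G0 fM hf.
have c8 : (0 : R) < 2 ^+ 8 by exact: exprn_gt0.
have c0 : 0 < c by rewrite cE mulr_gt0.
have cG : 0 <= c * G by rewrite mulr_ge0// ltW.
have key n : forall s, r <= s < 2 * r -> (2 * r - s) ^+ 8 * f s <= c * G + r ^+ 8 * M / 2 ^+ n.
  elim: n => [|n IH] s /andP[rs sr].
    have p0 : 0 <= 2 * r - s by lra.
    have p1 : 2 * r - s <= r by lra.
    have h1 : (2 * r - s) ^+ 8 <= r ^+ 8 by apply: lerXn2r; rewrite ?nnegrE// ltW.
    have h2 : f s <= M by apply: fM; rewrite rs.
    have h3 : 0 <= (2 * r - s) ^+ 8 by apply: exprn_ge0.
    have h4 : 0 <= r ^+ 8 by apply: exprn_ge0; exact: ltW.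
    move: ((2 * r - s) ^+ 8) (r ^+ 8) h1 h3 h4 => P P' h1 h3 h4.
    rewrite expr0 divr1; apply: (@le_trans _ _ (P' * M)); last by rewrite lerDr.
    apply: (@le_trans _ _ (P * M)); first by rewrite ler_wpM2l.
    by rewrite ler_wpM2r.
  pose t := (s + 2 * r) / 2; pose d := t - s.
  have d0 : 0 < d by rewrite /d /t; lra.
  have E : 2 * r - s = 2 * d by rewrite /d /t; field.
  have E2 : 2 * r - t = d by rewrite /d /t; field.
  have h1 := hf s t rs; rewrite -/d in h1.
  have st : s < t by rewrite /t; lra.
  have tr : t < 2 * r by rewrite /t; lra.
  have {}h1 := h1 st tr.
  have h2 := IH t; rewrite E2 in h2.
  have {}h2 : d ^+ 8 * f t <= c * G + r ^+ 8 * M / 2 ^+ n by apply: h2; apply/andP; split; [rewrite /t; lra|].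
  have d8 : 0 < d ^+ 8 by rewrite exprn_gt0.
  have h3 : d ^+ 8 * f s <= d ^+ 8 * f t / c + G.
    have := ler_wpM2l (ltW d8) h1; rewrite mulrDr mulrA [d ^+ 8 * (G / _)]mulrC divfK ?gt_eqF//.
  rewrite E exprMn [2 ^+ n.+1]exprSr invfM [r ^+ 8 * M * _]mulrA -[2 ^+ 8 * d ^+ 8 * f s]mulrA.
  have := ler_wpM2l (ltW c8) h3; rewrite mulrDr.
  have -> : 2 ^+ 8 * (d ^+ 8 * f t / c) = 2^-1 * (d ^+ 8 * f t).
    rewrite cE; move: (2 ^+ 8) c8 (d ^+ 8 * f t) => p p0 q; field; lra.
  have e8 : 2 * (2 ^+ 8 * G) = c * G by rewrite cE mulrA.
  move: h2 e8; move: (c * G) (2 ^+ 8 * G) (2 ^+ 8 * (d ^+ 8 * f s)) (d ^+ 8 * f t) (r ^+ 8 * M / 2 ^+ n).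
  by move=> w1 w2 x y z *; lra.
have r8 : 0 < r ^+ 8 by rewrite exprn_gt0.
rewrite ler_pdivlMr// mulrC; apply/ler_addgt0Pr => e e0.
have K0 : 0 <= r ^+ 8 * M by rewrite mulr_ge0// ltW.
have [n hn] : exists n : nat, r ^+ 8 * M / e < n%:R.
  by exists (Num.bound (r ^+ 8 * M / e)); apply: archi_boundP; rewrite divr_ge0// ltW.
have := key n r; rewrite lexx /= (_ : 2 * r - r = r); last by ring.
move=> /(_ _)/le_trans; apply; first by lra.
rewrite lerD2l ler_pdivrMr ?exprn_gt0// -ler_pdivrMl// mulrC.
apply: (le_trans (ltW hn)); rewrite -natrX ler_nat; apply: ltnW; exact: ltn_expl.
Qed.

End EnergyInequalities.

(** * The dissipation inequality at scale [r] *)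

Section Decay.
Variable R : realType.
Local Notation mu := (@leb3 R).

Lemma err0_le (R0 C : R) : 0 < R0 -> 1 <= C -> exists c, 0 < c /\
  forall dl A B Q h, 0 < dl -> 0 < A -> 0 < B -> 0 < h ->
  err0 R0 C dl A B Q h <= c * (h / dl * B ^+ 2 + h / dl * (B * Q ^+ 2) + A * B / (dl * h) + A * B / dl
    + A ^+ 2 * B / (dl * h)).
Proof.
move=> R00 C1; pose L := 3 * (R0 + 1).
have C0 : 0 < C by lra.
have L0 : 0 < L by rewrite /L; lra.
pose c1 := 720 * C; pose c2 := 240 * C * (4 + 16 * C) ^+ 2; pose c3 := 144 * L * C.
pose c4 := 216 * C; pose c5 := 72 * L * C.
have c10 : 0 < c1 by rewrite mulr_gt0 ?ltr0n.
have c20 : 0 < c2.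
  by apply: mulr_gt0; [rewrite mulr_gt0 ?ltr0n|apply: exprn_gt0; lra].
have c30 : 0 < c3 by rewrite mulr_gt0// mulr_gt0 ?ltr0n.
have c40 : 0 < c4 by rewrite mulr_gt0 ?ltr0n.
have c50 : 0 < c5 by rewrite mulr_gt0// mulr_gt0 ?ltr0n.
exists (c1 + c2 + c3 + c4 + c5); split; first by rewrite !addr_gt0.
move=> dl A B Q h dl0 A0 B0 h0.
have -> : err0 R0 C dl A B Q h = c1 * (h / dl * B ^+ 2) + c2 * (h / dl * (B * Q ^+ 2)) +
    c3 * (A * B / (dl * h)) + c4 * (A * B / dl) + c5 * (A ^+ 2 * B / (dl * h)).
  by rewrite /err0 -/L /c1 /c2 /c3 /c4 /c5; field; rewrite !gt_eqF.
have p1 : 0 <= h / dl * B ^+ 2 by rewrite mulr_ge0 ?divr_ge0 ?exprn_ge0// ltW.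
have p2 : 0 <= h / dl * (B * Q ^+ 2) by apply: mulr_ge0; [rewrite divr_ge0// ltW|apply: mulr_ge0; [exact: ltW|exact: sqr_ge0]].
have p3 : 0 <= A * B / (dl * h) by rewrite divr_ge0 ?mulr_ge0// ltW.
have p4 : 0 <= A * B / dl by rewrite divr_ge0 ?mulr_ge0// ltW.
have p5 : 0 <= A ^+ 2 * B / (dl * h) by rewrite divr_ge0 ?mulr_ge0 ?exprn_ge0// ltW.
move: (h / dl * B ^+ 2) (h / dl * (B * Q ^+ 2)) (A * B / (dl * h)) (A * B / dl) (A ^+ 2 * B / (dl * h)) p1 p2 p3 p4 p5.
move: c1 c2 c3 c4 c5 c10 c20 c30 c40 c50 => c1 c2 c3 c4 c5 c10 c20 c30 c40 c50.
move=> y1 y2 y3 y4 y5 p1 p2 p3 p4 p5; rewrite !mulrDr.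
have K c y : c <= c1 + c2 + c3 + c4 + c5 -> 0 <= y -> c * y <= (c1 + c2 + c3 + c4 + c5) * y.
  by move=> ? ?; rewrite ler_wpM2r.
by do ?apply: lerD; apply: K => //; lra.
Qed.

(** The truncation [ind] indexed by the outer half-side alone, as the iteration compares many
    squares at the same height. *)
Definition cutt (R0 t : R) (f : R3 R -> R) : T3 R -> R :=
  fun x => \1_(bx t (5 * (R0 + 1))) x * f x.

Lemma cutt_mono R0 s t f x : s <= t -> `|cutt R0 s f x| <= `|cutt R0 t f x|.
Proof.
move=> st; rewrite /cutt !normrM ler_wpM2r// !indicE !ger0_norm//.
have [xb|_] := boolP (x \in bx s _); last by rewrite ler0n.
by rewrite mem_set//; move: xb; rewrite inE; exact: bx_sub.
Qed.

Lemma cutt_L2 R0 t f : loc2 f -> L2 mu (cutt R0 t f).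
Proof.
move=> [mf lf]; pose b := Num.max t (5 * (R0 + 1)).
apply: (@L2_dom _ _ _ _ _ (cutb b f)) => // [|x].
  by apply: measurable_funM => //; exact: measurable_indic (bx_measurable _ _).
rewrite /cutt /cutb !normrM ler_wpM2r// !indicE !ger0_norm//.
have [xb|_] := boolP (x \in bx t _); last by rewrite ler0n.
by rewrite mem_set//; move: xb; rewrite inE; apply: bx_sub; rewrite le_max lexx ?orbT.
Qed.

Definition ring_set (R0 r : R) : set (R3 R) :=
  [set x | bx (2 * r) (5 * (R0 + 1)) x /\ ~ (`|x.1.1| < r /\ `|x.1.2| < r)].

Variables (u : 'I_3 -> R3 R -> R) (Du : 'I_3 -> 'I_3 -> R3 R -> R) (R0 : R).
Hypothesis lu : forall k, loc2 (u k).
Hypothesis lDu : forall k j, loc2 (Du k j).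
Hypothesis wu : forall k j, weak_partial j (u k) (Du k j).
Hypothesis du : divergence_free u.
Hypothesis u0 : forall k (x : R3 R), R0 < `|x.2| -> u k x = 0.
Hypothesis R00 : 0 < R0.
Hypothesis Heq : forall V : 'I_3 -> R3 R -> R, (forall k, test_function (V k)) ->
  (forall x, \sum_(k < 3) partial k (V k) x = 0) -> \sum_(k < 3) nsform u Du k (V k) = 0.

Definition dissip (t : R) : R := \sum_(k < 3) \sum_(j < 3) sq mu (cutt R0 t (Du k j)).

Lemma dissip_ge0 t : 0 <= dissip t.
Proof. by apply: sumr_ge0 => k _; apply: sumr_ge0 => j _; exact: sq_ge0. Qed.

Lemma dissip_mono s t : s <= t -> dissip s <= dissip t.
Proof.
move=> st; apply: ler_sum => k _; apply: ler_sum => j _; apply: sq_le.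
- exact: cutt_L2.
- exact: cutt_L2.
- by move=> x; exact: cutt_mono.
Qed.

Lemma dissip_ge t k j : sq mu (cutt R0 t (Du k j)) <= dissip t.
Proof.
rewrite /dissip (bigD1 k)//= (bigD1 j)//= -addrA lerDl addr_ge0//.
  by apply: sumr_ge0 => j' _; exact: sq_ge0.
by apply: sumr_ge0 => k' _; apply: sumr_ge0 => j' _; exact: sq_ge0.
Qed.

(** The cutoff is 1 over the square of half-side [s] and nonnegative elsewhere. *)
Lemma dissip_le_diss s dl : 0 < dl ->
  dissip s <= \sum_(k < 3) \sum_(j < 3) diss Du R0 s dl k j.
Proof.
move=> dl0; have d40 : 0 < dl / 4 by rewrite divr_gt0.
apply: ler_sum => k _; apply: ler_sum => j _.
have l1 := cutt_L2 R0 s (lDu k j).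
have l2 : L2 mu (ind R0 s dl (Du k j)) by exact: (cutt_L2 R0 (s + dl) (lDu k j)).
have mphi : measurable_fun setT (@hcut R s (dl / 4) : T3 R -> R).
  by apply: cont3_measurable; apply: smooth_continuous; exact: hcut_smooth.
have l3 := L2_bmul mphi (fun x => hcut_norm s (dl / 4) x) l2.
apply: le_Rintegral => //.
- exact: L2_sq_integrable.
- have := L2_mul_integrable l3 l2.
  by rewrite (_ : _ \o _ = EFin \o (fun x => hcut s (dl / 4) x * (ind R0 s dl (Du k j) x * ind R0 s dl (Du k j) x)))//;
    apply/funext => x /=; rewrite mulrA.
- move=> x _; rewrite /cutt indicE; have [xb|_] := boolP (x \in bx s _); last first.
    by rewrite mul0r expr0n/= mulr_ge0 ?hcut_ge0// -expr2 sqr_ge0.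
  move: xb; rewrite inE => xb; have [h1 h2 h3] := xb.
  rewrite mul1r hcut_eq1// mul1r /ind indicE mem_set ?mul1r ?expr2//.
  by apply: bx_sub xb => //; rewrite lerDl ltW.
Qed.

Variable C : R.
Hypothesis C1 : 1 <= C.
Hypothesis hC : forall s d, 0 < d ->
  (forall j x, `|partial j (@hcut R s d) x| <= C / d) /\
  (forall i j x, `|partial i (partial j (@hcut R s d)) x| <= C / d ^+ 2).

Lemma ring_set_measurable r : measurable (ring_set R0 r : set (T3 R)).
Proof.
have ma (f : T3 R -> measurableTypeR R) : measurable_fun setT f -> measurable [set x | `|f x| < r].
  move=> mf; have := mf measurableT _ (measurable_itv `]-r, r[); rewrite setTI.
  by congr (measurable _); apply/seteqP; split => x /=; rewrite in_itv/= ltr_norml.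
have -> : ring_set R0 r = bx (2 * r) (5 * (R0 + 1)) `\`
    ([set x | `|x.1.1| < r] `&` [set x | `|x.1.2| < r]) by [].
apply: measurableD; first exact: bx_measurable.
apply: measurableI; apply: ma.
  exact: (measurableT_comp measurable_fst measurable_fst).
exact: (measurableT_comp measurable_snd measurable_fst).
Qed.

Lemma mulr_sqr_le_cubes (a b : R) : 0 <= a -> 0 <= b -> a * (b * b) <= a ^+ 3 + b ^+ 3.
Proof.
move=> a0 b0; have [ab|/ltW ba] := leP a b.
  have : a * (b * b) <= b ^+ 3 by rewrite exprS expr2 ler_wpM2r// mulr_ge0.
  by move=> h; apply: (le_trans h); rewrite lerDr exprn_ge0.
have : a * (b * b) <= a ^+ 3 by rewrite exprS expr2 ler_wpM2l// ler_pM.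
by move=> h; apply: (le_trans h); rewrite lerDl exprn_ge0.
Qed.

Lemma dphi_ring r s dl j (x : R3 R) : 0 < r -> r <= s -> 0 < dl -> s + dl < 2 * r ->
  `|x.2| <= R0 -> partial j (@hcut R s (dl / 4)) x != 0 -> ring_set R0 r x.
Proof.
move=> r0 rs dl0 sr x3 nz; have d40 : 0 < dl / 4 by rewrite divr_gt0.
have [h1 h2] := partial_hcut_support d40 nz; split.
  by split; have := R00; lra.
move=> [k1 k2]; move: nz; rewrite partial_hcut coord3_i0 coord3_i1 derive1_cut1.
have z1 : `|x.1.1| <= s by lra.
have z2 : `|x.1.2| <= s by lra.
by rewrite (dcut1_eq0 d40 z1) (dcut1_eq0 d40 z2) !mulr0 addr0 eqxx.
Qed.

(** The derivative of the cutoff vanishes over the square of half-side [s], which contains the one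
    of half-side [r]; hence only the annulus contributes. The trilinear integrand is reduced to
    cubes by [mulr_sqr_le_cubes]. *)
Lemma flux_le r s dl N : 0 < r -> r <= s -> 0 < dl -> s + dl < 2 * r ->
  (forall k, (\int[mu]_x (\1_(ring_set R0 r) x * `|u k x| ^+ 3)%:E <= N%:E)%E) ->
  `|\sum_(k < 3) \sum_(j < 3) flux u s dl k j| <= 9 * (4 * C / dl * (N + N)).
Proof.
move=> r0 rs dl0 sr hN; have d40 : 0 < dl / 4 by rewrite divr_gt0.
have C0 : 0 < C by have := C1; lra.
have Cd : 0 <= 4 * C / dl by rewrite divr_ge0 ?mulr_ge0// ltW.
pose v k (x : T3 R) : R := \1_(ring_set R0 r) x * `|u k x| ^+ 3.
have v0 k x : 0 <= v k x by rewrite mulr_ge0 ?exprn_ge0.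
have mv k : measurable_fun setT (v k).
  apply: measurable_funM; first exact: measurable_indic (ring_set_measurable r).
  by apply: measurable_funX; apply: measurableT_comp => //; exact: (lu k).1.
have iv k : itg mu (v k).
  apply/integrableP; split; first exact/measurable_EFinP.
  apply: le_lt_trans (ltry N); apply: le_trans (hN k); rewrite le_eqVlt; apply/orP; left; apply/eqP.
  by apply: eq_integral => x _; rewrite /= ger0_norm.
have Nv k : \int[mu]_x v k x <= N.
  by rewrite -lee_fin /Rintegral fineK; [exact: hN|exact: (integrable_fin_num measurableT (iv k))].
apply: sum33_le => k j.
pose F x := u j x * partial j (@hcut R s (dl / 4)) x * (u k x * u k x).
have Fle x : `|F x| <= 4 * C / dl * (v j x + v k x).
  have [F0|nz] := eqVneq (F x) 0; first by rewrite F0 normr0 mulr_ge0// addr_ge0.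
  have [uj pj] : u j x != 0 /\ partial j (@hcut R s (dl / 4)) x != 0.
    by move: nz; rewrite /F !mulf_eq0 !negb_or -!andbA => /and3P[].
  have x3 : `|x.2| <= R0 by rewrite leNgt; apply/negP => /(u0 j) h; rewrite h eqxx in uj.
  have xr := dphi_ring r0 rs dl0 sr x3 pj.
  have hp := (hC s d40).1 j x; rewrite invf_div in hp.
  rewrite /v indicE mem_set// !mul1r /F !normrM.
  have -> : `|u j x| * `|partial j (hcut s (dl / 4)) x| * (`|u k x| * `|u k x|) =
    `|partial j (hcut s (dl / 4)) x| * (`|u j x| * (`|u k x| * `|u k x|)) by ring.
  apply: ler_pM => //; [by rewrite (_ : 4 * C / dl = C * (4 / dl))//; ring|].
  exact: mulr_sqr_le_cubes.
have mF : measurable_fun setT (F : T3 R -> R).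
  apply: measurable_funM; last by apply: measurable_funM; exact: (lu k).1.
  apply: measurable_funM; first exact: (lu j).1.
  by apply: cont3_measurable; apply: smooth_continuous; apply: smooth_partial; exact: hcut_smooth.
have iG : itg mu (fun x => 4 * C / dl * (v j x + v k x)) by apply: itg_scale; exact: itg_add.
have iF : itg mu F.
  apply: (@le_integrable _ _ _ mu setT measurableT _ (EFin \o (fun x => 4 * C / dl * (v j x + v k x)))) => //.
    exact/measurable_EFinP.
  move=> x _; rewrite /= lee_fin; apply: le_trans (Fle x) _; exact: ler_norm.
apply: (@le_trans _ _ (\int[mu]_x `|F x|)); first exact: le_normr_Rintegral.
apply: (@le_trans _ _ (\int[mu]_x (4 * C / dl * (v j x + v k x)))).
  by apply: le_Rintegral => //; exact: (integrable_norm iF).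
rewrite int_scale; last exact: itg_add.
by rewrite int_add// ler_wpM2l// lerD.
Qed.

Lemma collect_terms (X ci c' C' g1 g2 g3 g4 y1 y2 y3 y4 y5 y6 : R) : 0 < ci -> 0 < c' -> 0 < C' ->
  y1 <= g1 -> y2 <= g2 -> y3 <= g3 -> y4 <= g4 -> 0 <= y1 -> 0 <= y2 -> 0 <= y3 -> 0 <= y4 ->
  0 <= y5 -> 0 <= y6 ->
  2^-1 * (72 * C' * y1) + (X + y2 * ci + c' * (y2 + y3 + y4 + y5 + y6)) <=
  X + (ci + c' + 36 * C') * (g1 + g2 + g3 + g4 + y5 + y6).
Proof.
move=> ci0 c'0 C'0 h1 h2 h3 h4 p1 p2 p3 p4 p5 p6.
have -> : 2^-1 * (72 * C' * y1) = 36 * C' * y1 by field.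
have k (c y g : R) : 0 < c -> y <= g -> c * y <= c * g by move=> ? ?; rewrite ler_wpM2l// ltW.
have q (c y : R) : 0 < c -> 0 <= y -> 0 <= c * y by move=> ? ?; rewrite mulr_ge0// ltW.
have D0 : 0 < 36 * C' by rewrite mulr_gt0 ?ltr0n.
move: (36 * C') D0 => D D0.
have r1 : 0 <= g1 := le_trans p1 h1; have r2 : 0 <= g2 := le_trans p2 h2.
have r3 : 0 <= g3 := le_trans p3 h3; have r4 : 0 <= g4 := le_trans p4 h4.
have := k _ _ _ D0 h1; have := k _ _ _ ci0 h2; have := k _ _ _ c'0 h2; have := k _ _ _ c'0 h3.
have := k _ _ _ c'0 h4.
have := q _ _ ci0 r1; have := q _ _ c'0 r1; have := q _ _ D0 r2; have := q _ _ ci0 r3.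
have := q _ _ D0 r3; have := q _ _ ci0 r4; have := q _ _ D0 r4; have := q _ _ ci0 p5; have := q _ _ D0 p5.
have := q _ _ ci0 p6; have := q _ _ D0 p6.
rewrite !mulrDl !mulrDr [y2 * ci]mulrC; lra.
Qed.

(** [local_estimate], with the averaging length tuned to absorb the fraction [1 / c] of [B ^ 2], is
    the recursive inequality required by [iteration]; the flux enters through [N] alone. *)
Lemma dissipation_decay : exists K, 0 < K /\ forall r A N, 1 <= r -> 0 < A -> 0 <= N ->
  (forall k, sq mu (cutt R0 (2 * r) (u k)) <= A ^+ 2) ->
  (forall k, (\int[mu]_x (\1_(ring_set R0 r) x * `|u k x| ^+ 3)%:E <= N%:E)%E) ->
  dissip r <= K * (N * r ^+ 7 + A ^+ 2 * r ^+ 6 + A ^+ 2 * r ^+ 4 + A ^+ 4 * r ^+ 4 + A ^+ 6 + A ^+ 10)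
    / r ^+ 8.
Proof.
have [c0 [c00 hc0]] := err0_le R00 C1.
pose c : R := 2 * 2 ^+ 8.
have c0_ : 0 < c by rewrite mulr_gt0// exprn_gt0.
have ci0 : 0 < c^-1 by rewrite invr_gt0.
have [c' [c'0 hc']] := choose_averaging c00 ci0.
have C0 : 0 < C by have := C1; lra.
pose K := c^-1 + c' + 36 * C.
have K0 : 0 < K by rewrite !addr_gt0// mulr_gt0// ltr0n.
exists (c * K); split; first exact: mulr_gt0.
move=> r A N r1 A0 N0 hA hN; have r0 : 0 < r by lra.
pose G := N * r ^+ 7 + A ^+ 2 * r ^+ 6 + A ^+ 2 * r ^+ 4 + A ^+ 4 * r ^+ 4 + A ^+ 6 + A ^+ 10.
have G0 : 0 <= G by rewrite /G !addr_ge0// ?mulr_ge0 ?exprn_ge0// ltW.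
rewrite -[c * K * _]mulrA.
apply: (iteration (M := dissip (2 * r))) => //; [exact: dissip_ge0|by rewrite mulr_ge0// ltW| |].
  by move=> s /andP[_ /ltW]; exact: dissip_mono.
move=> s t rs st t2; pose d := t - s.
have d0 : 0 < d by rewrite subr_gt0.
have std : s + d = t by rewrite /d addrC subrK.
have dr : d <= r by rewrite /d; lra.
(* Adding [A ^ 2 / d ^ 2] to the dissipation makes [B] positive and gives [A / d <= B], at the price
   of a term of a kind already present in [G]. *)
pose D := dissip t + A ^+ 2 / d ^+ 2.
have A2d : 0 < A ^+ 2 / d ^+ 2 by rewrite divr_gt0// exprn_gt0.
have D0 : 0 < D by rewrite ltr_wpDl// dissip_ge0.
pose B := Num.sqrt D.
have B0 : 0 < B by rewrite sqrtr_gt0.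
have B2 : B ^+ 2 = D by rewrite sqr_sqrtr// ltW.
have [h [Q [h0 h8 Q0 QE hh]]] := hc' A B d A0 B0 d0.
have AB : A / d <= B.
  rewrite -(ler_pXn2r (n := 2))// ?nnegrE ?divr_ge0 ?(ltW A0) ?(ltW d0) ?(ltW B0)//.
  by rewrite B2 expr_div_n lerDr dissip_ge0.
have s0 : 0 <= s by lra.
have hu k : le2 mu (ind R0 s d (u k)) A.
  have E : ind R0 s d (u k) = cutt R0 t (u k) by rewrite /ind /cutt std.
  rewrite E; split; [exact: cutt_L2|exact: ltW|]; apply: le_trans (hA k).
  by apply: sq_le; [exact: cutt_L2|exact: cutt_L2|move=> x; apply: cutt_mono; exact: ltW].
have hDu k j : le2 mu (ind R0 s d (Du k j)) B.
  have E : ind R0 s d (Du k j) = cutt R0 t (Du k j) by rewrite /ind /cutt std.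
  rewrite E; split; [exact: cutt_L2|exact: ltW|]; rewrite B2.
  by apply: le_trans (dissip_ge t k j) _; rewrite lerDl ltW.
have QE' : A * B ^+ 3 <= Q ^+ 4 by rewrite QE.
have main := local_estimate lu lDu wu du u0 R00 Heq C1 hC s0 d0 A0 B0 AB Q0 QE' hu hDu h0 h8.
have hflux := flux_le r0 rs d0 (_ : s + d < 2 * r) hN; rewrite std in hflux; have {}hflux := hflux t2.
apply: le_trans (dissip_le_diss s d0) _; apply: le_trans main _.
have herr := le_trans (hc0 d A B Q h d0 A0 B0 h0) hh.
apply: le_trans (lerD (ler_wpM2l _ hflux) herr) _ => //.
(* Since [d <= r], a denominator [d ^ (8 - n)] may be replaced by [d ^ 8] with a compensating
   [r ^ n], so that all terms carry the same power. *)
have di n m : (n <= 8)%N -> 0 <= m -> m / d ^+ (8 - n) <= m * r ^+ n / d ^+ 8.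
  move=> n8 m0; rewrite ler_pdivrMr ?exprn_gt0//.
  have -> : m * r ^+ n / d ^+ 8 * d ^+ (8 - n) = m * (r ^+ n / d ^+ n).
    rewrite -{1}(subnK n8) exprD; field; by rewrite !expf_neq0 ?gt_eqF.
  by rewrite ler_peMr// ler_pdivlMr ?exprn_gt0// mul1r lerXn2r// ?nnegrE ltW.
have A_ n : 0 <= A ^+ n by rewrite exprn_ge0// ltW.
have d1 := di 7%N _ isT N0; have d2 := di 6%N _ isT (A_ 2%N); have d3 := di 4%N _ isT (A_ 2%N).
have d4 := di 4%N _ isT (A_ 4%N); have d5 := di 0%N _ isT (A_ 6%N); have d6 := di 0%N _ isT (A_ 10%N).
have E1 : d ^+ (8 - 7) = d by [].
have E2 : d ^+ (8 - 6) = d ^+ 2 by [].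
have E3 : d ^+ (8 - 4) = d ^+ 4 by [].
have E4 : d ^+ (8 - 0) = d ^+ 8 by [].
rewrite E1 in d1; rewrite E2 in d2; rewrite E3 in d3 d4; rewrite E4 !expr0 !mulr1 in d5 d6.
rewrite -/d in d1 d2 d3 d4 d5 d6 *.
have EG : K * G / d ^+ 8 = K * (N * r ^+ 7 / d ^+ 8 + A ^+ 2 * r ^+ 6 / d ^+ 8 + A ^+ 2 * r ^+ 4 / d ^+ 8
    + A ^+ 4 * r ^+ 4 / d ^+ 8 + A ^+ 6 / d ^+ 8 + A ^+ 10 / d ^+ 8) by rewrite /G; ring.
have nn m n : 0 <= m -> 0 <= m / d ^+ n by move=> ?; rewrite divr_ge0// exprn_ge0// ltW.
have EN : 9 * (4 * C / d * (N + N)) = 72 * C * (N / d) by ring.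
have p1 : 0 <= N / d by rewrite divr_ge0// ltW.
rewrite -/d EG EN B2 /D [c^-1 * _]mulrC [(dissip t + _) / c]mulrDl /K.
have T := collect_terms (dissip t / c) ci0 c'0 C0 d1 d2 d3 d4 p1 (nn _ 2%N (A_ 2%N)) (nn _ 4%N (A_ 2%N))
  (nn _ 4%N (A_ 4%N)) (nn _ 8%N (A_ 6%N)) (nn _ 8%N (A_ 10%N)).
exact: T.
Qed.

End Decay.

(** * Growth and decay from the mixed norm *)

Section Powers.
Variable R : realType.
Implicit Types a k q r mu lam : R.

Lemma powR3 a : 0 <= a -> a `^ 3 = a ^+ 3.
Proof. by move=> a0; rewrite powR_mulrn. Qed.

Lemma powR_anti a k s : 0 < k -> k <= a -> s <= 0 -> a `^ s <= k `^ s.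
Proof.
move=> k0 ka s0; have a0 : 0 < a by apply: lt_le_trans ka.
rewrite -[s]opprK (powRN a) (powRN k) lef_pV2 ?posrE ?powR_gt0//.
have s1 : 0 <= - s by rewrite oppr_ge0.
by apply: (ge0_ler_powR s1); rewrite ?nnegrE// ltW.
Qed.

Lemma powR_cancel a q : 0 < a -> a `^ (3 - q) * a `^ q = a ^+ 3.
Proof.
move=> a0; rewrite -powRD; last by apply/implyP => _; exact: lt0r_neq0.
by rewrite subrK powR3// ltW.
Qed.

(** Above the height [k] the factor [a ^ (3 - q)] is at most [k ^ (3 - q)], since [3 <= q]. With [k]
    left free to be optimised, this takes the place of Hölder's inequality. *)
Lemma cube_le a k q : 0 <= a -> 0 < k -> 3 <= q -> a ^+ 3 <= k ^+ 3 + k `^ (3 - q) * a `^ q.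
Proof.
move=> a0 k0 q3; have [ak|ka] := leP a k.
  have h : a ^+ 3 <= k ^+ 3 by apply: lerXn2r => //; rewrite nnegrE ltW.
  by apply: (le_trans h); rewrite lerDl mulr_ge0// powR_ge0.
have a1 : 0 < a by exact: lt_trans ka.
rewrite -(powR_cancel q a1); apply: (@le_trans _ _ (k `^ (3 - q) * a `^ q)).
  by rewrite ler_wpM2r ?powR_ge0// powR_anti// ?subr_le0// ltW.
by rewrite lerDr exprn_ge0// ltW.
Qed.

Lemma max_cube_le y mu r : 0 <= y -> 0 < mu -> 3 <= r ->
  Num.max y mu ^+ 3 <= mu ^+ 3 + mu `^ (3 - r) * y `^ r.
Proof.
move=> y0 mu0 r3; have [ym|ym] := leP y mu.
  by rewrite lerDl mulr_ge0// powR_ge0.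
exact: cube_le.
Qed.

(* The truncation height [lam / n] balances the two terms of [cube_le] on a square of
   side of order [n ^+ 3]: both are of order [n ^+ 3] precisely because [3 * al = 6 - q]. *)
Lemma slice_arithmetic (n : R) lam q al i : 1 <= n -> 0 < lam -> 3 * al = 6 - q ->
  0 <= i -> i <= lam `^ q ->
  (lam / n) ^+ 3 * (4 * n ^+ 3) ^+ 2 + (lam / n) `^ (3 - q) * ((5 * n ^+ 3) `^ al * i) <=
  (16 + 5 `^ al) * n ^+ 3 * lam ^+ 3.
Proof.
move=> n1 l0 alE i0 il; have n0 : 0 < n by lra.
have -> : (lam / n) ^+ 3 * (4 * n ^+ 3) ^+ 2 = 16 * n ^+ 3 * lam ^+ 3 by field; rewrite gt_eqF.
have -> : (lam / n) `^ (3 - q) = lam `^ (3 - q) * n `^ (q - 3).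
  rewrite powRM ?invr_ge0 ?(ltW l0) ?(ltW n0)//; congr (_ * _).
  rewrite -[n^-1]powR_inv1 ?(ltW n0)// -powRrM; congr (_ `^ _); ring.
have -> : (5 * n ^+ 3) `^ al = 5 `^ al * n `^ (6 - q).
  by rewrite powRM ?exprn_ge0 ?(ltW n0)// -powR3 ?(ltW n0)// -powRrM alE.
have E : n `^ (q - 3) * n `^ (6 - q) = n ^+ 3.
  rewrite -powRD; last by apply/implyP => _; exact: lt0r_neq0.
  by rewrite -powR3 ?(ltW n0)//; congr (_ `^ _); ring.
have -> : lam `^ (3 - q) * n `^ (q - 3) * (5 `^ al * n `^ (6 - q) * i) =
  5 `^ al * (n `^ (q - 3) * n `^ (6 - q)) * (lam `^ (3 - q) * i) by ring.
rewrite E !mulrDl lerD2l ler_wpM2l ?mulr_ge0 ?powR_ge0 ?exprn_ge0 ?(ltW n0)//.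
by rewrite -(powR_cancel q l0) ler_wpM2l ?powR_ge0.
Qed.

End Powers.

(** * From the mixed norm to cubes *)

Section MixedNorm.
Variable R : realType.
Local Notation mu := (@leb3 R).
Variables (q r al H : R) (f : R3 R -> R).
Hypotheses (q3 : 3 <= q) (r3 : 3 <= r) (al0 : 0 <= al) (alE : 3 * al = 6 - q) (H0 : 0 < H).
Hypothesis mf : measurable_fun setT (f : T3 R -> R).

Let w1 : R2 R -> R := horizontal_weight al.

Lemma norm2_le (p : R2 R) : norm2 p <= `|p.1| + `|p.2|.
Proof.
rewrite /norm2 -[leRHS]ger0_norm ?addr_ge0// -sqrtr_sqr ler_wsqrtr//.
rewrite -(real_normK (num_real p.1)) -(real_normK (num_real p.2)) sqrrD.
by rewrite -addrA lerD2l lerDr mulrn_wge0// mulr_ge0.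
Qed.

(** The factor 5 comes from [1 + 2 rho + 2 rho <= 5 rho]; the weight is nonincreasing in the norm
    because [0 <= al]. *)
Lemma weight_ge (p : R2 R) rho : 1 <= rho -> `|p.1| <= 2 * rho -> `|p.2| <= 2 * rho ->
  1 <= (5 * rho) `^ al * w1 p.
Proof.
move=> r1 h1 h2; have n0 : 0 <= norm2 p by exact: sqrtr_ge0.
have h : 1 + norm2 p <= 5 * rho by have := norm2_le p; lra.
have p0 : 0 < 1 + norm2 p by lra.
have : (5 * rho) `^ (- al) <= w1 p by apply: powR_anti => //; rewrite oppr_le0.
have h5 : 0 < (5 * rho) `^ al by rewrite powR_gt0//; lra.
rewrite powRN => k; apply: (@le_trans _ _ ((5 * rho) `^ al * ((5 * rho) `^ al)^-1)).
  by rewrite divff// lt0r_neq0.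
by apply: ler_wpM2l => //; exact: ltW.
Qed.

Lemma measurable_w1 : measurable_fun setT (w1 : T2 R -> R).
Proof.
apply: (measurableT_comp (measurable_powR _)); apply: measurable_funD => //.
have ms : measurable_fun setT (Num.sqrt : R -> R).
  by apply: continuous_measurable_fun => x; exact: sqrt_continuous.
apply: (measurableT_comp ms); apply: measurable_funD; apply: measurable_funX.
  exact: measurable_fst.
exact: measurable_snd.
Qed.

Definition wint (S : set (T2 R)) (z : R) : \bar R :=
  (\int[@leb2 R]_p (\1_S p * (`|f (p, z)| `^ q * w1 p))%:E)%E.

Section OneSet.
Variable S : set (T2 R).
Hypothesis mS : measurable S.

Let F (x : T3 R) : \bar R := (\1_S x.1 * (`|f x| `^ q * w1 x.1))%:E.

Lemma measurable_wintegrand : measurable_fun setT F.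
Proof.
apply/measurable_EFinP; apply: measurable_funM.
  exact: (measurableT_comp (measurable_indic mS) measurable_fst).
apply: measurable_funM; last exact: (measurableT_comp measurable_w1 measurable_fst).
by apply: (measurableT_comp (measurable_powR _)); exact: measurableT_comp.
Qed.

Lemma wintegrand_ge0 x : (0 <= F x)%E.
Proof. by rewrite lee_fin !mulr_ge0// ?powR_ge0. Qed.

Lemma measurable_wint : measurable_fun setT (wint S : measurableTypeR R -> \bar R).
Proof.
exact: (@measurable_fun_fubini_tonelli_G _ _ _ _ _ (@leb2 R) F measurable_wintegrand wintegrand_ge0).
Qed.

Lemma wint_ge0 z : (0 <= wint S z)%E.
Proof. by apply: integral_ge0 => p _; exact: (wintegrand_ge0 (p, z)). Qed.

(** [n] is the cube root of the scale: the truncation height [lam / n] and the resulting growth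
    rates are then integral powers of [n]. *)
Variable n : R.
Hypothesis n1 : 1 <= n.
Hypothesis Sn : forall p, S p -> `|p.1| <= 2 * n ^+ 3 /\ `|p.2| <= 2 * n ^+ 3.

Let n30 : 0 <= n ^+ 3. Proof. by rewrite exprn_ge0//; have := n1; lra. Qed.

Lemma leb2_S_le : (@leb2 R S <= ((4 * n ^+ 3) ^+ 2)%:E)%E.
Proof.
pose b := 2 * n ^+ 3.
have b0 : 0 <= b by rewrite mulr_ge0.
have sub : S `<=` `[- b, b]%classic `*` `[- b, b]%classic.
  by move=> p /Sn[h1 h2]; split; rewrite /= in_itv/= -ler_norml.
apply: (@le_trans _ _ (@leb2 R (`[- b, b]%classic `*` `[- b, b]%classic))).
  by apply: le_measure => //; rewrite inE//; apply: measurableX; exact: measurable_itv.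
have e : (@leb R `[(- b)%R, b]%classic = (4 * n ^+ 3)%:E)%E.
  rewrite lebesgue_measure_itv/= lte_fin; case: ltP => [_|h].
    by rewrite -EFinD; congr (_%:E); rewrite /b; ring.
  have bz : b = 0 by lra.
  by have -> : 4 * n ^+ 3 = 0 by move: bz; rewrite /b => ?; lra.
rewrite /leb2 product_measure1E; [|exact: measurable_itv|exact: measurable_itv].
by rewrite expr2 EFinM; apply: lee_pmul => //; rewrite -e.
Qed.

Let mslice z : measurable_fun setT (fun p : T2 R => f (p, z)).
Proof. exact: (measurable_pairr z mf). Qed.

Let mI z : measurable_fun setT (fun p => (\1_S p * (`|f (p, z)| `^ q * w1 p))%:E).
Proof. exact: (measurable_pairr z measurable_wintegrand). Qed.

(** [y] is the weighted Lq norm of the slice and [lam] its maximum with the floor [m]. Truncating at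
    height [lam / n] yields [n ^ 3 lam ^ 3], and [max_cube_le] then splits [lam ^ 3] into the floor
    and the power [y ^ r] occurring in the mixed norm. The floor keeps [lam] positive; an infinite
    slice makes the right-hand side infinite. *)
Lemma slice_cube_le m z : 0 < m -> (\int[@leb2 R]_p (\1_S p * `|f (p, z)| ^+ 3)%:E <=
  ((16 + 5 `^ al) * n ^+ 3)%:E * ((m ^+ 3)%:E + (m `^ (3 - r))%:E * (wint S z) `^ (r / q)))%E.
Proof.
move=> m0; have n0 : 0 < n by have := n1; lra.
have q0 : 0 < q by have := q3; lra.
have r0 : 0 < r by have := r3; lra.
have c0 : 0 < (16 + 5 `^ al) * n ^+ 3 by rewrite mulr_gt0 ?exprn_gt0// addr_gt0 ?powR_gt0.
have I0 := wint_ge0 z.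
case E : (wint S z) => [i| |]; last by move: I0; rewrite E.
  rewrite E lee_fin in I0.
  rewrite -[leRHS]/(((16 + 5 `^ al) * n ^+ 3 * (m ^+ 3 + m `^ (3 - r) * i `^ (r / q)))%:E).
  pose y := i `^ q^-1; have y0 : 0 <= y by exact: powR_ge0.
  have yr : y `^ r = i `^ (r / q) by rewrite -powRrM mulrC.
  pose lam := Num.max y m.
  have l0 : 0 < lam by rewrite lt_max m0 orbT.
  have il : i <= lam `^ q.
    have -> : i = y `^ q by rewrite -powRrM mulVf ?gt_eqF// powRr1.
    by apply: ge0_ler_powR; rewrite ?nnegrE ?(ltW q0) ?(ltW l0)// le_max lexx.
  pose k := lam / n; have k0 : 0 < k by rewrite divr_gt0.
  pose c1 := k ^+ 3; pose c2 := k `^ (3 - q) * (5 * n ^+ 3) `^ al.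
  have c10 : 0 <= c1 by rewrite exprn_ge0// ltW.
  have c20 : 0 <= c2 by rewrite mulr_ge0 ?powR_ge0.
  apply: (@le_trans _ _ (c1%:E * (\int[@leb2 R]_p (\1_S p)%:E) + c2%:E * wint S z)%E).
    rewrite -ge0_integralZl_EFin//; last exact/measurable_EFinP/measurable_indic.
    rewrite -(ge0_integralZl_EFin (@leb2 R) measurableT _ (mI z) c20); last first.
      by move=> p _; exact: (wintegrand_ge0 (p, z)).
    rewrite -ge0_integralD//; last 4 first.
    - by move=> p _; rewrite mule_ge0// lee_fin.
    - by apply: measurable_funeM; exact/measurable_EFinP/measurable_indic.
    - by move=> p _; apply: mule_ge0 => //; exact: (wintegrand_ge0 (p, z)).
    - exact: (measurable_funeM _ (mI z)).
    apply: ge0_le_int.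
    - apply/measurable_EFinP; apply: measurable_funM; first exact: measurable_indic.
      by apply: measurable_funX; apply: measurableT_comp => //; exact: mslice.
    - apply: emeasurable_funD; last exact: (measurable_funeM _ (mI z)).
      by apply: measurable_funeM; exact/measurable_EFinP/measurable_indic.
    - by move=> p; rewrite lee_fin mulr_ge0 ?exprn_ge0.
    - move=> p; rewrite -!EFinM -EFinD lee_fin indicE.
      have [pS|_] := boolP (p \in S); last by rewrite !mul0r !mulr0 addr0.
      rewrite !mul1r mulr1; apply: le_trans (cube_le _ k0 q3) _ => //.
      rewrite lerD2l /c2 -mulrA ler_wpM2l ?powR_ge0//.
      have [h1 h2] := Sn (set_mem pS).
      have n31 : 1 <= n ^+ 3 by rewrite exprn_ege1.
      have := weight_ge n31 h1 h2.
      move: (w1 p) ((5 * n ^+ 3) `^ al) (powR_ge0 `|f (p, z)| q) => w v X0 hw.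
      by rewrite mulrCA -[leLHS]mulr1 ler_wpM2l.
  rewrite integral_indic// setIT E.
  apply: (@le_trans _ _ ((c1 * (4 * n ^+ 3) ^+ 2 + c2 * i)%:E)).
    rewrite EFinD; apply: leeD; last by rewrite EFinM.
    rewrite [leRHS]EFinM; apply: lee_pmul => //; exact: leb2_S_le.
  rewrite lee_fin /c1 /c2 -mulrA; apply: le_trans (slice_arithmetic n1 l0 alE I0 il) _.
  by rewrite ler_wpM2l ?(ltW c0)// -yr; exact: max_cube_le.
rewrite poweRyr; last by rewrite mulf_neq0 ?invr_eq0 ?gt_eqF.
by rewrite gt0_muley ?lte_fin ?powR_gt0// addey// gt0_muley ?lte_fin// leey.
Qed.

(** [slice_cube_le] is integrated over the heights [|z| <= H]. The floor term contributes [m ^ 3]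
    times the length of this bounded range, which is where confinement to a slab enters. *)
Lemma volume_cube_le m : 0 < m -> (\int[mu]_x (\1_(S `*` `[- H, H]) x * `|f x| ^+ 3)%:E <=
  ((16 + 5 `^ al) * n ^+ 3)%:E * ((m ^+ 3 * (2 * H))%:E +
    (m `^ (3 - r))%:E * \int[@leb R]_z (wint S z) `^ (r / q)))%E.
Proof.
move=> m0; have n0 : 0 < n by have := n1; lra.
have c0 : 0 <= (16 + 5 `^ al) * n ^+ 3 by rewrite mulr_ge0 ?addr_ge0 ?powR_ge0.
have mSH : measurable (S `*` `[- H, H]%classic : set (T3 R)).
  by apply: measurableX => //; exact: measurable_itv.
have mG : measurable_fun setT (fun x : T3 R => (\1_(S `*` `[- H, H]) x * `|f x| ^+ 3)%:E).
  apply/measurable_EFinP; apply: measurable_funM; first exact: measurable_indic.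
  by apply: measurable_funX; exact: measurableT_comp.
have G0 (x : T3 R) : (0 <= (\1_(S `*` `[- H, H]) x * `|f x| ^+ 3)%:E)%E.
  by rewrite lee_fin mulr_ge0 ?exprn_ge0.
rewrite [leLHS](fubini_tonelli2 (m1 := @leb2 R) (m2 := @leb R) _ mG G0) /fubini_G.
have mw : measurable_fun setT (fun z : measurableTypeR R => ((wint S z) `^ (r / q))%E).
  exact: (measurableT_comp (measurable_poweR _) measurable_wint).
have mi : measurable_fun setT (fun z : measurableTypeR R => (\1_(`[- H, H]) z)%:E : \bar R).
  by apply/measurable_EFinP/measurable_indic; exact: measurable_itv.
have m30 : 0 <= m ^+ 3 by rewrite exprn_ge0// ltW.
apply: (@le_trans _ _ (\int[@leb R]_z (((16 + 5 `^ al) * n ^+ 3)%:E *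
    ((m ^+ 3)%:E * (\1_(`[- H, H]) z)%:E + (m `^ (3 - r))%:E * (wint S z) `^ (r / q))))%E).
  apply: ge0_le_int.
  - exact: (@measurable_fun_fubini_tonelli_G _ _ _ _ _ (@leb2 R) _ mG G0).
  - apply: measurable_funeM; apply: emeasurable_funD; exact: measurable_funeM.
  - by move=> z; apply: integral_ge0 => p _; exact: G0.
  - move=> z; rewrite indicE; have [zH|zH] := boolP (z \in _).
      rewrite mule1; apply: le_trans (slice_cube_le z m0); apply: ge0_le_int.
      + exact: (measurable_pairr z mG).
      + apply/measurable_EFinP; apply: measurable_funM; first exact: measurable_indic.
        by apply: measurable_funX; apply: measurableT_comp => //; exact: mslice.
      + by move=> p; exact: G0.
      + move=> p; rewrite lee_fin ler_wpM2r ?exprn_ge0// !indicE.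
        have [|_] := boolP ((p, z) \in _); last by rewrite ler0n.
        by rewrite inE => -[/= pS _]; rewrite mem_set.
    rewrite integral0_eq => [|p _].
      by rewrite mule_ge0 ?lee_fin// adde_ge0// mule_ge0 ?poweR_ge0 ?lee_fin ?powR_ge0.
    rewrite indicE memNset ?mul0r// => -[_ /= h]; move: zH.
    by rewrite notin_setE; apply.
have Hint : (\int[@leb R]_z (\1_(`[- H, H]) z)%:E = (2 * H)%:E)%E.
  rewrite integral_indic// setIT.
  have e : (@leb R `[(- H)%R, H]%classic = (2 * H)%:E)%E.
    by rewrite lebesgue_measure_itv/= lte_fin gtrN// -EFinD opprK; congr (_%:E); ring.
  exact: e.
have p1 z : (0 <= (m ^+ 3)%:E * (\1_(`[- H, H]%classic) z)%:E :> \bar R)%E.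
  by rewrite mule_ge0 ?lee_fin.
have p2 z : (0 <= (m `^ (3 - r))%:E * (wint S z) `^ (r / q))%E.
  by rewrite mule_ge0 ?poweR_ge0 ?lee_fin ?powR_ge0.
rewrite (ge0_integralZl_EFin (@leb R) measurableT (fun z _ => adde_ge0 (p1 z) (p2 z)) _ c0); last first.
  by apply: emeasurable_funD; exact: measurable_funeM.
apply: lee_wpmul2l; rewrite ?lee_fin//.
rewrite (ge0_integralD (@leb R) measurableT (fun z _ => p1 z) (measurable_funeM _ mi) (fun z _ => p2 z) (measurable_funeM _ mw)).
apply: leeD.
  by rewrite (ge0_integralZl_EFin (@leb R) measurableT _ mi m30)// Hint EFinM.
rewrite (ge0_integralZl_EFin (@leb R) measurableT _ mw (powR_ge0 _ _))// => z _; exact: poweR_ge0.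
Qed.

End OneSet.
End MixedNorm.

(** * Smallness of the mixed norm far from the vertical axis *)

Section Tail.
Variable R : realType.
Local Notation mu := (@leb3 R).

Lemma cvg0_lt (x : nat -> \bar R) (e : R) : 0 < e -> (x @ \oo --> 0)%E ->
  \forall n \near \oo, (x n < e%:E)%E.
Proof.
move=> e0 cv; have := cv [set y | (y < e%:E)%E]; apply.
by apply: (@open_ereal_lt' _ 0 e%:E); rewrite lte_fin.
Qed.

Lemma poweR_cvg0 (x : nat -> \bar R) s : 0 < s -> (forall n, 0 <= x n)%E -> (x @ \oo --> 0)%E ->
  ((fun n => x n `^ s) @ \oo --> 0)%E.
Proof.
move=> s0 x0 cv.
have si : 0 < s^-1 by rewrite invr_gt0.
apply/fine_cvgP; split.
  have := cvg0_lt ltr01 cv; apply: filterS => n h.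
  by apply: fin_num_poweR; rewrite ge0_fin_numE//; exact: lt_trans h (ltry _).
apply/cvgrPdist_le => e e0 /=.
have d0 : 0 < e `^ s^-1 by rewrite powR_gt0.
have := cvg0_lt d0 cv; apply: filterS => n h.
rewrite sub0r normrN fine_poweR ger0_norm ?powR_ge0//.
have -> : e = (e `^ s^-1) `^ s by rewrite -powRrM mulVf ?gt_eqF// powRr1// ltW.
apply: ge0_ler_powR; rewrite ?nnegrE ?(ltW s0) ?(ltW d0) ?fine_ge0//.
rewrite -lee_fin fineK; first exact: ltW.
by rewrite ge0_fin_numE//; exact: lt_trans h (ltry _).
Qed.

Variables (q r al : R) (f : R3 R -> R).
Hypotheses (q3 : 3 <= q) (r3 : 3 <= r).
Hypothesis mf : measurable_fun setT (f : T3 R -> R).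
Hypothesis fJ : (\int[@leb R]_z (wint q al f setT z) `^ (r / q) < +oo)%E.

Let rq0 : 0 < r / q. Proof. by have := q3; have := r3; move=> ? ?; rewrite divr_gt0//; lra. Qed.

Lemma measurable_wslice (S : set (T2 R)) z : measurable S -> measurable_fun setT
  (fun p : T2 R => (\1_S p * (`|f (p, z)| `^ q * horizontal_weight al p))%:E).
Proof. by move=> mS; exact: (measurable_pairr z (measurable_wintegrand q al mf mS)). Qed.

Lemma wint_mono (S S' : set (T2 R)) z : measurable S -> measurable S' -> S `<=` S' ->
  (wint q al f S z <= wint q al f S' z)%E.
Proof.
move=> mS mS' SS'; apply: ge0_le_int.
- exact: measurable_wslice.
- exact: measurable_wslice.
- by move=> p; exact: (wintegrand_ge0 q al f S (p, z)).
- move=> p; rewrite lee_fin ler_wpM2r ?mulr_ge0 ?powR_ge0// !indicE.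
  have [pS|_] := boolP (p \in S); last by rewrite ler0n.
  by rewrite mem_set//; apply: SS'; rewrite inE in pS.
Qed.

Lemma wint_pow_mono (S S' : set (T2 R)) z : measurable S -> measurable S' -> S `<=` S' ->
  ((wint q al f S z) `^ (r / q) <= (wint q al f S' z) `^ (r / q))%E.
Proof.
move=> mS mS' SS'; apply: (gt0_ler_poweR (ltW rq0)); last exact: wint_mono.
- by rewrite in_itv/= wint_ge0 leey.
- by rewrite in_itv/= wint_ge0 leey.
Qed.

Lemma measurable_wint_pow (S : set (T2 R)) : measurable S ->
  measurable_fun setT (fun z : measurableTypeR R => ((wint q al f S z) `^ (r / q))%E).
Proof. by move=> mS; exact: (measurableT_comp (measurable_poweR _) (measurable_wint q al mf mS)). Qed.

Definition outer (c : R) : set (T2 R) := [set p | ~ (`|p.1| < c /\ `|p.2| < c)].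

Lemma measurable_abs_lt d (T : measurableType d) (g : T -> measurableTypeR R) c :
  measurable_fun setT g -> measurable [set x | `|g x| < c].
Proof.
move=> mg; have := mg measurableT _ (measurable_itv `]-c, c[); rewrite setTI.
by congr (measurable _); apply/seteqP; split => x /=; rewrite in_itv/= ltr_norml.
Qed.

Lemma measurable_outer c : measurable (outer c).
Proof.
have -> : outer c = ~` ([set p | `|p.1| < c] `&` [set p | `|p.2| < c]) by [].
apply: measurableC; apply: measurableI; apply: measurable_abs_lt.
  exact: measurable_fst.
exact: measurable_snd.
Qed.

Lemma near_inner (p : R2 R) : \forall n \near \oo, ~ outer (n%:R ^+ 3) p.
Proof.
near=> n; move=> /=; apply; pose b := `|p.1| + `|p.2| + 1.
have hb : b <= n%:R by near: n; exact: nbhs_infty_ger.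
have p1 := normr_ge0 p.1; have p2 := normr_ge0 p.2.
have b1 : 1 <= n%:R :> R by apply: le_trans hb; rewrite /b; lra.
have hn : n%:R <= n%:R ^+ 3 :> R by rewrite ler_eXnr.
by split; apply: lt_le_trans (le_trans hb hn); rewrite /b; lra.
Unshelve. all: by end_near. Qed.

Lemma wint_outer_cvg z : (wint q al f setT z < +oo)%E ->
  ((fun n : nat => wint q al f (outer (n%:R ^+ 3)) z) @ \oo --> 0)%E.
Proof.
move=> fin.
pose X (p : T2 R) := `|f (p, z)| `^ q * horizontal_weight al p.
have X0 p : 0 <= X p by rewrite mulr_ge0 ?powR_ge0.
have iX : (@leb2 R).-integrable setT (EFin \o X).
  have E p : (X p)%:E = (\1_setT p * X p)%:E :> \bar R by rewrite indicT mul1r.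
  apply/integrableP; split.
    rewrite (_ : _ \o _ = fun p => (\1_setT p * X p)%:E); last by apply/funext => p /=; rewrite E.
    exact: (measurable_wslice z measurableT).
  under eq_integral do rewrite /= ger0_norm//.
  by under eq_integral do rewrite E.
have := @dominated_cvg _ _ _ (@leb2 R) setT measurableT
  (fun n p => (\1_(outer (n%:R ^+ 3)) p * X p)%:E) (fun=> 0%E) (EFin \o X) _ _ _ iX _.
rewrite integral0; apply.
- by move=> n; exact: (measurable_wslice z (measurable_outer _)).
- move=> p _; apply: cvg_near_cst; have := near_inner p; apply: filterS => n h.
  by rewrite indicE memNset// mul0r.
- by [].
- move=> n p _; rewrite /= lee_fin ger0_norm; last by rewrite mulr_ge0.
  by rewrite ler_piMl// indicE lern1 leq_b1.
Qed.

(** Dominated convergence is used twice: on each plane where the weighted integral is finite, which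
    is almost every plane, and then in the vertical variable. *)
Lemma tail_small (e : R) : 0 < e -> \forall n \near \oo,
  (\int[@leb R]_z (wint q al f (outer (n%:R ^+ 3)) z) `^ (r / q) < e%:E)%E.
Proof.
move=> e0; apply: cvg0_lt => //.
pose g z := ((wint q al f setT z) `^ (r / q))%E.
have g0 z : (0 <= g z)%E by exact: poweR_ge0.
have ig : (@leb R).-integrable setT g.
  apply/integrableP; split; first exact: (measurable_wint_pow measurableT).
  by under eq_integral do rewrite gee0_abs//.
have := @dominated_convergence _ _ _ (@leb R) setT measurableT
  (fun n z => ((wint q al f (outer (n%:R ^+ 3)) z) `^ (r / q))%E) (fun=> 0%E) g _ _ _ ig _.
rewrite integral0 => H; apply: (fun h1 h2 h3 h4 => let: And3 _ _ p := H h1 h2 h3 h4 in p).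
- by move=> n; apply: measurable_wint_pow; exact: measurable_outer.
- exact: measurable_cst.
- have := integrable_ae measurableT ig; apply: filterS => z /(_ I) gz _.
  apply: poweR_cvg0 => //; first by move=> n; exact: wint_ge0.
  apply: wint_outer_cvg; apply: (@lty_poweRy _ _ (r / q)); first by rewrite gt_eqF.
  by move: gz; rewrite ge0_fin_numE.
- apply: nearW => z n _; rewrite gee0_abs ?poweR_ge0//.
  by apply: wint_pow_mono => //; exact: measurable_outer.
Qed.

End Tail.

(** * Size of the L2 norm on large boxes and of the L3 norm on annuli *)

Section Growth.
Variable R : realType.
Local Notation mu := (@leb3 R).
Variables (q r al R0 : R) (f : R3 R -> R).
Hypotheses (q3 : 3 <= q) (r3 : 3 <= r) (al0 : 0 <= al) (alE : 3 * al = 6 - q) (R00 : 0 < R0).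
Hypothesis mf : measurable_fun setT (f : T3 R -> R).
Hypothesis lf : loc2 f.
Hypothesis fJ : (\int[@leb R]_z (wint q al f setT z) `^ (r / q) < +oo)%E.

Let H := 5 * (R0 + 1).
Let H0 : 0 < H. Proof. by rewrite /H; have := R00; lra. Qed.
Let c := 16 + 5 `^ al.
Let c0 : 0 < c. Proof. by rewrite addr_gt0 ?powR_gt0. Qed.

Let cH0 : 0 < c * (4 * H). Proof. by apply: mulr_gt0 => //; apply: mulr_gt0. Qed.

Definition square (a : R) : set (T2 R) := [set p | `|p.1| <= a /\ `|p.2| <= a].

Lemma measurable_square a : measurable (square a).
Proof.
rewrite (_ : square a = `[- a, a]%classic `*` `[- a, a]%classic).
  by apply: measurableX; exact: measurable_itv.
by apply/seteqP; split => -[x y] /=; rewrite /square/= !in_itv/= -!ler_norml.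
Qed.

Lemma bx_square a : bx a H = square a `*` `[- H, H]%classic.
Proof.
apply/seteqP; split => -[[x y] z].
  by move=> [/= h1 h2 h3]; split => //=; rewrite in_itv/= -ler_norml.
by move=> [[/= h1 h2]]; rewrite /= in_itv/= -ler_norml.
Qed.

(** The floor [m] is fixed first, small enough for its term to take half of [e]; the large factor
    [m ^ (3 - r)] it creates is then beaten by the tail, since the annulus lies in
    [outer (n ^ 3)]. *)
Lemma annulus_small (e : R) : 0 < e -> \forall n \near \oo,
  (\int[mu]_x (\1_(ring_set R0 (n%:R ^+ 3)) x * `|f x| ^+ 3)%:E <= (e * n%:R ^+ 3)%:E)%E.
Proof.
move=> e0.
pose m := Num.min 1 (e / (c * (4 * H))).
have m0 : 0 < m by rewrite lt_min ltr01 divr_gt0.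
have hm : c * (m ^+ 3 * (2 * H)) <= e / 2.
  have m1 : m <= 1 by rewrite ge_min lexx.
  have m3 : m ^+ 3 <= m by rewrite -[leRHS]expr1 ler_wiXn2l// ltW.
  have : m <= e / (c * (4 * H)) by rewrite ge_min lexx orbT.
  rewrite ler_pdivlMr// => hh.
  have : m ^+ 3 * (c * (4 * H)) <= m * (c * (4 * H)) by rewrite ler_wpM2r// (ltW cH0).
  have -> : c * (m ^+ 3 * (2 * H)) = m ^+ 3 * (c * (4 * H)) / 2 by field.
  by move=> ?; lra.
have mr0 : 0 < m `^ (3 - r) by rewrite powR_gt0.
pose d := e / 2 / (c * m `^ (3 - r)).
have d0 : 0 < d by rewrite !divr_gt0// mulr_gt0.
have ht := tail_small q3 r3 mf fJ d0.
near=> n.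
have n1 : 1 <= n%:R :> R by near: n; exact: nbhs_infty_ger.
have htn : (\int[@leb R]_z (wint q al f (outer (n%:R ^+ 3)) z) `^ (r / q) < d%:E)%E by near: n; exact: ht.
pose S := square (2 * n%:R ^+ 3) `&` outer (n%:R ^+ 3).
have mS : measurable S by apply: measurableI; [exact: measurable_square|exact: measurable_outer].
have E : ring_set R0 (n%:R ^+ 3) = S `*` `[- H, H]%classic.
  rewrite /ring_set -/H bx_square; apply/seteqP; split => -[p z].
    by move=> [[/= h1 h2] h3]; split.
  by move=> [/= [h1 h2] h3]; split.
rewrite E; apply: le_trans (volume_cube_le q3 r3 al0 alE H0 mf mS n1 _ m0) _; first by move=> p [[]].
have n30 : 0 <= n%:R ^+ 3 :> R by rewrite exprn_ge0.
apply: (@le_trans _ _ ((c * n%:R ^+ 3)%:E * ((m ^+ 3 * (2 * H))%:E + (m `^ (3 - r))%:E * d%:E))%E).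
  apply: lee_wpmul2l; first by rewrite lee_fin mulr_ge0// ltW.
  apply: leeD => //; apply: lee_wpmul2l; first by rewrite lee_fin ltW.
  apply: le_trans (ltW htn); apply: ge0_le_int.
  - exact: measurable_wint_pow.
  - by apply: measurable_wint_pow => //; exact: measurable_outer.
  - by move=> z; exact: poweR_ge0.
  - move=> z; apply: wint_pow_mono => //; first exact: measurable_outer.
    by move=> p [].
rewrite -[leLHS]/(((c * n%:R ^+ 3) * (m ^+ 3 * (2 * H) + m `^ (3 - r) * d))%:E) lee_fin.
have hd : c * (m `^ (3 - r) * d) = e / 2 by rewrite /d; field; rewrite !gt_eqF.
have -> : c * n%:R ^+ 3 * (m ^+ 3 * (2 * H) + m `^ (3 - r) * d) =
  (c * (m ^+ 3 * (2 * H)) + c * (m `^ (3 - r) * d)) * n%:R ^+ 3 by ring.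
by rewrite hd ler_wpM2r//; lra.
Unshelve. all: by end_near. Qed.

Lemma sqr_le_cube (a k : R) : 0 <= a -> 0 < k -> a ^+ 2 <= k ^+ 2 + k^-1 * a ^+ 3.
Proof.
move=> a0 k0; have [ak|ka] := leP a k.
  have h : a ^+ 2 <= k ^+ 2 by apply: lerXn2r => //; rewrite nnegrE ltW.
  by apply: (le_trans h); rewrite lerDl mulr_ge0 ?exprn_ge0// invr_ge0 ltW.
have h : a ^+ 2 <= k^-1 * a ^+ 3.
  by rewrite [leRHS]mulrC ler_pdivlMr// [a ^+ 3]exprSr ler_wpM2l ?sqr_ge0// ltW.
by apply: (le_trans h); rewrite lerDr sqr_ge0.
Qed.

(** The volume is of order [n ^ 6] and the integral of the cubes of order [n ^ 3]; interpolating at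
    height [k = 1 / n] gives [n ^ 4] for both terms of [sqr_le_cube]. *)
Lemma square_growth : exists K, 0 < K /\ forall n : nat, (0 < n)%N ->
  sq mu (cutt R0 (2 * n%:R ^+ 3) f) <= K * n%:R ^+ 4.
Proof.
pose J := (\int[@leb R]_z (wint q al f setT z) `^ (r / q))%E.
have J0 : (0 <= J)%E by apply: integral_ge0 => z _; exact: poweR_ge0.
pose j := fine J.
have JE : J = j%:E by rewrite fineK// ge0_fin_numE.
have j0 : 0 <= j by exact: fine_ge0.
exists (32 * H + c * (2 * H + j)); split.
  by rewrite addr_gt0// mulr_gt0// ?ltr0n// ltr_wpDr// mulr_gt0.
move=> n n0; have n1 : 1 <= n%:R :> R by rewrite ler1n.
have np : 0 < n%:R :> R by rewrite ltr0n.
have l2 := cutt_L2 R0 (2 * n%:R ^+ 3) lf.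
rewrite -lee_fin -sqE//.
pose B := bx (2 * n%:R ^+ 3) H.
have mB : measurable (B : set (T3 R)) by exact: bx_measurable.
have m3 : measurable_fun setT (fun x : T3 R => (\1_B x * `|f x| ^+ 3)%:E).
  apply/measurable_EFinP; apply: measurable_funM; first exact: measurable_indic.
  by apply: measurable_funX; exact: measurableT_comp.
have m1 : measurable_fun setT (fun x : T3 R => (\1_B x)%:E : \bar R).
  by apply/measurable_EFinP/measurable_indic.
pose k : R := n%:R^-1; have k0 : 0 < k by rewrite invr_gt0.
have b30 x : (0 <= (\1_B x * `|f x| ^+ 3)%:E)%E by rewrite lee_fin mulr_ge0 ?exprn_ge0.
have k20 : 0 <= k ^+ 2 by exact: sqr_ge0.
have ki0 : 0 <= k^-1 by rewrite invr_ge0 ltW.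
apply: (@le_trans _ _ ((k ^+ 2)%:E * (\int[mu]_x (\1_B x)%:E) +
   (k^-1)%:E * \int[mu]_x (\1_B x * `|f x| ^+ 3)%:E)%E).
  rewrite -(ge0_integralZl_EFin mu measurableT _ m1 k20)//.
  rewrite -(ge0_integralZl_EFin mu measurableT (fun x _ => b30 x) m3 ki0).
  rewrite -ge0_integralD//; last 4 first.
  - by move=> x _; rewrite mule_ge0 ?lee_fin.
  - exact: (measurable_funeM _ m1).
  - by move=> x _; rewrite mule_ge0 ?lee_fin.
  - exact: (measurable_funeM _ m3).
  apply: ge0_le_int.
  - by apply: measurable_sqE; case: l2.
  - by apply: emeasurable_funD; [exact: (measurable_funeM _ m1)|exact: (measurable_funeM _ m3)].
  - by move=> x; rewrite lee_fin sqr_ge0.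
  - move=> x; rewrite -!EFinM -EFinD lee_fin /cutt -/H -/B indicE.
    have [_|_] := boolP (x \in B); last by rewrite !mul0r !mulr0 expr0n/= addr0.
    by rewrite !mul1r mulr1 -(real_normK (num_real (f x))); exact: sqr_le_cube.
have V : (\int[mu]_x (\1_B x)%:E = ((4 * n%:R ^+ 3) ^+ 2 * (2 * H))%:E)%E.
  rewrite integral_indic// setIT; apply: etrans (leb3_bx _ (ltW H0)) _.
    by rewrite mulr_ge0// exprn_ge0.
  by congr (_%:E); ring.
have T := volume_cube_le q3 r3 al0 alE H0 mf (measurable_square (2 * n%:R ^+ 3)) n1
  (fun p h => h) ltr01.
have n30 : 0 <= n%:R ^+ 3 :> R by rewrite exprn_ge0.
have T' : (\int[mu]_x (\1_B x * `|f x| ^+ 3)%:E <= (c * n%:R ^+ 3 * (2 * H + j))%:E)%E.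
  rewrite /B bx_square; apply: (le_trans T).
  rewrite expr1n mul1r powR1 mul1e.
  rewrite -[leRHS]/((c * n%:R ^+ 3)%:E * ((2 * H)%:E + j%:E))%E -JE.
  apply: lee_wpmul2l; first by rewrite lee_fin mulr_ge0// ltW.
  apply: leeD; first exact: lexx.
  apply: ge0_le_int.
  - by apply: measurable_wint_pow => //; exact: measurable_square.
  - exact: measurable_wint_pow.
  - by move=> z; exact: poweR_ge0.
  - by move=> z; apply: wint_pow_mono => //; exact: measurable_square.
rewrite V; apply: (@le_trans _ _ ((k ^+ 2 * ((4 * n%:R ^+ 3) ^+ 2 * (2 * H)) + k^-1 * (c * n%:R ^+ 3 * (2 * H + j)))%:E)).
  rewrite [leRHS]EFinD; apply: leeD; first exact: lexx.
  by rewrite [leRHS]EFinM; apply: lee_wpmul2l; rewrite ?lee_fin.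
rewrite lee_fin le_eqVlt; apply/orP; left; apply/eqP.
by rewrite /k; field; rewrite gt_eqF.
Qed.

End Growth.

(** * Conclusion *)

Section Vanishing.
Variable R : realType.
Local Notation mu := (@leb3 R).
Local Notation e_ i := (unit_vector R i).
Local Notation i2 := (inord 2 : 'I_3).

(** A vertical shift by [3 H] leaves the support, so [g] is recovered from its vertical derivative
    by [Jk], whose L1 norm is at most [3 H]. *)
Lemma poincare3 (g : R3 R -> R) (H E : R) : 0 < H -> test_function g ->
  (forall x, g x != 0 -> `|x.2| <= H) -> le2 mu (partial i2 g) E -> le2 mu g (3 * H * E).
Proof.
move=> H0 tg gH hE; pose L := 3 * H; have L0 : 0 < L by rewrite mulr_gt0.
have tp := test_partial i2 tg.
have h := le2_avg i2 (Jk_kern L0) tp hE; rewrite mul1r in h.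
apply: (le2_dom (test_measurable tg) h) => x.
have [->|nz] := eqVneq (g x) 0; first by rewrite normr0.
have -> : avg i2 (Jk L) (partial i2 g) x = g x - g (x + L *: e_ i2).
  by rewrite -(partial_avg (Jk_kern L0) i2 i2 tg) partial_Jk.
have -> : g (x + L *: e_ i2) = 0; last by rewrite subr0.
apply/eqP; apply: contraT => /gH.
have -> : (x + L *: e_ i2).2 = x.2 + L by rewrite /= inordK// /GRing.scale/= mulr1.
have := gH x nz; rewrite !ler_norml /L => /andP[h1 h2] /andP[h3 h4].
by exfalso; lra.
Qed.

Lemma sq_zero_ae (f : T3 R -> R) : L2 mu f -> sq mu f <= 0 -> {ae mu, forall x, f x = 0}.
Proof.
move=> lf f0; have [mf _] := lf.
have s0 : sq mu f = 0 by apply/eqP; rewrite eq_le f0 sq_ge0.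
have := ae_eq_integral_abs mu measurableT (measurable_sqE mf).
case=> + _; have -> : (\int[mu]_x `|(f x ^+ 2)%:E| = 0)%E.
  under eq_integral do rewrite gee0_abs ?lee_fin ?sqr_ge0//.
  by rewrite sqE// s0.
move=> /(_ erefl); apply: filterS => x /(_ I)/= [].
by move=> /eqP; rewrite expf_eq0 => /eqP.
Qed.

Variables (u : 'I_3 -> R3 R -> R) (Du : 'I_3 -> 'I_3 -> R3 R -> R) (R0 : R).
Hypothesis lu : forall k, loc2 (u k).
Hypothesis lDu : forall k j, loc2 (Du k j).
Hypothesis wu : forall k j, weak_partial j (u k) (Du k j).
Hypothesis du : divergence_free u.
Hypothesis u0 : forall k (x : R3 R), R0 < `|x.2| -> u k x = 0.
Hypothesis R00 : 0 < R0.
Hypothesis Du0 : forall t, dissip Du R0 t <= 0.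

(** The vertical Poincaré inequality is applied to [chi U]. As [chi] does not depend on the height,
    only [partial i2 U] enters, and it is within [e] of [Du k i2], which has zero norm; [U] is
    within [e] of [u], so the norm of [u] is at most a fixed multiple of [e]. *)
Lemma sq_u_zero s k : 0 <= s -> sq mu (cutt R0 s (u k)) <= 0.
Proof.
move=> s0; pose H := R0 + 1; have H0 : 0 < H by rewrite /H; have := R00; lra.
have key e : 0 < e -> le2 mu (cutt R0 s (u k)) ((3 * H + 1) * e).
  move=> e0; have [U [tU vU _ eU edU]] := approximation_ind lu lDu wu du u0 R00 s0 ltr01 e0.
  pose chi := @hcut R s 1.
  have mchi : measurable_fun setT (chi : T3 R -> R).
    by apply: cont3_measurable; apply: smooth_continuous; exact: hcut_smooth.
  have tg : test_function (fun x => chi x * U k x) by apply: (test_mulr _ (tU k)); exact: hcut_smooth.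
  have gH x : chi x * U k x != 0 -> `|x.2| <= H.
    by rewrite mulf_eq0 negb_or => /andP[_ /vU].
  have dchi x : partial i2 chi x = 0.
    rewrite partial_hcut -[_ == i2]/(_ == _) eq_sym i2n1 eq_sym i2n0.
    by rewrite !mul0r !mulr0 add0r.
  have hD : le2 mu (partial i2 (fun x => chi x * U k x)) e.
    have DuL : le2 mu (ind R0 s 1 (Du k i2)) 0.
      have l := cutt_L2 R0 (s + 1) (lDu k i2).
      split => //; rewrite expr0n/=; apply: le_trans (Du0 (s + 1)); exact: dissip_ge.
    have h2 : le2 mu (ind R0 s 1 (partial i2 (U k))) e.
      have := le2_add (edU k i2) DuL; rewrite addr0.
      rewrite (_ : (fun x => _) = ind R0 s 1 (partial i2 (U k)))//.
      by apply/funext => x; rewrite /ind -mulrDr subrK.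
    apply: le2_dom h2 _ => [|x]; first exact: test_measurable (test_partial _ tg).
    rewrite (partial_mul i2 (@hcut_smooth R s 1) (test_smooth (tU k))) dchi mulr0 addr0.
    have [->|nz] := eqVneq (chi x * partial i2 (U k) x) 0; first by rewrite normr0.
    move: nz; rewrite mulf_eq0 negb_or => /andP[/(hcut_neq0 ltr01)[h3 h4] nz].
    rewrite /ind indicE mem_set.
      by rewrite mul1r normrM ler_piMl// hcut_norm.
    by split => //; have := dU_supp tU vU nz; have := R00; lra.
  have hU := poincare3 H0 tg gH hD.
  have hV := le2_sub hU (eU k).
  have hVe : 3 * H * e + e = (3 * H + 1) * e by ring.
  rewrite hVe in hV; apply: (le2_dom _ hV) => [|x]; first by case: (cutt_L2 R0 s (lu k)).
  - rewrite /cutt indicE; have [xb|_] := boolP (x \in bx s _); last by rewrite mul0r normr0.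
    rewrite inE in xb; have [h1 h2 h3] := xb.
    rewrite /chi hcut_eq1// /ind indicE mem_set; last by apply: bx_sub xb => //; rewrite lerDl.
    by rewrite !mul1r subKr.
apply/ler_addgt0Pr => w w0; rewrite add0r.
pose M := 3 * H + 1; have M0 : 0 < M by rewrite /M; lra.
pose e := Num.min 1 (w / M ^+ 2).
have e0 : 0 < e by rewrite lt_min ltr01 divr_gt0// exprn_gt0.
have [_ _ h] := key e e0; apply: (le_trans h); rewrite -/M exprMn.
have e1 : e <= 1 by rewrite ge_min lexx.
have e2 : e ^+ 2 <= e by rewrite -[leRHS]expr1 ler_wiXn2l// ltW.
have ew : e <= w / M ^+ 2 by rewrite ge_min lexx orbT.
rewrite mulrC -ler_pdivlMr ?exprn_gt0//; exact: le_trans e2 ew.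
Qed.

Lemma u_zero_ae : {ae mu, forall x k, u k x = 0}.
Proof.
have h k : {ae mu, forall x, forall n : nat, cutt R0 n%:R (u k) x = 0}.
  apply: ae_foralln => n; apply: sq_zero_ae; first exact: cutt_L2.
  exact: sq_u_zero.
apply: filterS3 (h ord0) (h (inord 1)) (h i2) => x h0 h1 h2 k.
have hk : forall n : nat, cutt R0 n%:R (u k) x = 0.
  by case: (I3_cases k) => ->.
have [x3|x3] := leP `|x.2| R0; last exact: u0.
have [n hn] : exists n : nat, `|x.1.1| + `|x.1.2| < n%:R.
  by exists (Num.bound (`|x.1.1| + `|x.1.2|)); apply: archi_boundP; rewrite addr_ge0.
have := hk n; rewrite /cutt indicE mem_set ?mul1r//.
have := normr_ge0 x.1.1; have := normr_ge0 x.1.2; have := R00.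
by move=> ? ? ?; split; lra.
Qed.

End Vanishing.

(** * Vanishing of the dissipation as the radius tends to infinity *)

Section Liouville.
Variable R : realType.
Local Notation mu := (@leb3 R).
Variables (q r al R0 : R) (u : 'I_3 -> R3 R -> R) (Du : 'I_3 -> 'I_3 -> R3 R -> R).
Hypotheses (q3 : 3 <= q) (r3 : 3 <= r) (al0 : 0 <= al) (alE : 3 * al = 6 - q) (R00 : 0 < R0).
Hypothesis lu : forall k, loc2 (u k).
Hypothesis lDu : forall k j, loc2 (Du k j).
Hypothesis wu : forall k j, weak_partial j (u k) (Du k j).
Hypothesis du : divergence_free u.
Hypothesis u0 : forall k (x : R3 R), R0 < `|x.2| -> u k x = 0.
Hypothesis Heq : forall V : 'I_3 -> R3 R -> R, (forall k, test_function (V k)) ->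
  (forall x, \sum_(k < 3) partial k (V k) x = 0) -> \sum_(k < 3) nsform u Du k (V k) = 0.
Hypothesis uJ : forall k, (\int[@leb R]_z (wint q al (u k) setT z) `^ (r / q) < +oo)%E.

(** With [r = n ^ 3], [A = a n ^ 2] and [N = e n ^ 3], only the flux term is critical: it gives
    exactly [e], and the others decay at least like [1 / n]. *)
Lemma decay_arithmetic (a e n : R) : 1 <= n -> 0 <= a -> 0 <= e ->
  (e * n ^+ 3 * (n ^+ 3) ^+ 7 + (a * n ^+ 2) ^+ 2 * (n ^+ 3) ^+ 6 + (a * n ^+ 2) ^+ 2 * (n ^+ 3) ^+ 4 +
   (a * n ^+ 2) ^+ 4 * (n ^+ 3) ^+ 4 + (a * n ^+ 2) ^+ 6 + (a * n ^+ 2) ^+ 10) / (n ^+ 3) ^+ 8 <=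
  e + (2 * a ^+ 2 + a ^+ 4 + a ^+ 6 + a ^+ 10) / n.
Proof.
move=> n1 a0 e0; have n0 : 0 < n by lra.
have -> : (e * n ^+ 3 * (n ^+ 3) ^+ 7 + (a * n ^+ 2) ^+ 2 * (n ^+ 3) ^+ 6 + (a * n ^+ 2) ^+ 2 * (n ^+ 3) ^+ 4 +
   (a * n ^+ 2) ^+ 4 * (n ^+ 3) ^+ 4 + (a * n ^+ 2) ^+ 6 + (a * n ^+ 2) ^+ 10) / (n ^+ 3) ^+ 8 =
   e + (a ^+ 2 / n ^+ 2 + a ^+ 2 / n ^+ 8 + a ^+ 4 / n ^+ 4 + a ^+ 6 / n ^+ 12 + a ^+ 10 / n ^+ 4).
  by field; rewrite gt_eqF.
rewrite lerD2l.
have k m p : (0 < p)%N -> a ^+ m / n ^+ p <= a ^+ m / n.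
  move=> p0; rewrite ler_wpM2l ?exprn_ge0// lef_pV2 ?posrE ?exprn_gt0//.
  by rewrite ler_eXnr.
have h1 := k 2%N 2%N isT; have h2 := k 2%N 8%N isT; have h3 := k 4%N 4%N isT.
have h4 := k 6%N 12%N isT; have h5 := k 10%N 4%N isT.
have -> : (2 * a ^+ 2 + a ^+ 4 + a ^+ 6 + a ^+ 10) / n =
  a ^+ 2 / n + a ^+ 2 / n + a ^+ 4 / n + a ^+ 6 / n + a ^+ 10 / n by ring.
exact: lerD (lerD (lerD (lerD h1 h2) h3) h4) h5.
Qed.

Lemma dissip_zero t : dissip Du R0 t <= 0.
Proof.
have [C [C1 hC]] := hcut_bounds R.
have [K [K0 hK]] := dissipation_decay lu lDu wu du u0 R00 Heq C1 hC.
have mu_ k : measurable_fun setT (u k : T3 R -> R) by exact: (lu k).1.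
have /choice[Kk hKk] k := square_growth q3 r3 al0 alE R00 (mu_ k) (lu k) (uJ k).
pose K2 := \sum_(k < 3) Kk k.
have K2k k : Kk k <= K2.
  by rewrite /K2 (bigD1 k)//= lerDl; apply: sumr_ge0 => j _; exact: ltW (hKk j).1.
have K20 : 0 < K2 by apply: lt_le_trans (K2k ord0); exact: (hKk ord0).1.
pose a := Num.sqrt K2; have a0 : 0 < a by rewrite sqrtr_gt0.
have aE : a ^+ 2 = K2 by rewrite sqr_sqrtr// ltW.
pose S := 2 * a ^+ 2 + a ^+ 4 + a ^+ 6 + a ^+ 10.
have S0 : 0 < S by rewrite !addr_gt0 ?mulr_gt0 ?exprn_gt0.
apply/ler_addgt0Pr => w w0; rewrite add0r.
(* The final bound is [K (e + S / n)], at most [2 K e = w] once [S / n <= e]. *)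
pose e := w / (2 * K); have e0 : 0 < e by rewrite divr_gt0// mulr_gt0.
have h k := annulus_small q3 r3 al0 alE R00 (mu_ k) (uJ k) e0.
near \oo => n.
have n1 : (0 < n)%N by near: n; exists 1%N.
have nR : 1 <= n%:R :> R by rewrite ler1n.
have n0 : 0 < n%:R :> R by lra.
have tn : t <= n%:R ^+ 3.
  by apply: (@le_trans _ _ n%:R); [near: n; exact: nbhs_infty_ger|rewrite ler_eXnr].
have hN k : (\int[mu]_x (\1_(ring_set R0 (n%:R ^+ 3)) x * `|u k x| ^+ 3)%:E <= (e * n%:R ^+ 3)%:E)%E.
  by case: (I3_cases k) => ->; near: n; exact: h.
have hS : S / n%:R <= e.
  by rewrite ler_pdivrMr// -ler_pdivrMl// mulrC; near: n; exact: nbhs_infty_ger.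
apply: le_trans (dissip_mono R0 lDu tn) _.
have r1 : 1 <= n%:R ^+ 3 :> R by rewrite exprn_ege1.
have A0 : 0 < a * n%:R ^+ 2 by rewrite mulr_gt0// exprn_gt0.
have N0 : 0 <= e * n%:R ^+ 3 by rewrite mulr_ge0 ?(ltW e0)// exprn_ge0.
have hA k : sq mu (cutt R0 (2 * n%:R ^+ 3) (u k)) <= (a * n%:R ^+ 2) ^+ 2.
  apply: le_trans ((hKk k).2 n n1) _.
  by rewrite exprMn aE -exprM ler_wpM2r// exprn_ge0.
apply: (le_trans (hK _ _ _ r1 A0 N0 hA hN)); rewrite -mulrA.
apply: (@le_trans _ _ (K * (e + S / n%:R))).
  by rewrite ler_wpM2l ?(ltW K0)//; apply: decay_arithmetic => //; exact: ltW.
apply: (@le_trans _ _ (K * (e + e))); first by rewrite ler_wpM2l ?(ltW K0)// lerD2l.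
by rewrite le_eqVlt; apply/orP; left; apply/eqP; rewrite /e; field; rewrite gt_eqF.
Unshelve. all: by end_near. Qed.

Lemma liouville : {ae mu, forall x k, u k x = 0}.
Proof. exact: (u_zero_ae lu lDu wu du u0 R00 dissip_zero). Qed.

End Liouville.

(** * Reduction to a representative vanishing everywhere outside the slab *)

Section Reduction.
Variable R : realType.
Local Notation mu := (@leb3 R).

(** Each point outside the essential support has its own open neighbourhood where [u] vanishes
    almost everywhere. To collect these null sets, the neighbourhoods are replaced by the countably
    many [rbox] sets, enumerated through their codes. *)
Lemma ess_support_ae (u : 'I_3 -> R3 R -> R) (R0 : R) :
  ess_support u `<=` [set x | - R0 <= x.2 <= R0] ->
  {ae mu, forall y : T3 R, R0 < `|(y : R3 R).2| -> forall k, u k y = 0}.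
Proof.
move=> hu.
pose null q (y : T3 R) : Prop := rbox q y -> forall k, u k y = 0.
have H : {ae mu, forall y : T3 R, forall n : nat, forall q, unpickle n = Some q ->
    {ae mu, forall y : T3 R, null q y} -> null q y}.
  apply: ae_foralln => n; case E : (unpickle n) => [q|]; last by apply: nearW => y q.
  have [hq|hq] := pselect {ae mu, forall y : T3 R, null q y}.
    by move: hq; apply: filterS => y hy q' [<-].
  by apply: nearW => y q' [<-].
move: H; apply: filterS => y hy y2 k.
have : ~ ess_support u y.
  move=> /hu /=; rewrite -ler_norml => h.
  by move: y2; rewrite ltNge h.
move=> /existsNP[U] /not_implyP[oU] /not_implyP[Uy] /contrapT hU.
have [q qy qU] := rbox_base oU Uy.
apply: (hy (pickle q) q) => //; first exact: pickleK.
have hU' : {ae mu, forall z : T3 R, U z -> forall k, u k z = 0} by exact: hU.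
by move: hU'; apply: filterS => z hz /qU; exact: hz.
Qed.

(** [u] vanishes off the slab only almost everywhere; this modification does so at every point, as
    the pointwise support arguments require. *)
Definition slab (R0 : R) (f : R3 R -> R) : R3 R -> R :=
  fun x => \1_[set x : R3 R | `|x.2| <= R0] x * f x.

Lemma slab_measurable R0 (f : R3 R -> R) : measurable_fun setT (f : T3 R -> R) ->
  measurable_fun setT (slab R0 f : T3 R -> R).
Proof.
move=> mf; apply: measurable_funM => //; apply: measurable_indic.
have -> : [set x : T3 R | `|x.2| <= R0] = setT `*` `[- R0, R0]%classic.
  by apply/seteqP; split => x /=; rewrite in_itv/= -ler_norml => h; [split|case: h].
by apply: measurableX => //; exact: measurable_itv.
Qed.

Lemma slab_le R0 (f : R3 R -> R) x : `|slab R0 f x| <= `|f x|.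
Proof. by rewrite /slab normrM ler_piMl// indicE ger0_norm// lern1 leq_b1. Qed.

Lemma slab_out R0 (f : R3 R -> R) (x : R3 R) : R0 < `|x.2| -> slab R0 f x = 0.
Proof. by move=> h; rewrite /slab indicE memNset ?mul0r//= => k; move: h; rewrite ltNge k. Qed.

Lemma slab_id R0 (f : R3 R -> R) (x : R3 R) : (R0 < `|x.2| -> f x = 0) -> slab R0 f x = f x.
Proof.
have [h _|h /(_ isT) fx] := leP `|x.2| R0; last by rewrite slab_out.
by rewrite /slab indicE mem_set ?mul1r.
Qed.

Lemma slab_loc2 R0 (f : R3 R -> R) : loc2 f -> loc2 (slab R0 f).
Proof.
move=> [mf lf]; have ms := slab_measurable R0 mf; split => // a.
apply: (L2_dom _ (lf a)) => [|x].
  by apply: measurable_funM => //; exact: measurable_indic (bx_measurable _ _).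
by rewrite /cutb normrM [leRHS]normrM; apply: ler_wpM2l => //; exact: slab_le.
Qed.

Lemma Lloc_loc2 (f : R3 R -> R) : Lloc 2 f -> loc2 f.
Proof.
move=> [mf lf]; split => // a; split.
  by apply: measurable_funM => //; exact: measurable_indic (bx_measurable _ _).
have E : (\int[mu]_x (cutb a f x ^+ 2)%:E = \int[mu]_(x in bx a a) (`|f x| `^ 2)%:E)%E.
  rewrite [RHS]integral_mkcond; apply: eq_integral => x _; rewrite /patch /cutb indicE.
  case: (boolP (x \in _)) => xb; last by rewrite mul0r expr0n.
  by rewrite mul1r powR_mulrn// real_normK ?num_real.
by rewrite E; apply: lf; exact: bx_compact.
Qed.

Lemma Rintegral_ae (f g : T3 R -> R) : measurable_fun setT f -> measurable_fun setT g ->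
  {ae mu, forall x, f x = g x} -> \int[mu]_x f x = \int[mu]_x g x.
Proof.
move=> mf mg fg; congr fine; apply: ae_eq_integral => //; try exact/measurable_EFinP.
by move: fg; apply: filterS => x fx _; rewrite /= fx.
Qed.

Lemma mixed_norm_wint (q r al R0 : R) (f : R3 R -> R) : 0 < q -> 0 < r ->
  Lqr q r (horizontal_weight al) (fun=> 1) f ->
  (\int[@leb R]_z (wint q al (slab R0 f) setT z) `^ (r / q) < +oo)%E.
Proof.
move=> q0 r0 [mf /lty_poweRy hf].
have {}hf := hf (lt0r_neq0 (_ : 0 < r^-1)); rewrite invr_gt0 in hf; have {}hf := hf r0.
have ms := slab_measurable R0 mf.
have rq : 0 <= r / q by rewrite divr_ge0// ltW.
have I0 (g : R3 R -> R) z : (0 <= wint q al g setT z)%E by exact: wint_ge0.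
have E z : wint q al f setT z = (\int[@leb2 R]_p (`|f (p, z)| `^ q * horizontal_weight al p)%:E)%E.
  by apply: eq_integral => p _; rewrite indicT mul1r.
apply: le_lt_trans hf; under [leRHS]eq_integral do rewrite mule1 -E.
apply: ge0_le_int.
- exact: (measurableT_comp (measurable_poweR _) (measurable_wint q al ms measurableT)).
- exact: (measurableT_comp (measurable_poweR _) (measurable_wint q al mf measurableT)).
- by move=> z; exact: poweR_ge0.
- move=> z; apply: (gt0_ler_poweR rq); [by rewrite in_itv/= I0 leey|by rewrite in_itv/= I0 leey|].
  apply: ge0_le_int.
  + exact: measurable_wslice.
  + exact: measurable_wslice.
  + by move=> p; exact: (wintegrand_ge0 q al (slab R0 f) setT (p, z)).
  + move=> p; rewrite lee_fin ler_wpM2l// ler_wpM2r ?powR_ge0//.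
    by apply: ge0_ler_powR; rewrite ?nnegrE ?(ltW q0)//; exact: slab_le.
Qed.

End Reduction.

Theorem theorem1p7 (R : realType) (q r alpha : R)
    (w1 : R2 R -> R) (w2 : R -> R) (u : 'I_3 -> R3 R -> R)
    (q_range : 3 <= q <= 6) (r_range : 3 <= r)
    (alphaE : alpha = (6 - q) / 3)
    (w1E : w1 = horizontal_weight alpha) (w2E : w2 = fun=> 1)
    (u_H1loc : forall k, H1loc (u k))
    (u_sol : weak_solution (q / 2) (r / 2) w1 w2 u)
    (u_Lqr : forall k, Lqr q r w1 w2 (u k))
    (u_supp : exists R0 : R, 0 < R0 /\
        ess_support u `<=` [set x | - R0 <= x.2 <= R0]) :
  {ae @leb3 R, forall x, forall k, u k x = 0}.
Proof.
have [R0 [R00 /ess_support_ae u_out]] := u_supp.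
have [u_div [Du [p [u_grad _ u_eq]]]] := u_sol.
have lu k : loc2 (u k) by apply: Lloc_loc2; exact: (u_grad k).1.
have lDu k j : loc2 (Du k j) by apply: Lloc_loc2; exact: ((u_grad k).2 j).1.
(* Weak derivatives, divergence and equation involve integrals only, so they pass from [u] to this
   representative. *)
pose v k := slab R0 (u k).
have lv k : loc2 (v k) by exact: slab_loc2.
have vu : {ae @leb3 R, forall x : T3 R, forall k, v k x = u k x}.
  by move: u_out; apply: filterS => x hx k; apply: slab_id => /hx.
have mv k : measurable_fun setT (v k : T3 R -> R) by exact: (lv k).1.
have mu_ k : measurable_fun setT (u k : T3 R -> R) by exact: (lu k).1.
have mDu k j : measurable_fun setT (Du k j : T3 R -> R) by exact: (lDu k j).1.
have mp phi j : test_function phi -> measurable_fun setT (partial j phi : T3 R -> R).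
  by move=> tp; exact: test_measurable (test_partial j tp).
have msum (F : 'I_3 -> T3 R -> R) : (forall j, measurable_fun setT (F j)) ->
    measurable_fun setT (fun x => \sum_(j < 3) F j x).
  by move=> mF; under eq_fun do rewrite sum3E; do 2 apply: measurable_funD => //.
have wv k j : weak_partial j (v k) (Du k j).
  move=> phi tphi; rewrite -((u_grad k).2 j).2//; apply: Rintegral_ae.
  - by apply: measurable_funM => //; exact: mp.
  - by apply: measurable_funM => //; exact: mp.
  - by move: vu; apply: filterS => x ->.
have v_div : divergence_free v.
  move=> phi tphi; rewrite -[RHS](u_div phi tphi); apply: Rintegral_ae.
  - by apply: msum => j; apply: measurable_funM => //; exact: mp.
  - by apply: msum => j; apply: measurable_funM => //; exact: mp.
  - by move: vu; apply: filterS => x hx; apply: eq_bigr => k _; rewrite hx.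
have v_eq (V : 'I_3 -> R3 R -> R) : (forall k, test_function (V k)) ->
    (forall x, \sum_(k < 3) partial k (V k) x = 0) -> \sum_(k < 3) nsform v Du k (V k) = 0.
  move=> tV dV; have := u_eq V tV.
  (* The integrand of the pressure term vanishes at every point, because [V] is solenoidal
     everywhere. *)
  rewrite (_ : \int[@leb3 R]_x (p x * _) = 0) ?subr0; last first.
    rewrite (_ : (fun x => _) = fun=> 0); first by rewrite Rintegral_cst// mul0r.
    by apply/funext => x; rewrite dV mulr0.
  move=> H0; apply: etrans H0; apply: eq_bigr => k _; rewrite nsformE//; apply: Rintegral_ae.
  - apply: measurable_funD; first by apply: msum => j; apply: measurable_funM => //; exact: mp.
    apply: measurable_funM; last exact: test_measurable.
    by apply: msum => j; exact: measurable_funM.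
  - apply: measurable_funD; first by apply: msum => j; apply: measurable_funM => //; exact: mp.
    apply: measurable_funM; last exact: test_measurable.
    by apply: msum => j; exact: measurable_funM.
  - move: vu; apply: filterS => x hx; congr (_ + _ * _).
    by apply: eq_bigr => j _; rewrite hx.
have /andP[q3 q6] := q_range.
have al0 : 0 <= alpha by rewrite alphaE; lra.
have alE : 3 * alpha = 6 - q by rewrite alphaE; field.
have q0 : 0 < q by lra.
have r0 : 0 < r by lra.
have vJ k : (\int[@leb R]_z (wint q alpha (v k) setT z) `^ (r / q) < +oo)%E.
  by apply: mixed_norm_wint => //; have := u_Lqr k; rewrite w1E w2E.
have v_out k (x : R3 R) : R0 < `|x.2| -> v k x = 0 by exact: slab_out.
have v0 : {ae @leb3 R, forall x : T3 R, forall k, v k x = 0} :=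
  liouville q3 r_range al0 alE R00 lv lDu wv v_div v_out v_eq vJ.
have res : {ae @leb3 R, forall x : T3 R, forall k, u k x = 0}.
  by apply: filterS2 v0 vu => x h1 h2 k; rewrite -h2 h1.
exact: res.
Qed.
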